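(* Let $\Sigma\subset\mathbf P^5$ be the intersection of three quadrics of the context. (1) The lines on $\Sigma$ are exactly the following eight: $\widetilde\Theta_1:\ X_1=X_2=X_3=\sum_i\sqrt{d_i}\,Y_i=0$, $\widetilde\Theta_2:\ Y_1=Y_2=X_3=\sqrt{c_1}X_1+\sqrt{c_2}X_2+\sqrt{d_3}Y_3=0$, $\widetilde\Theta_3:\ Y_1=X_2=Y_3=\sqrt{c_1}X_1+\sqrt{d_2}Y_2+\sqrt{c_3}X_3=0$, $\widetilde\Theta_4:\ X_1=Y_2=Y_3=\sqrt{d_1}Y_1+\sqrt{c_2}X_2+\sqrt{c_3}X_3=0$, $E_1:\ Y_1=Y_2=Y_3=\sum_i\sqrt{c_i}\,X_i=0$, $E_2:\ X_1=X_2=Y_3=\sqrt{d_1}Y_1+\sqrt{d_2}Y_2+\sqrt{c_3}X_3=0$, $E_3:\ X_1=Y_2=X_3=\sqrt{d_1}Y_1+\sqrt{c_2}X_2+\sqrt{d_3}Y_3=0$, $E_4:\ Y_1=X_2=X_3=\sqrt{c_1}X_1+\sqrt{d_2}Y_2+\sqrt{d_3}Y_3=0$. (2) The surface $\Sigma$ has exactly twelve nodes, at the twelve intersection points of the lines $\widetilde\Theta_i$ and $E_j$. In particular $\Sigma$ is a $K3$ surface with rational double points.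
   Context: $k$ is an algebraically closed field of characteristic $2$; $(X_1,X_2,X_3,Y_1,Y_2,Y_3)$ are homogeneous coordinates on $\mathbf P^5$. The constants $a_i,c_i,d_i\in k$ $(i=1,2,3)$ satisfy: $a_1,a_2,a_3$ pairwise distinct and $\prod_ic_id_i\neq0$ (the condition for the quadratic line complex $\mathcal X$ defined by the first two equations below to be non-singular). $\Sigma$ is the surface (the set of singular lines of $\mathcal X$) $$\sum_{i=1}^3X_iY_i=\sum_{i=1}^3(a_iX_iY_i+c_iX_i^2+d_iY_i^2)=\sum_{i=1}^3a_i^2X_iY_i=0.$$ A node is a rational double point of type $A_1$. ''$K3$ surface with rational double points'' means that its only singularities are rational double points and its minimal resolution is a $K3$ surface. *)

(* Defs.v *)
From HB Require Import structures.
From mathcomp Require Import all_boot all_order all_algebra.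
From mathcomp Require Export mpoly.

Set Implicit Arguments.
Unset Strict Implicit.
Unset Printing Implicit Defensive.

Import GRing.Theory.
Local Open Scope ring_scope.

(* A point of P^(n-1) is given by a nonzero row vector p of homogeneous       *)
(* coordinates, up to scaling (so the point is <[p]>%VS); a line of P^(n-1)   *)
(* is a subspace of dimension 2. Closed subsets are given by their cones.     *)

Section Cones.
Variables (k : fieldType) (n : nat).

Definition zeros (s : seq {mpoly k[n]}) : pred 'rV[k]_n :=
  fun v => all (fun F : {mpoly k[n]} => F.@[v 0] == 0) s.

Definition poly_ideal r (q : 'I_r -> {mpoly k[n]}) (F : {mpoly k[n]}) : Prop :=
  exists h : 'I_r -> {mpoly k[n]}, F = \sum_i h i * q i.

End Cones.

(* Formal power series in n variables, as families of coefficients; they are  *)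
(* compared coefficientwise.                                                  *)
Section PowerSeries.
Variable k : fieldType.

Definition pseries n := 'X_{1..n} -> k.

Definition ps_of_mpoly n (F : {mpoly k[n]}) : pseries n := fun m => F@_m.

Definition ps_add n (f g : pseries n) : pseries n := fun m => f m + g m.

Definition ps_scale n (c : k) (f : pseries n) : pseries n := fun m => c * f m.

Definition ps_mul n (f g : pseries n) : pseries n := fun m =>
  \sum_(h : 'X_{1..n < (mdeg m).+1, (mdeg m).+1}
          | m == (bmnm h.1 + bmnm h.2)%MM) f h.1 * g h.2.

Definition ps_cong n r (q : 'I_r -> pseries n) (f g : pseries n) : Prop :=
  exists h : 'I_r -> pseries n,
    forall m, f m - g m = \sum_i ps_mul (h i) (q i) m.

(* phi describes, on representatives, an isomorphism of k-algebras from       *)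
(* k[[u_1, .., u_n]]/(q) to k[[u_1, .., u_n']]/(q').                          *)
Definition ps_quot_iso n r (q : 'I_r -> pseries n)
    n' r' (q' : 'I_r' -> pseries n') (phi : pseries n -> pseries n') : Prop :=
  [/\ [/\ ps_cong q' (phi (ps_of_mpoly 1)) (ps_of_mpoly 1),
          forall f g, ps_cong q' (phi (ps_add f g)) (ps_add (phi f) (phi g)),
          forall f g, ps_cong q' (phi (ps_mul f g)) (ps_mul (phi f) (phi g))
        & forall c f, ps_cong q' (phi (ps_scale c f)) (ps_scale c (phi f))],
      forall f g, ps_cong q f g <-> ps_cong q' (phi f) (phi g)
    & forall g, exists f, ps_cong q' (phi f) g].

(* The A_1 singularity z^2 + x y = 0; this form is valid in every             *)
(* characteristic, including 2.                                               *)
Definition A1_eq : {mpoly k[3]} := 'X_2%R ^+ 2 + 'X_0%R * 'X_1%R.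

End PowerSeries.

Section CompleteIntersection.
Variables (k : fieldType) (n r : nat) (q : 'I_r -> {mpoly k[n.+1]}).

(* F in the affine chart where the j-th coordinate is 1, with the origin      *)
(* moved to p.                                                                *)
Definition chart_at (j : 'I_n.+1) (p : 'rV[k]_n.+1) (F : {mpoly k[n.+1]}) :
    {mpoly k[n]} :=
  mmap (@mpolyC n k)
    (fun l => if unlift j l is Some l' then (p 0 l / p 0 j)%:MP + 'X_l' else 1)
    F.

(* The completed local ring at p of the scheme q = 0 is isomorphic to         *)
(* k[[x, y, z]]/(z^2 + x y).                                                  *)
Definition node (p : 'rV[k]_n.+1) : Prop :=
  (forall i, (q i).@[p 0] = 0) /\
  exists2 j : 'I_n.+1, p 0 j != 0 &
  exists phi, ps_quot_iso (fun i => ps_of_mpoly (chart_at j p (q i)))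
                          (fun _ : 'I_1 => ps_of_mpoly (A1_eq k)) phi.

Definition jacobian (p : 'rV[k]_n.+1) : 'M[k]_(r, n.+1) :=
  \matrix_(i, j) ((q i)^`M(j)).@[p 0].

(* Jacobian criterion, for q = 0 of codimension r.                            *)
Definition singular_point (p : 'rV[k]_n.+1) : Prop :=
  [/\ p != 0, forall i, (q i).@[p 0] = 0
    & (\rank (jacobian p) < r)%N].

End CompleteIntersection.

(* Projective varieties, after Weil and Zariski. A projective variety with    *)
(* function field K is given by the homogeneous coordinates y, in K, of a     *)
(* generic point: its closed points are the specializations of y over k, and  *)
(* its local rings are realized as subrings of K. Varieties with the same     *)
(* field K are birational, the identity of K being the birational map.        *)
Section Models.
Variables (k K : fieldType) (iota : {rmorphism k -> K}).

Definition hval n (y : 'rV[K]_n) (F : {mpoly k[n]}) : K := mmap iota (y 0) F.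

Definition generic_point n r (q : 'I_r -> {mpoly k[n]}) (y : 'rV[K]_n) : Prop :=
  forall d (F : {mpoly k[n]}), F \is d.-homog ->
    (hval y F = 0 <-> poly_ideal q F).

(* K is the field k(y_i / y_j) of rational functions. *)
Definition has_function_field n (y : 'rV[K]_n) : Prop :=
  y != 0 /\
  forall f : K, exists d (F G : {mpoly k[n]}),
    [/\ F \is d.-homog, G \is d.-homog, hval y G != 0
      & f = hval y F / hval y G].

Definition alg_indep n (t : 'I_n -> K) : Prop :=
  forall F : {mpoly k[n]}, mmap iota t F = 0 -> F = 0.

Definition trdeg2 : Prop :=
  (exists t : 'I_2 -> K, alg_indep t) /\ forall t : 'I_3 -> K, ~ alg_indep t.

Definition point n (y : 'rV[K]_n) (p : 'rV[k]_n) : Prop :=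
  p != 0 /\
  forall d (F : {mpoly k[n]}), F \is d.-homog -> hval y F = 0 -> F.@[p 0] = 0.

Definition local_ring n (y : 'rV[K]_n) (p : 'rV[k]_n) (f : K) : Prop :=
  exists d (F G : {mpoly k[n]}),
    [/\ F \is d.-homog, G \is d.-homog, G.@[p 0] != 0
      & f = hval y F / hval y G].

Definition max_ideal n (y : 'rV[K]_n) (p : 'rV[k]_n) (f : K) : Prop :=
  exists d (F G : {mpoly k[n]}),
    [/\ F \is d.-homog, G \is d.-homog, F.@[p 0] = 0, G.@[p 0] != 0
      & f = hval y F / hval y G].

(* The birational map from the variety of y' to the variety of y is           *)
(* everywhere defined, i.e., it is a morphism.                                *)
Definition dominates n' (y' : 'rV[K]_n') n (y : 'rV[K]_n) : Prop :=
  forall p', point y' p' -> exists p, [/\ point y p,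
    forall f, local_ring y p f -> local_ring y' p' f
  & forall f, max_ideal y p f -> max_ideal y' p' f].

Definition local_params n (y : 'rV[K]_n) (p : 'rV[k]_n) (u v : K) : Prop :=
  [/\ max_ideal y p u, max_ideal y p v
    & forall f, max_ideal y p f -> exists a b,
        [/\ local_ring y p a, local_ring y p b & f = a * u + b * v]].

(* All local rings at closed points are regular of dimension 2, which over an *)
(* algebraically closed field amounts to smoothness.                          *)
Definition smooth_surface n (y : 'rV[K]_n) : Prop :=
  [/\ has_function_field y, trdeg2
    & forall p, point y p -> exists u v, local_params y p u v].

Definition resolution m (x : 'rV[K]_m) n (y : 'rV[K]_n) : Prop :=
  smooth_surface y /\ dominates y x.

(* Resolutions of projective surfaces by complete surfaces are projective, so *)
(* quantifying over projective ones is no restriction.                        *)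
Definition minimal_resolution m (x : 'rV[K]_m) n (y : 'rV[K]_n) : Prop :=
  resolution x y /\
  forall n' (y' : 'rV[K]_n'), resolution x y' -> dominates y' y.

Definition k_derivation (D : K -> K) : Prop :=
  [/\ forall f g, D (f + g) = D f + D g,
      forall f g, D (f * g) = D f * g + f * D g
    & forall c, D (iota c) = 0].

(* A rational 2-form is identified with an alternating form om on the         *)
(* k-derivations of K; the condition says that om is c du dv with c a unit    *)
(* of the local ring, i.e., that om generates the canonical sheaf at p.       *)
Definition trivial_canonical n (y : 'rV[K]_n) : Prop :=
  exists om : (K -> K) -> (K -> K) -> K,
    forall p, point y p -> exists u v c,
      [/\ local_params y p u v, local_ring y p c, ~ max_ideal y p c
        & forall D1 D2, k_derivation D1 -> k_derivation D2 ->
            om D1 D2 = c * (D1 u * D2 v - D1 v * D2 u)].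

Definition zopen n (y : 'rV[K]_n) (U : 'rV[k]_n -> Prop) : Prop :=
  exists S : {mpoly k[n]} -> Prop,
    (forall F, S F -> exists d, F \is d.-homog) /\
    forall p, point y p -> (U p <-> exists2 F, S F & F.@[p 0] != 0).

(* Regular functions on U, for U open and nonempty. *)
Definition section n (y : 'rV[K]_n) (U : 'rV[k]_n -> Prop) (f : K) : Prop :=
  forall p, point y p -> U p -> local_ring y p f.

(* The first Cech cohomology group of the structure sheaf, hence H^1(X, O_X), *)
(* is zero: every 1-cocycle on a finite open cover is a coboundary. Finite    *)
(* covers suffice since X is quasi-compact, and the members of the cover are  *)
(* taken nonempty so that sections over their intersections, again nonempty   *)
(* as X is irreducible, are elements of K.                                    *)
Definition H1_structure_sheaf_zero n (y : 'rV[K]_n) : Prop :=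
  forall r (U : 'I_r -> 'rV[k]_n -> Prop),
    (forall i, zopen y (U i)) ->
    (forall i, exists2 p, point y p & U i p) ->
    (forall p, point y p -> exists i, U i p) ->
  forall f : 'I_r -> 'I_r -> K,
    (forall i j, section y (fun p => U i p /\ U j p) (f i j)) ->
    (forall i j l, f i j + f j l = f i l) ->
  exists g : 'I_r -> K,
    (forall i, section y (U i) (g i)) /\ forall i j, f i j = g i - g j.

Definition K3_surface n (y : 'rV[K]_n) : Prop :=
  [/\ smooth_surface y, trivial_canonical y & H1_structure_sheaf_zero y].

End Models.

(* The scheme q = 0 in P^n is a reduced and irreducible variety whose minimal *)
(* resolution is a K3 surface.                                                *)
Definition minimal_resolution_is_K3 (k : fieldType) n r
    (q : 'I_r -> {mpoly k[n.+1]}) : Prop :=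
  exists (K : fieldType) (iota : {rmorphism k -> K}) (x : 'rV[K]_n.+1),
    [/\ generic_point iota q x, has_function_field iota x
      & exists m (y : 'rV[K]_m),
          minimal_resolution iota x y /\ K3_surface iota y].

(* A K3 surface with rational double points, all of type A_1. *)
Definition K3_surface_with_nodes (k : fieldType) n r
    (q : 'I_r -> {mpoly k[n.+1]}) : Prop :=
  (forall p, singular_point q p -> node q p) /\ minimal_resolution_is_K3 q.

Section Sigma.
Variable k : fieldType.

Definition X (i : 'I_3) : {mpoly k[6]} := 'X_(lshift 3 i).
Definition Y (i : 'I_3) : {mpoly k[6]} := 'X_(rshift 3 i).

Variables a c d : 'I_3 -> k.

Definition Sigma_eqs : seq {mpoly k[6]} :=
  [:: \sum_i X i * Y i;
      \sum_i (a i *: (X i * Y i) + c i *: X i ^+ 2 + d i *: Y i ^+ 2);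
      \sum_i a i ^+ 2 *: (X i * Y i)].

Definition Sigma_eq (i : 'I_3) : {mpoly k[6]} := nth 0 Sigma_eqs i.

Definition Sigma : pred 'rV[k]_6 := zeros Sigma_eqs.

(* sc i and sd i stand for the square roots of c i and d i. The indices       *)
(* 1, 2, 3 (resp. 1, .., 4) are shifted to 0, 1, 2 (resp. 0, .., 3).          *)
Variables sc sd : 'I_3 -> k.

Definition Theta (i : 'I_4) : pred 'rV[k]_6 := zeros (nth [::] [::
  [:: X 0; X 1; X 2; sd 0 *: Y 0 + sd 1 *: Y 1 + sd 2 *: Y 2];
  [:: Y 0; Y 1; X 2; sc 0 *: X 0 + sc 1 *: X 1 + sd 2 *: Y 2];
  [:: Y 0; X 1; Y 2; sc 0 *: X 0 + sd 1 *: Y 1 + sc 2 *: X 2];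
  [:: X 0; Y 1; Y 2; sd 0 *: Y 0 + sc 1 *: X 1 + sc 2 *: X 2]] i).

Definition E (i : 'I_4) : pred 'rV[k]_6 := zeros (nth [::] [::
  [:: Y 0; Y 1; Y 2; sc 0 *: X 0 + sc 1 *: X 1 + sc 2 *: X 2];
  [:: X 0; X 1; Y 2; sd 0 *: Y 0 + sd 1 *: Y 1 + sc 2 *: X 2];
  [:: X 0; Y 1; X 2; sd 0 *: Y 0 + sc 1 *: X 1 + sd 2 *: Y 2];
  [:: Y 0; X 1; X 2; sc 0 *: X 0 + sd 1 *: Y 1 + sd 2 *: Y 2]] i).

Definition ThetaE (l : 'I_4 + 'I_4) : pred 'rV[k]_6 :=
  match l with inl i => Theta i | inr j => E j end.

Definition meeting_point (p : 'rV[k]_6) : Prop :=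
  p != 0 /\ exists i j, Theta i p /\ E j p.

End Sigma.

(* Main.v *)
(* Since the a_i are distinct, the three equations are equivalent to
   X_i Y_i = g_i L^2 (i = 0, 1, 2), where L = sum_i (sc_i X_i + sd_i Y_i) and
   g_0, g_1, g_2 are nonzero. A line on the surface must lie in L = 0, where one
   of X_i, Y_i vanishes for each i: this leaves eight lines. A singular point
   satisfies X_i = Y_i = 0 for some i, hence L = 0, and is a meeting point; there,
   solving for the other coordinates by power series, the surface becomes the
   cone xy = z^2.

   With L = 1 the function field is generated by z_i = X_i subject to
   sum_i (al_i z_i + de_i / z_i) = 1, a relation preserved by inverting a z_i
   (with al_i and de_i exchanged) and by permutations. The K3 surface is the
   closure of (z_0, z_1, z_2, z_0/z_1, z_0 z_1) in (P^1)^5, Segre embedded. Up to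
   these symmetries every point lies in the chart with coordinates z_0, z_1/z_0,
   z_2, a smooth hypersurface on which
   dlog z_0 dlog z_1 / (al_2 z_2 + de_2 / z_2) generates the 2-forms.

   Minimality: a local ring R of a resolution is free over its subring of squares
   on 1, u, v, uv. This makes R completely integrally closed by Krull's
   intersection theorem, so that the roots of a polynomial over R with a unit
   coefficient lie in R or have their inverse in R. Comparing coordinates of
   functions over K^2 then shows that each of the five functions above is regular
   at the point or has a regular inverse.

   H^1 = 0: a cocycle is split first on affine charts (Serre), then across z_2
   and 1/z_2, then across z_1/z_0 and its inverse, which leaves four corners,
   indexed by the signs of the exponents of z_0 and z_1. There the differences
   are Laurent polynomials u + z_2 v in z_0, z_1, and comparing coefficients
   splits them. *)

From HB Require Import structures.
Require Import Defs.
From mathcomp Require Import all_boot all_order all_algebra all_fingroup all_field.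
From mathcomp Require Import boolp ring zify.

Set Implicit Arguments.
Unset Strict Implicit.
Unset Printing Implicit Defensive.

Import GRing.Theory.
Local Open Scope ring_scope.

(** The combinatorics is that of a cube. With denominators cleared, the relation between the z_i
    defines a surface of tridegree (2,2,2) in (P^1)^3. It contains the twelve edges of the cube on
    which two of the z_i are constant, equal to 0 or infinity, and its eight vertices are nodes; at
    the origin the tangent cone is de_0 z_1 z_2 + de_1 z_0 z_2 + de_2 z_0 z_1. The two extra factors
    z_0/z_1 and z_0 z_1 of the model separate directions at the vertices and so remove these nodes.
    On Sigma the roles are exchanged: eight lines for the vertices, twelve nodes for the edges.

    Varieties occur only through subrings of one field K, so the working object is a place, which
    pairs a function with its value at a point. Minimality is the hard point: a local ring of an
    arbitrary resolution is known only through two parameters. Freeness over the squares stands in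
    for unique factorization there, because an identity between combinations of squares determines
    the square roots of the coefficients. *)

Lemma char2_eq (R : comNzRingType) (e a b : R) :
  2%N \in [pchar R] -> a = b + e *+ 2 -> a = b.
Proof. by move=> h ->; rewrite mulr2n addrr_pchar2 // addr0. Qed.

Lemma char2_eqD (R : nzRingType) (a b : R) :
  2%N \in [pchar R] -> a + b = 0 -> a = b.
Proof. by move=> h /eqP; rewrite addr_eq0 oppr_pchar2 // => /eqP. Qed.

Lemma sum3 (V : nmodType) (F : 'I_3 -> V) : \sum_i F i = F 0 + F 1 + F 2.
Proof.
rewrite !big_ord_recl big_ord0 addr0 addrA.
by congr (_ + F _ + F _); apply: val_inj.
Qed.

Lemma ord3_ind (P : 'I_3 -> Prop) : P 0 -> P 1 -> P 2 -> forall i, P i.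
Proof.
move=> h0 h1 h2 [[|[|[|m]]] Hm] //.
- by rewrite (_ : Ordinal Hm = 0) //; apply: val_inj.
- by rewrite (_ : Ordinal Hm = 1) //; apply: val_inj.
- by rewrite (_ : Ordinal Hm = 2) //; apply: val_inj.
Qed.

Lemma ord3_cyc (i : 'I_3) : [/\ i != i + 1, i != i + 2 & i + 1 != i + 2].
Proof. by elim/ord3_ind: i. Qed.

Lemma sum3c (V : nmodType) (F : 'I_3 -> V) (i : 'I_3) :
  \sum_j F j = F i + F (i + 1) + F (i + 2).
Proof.
rewrite sum3; elim/ord3_ind: i.
- by congr (_ + F _ + F _); apply: val_inj.
- rewrite -addrA addrC; congr (_ + _ + _); congr (F _); exact: val_inj.
- rewrite addrC addrA; congr (_ + _ + _); congr (F _); exact: val_inj.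
Qed.

(** * The net of quadrics in diagonal form *)

Section Quadrics.
Variables (k : fieldType) (char2 : 2%N \in [pchar k]).
Variables (a sc sd : 'I_3 -> k).

(** The numbers [gam i] solve the Vandermonde system of [gam_sum]: their moments of order 0, 1, 2
    are 0, 1, 0. Replacing X_i Y_i by X_i Y_i + gam_i L^2 therefore leaves the first and third
    quadrics unchanged and contributes exactly L^2 to the second. *)
Definition den i := (a i + a (i + 1)) * (a i + a (i + 2)).
Definition gam i := (a (i + 1) + a (i + 2)) / den i.

Definition LamP : {mpoly k[6]} := \sum_i (sc i *: X k i + sd i *: Y k i).
Definition nq i : {mpoly k[6]} := X k i * Y k i + gam i *: LamP ^+ 2.

Definition sqf (f : 'I_3 -> k) i := f i ^+ 2.

Hypothesis a_inj : injective a.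

Lemma aD_neq0 i j : i != j -> a i + a j != 0.
Proof.
by move=> h; rewrite -(GRing.subr_pchar2 char2) subr_eq0; apply: contra h => /eqP/a_inj->.
Qed.

Lemma den_neq0 i : den i != 0.
Proof. by case: (ord3_cyc i) => *; rewrite mulf_neq0 // aD_neq0. Qed.

Lemma gam_neq0 i : gam i != 0.
Proof. by case: (ord3_cyc i) => *; rewrite mulf_neq0 ?invr_eq0 ?den_neq0 ?aD_neq0. Qed.

Lemma char2_mpoly n : 2%N \in [pchar {mpoly k[n]}].
Proof.
rewrite inE /= -[2%:R]/(1 *+ 2) -mpolyC1 -raddfMn /= [1 *+ 2]mulr2n.
by rewrite addrr_pchar2 // mpolyC0.
Qed.

Lemma gam_sum : [/\ \sum_i gam i = 0, \sum_i a i * gam i = 1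
  & \sum_i a i ^+ 2 * gam i = 0].
Proof.
have [h01 h02 h12] : [/\ a 0 + a 1 != 0, a 0 + a 2 != 0 & a 1 + a 2 != 0].
  by rewrite !aD_neq0.
have e0 : gam 0 = (a 1 + a 2) / ((a 0 + a 1) * (a 0 + a 2)).
  by rewrite /gam /den; congr ((a _ + a _) / ((_ + a _) * (_ + a _))); apply: val_inj.
have e1 : gam 1 = (a 2 + a 0) / ((a 1 + a 2) * (a 1 + a 0)).
  by rewrite /gam /den; congr ((a _ + a _) / ((_ + a _) * (_ + a _))); apply: val_inj.
have e2 : gam 2 = (a 0 + a 1) / ((a 2 + a 0) * (a 2 + a 1)).
  by rewrite /gam /den; congr ((a _ + a _) / ((_ + a _) * (_ + a _))); apply: val_inj.
have h1 : a 1 + a 0 != 0 by rewrite addrC.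
have h2 : a 2 + a 0 != 0 by rewrite addrC.
have h3 : a 2 + a 1 != 0 by rewrite addrC.
rewrite !sum3 e0 e1 e2; split.
(* The tactic [field] knows nothing of 2 = 0. Each sum differs from its asserted value by the double
   of an explicit fraction, which is supplied by hand. *)
- apply: (@char2_eq _ ((a 0 ^+ 2 + a 1 ^+ 2 + a 2 ^+ 2 + a 0 * a 1 + a 1 * a 2 + a 0 * a 2)
     / ((a 0 + a 1) * (a 0 + a 2) * (a 1 + a 2)))) => //; field.
  by rewrite ?h01 ?h02 ?h12 ?h1 ?h2 ?h3.
- apply: (@char2_eq _ (2%:R * a 0 * a 1 * a 2
     / ((a 0 + a 1) * (a 0 + a 2) * (a 1 + a 2)))) => //; field.
  by rewrite ?h01 ?h02 ?h12 ?h1 ?h2 ?h3.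
- apply: (@char2_eq _ ((a 0 ^+ 2 * a 1 ^+ 2 + a 1 ^+ 2 * a 2 ^+ 2 + a 0 ^+ 2 * a 2 ^+ 2 +
   a 0 ^+ 2 * a 1 * a 2 + a 0 * a 1 ^+ 2 * a 2 + a 0 * a 1 * a 2 ^+ 2)
     / ((a 0 + a 1) * (a 0 + a 2) * (a 1 + a 2)))) => //; field.
  by rewrite ?h01 ?h02 ?h12 ?h1 ?h2 ?h3.
Qed.

(** Squaring is additive in characteristic 2, so the square terms of the second quadric form
    together the square of a single linear form. *)
Lemma LamP_sq : LamP ^+ 2 = \sum_i (sqf sc i *: X k i ^+ 2 + sqf sd i *: Y k i ^+ 2).
Proof.
rewrite /LamP !sum3 /sqf.
have h := char2_mpoly 6.
have sq x y : (x + y : {mpoly k[6]}) ^+ 2 = x ^+ 2 + y ^+ 2.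
  by rewrite -!(pFrobenius_autE h) (pFrobenius_autD_comm _ (mulrC _ _)).
by rewrite !sq !exprZn.
Qed.

Lemma Sigma_eq_nq (r : 'I_3) :
  Sigma_eq a (sqf sc) (sqf sd) r = \sum_i a i ^+ r *: nq i.
Proof.
have [g0 g1 g2] := gam_sum.
have E r' (G : \sum_i a i ^+ r' * gam i = (r' == 1%N)%:R) :
   \sum_i a i ^+ r' *: nq i =
   \sum_i a i ^+ r' *: (X k i * Y k i) + (r' == 1%N)%:R *: LamP ^+ 2.
  rewrite -G scaler_suml -big_split /=; apply: eq_bigr => i _.
  by rewrite /nq scalerDr scalerA.
elim/ord3_ind: r; rewrite /Sigma_eq /Sigma_eqs /=.
- rewrite [RHS](E 0%N) ?scale0r ?addr0.
    by apply: eq_bigr => i _; rewrite scale1r.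
  by rewrite -[RHS]g0; apply: eq_bigr => i _; rewrite mul1r.
- rewrite [RHS](E 1%N) ?scale1r ?LamP_sq -?big_split //=.
  by apply: eq_bigr => i _; rewrite expr1 addrA.
- by rewrite [RHS](E 2%N) // scale0r addr0.
Qed.

(** Row i of the inverse Vandermonde matrix: the coefficients of the Lagrange polynomial (T +
    a_{i+1})(T + a_{i+2}) / [den i]. Its middle entry is [gam i]. *)
Definition vinv i (r : 'I_3) : k :=
  (if r == 0 then a (i + 1) * a (i + 2)
   else if r == 1 then a (i + 1) + a (i + 2) else 1) / den i.

Lemma vinvP i j : \sum_r vinv i r * a j ^+ r = (i == j)%:R.
Proof.
have dn := den_neq0 i.
have -> : \sum_r vinv i r * a j ^+ r = (a j + a (i + 1)) * (a j + a (i + 2)) / den i.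
  by rewrite sum3 /vinv /=; field.
have [<-|ne] := eqVneq; first by rewrite divff.
have : (j == i + 1) || (j == i + 2).
  by move: ne; clear; elim/ord3_ind: i; elim/ord3_ind: j.
by case/orP=> /eqP ->; rewrite addrr_pchar2 // ?mulr0 ?mul0r.
Qed.

Lemma nq_Sigma_eq i :
  nq i = \sum_r vinv i r *: Sigma_eq a (sqf sc) (sqf sd) r.
Proof.
under eq_bigr => r _ do rewrite Sigma_eq_nq scaler_sumr.
rewrite exchange_big /= (bigD1 i) //= [X in _ + X]big1 ?addr0.
  under eq_bigr => r _ do rewrite scalerA.
  by rewrite -scaler_suml vinvP eqxx scale1r.
move=> j ne; under eq_bigr => r _ do rewrite scalerA.
by rewrite -scaler_suml vinvP eq_sym (negbTE ne) scale0r.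
Qed.

Definition cx (v : 'rV[k]_6) (i : 'I_3) := v 0 (lshift 3 i).
Definition cy (v : 'rV[k]_6) (i : 'I_3) := v 0 (rshift 3 i).
Definition lam (v : 'rV[k]_6) := \sum_i (sc i * cx v i + sd i * cy v i).

Lemma meval_LamP (v : 'rV[k]_6) : LamP.@[v 0] = lam v.
Proof.
rewrite /LamP /lam raddf_sum /=; apply: eq_bigr => i _.
by rewrite mevalD !mevalZ !mevalXU.
Qed.

Lemma meval_nq (v : 'rV[k]_6) i : (nq i).@[v 0] = cx v i * cy v i + gam i * lam v ^+ 2.
Proof. by rewrite mevalD mevalM mevalZ rmorphXn /= meval_LamP !mevalXU. Qed.

Lemma Sigma_eq0P (v : 'rV[k]_6) :
  (forall r, (Sigma_eq a (sqf sc) (sqf sd) r).@[v 0] = 0) <->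
  (forall i, cx v i * cy v i = gam i * lam v ^+ 2).
Proof.
split=> h.
  move=> i; apply: char2_eqD => //; rewrite -meval_nq nq_Sigma_eq raddf_sum /=.
  by apply: big1 => r _; rewrite mevalZ h mulr0.
move=> r; rewrite Sigma_eq_nq raddf_sum /=; apply: big1 => i _.
by rewrite mevalZ meval_nq h addrr_pchar2 // mulr0.
Qed.

Lemma SigmaP (v : 'rV[k]_6) :
  (v \in Sigma a (sqf sc) (sqf sd)) <->
  (forall i, cx v i * cy v i = gam i * lam v ^+ 2).
Proof.
rewrite -Sigma_eq0P /Sigma /zeros unfold_in; split=> [/allP h r|h].
  by apply/eqP/h; rewrite /Sigma_eq; apply: mem_nth; case: r.
by rewrite /= -!/(Sigma_eq a (sqf sc) (sqf sd) _) (h 0) (h 1) (h 2) eqxx.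
Qed.

End Quadrics.

Lemma rowDE (k : pzSemiRingType) n (v w : 'rV[k]_n) i : (v + w) 0 i = v 0 i + w 0 i.
Proof. by rewrite mxE. Qed.

Lemma rowZE (k : pzSemiRingType) n x (v : 'rV[k]_n) i : (x *: v) 0 i = x * v 0 i.
Proof. by rewrite mxE. Qed.

Lemma cxD (k : fieldType) (v w : 'rV[k]_6) i : cx (v + w) i = cx v i + cx w i.
Proof. by rewrite /cx mxE. Qed.

Lemma cyD (k : fieldType) (v w : 'rV[k]_6) i : cy (v + w) i = cy v i + cy w i.
Proof. by rewrite /cy mxE. Qed.

(** [co true i] is the index of X_i and [co false i] that of Y_i, so that exchanging X_i and Y_i
    becomes negation of the boolean. *)
Definition co (b : bool) (i : 'I_3) : 'I_6 := if b then lshift 3 i else rshift 3 i.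
Arguments co : simpl never.
Lemma co_inj b b' i i' : co b i = co b' i' -> b = b' /\ i = i'.
Proof.
move=> /(congr1 val); rewrite /co; have := ltn_ord i; have := ltn_ord i'.
by case: b b' => -[] /= li li' e; split=> //; try (apply: val_inj => /=); lia.
Qed.

Lemma co_eq b b' i i' : (co b i == co b' i') = (b == b') && (i == i').
Proof.
apply/eqP/andP => [/co_inj [-> ->]|[/eqP-> /eqP->]] //.
Qed.

Lemma coP (j : 'I_6) : exists b i, j = co b i.
Proof. by case: (split_ordP (j : 'I_(3 + 3))) => i ->; [exists true|exists false]; exists i. Qed.

Lemma rowP6 (R : nzRingType) (v w : 'rV[R]_6) : (forall b i, v 0 (co b i) = w 0 (co b i)) -> v = w.
Proof. by move=> h; apply/rowP => j; have [b [i ->]] := coP j. Qed.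

(** * Lines and their intersection points *)

Section Lines.
Variables (k : fieldType) (char2 : 2%N \in [pchar k]).
Variables (a sc sd : 'I_3 -> k) (a_inj : injective a).
Hypothesis sc_neq0 : forall i, sc i != 0.
Hypothesis sd_neq0 : forall i, sd i != 0.

Definition cf b i := if b then sc i else sd i.
Arguments cf : simpl never.

Lemma cf_neq0 b i : cf b i != 0.
Proof. by case: b; [exact: sc_neq0|exact: sd_neq0]. Qed.

Lemma lamE (v : 'rV[k]_6) :
  lam sc sd v = \sum_i (cf true i * v 0 (co true i) + cf false i * v 0 (co false i)).
Proof. by []. Qed.

Lemma lamD v w : lam sc sd (v + w) = lam sc sd v + lam sc sd w.
Proof.
rewrite !lamE -big_split; apply: eq_bigr => i _ /=; rewrite !mxE; ring.
Qed.

Lemma lamZ x v : lam sc sd (x *: v) = x * lam sc sd v.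
Proof. rewrite !lamE mulr_sumr; apply: eq_bigr => i _ /=; rewrite !mxE; ring. Qed.

(** A vector supported on two coordinates. Each entry is the coefficient of L at the other
    coordinate, so L takes twice the product of the coefficients, that is 0. *)
Definition pv i b j b' : 'rV[k]_6 :=
  cf b' j *: delta_mx 0 (co b i) + cf b i *: delta_mx 0 (co b' j).

Lemma pvE i b j b' c l :
  pv i b j b' 0 (co c l) =
  cf b' j * ((c == b) && (l == i))%:R + cf b i * ((c == b') && (l == j))%:R.
Proof. by rewrite !mxE !eqxx !co_eq. Qed.

Lemma lam_delta b i : lam sc sd (delta_mx 0 (co b i)) = cf b i.
Proof.
rewrite lamE (bigD1 i) //= big1 => [|j ne].
  rewrite !mxE /= !co_eq eqxx !andbT addr0.
  by case: b; rewrite /= ?mulr1 ?mulr0 ?addr0 ?add0r.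
by rewrite !mxE /= !co_eq (negbTE ne) !andbF !mulr0 addr0.
Qed.

Lemma lam_pv i b j b' : lam sc sd (pv i b j b') = 0.
Proof. by rewrite lamD !lamZ !lam_delta mulrC (addrr_pchar2 char2). Qed.

Definition line (t : 'I_3 -> bool) (v : 'rV[k]_6) :=
  (forall i, v 0 (co (t i) i) = 0) /\ lam sc sd v = 0.

Lemma line_pv t i j : i != j -> line t (pv i (~~ t i) j (~~ t j)).
Proof.
move=> ne; split; last exact: lam_pv.
move=> l; rewrite pvE.
have [->|nl] := eqVneq l i.
  by rewrite (negbTE ne) !andbF; case: (t i); rewrite !mulr0 addr0.
rewrite andbF mulr0 add0r; have [->|nj] := eqVneq l j; last by rewrite andbF mulr0.
by case: (t j); rewrite mulr0.
Qed.

Definition lspace (t : 'I_3 -> bool) : {vspace 'rV[k]_6} :=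
  (<[pv 0%R (~~ t 0%R) 2%R (~~ t 2%R)]> + <[pv 1%R (~~ t 1%R) 2%R (~~ t 2%R)]>)%VS.

Lemma lspaceP t v : v \in lspace t <-> line t v.
Proof.
split.
  case/memv_addP=> v1 /vlineP[x ->] [v2 /vlineP[y ->] ->].
  have [|h1 h1'] := @line_pv t 0 2; first by [].
  have [|h2 h2'] := @line_pv t 1 2; first by [].
  split=> [i|]; last by rewrite lamD !lamZ h1' h2' !mulr0 addr0.
  by rewrite rowDE !rowZE h1 h2 !mulr0 addr0.
move=> [h hl]; set c := cf (~~ t 2) 2; have c0 : c != 0 by apply: cf_neq0.
apply/memv_addP; exists (v 0 (co (~~ t 0) 0) / c *: pv 0 (~~ t 0) 2 (~~ t 2)).
  by apply/vlineP; eexists.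
exists (v 0 (co (~~ t 1) 1) / c *: pv 1 (~~ t 1) 2 (~~ t 2)); first by apply/vlineP; eexists.
have hl' : \sum_i cf (~~ t i) i * v 0 (co (~~ t i) i) = 0.
  rewrite -[RHS]hl lamE; apply: eq_bigr => i _; move: (h i).
  by case: (t i) => /= ->; rewrite mulr0 ?addr0 ?add0r.
move: hl'; rewrite sum3 => hl'.
apply: rowP6 => b i; rewrite rowDE !rowZE !pvE -/c.
have [->|nb] := eqVneq b (t i).
  have nn x : (x == ~~ x) = false by case: x.
  rewrite h; elim/ord3_ind: i => /=; rewrite ?andbF ?andbT.
  - by rewrite nn !mulr0 ?addr0 ?mulr0 ?addr0.
  - by rewrite nn !mulr0 ?addr0 ?mulr0 ?addr0.
  - by rewrite nn !mulr0 ?addr0 ?mulr0 ?addr0.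
have -> : b = ~~ t i by move: nb; case: (t i); case: b.
elim/ord3_ind: i {nb} => /=; rewrite ?andbF ?andbT ?eqxx ?mulr0 ?mulr1 ?addr0 ?add0r.
- by rewrite mulr0 addr0 mulfVK.
- by rewrite mulr0 add0r mulfVK.
- rewrite -/c in hl'; apply: (mulfI c0); move/(char2_eqD char2): hl' => <-.
  by field.
Qed.

Lemma pv_neq0 i b j b' : i != j -> pv i b j b' != 0.
Proof.
move=> ne; apply/eqP => /rowP /(_ (co b i)); rewrite pvE !eqxx mxE (negbTE ne) andbF.
by rewrite mulr1 mulr0 addr0 => /eqP; rewrite (negbTE (cf_neq0 _ _)).
Qed.

Lemma dim_lspace t : \dim (lspace t) = 2%N.
Proof.
rewrite /lspace dimv_disjoint_sum ?dim_vline ?pv_neq0 //.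
apply/eqP; rewrite -subv0; apply/subvP => v /memv_capP[/vlineP[x ->] /vlineP[y]].
move/rowP/(_ (co (~~ t 0) 0)).
rewrite !rowZE !pvE !eqxx /= !andbF !mulr0 !addr0 mulr0 mulr1 => /eqP.
by rewrite mulf_eq0 (negbTE (cf_neq0 _ _)) orbF => /eqP->; rewrite scale0r mem0v.
Qed.

Lemma line_ext t t' : (forall v, line t v <-> line t' v) -> t =1 t'.
Proof.
move=> h i; apply/eqP/negP => /negP ne; have [ne1 _ _] := ord3_cyc i.
have /h[/(_ i) h1 _] := line_pv t ne1; move: h1; rewrite pvE.
have -> : t' i = ~~ t i by move: ne; case: (t i); case: (t' i).
rewrite !eqxx mulr1 (negbTE ne1) andbF mulr0 addr0 => /eqP.
by rewrite (negbTE (cf_neq0 _ _)).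
Qed.

Lemma line_Sigma t v : line t v ->
  forall i, cx v i * cy v i = gam a i * lam sc sd v ^+ 2.
Proof.
move=> [h ->] i; rewrite expr0n mulr0; move: (h i); rewrite /co /cx /cy.
by case: (t i) => ->; rewrite ?mul0r ?mulr0.
Qed.

(** If L were nonzero at some v of the line, the line would contain u nonzero with L(u) = 0.
    Comparing the equations at u, v and u + v gives X_i(u) Y_i(u) = 0 and X_i(v) Y_i(u) + X_i(u)
    Y_i(v) = 0 with X_i(v), Y_i(v) nonzero, which forces u = 0. So L vanishes on the line, and so do
    all the products X_i Y_i. *)
Lemma Sigma_line (L : {vspace 'rV[k]_6}) : \dim L = 2%N ->
  (forall v, v \in L -> forall i, cx v i * cy v i = gam a i * lam sc sd v ^+ 2) ->
  exists t, L = lspace t.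
Proof.
move=> dL hL.
have L0 v : v \in L -> lam sc sd v = 0.
  move=> vL; apply/eqP/negP => /negP lv.
  have [w wL wv] : exists2 w, w \in L & w \notin <[v]>%VS.
    apply/subvPn; apply/negP => /dimvS; rewrite dL dim_vline; lia.
  pose u := w + (lam sc sd w / lam sc sd v) *: v.
  have uL : u \in L by rewrite rpredD // rpredZ.
  have lu : lam sc sd u = 0 by rewrite lamD lamZ mulfVK ?(addrr_pchar2 char2).
  have u0 : u != 0.
    apply: contra wv; rewrite addr_eq0 => /eqP ->; rewrite rpredN.
    by apply/vlineP; eexists.
  case/eqP: u0; apply: rowP6 => b i; rewrite [RHS]mxE.
  have g0 : gam a i * lam sc sd v ^+ 2 != 0 by rewrite mulf_neq0 ?expf_neq0 ?gam_neq0.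
  have := hL _ (rpredD vL uL) i; rewrite lamD lu addr0 cxD cyD.
  have := hL _ vL i; have := hL _ uL i; rewrite lu expr0n mulr0 /= => e0 e1 e2.
  move: g0; rewrite -e1 mulf_eq0 negb_or => /andP[x1 y1].
  have e3 : cx v i * cy u i + cx u i * cy v i = 0.
    have -> : cx v i * cy u i + cx u i * cy v i =
      (cx v i + cx u i) * (cy v i + cy u i) - cx v i * cy v i - cx u i * cy u i by ring.
    by rewrite e2 e1 e0 subr0 subrr.
  move/eqP: e0; rewrite mulf_eq0 => /orP[] /eqP z; move: e3; rewrite z !(mul0r, mulr0, addr0, add0r) => /eqP;
   rewrite mulf_eq0 ?(negbTE x1) ?(negbTE y1) ?orbF /= => /eqP z'.
  - by case: b; [exact: z|exact: z'].
  - by case: b; [exact: z'|exact: z].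
have XY v i : v \in L -> cx v i * cy v i = 0.
  by move=> vL; rewrite hL // L0 // expr0n mulr0.
(* A linear space is not the union of two proper subspaces: with X_i nonzero at v and Y_i nonzero at
   w, the product X_i Y_i would not vanish at v + w. *)
have dich i : (forall v, v \in L -> cx v i = 0) \/ (forall v, v \in L -> cy v i = 0).
  apply: contrapT => /not_orP[] /existsNP[v /not_implyP[vL /eqP xv]].
  move=> /existsNP[w /not_implyP[wL /eqP yw]].
  move: (XY _ i vL) (XY _ i wL) (XY _ i (rpredD vL wL)).
  rewrite cxD cyD => /eqP.
  rewrite mulf_eq0 (negbTE xv) /= => /eqP-> /eqP.
  rewrite mulf_eq0 (negbTE yw) orbF => /eqP->; rewrite addr0 add0r => /eqP.
  by rewrite mulf_eq0 (negbTE xv) (negbTE yw).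
pose t i := `[< forall v, v \in L -> cx v i = 0 >].
exists t; apply/eqP; rewrite eqEdim dL dim_lspace leqnn andbT.
apply/subvP => v vL; apply/lspaceP; split=> [i|]; last exact: L0.
rewrite /t; case: asboolP => h; first exact: h.
by case: (dich i) => // h'; apply: h'.
Qed.

(** Entry i is true when X_i vanishes on the line and false when Y_i does. The lines Theta are the
    patterns with an odd number of true entries, the lines E those with an even number. *)
Definition pat (l : 'I_4 + 'I_4) : seq bool :=
  match l with
  | inl i => nth [::] [:: [:: true; true; true]; [:: false; false; true];
                          [:: false; true; false]; [:: true; false; false]] i
  | inr i => nth [::] [:: [:: false; false; false]; [:: true; true; false];
                          [:: true; false; true]; [:: false; true; true]] i
  end.
Definition tpat l (i : 'I_3) := nth true (pat l) i.

Lemma ThetaEP l v : (v \in ThetaE sc sd l) <-> line (tpat l) v.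
Proof.
have hX i : (X k i).@[v 0] = v 0 (co true i) by rewrite mevalXU.
have hY i : (Y k i).@[v 0] = v 0 (co false i) by rewrite mevalXU.
suff ->: (v \in ThetaE sc sd l) =
  [&& v 0 (co (tpat l 0) 0) == 0, v 0 (co (tpat l 1) 1) == 0,
      v 0 (co (tpat l 2) 2) == 0 & lam sc sd v == 0].
  split.
    case/and4P => /eqP h0 /eqP h1 /eqP h2 /eqP hl; split=> //.
    by elim/ord3_ind.
  by move=> [h ->]; rewrite !h eqxx.
rewrite lamE sum3 /= /ThetaE /Theta /E /zeros.
case: l => -[[|[|[|[|m]]]] Hm] //=; rewrite -topredE /= !mevalD !mevalZ !hX !hY andbT;
  rewrite /tpat /=; (do 3 (apply: andb_id2l => /eqP ->)).
all: by rewrite !mulr0 ?addr0 ?add0r.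
Qed.

End Lines.

Lemma vlineZ (k : fieldType) (V : vectType k) x (v : V) :
  x != 0 -> (<[x *: v]> = <[v]>)%VS.
Proof.
move=> x0; apply/eqP; rewrite eqEsubv -!memvE; apply/andP; split.
  by apply/vlineP; exists x.
by apply/vlineP; exists x^-1; rewrite scalerA mulVf // scale1r.
Qed.

Section Meeting.
Variables (k : fieldType) (char2 : 2%N \in [pchar k]).
Variables (a sc sd : 'I_3 -> k) (a_inj : injective a).
Hypothesis sc_neq0 : forall i, sc i != 0.
Hypothesis sd_neq0 : forall i, sd i != 0.

(** With the eight patterns as vertices of a cube, X_l = Y_l = 0 places p on two lines whose
    patterns are joined by an edge in direction l. *)
Definition edgept (p : 'rV[k]_6) := exists l,
  [/\ cx p l = 0, cy p l = 0, lam sc sd p = 0 & forall i, cx p i * cy p i = 0].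

Definition parity (t : 'I_3 -> bool) := t 0 (+) t 1 (+) t 2.

Lemma parity_tpat l : parity (tpat l) = if l is inl _ then true else false.
Proof. by case: l => -[[|[|[|[|]]]] Hm]. Qed.

Lemma tpat_parity (t : 'I_3 -> bool) :
  exists2 l, tpat l =1 t & parity t = if l is inl _ then true else false.
Proof.
suff [l hl] : exists l, tpat l =1 t.
  by exists l; rewrite -?parity_tpat // /parity !hl.
have [l [h0 h1 h2]] : exists l, [/\ tpat l 0 = t 0, tpat l 1 = t 1 & tpat l 2 = t 2].
  case: (t 0); case: (t 1); case: (t 2).
  - by exists (inl 0).
  - by exists (inr 1).
  - by exists (inr 2).
  - by exists (inl 3).
  - by exists (inr 3).
  - by exists (inl 2).
  - by exists (inl 1).
  - by exists (inr 0).
by exists l; elim/ord3_ind.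
Qed.

Lemma cxcy0 (p : 'rV[k]_6) b i : p 0 (co b i) = 0 -> cx p i * cy p i = 0.
Proof. by rewrite /cx /cy; case: b => /= h; rewrite h ?mul0r ?mulr0. Qed.

Lemma meeting_pointP p : meeting_point sc sd p <-> p != 0 /\ edgept p.
Proof.
split=> [[p0 [i [j [hi hj]]]]|[p0 [l [xl yl hl hxy]]]]; split=> //.
  have /ThetaEP[h1 hl] : p \in ThetaE sc sd (inl i) by [].
  have /ThetaEP[h2 _] : p \in ThetaE sc sd (inr j) by [].
  have /existsP[l ne] : [exists l, tpat (inl i) l != tpat (inr j) l].
    apply: contraT => /existsPn h.
    have e l : tpat (inl i) l = tpat (inr j) l by apply/eqP; rewrite -[_ == _]negbK h.
    have := parity_tpat (inl i); rewrite /parity !e.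
    by rewrite -/(parity (tpat (inr j))) parity_tpat.
  exists l; split=> //; last by move=> m; apply: cxcy0 (h1 m).
    move: (h1 l) (h2 l) ne; rewrite /cx -/(co true l).
    by case: (tpat (inl i) l); case: (tpat (inr j) l).
  move: (h1 l) (h2 l) ne; rewrite /cy -/(co false l).
  by case: (tpat (inl i) l); case: (tpat (inr j) l).
(* Since X_l and Y_l both vanish at p, the pattern of a line through p may be flipped at l. This
   changes its parity, so one of the two lines is a Theta and the other an E. *)
pose t i := cx p i == 0; pose t' i := if i == l then ~~ t i else t i.
have vt i : p 0 (co (t i) i) = 0.
  rewrite /t; case: eqP => [//|xi]; move/eqP: (hxy i); rewrite mulf_eq0.
  by case/orP=> /eqP.
have lt : line sc sd t p by [].
have lt' : line sc sd t' p.
  split=> // i; rewrite /t'; case: eqP => [->|_]; last exact: vt.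
  by case: (~~ t l); [exact: xl|exact: yl].
have par : parity t' = ~~ parity t.
  rewrite /parity /t'; elim/ord3_ind: l {xl yl t' lt'} => /=.
  - by case: (t 0); case: (t 1); case: (t 2).
  - by case: (t 0); case: (t 1); case: (t 2).
  - by case: (t 0); case: (t 1); case: (t 2).
have lineE u u' : u =1 u' -> line sc sd u p -> line sc sd u' p.
  by move=> e [h1 h2]; split=> // i; rewrite -e.
have [m hm pm] := tpat_parity t; have [m' hm' pm'] := tpat_parity t'.
have /ThetaEP Tm : line sc sd (tpat m) p by apply: lineE lt => i; rewrite hm.
have /ThetaEP Tm' : line sc sd (tpat m') p by apply: lineE lt' => i; rewrite hm'.
move: Tm Tm' pm pm'; rewrite par; case: m {hm} => i; case: m' {hm'} => j T T' -> //.
- by move=> _; exists i, j.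
- by move=> _; exists j, i.
Qed.

(** An index (l, b, c) names an edge of the cube: its direction l, then the choice between X and Y
    for the nonzero coordinates at l + 1 and l + 2. This accounts for 3 x 2 x 2 = 12 points. *)
Definition epoint (s : 'I_3 * bool * bool) : 'rV[k]_6 :=
  pv sc sd (s.1.1 + 1) s.1.2 (s.1.1 + 2) s.2.

Lemma epoint_neq0 s : epoint s != 0.
Proof. by apply: pv_neq0 => //; case: (ord3_cyc s.1.1). Qed.

Lemma epoint_supp s b m : (epoint s 0 (co b m) != 0) =
  ((b == s.1.2) && (m == s.1.1 + 1)) || ((b == s.2) && (m == s.1.1 + 2)).
Proof.
rewrite /epoint pvE; have [_ _ ne] := ord3_cyc s.1.1.
case: (boolP (_ && _)) => [/andP[/eqP -> /eqP ->]|_] /=.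
  by rewrite (negbTE ne) andbF mulr1 mulr0 addr0 cf_neq0.
by rewrite mulr0 add0r mulf_eq0 negb_or cf_neq0 //=; case: (_ && _); rewrite ?oner_eq0 ?eqxx.
Qed.

Lemma epoint_inj s s' : <[epoint s]>%VS = <[epoint s']>%VS -> s = s'.
Proof.
move=> e; have : epoint s \in <[epoint s']>%VS by rewrite -e memv_line.
case/vlineP=> x ex.
have x0 : x != 0.
  by apply: contraNneq (epoint_neq0 s) => x0; rewrite ex x0 scale0r.
have h b m : (epoint s 0 (co b m) != 0) = (epoint s' 0 (co b m) != 0).
  by rewrite ex rowZE mulf_eq0 (negbTE x0).
have {h} h b m := etrans (esym (epoint_supp s b m)) (etrans (h b m) (epoint_supp s' b m)).
move: (h true 0) (h false 0) (h true 1) (h false 1) (h true 2) (h false 2).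
case: s s' {e ex h} => [[l b] c] [[l' b'] c'] /=.
elim/ord3_ind: l; elim/ord3_ind: l'; case: b; case: c; case: b'; case: c' => //=.
Qed.

Lemma edge_epoint p : (p != 0 /\ edgept p) <->
  (p != 0 /\ exists s, <[p]>%VS = <[epoint s]>%VS).
Proof.
split=> -[p0 H]; split=> //; last first.
  case: H => s e; have : p \in <[epoint s]>%VS by rewrite -e memv_line.
  case/vlineP=> x ex.
  have [ne1 ne2 ne3] := ord3_cyc s.1.1.
  have h b m : p 0 (co b m) = x * epoint s 0 (co b m) by rewrite ex rowZE.
  exists s.1.1; split.
  - rewrite /cx -/(co true s.1.1) h; apply/eqP; rewrite mulf_eq0; apply/orP; right.
    by apply/negPn; rewrite epoint_supp (negbTE ne1) (negbTE ne2) !andbF.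
  - rewrite /cy -/(co false s.1.1) h; apply/eqP; rewrite mulf_eq0; apply/orP; right.
    by apply/negPn; rewrite epoint_supp (negbTE ne1) (negbTE ne2) !andbF.
  - by rewrite ex lamZ lam_pv // mulr0.
  - move=> i.
    have : (epoint s 0 (co true i) == 0) || (epoint s 0 (co false i) == 0).
      rewrite -[_ == 0]negbK -[_ (co false i) == 0]negbK -negb_and !epoint_supp.
      have [->|] := eqVneq i (s.1.1 + 1); rewrite ?(negbTE ne3) ?andbF ?andbT ?orbF ?orFb.
        by case: (s.1.2).
      by move=> _; case: (s.2) => /=; rewrite ?andbF.
    by case/orP=> /eqP z; [apply: (@cxcy0 _ true)|apply: (@cxcy0 _ false)]; rewrite h z mulr0.
case: H => l [xl yl hl hxy]; pose i := l + 1; pose j := l + 2.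
have [ne1 ne2 ne3] := ord3_cyc l.
pose s m := cx p m != 0.
have vs m : p 0 (co (~~ s m) m) = 0.
  rewrite /s negbK; case: eqP => [//|xi]; move/eqP: (hxy m); rewrite mulf_eq0.
  by case/orP=> /eqP.
have lE : cf sc sd (s i) i * p 0 (co (s i) i) + cf sc sd (s j) j * p 0 (co (s j) j) = 0.
  rewrite -[RHS]hl lamE (sum3c _ l) -/i -/j.
  have xl' : p 0 (co true l) = 0 := xl; have yl' : p 0 (co false l) = 0 := yl.
  rewrite xl' yl' !mulr0 !add0r; move: (vs i) (vs j).
  by case: (s i); case: (s j) => /= -> ->; rewrite !mulr0 ?addr0 ?add0r.
have ci := cf_neq0 sc_neq0 sd_neq0 (s i) i; have cj := cf_neq0 sc_neq0 sd_neq0 (s j) j.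
have nli : (l == i) = false by apply: negbTE.
have nlj : (l == j) = false by apply: negbTE.
have nij : (i == j) = false by apply: negbTE.
have nji : (j == i) = false by rewrite eq_sym.
have ep : p = (p 0 (co (s i) i) / cf sc sd (s j) j) *: epoint (l, s i, s j).
  apply: rowP6 => b m; rewrite rowZE /epoint pvE /= -/i -/j.
  have : [|| m == l, m == i | m == j].
    by rewrite /i /j; clear; elim/ord3_ind: l; elim/ord3_ind: m.
  case/or3P => /eqP ->; rewrite ?eqxx ?nli ?nlj ?nij ?nji.
  - by rewrite !andbF !mulr0 addr0 mulr0; case: b; [exact: xl|exact: yl].
  - rewrite andbF andbT mulr0 addr0; have [->|nb] := eqVneq b (s i).
      by rewrite mulr1 mulfVK.
    by rewrite !mulr0; have -> : b = ~~ s i by move: nb; case: (s i); case: b.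
  - rewrite andbF andbT mulr0 add0r; have [->|nb] := eqVneq b (s j).
      move/(char2_eqD char2): lE => lE; rewrite mulr1 mulrAC -[_ * cf _ _ _ _]mulrC lE.
      by rewrite mulrC mulrA mulVf // mul1r.
    by rewrite !mulr0; have -> : b = ~~ s j by move: nb; case: (s j); case: b.
exists (l, s i, s j); rewrite {1}ep vlineZ //.
by apply: contraNneq p0 => z; rewrite ep z scale0r.
Qed.

Lemma twelve_points : exists P : 'I_12 -> 'rV[k]_6,
  [/\ forall n, P n != 0, injective (fun n => <[P n]>%VS)
    & forall p : 'rV[k]_6, meeting_point sc sd p <->
        p != 0 /\ exists n, <[p]>%VS = <[P n]>%VS].
Proof.
have e12 : #|{: 'I_3 * bool * bool}| = 12%N by rewrite !card_prod card_ord card_bool.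
pose ev (n : 'I_12) : 'I_3 * bool * bool := enum_val (cast_ord (esym e12) n).
have ev_inj : injective ev by move=> n m /enum_val_inj/cast_ord_inj.
exists (fun n => epoint (ev n)); split=> [n|n m /epoint_inj/ev_inj //|p].
  exact: epoint_neq0.
rewrite meeting_pointP edge_epoint; split=> -[p0 [s h]]; split=> //; last by exists (ev s).
exists (cast_ord e12 (enum_rank s)); rewrite h /ev.
by rewrite (_ : cast_ord _ _ = enum_rank s) ?enum_rankK //; apply: val_inj.
Qed.

(** The derivative of L^2 is zero in characteristic 2, so only X_i Y_i contributes. *)
Lemma mderiv_nq i b m :
  (nq a sc sd i)^`M(co b m) = (i == m)%:R *: 'X_(co (~~ b) m).
Proof.
have h2 := char2_mpoly char2 6.
rewrite /nq mderivD mderivM mderivZ expr2 mderivM [X in _ *: (_ + X)]mulrC addrr_pchar2 //.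
rewrite scaler0 addr0 /X /Y !mderivX -!/(co true i) -!/(co false i).
have U c : (U_(co c i) (co b m))%MM = ((c == b) && (i == m)) by rewrite mnmE co_eq.
rewrite !U; have [<-|ne] := eqVneq i m; last by rewrite !andbF !scale0r mul0r mulr0 addr0.
have X0 : 'X_[0%MM] = 1 :> {mpoly k[6]} by rewrite mpolyX0.
have Um c : (U_(co c i) - U_(co c i) = 0 :> 'X_{1..6})%MM.
  by apply/mnmP => j; rewrite mnmBE subnn mnm0E.
case: b {U} => /=; rewrite !scale1r !scale0r ?mul0r ?mulr0 ?addr0 ?add0r.
  by rewrite Um X0 mul1r.
by rewrite Um X0 mulr1.
Qed.

Let q := Sigma_eq a (sqf sc) (sqf sd).

Lemma jacobianE p (r : 'I_3) b m :
  jacobian q p r (co b m) = a m ^+ r * p 0 (co (~~ b) m).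
Proof.
rewrite mxE /q Sigma_eq_nq // (raddf_sum (mderiv _)) /= raddf_sum /= (bigD1 m) //=.
rewrite big1 => [|i ne]; rewrite mderivZ mderiv_nq mevalZ mevalZ mevalXU.
  by rewrite eqxx mul1r addr0.
by rewrite (negbTE ne) mul0r mulr0.
Qed.

(** If X_i = Y_i = 0 for some i, then L = 0 because [gam i] is nonzero, and p is an edge point.
    Otherwise every i has a nonzero coordinate, so a vector u in the left kernel of the Jacobian
    satisfies sum_r u_r a_i^r = 0 for all i, and the Vandermonde matrix is invertible. *)
Lemma rank_jacobian (p : 'rV[k]_6) : (forall i, (q i).@[p 0] = 0) -> p != 0 ->
  \rank (jacobian q p) = 3%N \/ edgept p.
Proof.
move/(Sigma_eq0P char2 sc sd a_inj) => hp p0.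
case: (boolP [exists i, (cx p i == 0) && (cy p i == 0)]) => [|/existsPn hn].
  case/existsP=> i /andP[/eqP x0 /eqP y0]; right; exists i.
  have l0 : lam sc sd p = 0.
    move: (hp i); rewrite x0 mul0r => /esym/eqP.
    by rewrite mulf_eq0 (negbTE (gam_neq0 char2 a_inj i)) expf_eq0 /= => /eqP.
  by split=> // j; rewrite hp l0 expr0n mulr0.
left; apply/eqP; rewrite -[_ == _]/(row_free _) -kermx_eq0; apply/rowV0P => u.
move/sub_kermxP => uJ.
have uA i : \sum_r u 0 r * a i ^+ r = 0.
  have [b hb] : exists b, p 0 (co (~~ b) i) != 0.
    by move: (hn i); rewrite negb_and => /orP[h|h]; [exists false|exists true].
  move/rowP/(_ (co b i)): uJ; rewrite !mxE.
  under eq_bigr => r _ do rewrite jacobianE mulrA.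
  rewrite -mulr_suml => /eqP; rewrite mulf_eq0 (negbTE hb) orbF => /eqP e.
  by rewrite -[RHS]e; apply: eq_bigr.
pose A : 'M[k]_3 := \matrix_(r, i) a i ^+ r.
pose W : 'M[k]_3 := \matrix_(i, r) vinv a i r.
have WA : W *m A = 1%:M.
  apply/matrixP => i j; rewrite !mxE -(vinvP char2 a_inj i j).
  by apply: eq_bigr => r _; rewrite !mxE.
rewrite -[u]mulmx1 -(mulmx1C WA) mulmxA.
suff -> : u *m A = 0 by rewrite mul0mx.
by apply/rowP => i; rewrite !mxE -[RHS](uA i); apply: eq_bigr => r _; rewrite mxE.
Qed.
End Meeting.

(** * Formal power series *)

Section PowerSeriesRing.
Variables (k : fieldType) (n : nat).
Implicit Types (f g h : pseries k n) (m : 'X_{1..n}).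

HB.instance Definition _ := gen_eqMixin (pseries k n).
HB.instance Definition _ := gen_choiceMixin (pseries k n).

Definition ps_zero : pseries k n := fun=> 0.
Definition ps_opp f : pseries k n := fun m => - f m.

Fact ps_addA : associative (@ps_add k n).
Proof. by move=> f g h; apply: funext => m; rewrite /ps_add addrA. Qed.
Fact ps_addC : commutative (@ps_add k n).
Proof. by move=> f g; apply: funext => m; rewrite /ps_add addrC. Qed.
Fact ps_add0 : left_id ps_zero (@ps_add k n).
Proof. by move=> f; apply: funext => m; rewrite /ps_add add0r. Qed.
Fact ps_addN : left_inverse ps_zero ps_opp (@ps_add k n).
Proof. by move=> f; apply: funext => m; rewrite /ps_add addNr. Qed.

HB.instance Definition _ := GRing.isZmodule.Build (pseries k n)
  ps_addA ps_addC ps_add0 ps_addN.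

Definition trunc N f : {mpoly k[n]} := \sum_(m : 'X_{1..n < N.+1}) f m *: 'X_[m].

Lemma trunc_coef N f m : (mdeg m <= N)%N -> (trunc N f)@_m = f m.
Proof. by move=> le; rewrite mcoeff_mpoly. Qed.

(** The coefficient of a product at m involves only coefficients of degree at most [mdeg m], so it
    can be computed on polynomial truncations. The ring laws of power series are inherited from
    polynomials in this way. *)
Lemma ps_mul_coef f g (F G : {mpoly k[n]}) m :
  (forall m', (mdeg m' <= mdeg m)%N -> f m' = F@_m') ->
  (forall m', (mdeg m' <= mdeg m)%N -> g m' = G@_m') ->
  ps_mul f g m = (F * G)@_m.
Proof.
move=> hf hg; rewrite mcoeffM; apply: eq_bigr => h _.
by rewrite hf ?hg //; [exact: (bmdeg h.2)|exact: (bmdeg h.1)].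
Qed.

Let T f m m' : (mdeg m' <= mdeg m)%N -> f m' = (trunc (mdeg m) f)@_m'.
Proof. by move=> le; rewrite trunc_coef. Qed.

Let T1 m m' : (mdeg m' <= mdeg m)%N -> ps_of_mpoly 1 m' = (1 : {mpoly k[n]})@_m'.
Proof. by []. Qed.

Let TM f g m m' : (mdeg m' <= mdeg m)%N ->
  ps_mul f g m' = (trunc (mdeg m) f * trunc (mdeg m) g)@_m'.
Proof.
move=> le; apply: ps_mul_coef => m'' le'; apply: T; exact: leq_trans le' le.
Qed.

Fact ps_mulA : associative (@ps_mul k n).
Proof.
move=> f g h; apply: funext => m.
by rewrite (ps_mul_coef (@T f m) (@TM g h m)) (ps_mul_coef (@TM f g m) (@T h m)) mulrA.
Qed.
Fact ps_mulC : commutative (@ps_mul k n).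
Proof.
move=> f g; apply: funext => m.
by rewrite (ps_mul_coef (@T f m) (@T g m)) (ps_mul_coef (@T g m) (@T f m)) mulrC.
Qed.
Fact ps_mul1 : left_id (ps_of_mpoly 1) (@ps_mul k n).
Proof.
move=> f; apply: funext => m.
by rewrite (ps_mul_coef (@T1 m) (@T f m)) mul1r -T.
Qed.
Fact ps_mulDl : left_distributive (@ps_mul k n) (@ps_add k n).
Proof.
move=> f g h; apply: funext => m.
have TD m' : (mdeg m' <= mdeg m)%N ->
    ps_add f g m' = (trunc (mdeg m) f + trunc (mdeg m) g)@_m'.
  by move=> le; rewrite mcoeffD -!T.
rewrite (ps_mul_coef TD (@T h m)) /ps_add.
by rewrite (ps_mul_coef (@T f m) (@T h m)) (ps_mul_coef (@T g m) (@T h m)) mulrDl mcoeffD.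
Qed.
Fact ps_1neq0 : (ps_of_mpoly 1 : pseries k n) != 0.
Proof.
apply/eqP => /(congr1 (fun f : pseries k n => f 0%MM)).
by rewrite /ps_of_mpoly mcoeff1 eqxx => /eqP; rewrite oner_eq0.
Qed.

HB.instance Definition _ := GRing.Zmodule_isComNzRing.Build (pseries k n)
  ps_mulA ps_mulC ps_mul1 ps_mulDl ps_1neq0.

Lemma psD f g m : (f + g) m = f m + g m. Proof. by []. Qed.
Lemma psN f m : (- f) m = - f m. Proof. by []. Qed.

Lemma psMcoef f g (F G : {mpoly k[n]}) m :
  (forall m', (mdeg m' <= mdeg m)%N -> f m' = F@_m') ->
  (forall m', (mdeg m' <= mdeg m)%N -> g m' = G@_m') ->
  (f * g) m = (F * G)@_m.
Proof. exact: ps_mul_coef. Qed.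

Lemma ps_sum I (r : seq I) (P : pred I) (F : I -> pseries k n) m :
  (\sum_(i <- r | P i) F i) m = \sum_(i <- r | P i) F i m.
Proof. by elim/big_rec2: _ => // i y x _ <-. Qed.

Definition psP : {mpoly k[n]} -> pseries k n := @ps_of_mpoly k n.

Fact psP_additive : additive psP.
Proof. by move=> F G; apply: funext => m; rewrite /psP /ps_of_mpoly mcoeffB. Qed.
HB.instance Definition _ := GRing.isAdditive.Build _ _ psP psP_additive.
Fact psP_multiplicative : multiplicative psP.
Proof. by split=> // F G; apply: funext => m; rewrite /psP /ps_of_mpoly (@psMcoef _ _ F G). Qed.
HB.instance Definition _ := GRing.isMultiplicative.Build _ _ psP psP_multiplicative.

Definition psC (c : k) : pseries k n := psP c%:MP.
Fact psC_additive : additive psC. Proof. by move=> x y; rewrite /psC !raddfB. Qed.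
HB.instance Definition _ := GRing.isAdditive.Build _ _ psC psC_additive.
Fact psC_multiplicative : multiplicative psC.
Proof. by split=> [x y|]; rewrite /psC ?rmorphM ?rmorph1. Qed.
HB.instance Definition _ := GRing.isMultiplicative.Build _ _ psC psC_multiplicative.

Lemma psCM c f m : (psC c * f) m = c * f m.
Proof.
rewrite (@psMcoef _ _ c%:MP (trunc (mdeg m) f)) //; last by move=> *; apply: T.
by rewrite mcoeffCM trunc_coef.
Qed.

Lemma psM0 f g : (f * g) 0%MM = f 0%MM * g 0%MM.
Proof.
rewrite (psMcoef (@T f 0%MM) (@T g 0%MM)) (mcoeffM _ _ 0%MM).
rewrite (bigD1 (BMultinom (n := n) (bound := (mdeg 0%MM).+1) (ltnSn _), BMultinom (ltnSn _))) /=; last by rewrite addm0.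
rewrite big1 ?addr0 -?T //= => -[h1 h2] /= /andP[/eqP e].
case/eqP; congr (_, _); apply: val_inj => /=; apply/eqP.
  by rewrite -mdeg_eq0 -leqn0 -[X in (_ <= X)%N](@mdeg0 n); exact: (bmdeg h1).
by rewrite -mdeg_eq0 -leqn0 -[X in (_ <= X)%N](@mdeg0 n); exact: (bmdeg h2).
Qed.

(** Membership in the N-th power of the maximal ideal. It serves as the notion of convergence: a
    series of every order is 0 by [ordgeP]. *)
Definition ordge N f := forall m, (mdeg m < N)%N -> f m = 0.

Lemma ordgeD N f g : ordge N f -> ordge N g -> ordge N (f + g).
Proof. by move=> hf hg m lt; rewrite psD hf ?hg ?addr0. Qed.
Lemma ordgeN N f : ordge N f -> ordge N (- f).
Proof. by move=> hf m lt; rewrite psN hf ?oppr0. Qed.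
Lemma ordgeB N f g : ordge N f -> ordge N g -> ordge N (f - g).
Proof. by move=> hf hg; apply/ordgeD/ordgeN. Qed.
Lemma ordge_le M N f : (M <= N)%N -> ordge N f -> ordge M f.
Proof. by move=> le h m lt; apply/h/(leq_trans lt). Qed.
Lemma ordgeM M N f g : ordge M f -> ordge N g -> ordge (M + N) (f * g).
Proof.
move=> hf hg m lt; rewrite (psMcoef (@T f m) (@T g m)) mcoeffM; apply: big1 => h /eqP e.
rewrite -!T; [|exact: (bmdeg h.2)|exact: (bmdeg h.1)].
have : (mdeg h.1 + mdeg h.2 < M + N)%N by rewrite -mdegD -e.
case: (ltnP (mdeg h.1) M) => [lt1 _|le1 lt2]; first by rewrite hf ?mul0r.
rewrite (hg h.2) ?mulr0 //; lia.
Qed.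
Lemma ordge0M f g N : ordge N g -> ordge N (f * g).
Proof. by move=> h; rewrite -[N]add0n; apply: ordgeM. Qed.
Lemma ordgeP f : (forall N, ordge N f) -> f = 0.
Proof. by move=> h; apply: funext => m; apply: (h (mdeg m).+1). Qed.
Lemma ordge1 f : ordge 1 f <-> f 0%MM = 0.
Proof.
split=> [h|h m]; first by apply: h; rewrite mdeg0.
by rewrite ltnS leqn0 mdeg_eq0 => /eqP ->.
Qed.
Lemma ordgeX f i : ordge 1 f -> ordge i (f ^+ i).
Proof.
move=> h; elim: i => // i IH; rewrite exprS -[i.+1]add1n; exact: ordgeM.
Qed.

(** Contraction principle: P raises the order of a difference by one, so the iterates from 0 form a
    Cauchy sequence. It replaces the implicit function theorem below. *)
Lemma ps_fixpoint (P : pseries k n -> pseries k n) :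
  (forall f, ordge 1 f -> ordge 1 (P f)) ->
  (forall N f g, ordge 1 f -> ordge 1 g -> ordge N (f - g) -> ordge N.+1 (P f - P g)) ->
  exists2 f, ordge 1 f & P f = f.
Proof.
move=> P1 PN; pose it N := iter N P 0.
have it1 N : ordge 1 (it N) by elim: N => [|N IH] //=; apply: P1.
have itS N : ordge N (it N.+1 - it N).
  by elim: N => [|N IH]; [move=> m|apply: PN (it1 _) (it1 _) IH].
have itM N M : (N <= M)%N -> ordge N (it M - it N).
  elim: M => [|M IH]; first by case: N => // _ m.
  rewrite leq_eqVlt => /orP[/eqP<-|lt]; first by rewrite subrr.
  rewrite -[it M.+1](subrK (it M)) -addrA; apply: ordgeD (IH lt).
  by apply: ordge_le (itS M).
(* The coefficient at m no longer changes from the iterate of index [mdeg m] + 1 on. *)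
pose f : pseries k n := fun m => it (mdeg m).+1 m.
have fit N : ordge N (f - it N).
  move=> m lt; apply/eqP; rewrite psD psN /f subr_eq0; apply/eqP/esym.
  by apply/eqP; rewrite -subr_eq0; apply/eqP; apply: (itM (mdeg m).+1 N lt).
have f1 : ordge 1 f by rewrite -[f](subrK (it 1%N)); apply: ordgeD.
exists f => //; apply/eqP; rewrite -subr_eq0; apply/eqP/ordgeP => N.
rewrite -[P f](subrK (P (it N))) -addrA; apply: ordgeD.
  by apply: ordge_le (PN N _ _ f1 (it1 N) (fit N)).
rewrite -[P (it N)]/(it N.+1) -opprB; apply: ordgeN.
by apply: ordge_le (fit N.+1).
Qed.

(** Geometric series: with e = 1 - f/c of positive order, h = e (1 + h) has a solution, and (1 +
    h)/c inverts f. *)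
Lemma ps_inv f : f 0%MM != 0 -> exists g, f * g = 1.
Proof.
set c := f 0%MM => c0.
have f1 : ordge 1 (1 - psC c^-1 * f).
  by apply/ordge1; rewrite psD psN psCM mulVf // /GRing.one /= /ps_of_mpoly mcoeff1 eqxx subrr.
pose e := 1 - psC c^-1 * f.
have [||h h1 hE] := @ps_fixpoint (fun h => e * (1 + h)).
- by move=> h _; rewrite mulrC; apply: ordge0M.
- by move=> N h h' _ _ hh; rewrite -mulrBr opprD addrACA subrr add0r -add1n; apply: ordgeM.
exists (psC c^-1 * (1 + h)).
have -> : f * (psC c^-1 * (1 + h)) = (1 + h) - e * (1 + h) by rewrite /e; ring.
by rewrite hE addrK.
Qed.

End PowerSeriesRing.

Lemma mmap_cong (R : comNzRingType) (S : comNzRingType) (phi : {rmorphism R -> S}) n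
    (J : S -> Prop) (s t : 'I_n -> S) (F : {mpoly R[n]}) :
  J 0 -> (forall x y, J x -> J y -> J (x + y)) -> (forall x y, J y -> J (x * y)) ->
  (forall i, J (s i - t i)) -> J (mmap phi s F - mmap phi t F).
Proof.
move=> J0 JD JM st.
have JP : forall x y x' y', J (x - x') -> J (y - y') -> J (x * y - x' * y').
  move=> x y x' y' hx hy.
  have -> : x * y - x' * y' = y * (x - x') + x' * (y - y') by ring.
  by apply: JD; apply: JM.
rewrite /mmap -sumrB; apply: (big_ind J) => // m _.
rewrite -mulrBr; apply: JM; rewrite /mmap1.
apply: (big_rec2 (fun x y => J (x - y))) => [|i x y _ h]; first by rewrite subrr.
apply: (JP _ _ _ _ _ h); elim: (m i) => [|j IH]; first by rewrite subrr.
by rewrite !exprS; apply: JP.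
Qed.

Section Subst.
Variables (k : fieldType) (n n' : nat) (s : 'I_n -> pseries k n').
Hypothesis s1 : forall i, ordge 1 (s i).
Implicit Types (f g : pseries k n).

(** Since every [s i] has order at least 1, terms of f of degree above [mdeg m] do not reach the
    coefficient at m, and a truncation is enough. *)
Definition psubst f : pseries k n' := fun m => mmap (@psC k n') s (trunc (mdeg m) f) m.

Lemma mmap1_ordge (m : 'X_{1..n}) : ordge (mdeg m) (mmap1 s m).
Proof.
rewrite /mmap1 mdegE.
by elim/big_rec2: _ => // i N f _ h; apply: ordgeM h; apply: ordgeX.
Qed.

Lemma mmap_ordge N (F : {mpoly k[n]}) :
  (forall m, (mdeg m < N)%N -> F@_m = 0) -> ordge N (mmap (@psC k n') s F).
Proof.
move=> h; apply: (big_ind (ordge N)) => [|*|m _] //; first exact: ordgeD.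
have [lt|le] := ltnP (mdeg m) N; first by rewrite h // raddf0 mul0r.
by apply/ordge0M/(ordge_le le)/mmap1_ordge.
Qed.

Lemma psubst_approx N f (F : {mpoly k[n]}) :
  (forall m, (mdeg m <= N)%N -> f m = F@_m) ->
  ordge N.+1 (psubst f - mmap (@psC k n') s F).
Proof.
move=> h m lt; rewrite psD psN /psubst -psN -psD -raddfB.
apply: (mmap_ordge (N := (mdeg m).+1)) => // m' lt'.
by rewrite mcoeffB trunc_coef // h ?subrr //; apply: (@leq_trans (mdeg m)).
Qed.

(** Up to order N a substitution is that of any polynomial agreeing with f in degrees at most N.
    Products and composites of substitutions are thereby reduced to polynomials. *)
Lemma psubst_eq f (G : pseries k n') :
  (forall N (F : {mpoly k[n]}), (forall m, (mdeg m <= N)%N -> f m = F@_m) ->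
    ordge N.+1 (G - mmap (@psC k n') s F)) -> psubst f = G.
Proof.
move=> h; apply/eqP; rewrite -subr_eq0; apply/eqP/ordgeP => N.
apply: (@ordge_le _ _ N N.+1) => //.
have hT : forall m, (mdeg m <= N)%N -> f m = (trunc N f)@_m by move=> m le; rewrite trunc_coef.
rewrite -[psubst f](subrK (mmap (@psC k n') s (trunc N f))) -addrA.
apply: ordgeD (psubst_approx hT) _; rewrite -opprB; apply: ordgeN; exact: h.
Qed.

Lemma psubstP (F : {mpoly k[n]}) : psubst (psP F) = mmap (@psC k n') s F.
Proof.
apply: psubst_eq => N G h; rewrite -raddfB; apply: mmap_ordge => m lt.
by rewrite mcoeffB -h // subrr.
Qed.

Let T N f m : (mdeg m <= N)%N -> f m = (trunc N f)@_m.
Proof. by move=> le; rewrite trunc_coef. Qed.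

Fact psubst_additive : additive psubst.
Proof.
move=> f g; apply: psubst_eq => N F h.
have -> : F = trunc N f - trunc N g + (F - (trunc N f - trunc N g)) by rewrite addrC subrK.
rewrite rmorphD opprD addrA; apply: ordgeB; last first.
  by apply: mmap_ordge => m lt; rewrite !mcoeffB -h // -!T // psD psN subrr.
rewrite rmorphB /=; set u := mmap _ _ (trunc N f); set v := mmap _ _ (trunc N g).
have -> : psubst f - psubst g - (u - v) = (psubst f - u) - (psubst g - v) by ring.
by apply: ordgeB; apply: psubst_approx => m le; apply: T.
Qed.
HB.instance Definition _ := GRing.isAdditive.Build _ _ psubst psubst_additive.

Fact psubst_multiplicative : multiplicative psubst.
Proof.
split=> [f g|]; last first.
  by have := psubstP 1; rewrite -[psP 1]/(1 : pseries k n) rmorph1.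
apply: psubst_eq => N F h.
have -> : F = trunc N f * trunc N g + (F - trunc N f * trunc N g) by rewrite addrC subrK.
rewrite rmorphD opprD addrA; apply: ordgeB; last first.
  apply: mmap_ordge => m lt; rewrite mcoeffB -h //.
  rewrite (@psMcoef _ _ f g (trunc N f) (trunc N g)) ?subrr // => m' le; apply: T;
  exact: leq_trans le lt.
rewrite rmorphM /=; set u := mmap _ _ (trunc N f); set v := mmap _ _ (trunc N g).
have -> : psubst f * psubst g - u * v = psubst g * (psubst f - u) + u * (psubst g - v) by ring.
by apply: ordgeD; apply: ordge0M; apply: psubst_approx => m le; apply: T.
Qed.
HB.instance Definition _ := GRing.isMultiplicative.Build _ _ psubst psubst_multiplicative.

Lemma psubstC (c : k) : psubst (psC c) = psC c.
Proof. by rewrite psubstP mmapC. Qed.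

Lemma psubstX i : psubst (psP 'X_i) = s i.
Proof. by rewrite psubstP mmapX mmap1U. Qed.

Lemma psubst_ordge N f : ordge N f -> ordge N (psubst f).
Proof.
case: N => [|N] h; first by move=> m.
rewrite -[psubst f](subrK (mmap (@psC k n') s (trunc N f))).
apply: ordgeD; first by apply: psubst_approx => m le; apply: T.
by apply: mmap_ordge => m lt; rewrite -T // h.
Qed.

Lemma psubstD f g : psubst (f + g) = psubst f + psubst g. Proof. exact: raddfD. Qed.
Lemma psubstB f g : psubst (f - g) = psubst f - psubst g. Proof. exact: raddfB. Qed.
Lemma psubstM f g : psubst (f * g) = psubst f * psubst g. Proof. exact: rmorphM. Qed.
Lemma psubst1 : psubst 1 = 1. Proof. exact: rmorph1. Qed.
Lemma psubstXn f i : psubst (f ^+ i) = psubst f ^+ i. Proof. exact: rmorphXn. Qed.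
Lemma psubst_sum I (r : seq I) (P : pred I) F :
  psubst (\sum_(i <- r | P i) F i) = \sum_(i <- r | P i) psubst (F i).
Proof. exact: raddf_sum. Qed.
Lemma psubst_prod I (r : seq I) (P : pred I) F :
  psubst (\prod_(i <- r | P i) F i) = \prod_(i <- r | P i) psubst (F i).
Proof. exact: rmorph_prod. Qed.

End Subst.

Lemma psubst_comp (k : fieldType) n n' n'' (s : 'I_n -> pseries k n')
    (t : 'I_n' -> pseries k n'') (f : pseries k n) :
  (forall i, ordge 1 (s i)) -> (forall i, ordge 1 (t i)) ->
  psubst t (psubst s f) = psubst (fun i => psubst t (s i)) f.
Proof.
move=> s1 t1; apply/esym/psubst_eq => [i|N F h]; first exact: psubst_ordge.
have -> : mmap (@psC k n'') (fun i => psubst t (s i)) F = psubst t (mmap (@psC k n') s F).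
  rewrite /mmap psubst_sum //; apply: eq_bigr => m _; rewrite psubstM //= psubstC //; congr (_ * _).
  by rewrite /mmap1 psubst_prod //; apply: eq_bigr => i _; rewrite psubstXn.
rewrite -psubstB //; apply: psubst_ordge => //; exact: psubst_approx.
Qed.

Lemma psubst_id (k : fieldType) n (f : pseries k n) : psubst (fun i => psP 'X_i) f = f.
Proof.
apply: psubst_eq => [i|N F h].
  by apply/ordge1; rewrite /psP /ps_of_mpoly mcoeffX mnm1_eq0.
have -> : mmap (@psC k n) (fun i => psP 'X_i) F = psP F.
  rewrite [in RHS](mpolyE F) raddf_sum /= /mmap; apply: eq_bigr => m _.
  rewrite -mul_mpolyC rmorphM /=; congr (_ * _).
  by rewrite mpolyXE_id rmorph_prod /=; apply: eq_bigr => i _; rewrite rmorphXn.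
by move=> m lt; rewrite psD psN h // subrr.
Qed.

Lemma eq_psubst (k : fieldType) n n' (s t : 'I_n -> pseries k n') :
  s =1 t -> psubst s =1 psubst t.
Proof. by move/funext ->. Qed.

(** Each monomial of f is divisible by some variable of P; it is charged to the first one found by
    [pick] and divided by it. No cancellation takes place, so orders drop by one at most. *)
Lemma ps_split_vars (k : fieldType) n (P : pred 'I_n) (f : pseries k n) :
  (forall m : 'X_{1..n}, (forall i, P i -> m i = 0%N) -> f m = 0) ->
  exists2 G : 'I_n -> pseries k n, f = \sum_(i | P i) psP 'X_i * G i
    & forall i N, ordge N.+1 f -> ordge N (G i).
Proof.
move=> h.
pose fst (m : 'X_{1..n}) := [pick i | P i && (m i != 0%N)].
pose G i : pseries k n := fun m => if fst (m + U_(i))%MM == Some i then f (m + U_(i))%MM else 0.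
exists G => [|i N hf m lt]; last first.
  rewrite /G; case: ifP => // _; apply: hf; by rewrite mdegD mdeg1 addn1 ltnS.
have XG i m : (psP 'X_i * G i) m = if m i != 0%N then (if fst m == Some i then f m else 0) else 0.
  have [mi|mi] := boolP (m i != 0%N); last first.
    have -> : (psP 'X_i * G i) m = ('X_i * trunc (mdeg m) (G i))@_m.
      by apply: psMcoef => m' le; rewrite ?trunc_coef.
    rewrite mulrC mcoeffMr; apply: big1 => -[h1 h2] /= /eqP e.
    rewrite mcoeffX; case: eqP => [e'|_]; last by rewrite mulr0.
    by case/negP: mi; rewrite (congr1 (fun u : 'X_{1..n} => u i) e) -e' mnmDE mnm1E eqxx.
  have em : m = (U_(i) + (m - U_(i)))%MM by rewrite addmC submK // lep1mP.
  have -> : (psP 'X_i * G i) m = ('X_i * trunc (mdeg m) (G i))@_m.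
    by apply: psMcoef => m' le; rewrite ?trunc_coef.
  have -> : ('X_i * trunc (mdeg m) (G i))@_m = (trunc (mdeg m) (G i))@_(m - U_(i))%MM.
    by rewrite mulrC [X in _@_X = _]em mcoeffMX.
  rewrite trunc_coef; last by rewrite [X in (_ <= mdeg X)%N]em mdegD leq_addl.
  by rewrite /G addmC -em.
apply: funext => m; rewrite ps_sum.
case fm : (fst m) => [i|]; last first.
  rewrite h => [|i Pi].
    rewrite big1 // => i Pi; rewrite XG fm; by case: ifP.
  move: fm; rewrite /fst; case: pickP => // /(_ i); rewrite Pi /= => /negbT.
  by rewrite negbK => /eqP.
have /andP[Pi mi] : P i && (m i != 0%N).
  by move: fm; rewrite /fst; case: pickP => // j hj [<-].
rewrite (bigD1 i) //= XG mi fm eqxx big1 ?addr0 // => j /andP[_ ji].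
rewrite XG fm; case: ifP => // _; case: eqP => // -[e]; by rewrite e eqxx in ji.
Qed.

(** In doubled variables, f(x + y) - f(x) has no monomial in x alone, so it lies in the ideal
    generated by the y_i by [ps_split_vars]. *)
Lemma psubst_taylor (k : fieldType) n n' (s t : 'I_n -> pseries k n') (f : pseries k n) :
  (forall i, ordge 1 (s i)) -> (forall i, ordge 1 (t i)) ->
  exists G : 'I_n -> pseries k n', psubst s f - psubst t f = \sum_i (s i - t i) * G i.
Proof.
move=> s1 t1.
pose x (i : 'I_(n + n)) : pseries k (n + n) := psP 'X_i.
have x1 i : ordge 1 (x i).
  by apply/ordge1; rewrite /x /psP /ps_of_mpoly mcoeffX mnm1_eq0.
pose u (i : 'I_n) := x (lshift n i) + x (rshift n i); pose v (i : 'I_n) := x (lshift n i).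
have u1 i : ordge 1 (u i) by apply: ordgeD.
have v1 i : ordge 1 (v i) by apply: x1.
pose F := psubst u f - psubst v f.
pose J (g : pseries k (n + n)) :=
  forall m : 'X_{1..n + n}, (forall i : 'I_n, m (rshift n i) = 0%N) -> g m = 0.
have J0 : J 0 by [].
have JD g h : J g -> J h -> J (g + h) by move=> hg hh m hm; rewrite psD hg ?hh ?addr0.
have JM g h : J h -> J (g * h).
  move=> hh m hm.
  rewrite (@psMcoef _ _ g h (trunc (mdeg m) g) (trunc (mdeg m) h)); first last.
  - by move=> m' le; rewrite trunc_coef.
  - by move=> m' le; rewrite trunc_coef.
  rewrite mcoeffM; apply: big1 => p /eqP e.
  rewrite [(trunc _ h)@_ _]trunc_coef; last exact: (bmdeg p.2).
  rewrite hh ?mulr0 // => i.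
  have := congr1 (fun u : 'X_{1..n + n} => u (rshift n i)) e; rewrite hm mnmDE => /esym/eqP.
  by rewrite addn_eq0 => /andP[_ /eqP].
have JF : J F.
  move=> m hm; pose N := mdeg m.
  have hT : forall m', (mdeg m' <= N)%N -> f m' = (trunc N f)@_m' by move=> m' le; rewrite trunc_coef.
  have := psubst_approx v1 hT (ltnSn N); have := psubst_approx u1 hT (ltnSn N).
  rewrite /F !psD !psN => /eqP; rewrite subr_eq0 => /eqP-> /eqP; rewrite subr_eq0 => /eqP->.
  rewrite -psN -psD; apply: (@mmap_cong _ _ (@psC k (n + n)) _ J) => // i.
  rewrite /u /v addrC addKr => m' hm'; rewrite /x /psP /ps_of_mpoly mcoeffX.
  by case: eqP => // e; move: (hm' i); rewrite -e mnm1E eqxx.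
pose P (i : 'I_(n + n)) := if split i is inr _ then true else false.
have [m hm|G FG _] := @ps_split_vars k (n + n) P F.
  apply: JF => i; apply: hm; rewrite /P; case: split_ordP => // j /eqP.
  by rewrite eq_rlshift.
(* The specialization x = t, y = s - t, under which x + y becomes s. *)
pose sg (i : 'I_(n + n)) := match split i with inl j => t j | inr j => s j - t j end.
have sg1 i : ordge 1 (sg i) by rewrite /sg; case: split => // j; apply: ordgeB.
have sgl i : sg (lshift n i) = t i by rewrite /sg (unsplitK (inl _ i)).
have sgr i : sg (rshift n i) = s i - t i by rewrite /sg (unsplitK (inr _ i)).
exists (fun i => psubst sg (G (rshift n i))).
have e1 : psubst (fun i => psubst sg (u i)) f = psubst s f.
  by apply: eq_psubst => i; rewrite /u psubstD // !psubstX // sgl sgr addrC subrK.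
have e2 : psubst (fun i => psubst sg (v i)) f = psubst t f.
  by apply: eq_psubst => i; rewrite psubstX // sgl.
have := congr1 (psubst sg) FG; rewrite /F psubstB // !psubst_comp // e1 e2 => ->.
rewrite psubst_sum // big_mkcond big_split_ord /= big1 ?add0r => [|i _]; last first.
  by rewrite /P (unsplitK (inl _ i)).
apply: eq_bigr => i _; rewrite /P (unsplitK (inr _ i)) /= psubstM // psubstX //.
by rewrite sgr.
Qed.

(** * Ideals and isomorphisms between quotients of power series rings *)

Definition in_ideal (R : pzRingType) r (q : 'I_r -> R) (f : R) :=
  exists h : 'I_r -> R, f = \sum_i h i * q i.

Lemma in_ideal0 (R : pzRingType) r (q : 'I_r -> R) : in_ideal q 0.
Proof. by exists (fun=> 0); rewrite big1 // => i _; rewrite mul0r. Qed.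

Lemma in_idealD (R : pzRingType) r (q : 'I_r -> R) f g :
  in_ideal q f -> in_ideal q g -> in_ideal q (f + g).
Proof.
move=> [h ->] [h' ->]; exists (fun i => h i + h' i); rewrite -big_split.
by apply: eq_bigr => i _; rewrite mulrDl.
Qed.

Lemma in_idealM (R : pzRingType) r (q : 'I_r -> R) f g :
  in_ideal q g -> in_ideal q (f * g).
Proof.
move=> [h ->]; exists (fun i => f * h i); rewrite mulr_sumr.
by apply: eq_bigr => i _; rewrite mulrA.
Qed.

Lemma in_idealN (R : pzRingType) r (q : 'I_r -> R) f : in_ideal q f -> in_ideal q (- f).
Proof. by rewrite -mulN1r; apply: in_idealM. Qed.

Lemma in_ideal_gen (R : pzRingType) r (q : 'I_r -> R) i : in_ideal q (q i).
Proof.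
exists (fun j => (j == i)%:R); rewrite (bigD1 i) //= eqxx mul1r big1 ?addr0 // => j /negbTE->.
by rewrite mul0r.
Qed.

Lemma in_ideal_sum (R : pzRingType) r (q : 'I_r -> R) I (l : seq I) (P : pred I) F :
  (forall i, P i -> in_ideal q (F i)) -> in_ideal q (\sum_(i <- l | P i) F i).
Proof.
move=> h; apply: (big_ind (in_ideal q)) => //; [exact: in_ideal0|exact: in_idealD].
Qed.

Lemma in_ideal_trans (R : pzRingType) r (q : 'I_r -> R) r' (q' : 'I_r' -> R) f :
  (forall i, in_ideal q' (q i)) -> in_ideal q f -> in_ideal q' f.
Proof. by move=> h [g ->]; apply: in_ideal_sum => i _; apply: in_idealM. Qed.

Lemma ps_congE (k : fieldType) n r (q : 'I_r -> pseries k n) f g :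
  ps_cong q f g <-> in_ideal q (f - g).
Proof.
split=> -[h e]; exists h; first by apply: funext => m; rewrite ps_sum -e.
by move=> m; rewrite -[LHS]/((f - g) m) e ps_sum.
Qed.

Lemma ps_scaleE (k : fieldType) n c (f : pseries k n) : ps_scale c f = psC c * f.
Proof. by apply: funext => m; rewrite psCM. Qed.

(** Substituting t and then s is exactly the identity, whereas the other composite is the identity
    only modulo q; [psubst_taylor] extends that congruence from the variables to all series. *)
Lemma subst_quot_iso (k : fieldType) n r (q : 'I_r -> pseries k n)
    n' r' (q' : 'I_r' -> pseries k n') (s : 'I_n -> pseries k n') (t : 'I_n' -> pseries k n) :
  (forall i, ordge 1 (s i)) -> (forall i, ordge 1 (t i)) ->
  (forall i, psubst s (t i) = psP 'X_i) ->
  (forall i, in_ideal q' (psubst s (q i))) ->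
  (forall i, in_ideal q (psubst t (q' i))) ->
  (forall i, in_ideal q (psP 'X_i - psubst t (s i))) ->
  ps_quot_iso q q' (psubst s).
Proof.
move=> s1 t1 st sq tq ts.
have ce (f g : pseries k n') : f = g -> ps_cong q' f g.
  by move=> ->; apply/ps_congE; rewrite subrr; apply: in_ideal0.
have stf g : psubst s (psubst t g) = g.
  by rewrite psubst_comp // (eq_psubst st) psubst_id.
split.
- split; [exact/ce/psubst1|by move=> f g; exact/ce/psubstD| |].
    by move=> f g; exact/ce/psubstM.
  by move=> c f; apply/ce; rewrite !ps_scaleE -(psubstC s1 c); exact: psubstM.
- move=> f g; rewrite !ps_congE -(psubstB s1).
  set e := f - g; split=> [[h ->]|[h he]].
    by rewrite psubst_sum //; apply: in_ideal_sum => i _; rewrite psubstM //; apply: in_idealM.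
  (* Here e is split as (e - t(s(e))) + t(s(e)): the second term lies in the ideal because s(e)
     does, the first by the Taylor formula. *)
  rewrite -[e](subrK (psubst t (psubst s e))); apply: in_idealD; last first.
    by rewrite he psubst_sum //; apply: in_ideal_sum => i _; rewrite psubstM //; apply: in_idealM.
  rewrite psubst_comp // -{1}[e]psubst_id.
  have [||G ->] := @psubst_taylor k n n (fun i => psP 'X_i) (fun i => psubst t (s i)) e.
  - by move=> i; apply/ordge1; rewrite /psP /ps_of_mpoly mcoeffX mnm1_eq0.
  - by move=> i; apply: psubst_ordge.
  by apply: in_ideal_sum => i _; rewrite mulrC; apply: in_idealM.
- by move=> g; exists (psubst t g); apply: ce; apply: stf.
Qed.

Lemma char2_pseries (k : fieldType) n : 2%N \in [pchar k] -> 2%N \in [pchar (pseries k n)].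
Proof.
move=> h; rewrite inE /= -[1](rmorph1 (@psC k n)) -raddfMn /= [1 *+ 2]mulr2n.
by rewrite addrr_pchar2 // raddf0.
Qed.

Lemma ordge1_X (k : fieldType) n (i : 'I_n) : ordge 1 (psP ('X_i : {mpoly k[n]})).
Proof. by apply/ordge1; rewrite /psP /ps_of_mpoly mcoeffX mnm1_eq0. Qed.

Lemma psC0 (k : fieldType) n (x : k) : (psC x : pseries k n) 0%MM = x.
Proof. by rewrite /psC /psP /ps_of_mpoly mcoeffC eqxx mulr1. Qed.

Lemma closed_sqrt (k : closedFieldType) (x : k) : exists y, y ^+ 2 = x.
Proof.
have [y] := @solve_monicpoly k 2 (fun i => if i == 0%N then x else 0) isT.
by rewrite big_ord_recl big_ord1 /= expr0 mulr1 mul0r addr0; exists y.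
Qed.

(** * Nodes *)

Section Node.
Variables (k : closedFieldType) (char2 : 2%N \in [pchar k]).
Variables (a sc sd : 'I_3 -> k) (a_inj : injective a).
Hypothesis sc_neq0 : forall i, sc i != 0.
Hypothesis sd_neq0 : forall i, sd i != 0.

Local Notation q := (Sigma_eq a (sqf sc) (sqf sd)).
Local Notation cf := (cf sc sd).
Variables (A : 'I_6) (p : 'rV[k]_6).

(** [nu l] is the homogeneous coordinate l in the chart at A centred at p. Then [sN], [sL], [sE] are
    the expansions at p of the coordinates, of L and of the quadrics X_i Y_i + gam_i L^2, while [sQ]
    are those of the given equations. *)
Definition nu (l : 'I_6) : {mpoly k[5]} :=
  if unlift A l is Some l' then (p 0 l / p 0 A)%:MP + 'X_l' else 1.
Definition sN l : pseries k 5 := psP (nu l).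
Definition sQ r : pseries k 5 := ps_of_mpoly (chart_at A p (q r)).
Definition sL : pseries k 5 :=
  \sum_i (psC (cf true i) * sN (co true i) + psC (cf false i) * sN (co false i)).
Definition sE i : pseries k 5 :=
  sN (co true i) * sN (co false i) + psC (gam a i) * sL ^+ 2.

Lemma chartD (F G : {mpoly k[6]}) : chart_at A p (F + G) = chart_at A p F + chart_at A p G.
Proof. exact: raddfD. Qed.
Lemma chartM (F G : {mpoly k[6]}) : chart_at A p (F * G) = chart_at A p F * chart_at A p G.
Proof. exact: rmorphM. Qed.
Lemma chartZ x (F : {mpoly k[6]}) : chart_at A p (x *: F) = x%:MP * chart_at A p F.
Proof. by rewrite -mul_mpolyC chartM {1}/chart_at mmapC. Qed.
Lemma chart_sum I (r : seq I) (F : I -> {mpoly k[6]}) :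
  chart_at A p (\sum_(i <- r) F i) = \sum_(i <- r) chart_at A p (F i).
Proof. exact: raddf_sum. Qed.
Lemma psPZ x (F : {mpoly k[5]}) : psP (x%:MP * F) = psC x * psP F.
Proof. exact: rmorphM. Qed.

Lemma chart_nq i : psP (chart_at A p (nq a sc sd i)) = sE i.
Proof.
have hX l : chart_at A p 'X_l = nu l by rewrite /chart_at mmapX mmap1U.
suff hL : psP (chart_at A p (LamP sc sd)) = sL.
  rewrite /nq chartD chartM chartZ expr2 chartM !hX raddfD /= psPZ.
  by rewrite [psP (nu _ * _)]rmorphM [psP (chart_at _ _ _ * _)]rmorphM /= hL -expr2.
rewrite /LamP chart_sum raddf_sum; apply: eq_bigr => m _ /=.
by rewrite chartD !chartZ !hX raddfD /= !psPZ.
Qed.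

Lemma sQ_sE r : sQ r = \sum_i psC (a i ^+ r) * sE i.
Proof.
rewrite /sQ Sigma_eq_nq // -/(psP _) chart_sum raddf_sum /=.
by apply: eq_bigr => i _; rewrite chartZ psPZ chart_nq.
Qed.

Lemma sE_sQ i : sE i = \sum_r psC (vinv a i r) * sQ r.
Proof.
rewrite -chart_nq nq_Sigma_eq // chart_sum raddf_sum /=.
by apply: eq_bigr => r _; rewrite chartZ psPZ.
Qed.

Lemma in_ideal_sQ f : in_ideal sE f -> in_ideal sQ f.
Proof.
apply: in_ideal_trans => i; rewrite sE_sQ; apply: in_ideal_sum => r _.
exact/in_idealM/in_ideal_gen.
Qed.

Definition xx (l : 'I_6) : pseries k 5 := if unlift A l is Some l' then psP 'X_l' else 0.

Lemma sN_A : sN A = 1. Proof. by rewrite /sN /nu unlift_none rmorph1. Qed.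

Lemma sN_xx l : l != A -> sN l = psC (p 0 l / p 0 A) + xx l.
Proof.
by rewrite eq_sym /sN /nu /xx => /unlift_some[l' -> ->]; rewrite raddfD.
Qed.

Lemma xx_ord l : ordge 1 (xx l).
Proof. by rewrite /xx; case: unlift => [l'|] //; apply: ordge1_X. Qed.

Lemma sNsym b i : sN (co true i) * sN (co false i) = sN (co b i) * sN (co (~~ b) i).
Proof. by case: b => //=; rewrite mulrC. Qed.

Lemma sLsym (b : 'I_3 -> bool) : sL = \sum_i
  (psC (cf (b i) i) * sN (co (b i) i) + psC (cf (~~ b i) i) * sN (co (~~ b i) i)).
Proof. by apply: eq_bigr => i _; case: (b i) => //=; rewrite addrC. Qed.

Lemma ord3_third (l i : 'I_3) : l != i -> exists j, [/\ l != j, i != j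
  & forall (V : nmodType) (F : 'I_3 -> V), \sum_m F m = F l + F i + F j].
Proof.
move=> li; have [n1 n2 n3] := ord3_cyc l.
have : (i == l + 1) || (i == l + 2).
  by move: li; clear; elim/ord3_ind: l; elim/ord3_ind: i.
case/orP=> /eqP ->.
  by exists (l + 2); split=> // V F; apply: sum3c.
exists (l + 1); split=> [//||V F]; first by rewrite eq_sym.
by rewrite (sum3c F l) addrAC.
Qed.

(** At p the pair of index l vanishes, A is the nonzero coordinate of index i, and B = [co b' j] is
    the other nonzero one. Write A', B' for their partners and C, D for the pair l. Equation i reads
    x_A' = gam_i L^2; equation j reads (unit) x_B' = gam_j L^2; L is linear in x_B with nonzero
    coefficient. So x_C, x_D and z = g L with g^2 = gam_l are local coordinates, in which equation l
    becomes x_C x_D + z^2 = 0. *)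
Lemma edge_node : p != 0 -> edgept sc sd p -> p 0 A != 0 ->
  exists phi, ps_quot_iso sQ (fun _ : 'I_1 => ps_of_mpoly (A1_eq k)) phi.
Proof.
move=> p0 [l [xl yl hl hxy]] pA.
have c3 : 2%N \in [pchar (pseries k 3)] by apply: char2_pseries.
have c5 : 2%N \in [pchar (pseries k 5)] by apply: char2_pseries.
have [b [i eA]] := coP A.
have pl c : p 0 (co c l) = 0 by case: c; [exact: xl|exact: yl].
have li : l != i by apply: contraNneq pA => e; rewrite eA -e pl.
have [j [lj ij S3]] := ord3_third li.
have pA' : p 0 (co (~~ b) i) = 0.
  have : p 0 (co b i) * p 0 (co (~~ b) i) = 0.
    by rewrite -[RHS](hxy i); case: (b) => //=; rewrite mulrC.
  by move/eqP; rewrite mulf_eq0 -eA (negbTE pA) /= => /eqP.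
have [b' pB'] : exists b', p 0 (co (~~ b') j) = 0.
  by move/eqP: (hxy j); rewrite mulf_eq0 => /orP[] /eqP z; [exists false|exists true].
have lamE' : cf b i * p 0 A + cf b' j * p 0 (co b' j) = 0.
  rewrite -[RHS]hl lamE S3 !pl !mulr0 !add0r; move: pA' pB'; rewrite eA.
  by case: (b); case: (b') => /= -> ->; rewrite !mulr0 ?addr0 ?add0r.
have cB0 := cf_neq0 sc_neq0 sd_neq0 b' j; have cA0 := cf_neq0 sc_neq0 sd_neq0 b i.
(* The value at p of the coordinate B in the chart. It is nonzero because L(p) = 0 involves A and B
   only. *)
pose be := p 0 (co b' j) / p 0 A.
have be_lam : cf b i + cf b' j * be = 0.
  apply: (mulIf pA); rewrite mul0r mulrDl -[RHS]lamE'; congr (_ + _).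
  by rewrite /be mulrA mulfVK.
have be0 : be != 0.
  apply: contraNneq cA0 => z; move: be_lam; rewrite z mulr0 addr0 => ->; exact: eqxx.
have [g gE] := closed_sqrt (gam a l).
have g0 : g != 0.
  by have := gam_neq0 char2 a_inj l; rewrite -gE expf_eq0.
pose C5 := @psC k 5; pose C3 := @psC k 3.
pose xA' := xx (co (~~ b) i); pose xB := xx (co b' j); pose xB' := xx (co (~~ b') j).
pose xC := xx (co true l); pose xD := xx (co false l).
have coA c m : (c, m) != (b, i) -> co c m != A.
  by rewrite eA co_eq => h; apply: contra h => /andP[/eqP-> /eqP->].
have nA' : sN (co (~~ b) i) = xA'.
  rewrite sN_xx ?pA' ?mul0r ?raddf0 ?add0r //; apply: coA.
  by rewrite xpair_eqE eqxx andbT; case: (b).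
have nB : sN (co b' j) = C5 be + xB.
  by rewrite sN_xx //; apply: coA; rewrite xpair_eqE [j == i]eq_sym (negbTE ij) andbF.
have nB' : sN (co (~~ b') j) = xB'.
  rewrite sN_xx ?pB' ?mul0r ?raddf0 ?add0r //; apply: coA.
  by rewrite xpair_eqE [j == i]eq_sym (negbTE ij) andbF.
have nl c : sN (co c l) = xx (co c l).
  rewrite sN_xx ?pl ?mul0r ?raddf0 ?add0r //; apply: coA.
  by rewrite xpair_eqE (negbTE li) andbF.
have nA : sN (co b i) = 1 by rewrite -eA sN_A.
pose cA' := cf (~~ b) i; pose cB := cf b' j; pose cB' := cf (~~ b') j.
pose cC := cf true l; pose cD := cf false l.
have sLE : sL = C5 cA' * xA' + C5 cB * xB + C5 cB' * xB' + C5 cC * xC + C5 cD * xD.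
  pose bb m := if m == i then b else if m == j then b' else true.
  rewrite (sLsym bb) S3 /bb (negbTE li) (negbTE lj) eqxx [j == i]eq_sym (negbTE ij) eqxx /=.
  rewrite nA nA' nB nB' !nl -/xC -/xD.
  have h : C5 (cf b i) + C5 cB * C5 be = 0.
    by rewrite -rmorphM -raddfD /= be_lam raddf0.
  rewrite -/C5 -/cA' -/cB -/cB' -/cC -/cD.
  rewrite -[RHS]addr0 -[X in _ = _ + X]h; ring.
have eE i' c : sE i' = sN (co c i') * sN (co (~~ c) i') + C5 (gam a i') * sL ^+ 2.
  by rewrite /sE (sNsym c).
have eI : sE i = xA' + C5 (gam a i) * sL ^+ 2 by rewrite (eE i b) nA nA' mul1r.
have eJ : sE j = (C5 be + xB) * xB' + C5 (gam a j) * sL ^+ 2 by rewrite (eE j b') nB nB'.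
have eL : sE l = xC * xD + C5 (gam a l) * sL ^+ 2 by rewrite (eE l true) !nl.
pose x3 : pseries k 3 := psP 'X_0; pose y3 : pseries k 3 := psP 'X_1.
pose z3 : pseries k 3 := psP 'X_2.
(* [W] is the series that L must become, so that gam_l L^2 = z^2. Equation i then dictates [SA'],
   and solving the expression of L for x_B gives [SB] as a function of the still unknown x_B'. *)
pose W := C3 g^-1 * z3.
have W1 : ordge 1 W by apply/ordge0M/ordge1_X.
pose SA' := C3 (gam a i) * W ^+ 2.
have SA'1 : ordge 1 SA' by apply/ordge0M; rewrite expr2; apply: ordge0M.
pose SB (f : pseries k 3) :=
  C3 cB^-1 * (W + C3 cA' * SA' + C3 cB' * f + C3 cC * x3 + C3 cD * y3).
have SB1 f : ordge 1 f -> ordge 1 (SB f).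
  move=> f1; apply/ordge0M; do !(apply: ordgeD => //); apply: ordge0M => //;
  exact: ordge1_X.
(* Equation j, (be + x_B) x_B' = gam_j L^2, solved for x_B' as a fixed point; it is contracting
   because [SB] has no constant term. *)
have [||xi xi1 xiE] := @ps_fixpoint k 3
    (fun f => C3 be^-1 * (SB f * f + C3 (gam a j) * W ^+ 2)).
- move=> f f1; apply/ordge0M/ordgeD; first by apply: ordge0M.
  by apply: ordge0M; rewrite expr2; apply: ordge0M.
- move=> N f h f1 h1 fh.
  have -> : C3 be^-1 * (SB f * f + C3 (gam a j) * W ^+ 2) -
     C3 be^-1 * (SB h * h + C3 (gam a j) * W ^+ 2) =
     (C3 be^-1 * (C3 cB^-1 * C3 cB' * f + SB h)) * (f - h) by rewrite /SB; ring.
  rewrite -[N.+1]add1n; apply: ordgeM fh; apply/ordge0M/ordgeD; last exact: SB1.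
  exact: ordge0M.
pose s6 (m : 'I_6) := if m == co (~~ b) i then SA' else if m == co (~~ b') j then xi else
  if m == co b' j then SB xi else if m == co true l then x3 else
  if m == co false l then y3 else 0.
pose s l' := s6 (lift A l').
have s61 m : ordge 1 (s6 m).
  rewrite /s6; case: ifP => // _; case: ifP => // _; case: ifP => _; first exact: SB1.
  by case: ifP => _; [|case: ifP => _ //]; apply: ordge1_X.
have s1 l' : ordge 1 (s l') by apply: s61.
have sx m : m != A -> psubst s (xx m) = s6 m.
  by rewrite eq_sym /xx => /unlift_some[l' -> ->]; rewrite (psubstX s1).
have sA' : psubst s xA' = SA'.
  rewrite sx ?/s6 ?eqxx //; apply: coA.
  by rewrite xpair_eqE eqxx andbT; case: (b).
have sB' : psubst s xB' = xi.
  rewrite sx; last by apply: coA; rewrite xpair_eqE [j == i]eq_sym (negbTE ij) andbF.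
  by rewrite /s6 !co_eq [j == i]eq_sym (negbTE ij) andbF !eqxx.
have sB : psubst s xB = SB xi.
  rewrite sx; last by apply: coA; rewrite xpair_eqE [j == i]eq_sym (negbTE ij) andbF.
  by rewrite /s6 !co_eq [j == i]eq_sym (negbTE ij) andbF !eqxx andbT; case: (b').
have sl c : psubst s (xx (co c l)) = if c then x3 else y3.
  rewrite sx; last by apply: coA; rewrite xpair_eqE (negbTE li) andbF.
  by rewrite /s6 !co_eq (negbTE li) (negbTE lj) !andbF eqxx !andbT; case: (c).
have sC c : psubst s (C5 c) = C3 c by rewrite (psubstC s1).
have CV n (c : k) : c != 0 -> (psC c : pseries k n) * psC c^-1 = 1.
  by move=> c0; rewrite -rmorphM /= divff // rmorph1.
have sLW : psubst s sL = W.
  rewrite sLE !psubstD // !psubstM // !sC sA' sB sB' !sl.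
  have h : C3 cB * SB xi = W + C3 cA' * SA' + C3 cB' * xi + C3 cC * x3 + C3 cD * y3.
    by rewrite /SB mulrA CV // mul1r.
  rewrite h /=; apply: (char2_eq (e := C3 cA' * SA' + C3 cB' * xi + C3 cC * x3 + C3 cD * y3)) => //.
  ring.
have gW : C3 (gam a l) * W ^+ 2 = z3 ^+ 2.
  have -> : C3 (gam a l) = C3 g ^+ 2 by rewrite -gE /C3 rmorphXn.
  by rewrite /W exprMn mulrA -exprMn CV // expr1n mul1r.
(* The inverse substitution: x, y, z go to x_C, x_D and g L. *)
pose t (m : 'I_3) := if m == 0 then xC else if m == 1 then xD else C5 g * sL.
have sL1 : ordge 1 sL.
  by rewrite sLE; do !(apply: ordgeD => //); apply: ordge0M; apply: xx_ord.
have t1 m : ordge 1 (t m).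
  rewrite /t; case: ifP => _; [|case: ifP => _]; [exact: xx_ord|exact: xx_ord|].
  exact: ordge0M.
have tX (m : 'I_3) : psubst t (psP 'X_m) = t m by rewrite (psubstX t1).
have tW : psubst t W = sL.
  rewrite /W psubstM // psubstC // tX /t /= mulrA [psC _ * _]mulrC CV // mul1r.
  by [].
have tC c : psubst t (C3 c) = C5 c by rewrite (psubstC t1).
have A1E : ps_of_mpoly (A1_eq k) = z3 ^+ 2 + x3 * y3.
  rewrite -/(psP _) /A1_eq raddfD /=.
  by rewrite [psP (_ ^+ _)](rmorphXn (@psP k 3)) [psP (_ * _)](rmorphM (@psP k 3)).
have [xi' xi'd] : exists x, x = psubst t xi by exists (psubst t xi).
have xi'1 : ordge 1 xi' by rewrite xi'd; apply: psubst_ordge.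
have tSA' : psubst t SA' = C5 (gam a i) * sL ^+ 2.
  by rewrite /SA' psubstM // tC psubstXn // tW.
pose SB' := C5 cB^-1 * (sL + C5 cA' * (C5 (gam a i) * sL ^+ 2) + C5 cB' * xi' + C5 cC * xC + C5 cD * xD).
have tSB : psubst t (SB xi) = SB'.
  rewrite /SB psubstM // !psubstD // tW (psubstM t1 (C3 cA')) tSA' (psubstM t1 _ xi).
  by rewrite (psubstM t1 _ x3) (psubstM t1 _ y3) !tC !tX -xi'd.
have xi'E : xi' = C5 be^-1 * (SB' * xi' + C5 (gam a j) * sL ^+ 2).
  rewrite [LHS]xi'd -[in LHS]xiE (psubstM t1 (C3 _)) psubstD // (psubstM t1 (SB xi)) tSB.
  rewrite (psubstM t1 (C3 _)) psubstXn // tW !tC -xi'd.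
  by [].
have bxi' : C5 be * xi' = SB' * xi' + C5 (gam a j) * sL ^+ 2.
  by rewrite {1}xi'E mulrA CV // mul1r.
have xBE : xB = C5 cB^-1 * (sL + C5 cA' * xA' + C5 cB' * xB' + C5 cC * xC + C5 cD * xD).
  have -> : sL + C5 cA' * xA' + C5 cB' * xB' + C5 cC * xC + C5 cD * xD = C5 cB * xB.
    rewrite sLE; apply: (char2_eq (e := C5 cA' * xA' + C5 cB' * xB' + C5 cC * xC + C5 cD * xD)) => //.
    ring.
  by rewrite mulrA [C5 cB^-1 * _]mulrC CV // mul1r.
(* The coordinate x_B' and the pulled back fixed point solve equation j up to the ideal. Subtracting
   the two equations gives [ep] times a series [U] with constant term [be], hence a unit. *)
pose ep := xB' - xi'.
have epE : ep = xB' + xi' by rewrite /ep GRing.subr_pchar2.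
have dB : xB + SB' = C5 cB^-1 * (C5 cA' * sE i + C5 cB' * ep).
  rewrite eI epE {1}xBE /SB'.
  apply: (char2_eq (e := C5 cB^-1 * (sL + C5 cC * xC + C5 cD * xD))) => //; ring.
pose U := C5 be + xB + C5 cB^-1 * C5 cB' * xi'.
have epU : ep * U = sE j + C5 cB^-1 * C5 cA' * xi' * sE i.
  have h : sE j + (C5 be * xi' + (SB' * xi' + C5 (gam a j) * sL ^+ 2)) +
      xi' * (xB + SB' + C5 cB^-1 * (C5 cA' * sE i + C5 cB' * ep)) =
      ep * U + C5 cB^-1 * C5 cA' * xi' * sE i +
      (C5 (gam a j) * sL ^+ 2 + SB' * xi') *+ 2.
    rewrite eJ epE /U; ring.
  move: h; rewrite -bxi' -dB !addrr_pchar2 // mulr0 !addr0 mulr2n addrr_pchar2 // addr0 => ->.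
  by rewrite -addrA addrr_pchar2 // addr0.
have [V UV] : exists V, U * V = 1.
  have xB0 : xB 0%MM = 0 by apply/ordge1/xx_ord.
  have xi0 : (C5 cB^-1 * C5 cB' * xi') 0%MM = 0 by apply/ordge1/ordge0M.
  by apply: ps_inv; rewrite /U !psD xB0 xi0 !addr0 /C5 psC0.
have epI : in_ideal sE ep.
  rewrite -[ep]mulr1 -UV mulrA mulrC; apply: in_idealM; rewrite epU.
  by apply: in_idealD; [|apply: in_idealM]; apply: in_ideal_gen.
have BI : in_ideal sE (xB - SB').
  rewrite GRing.subr_pchar2 // dB; apply/in_idealM/in_idealD; apply: in_idealM => //.
  exact: in_ideal_gen.
exists (psubst s); apply: (subst_quot_iso (t := t)) => //.
- elim/ord3_ind; rewrite /t /=; [exact: sl true|exact: sl false|].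
  by rewrite psubstM // sC sLW /W mulrA CV // mul1r.
- move=> r; rewrite sQ_sE psubst_sum //; apply: in_ideal_sum => i' _.
  rewrite psubstM //; apply: in_idealM.
  have : [|| i' == l, i' == i | i' == j].
    have := S3 _ (fun m => (m == i') : nat).
    rewrite (bigD1 i') //= eqxx big1 => [|m /negbTE -> //].
    by rewrite ![i' == _]eq_sym; case: eqP; case: eqP; case: eqP.
  case/or3P => /eqP ->.
  + rewrite eL psubstD // (psubstM s1 xC) (psubstM s1 (C5 _)) sC psubstXn // sLW gW (sl true) (sl false) addrC -A1E.
    exact: (in_ideal_gen (fun _ : 'I_1 => _) 0).
  + rewrite eI psubstD // (psubstM s1 (C5 _)) sC psubstXn // sLW sA' addrr_pchar2 //; exact: in_ideal0.
  + rewrite eJ psubstD // (psubstM s1 (_ + _)) (psubstM s1 (C5 _)) psubstD // !sC psubstXn // sLW sB sB'.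
    have -> : (C3 be + SB xi) * xi = C3 (gam a j) * W ^+ 2.
      have h : C3 be * xi = SB xi * xi + C3 (gam a j) * W ^+ 2.
        by rewrite -[in LHS]xiE mulrA CV // mul1r.
      by rewrite mulrDl h addrAC addrr_pchar2 // add0r.
    rewrite addrr_pchar2 //; exact: in_ideal0.
- move=> _; have gg : C5 g ^+ 2 = C5 (gam a l) by rewrite -gE /C5 rmorphXn.
  rewrite A1E psubstD // (psubstM t1 x3) psubstXn // !tX /t /= addrC exprMn gg -eL.
  exact/in_ideal_sQ/in_ideal_gen.
- move=> l'; apply: in_ideal_sQ.
  have -> : psP 'X_l' = xx (lift A l') by rewrite /xx liftK.
  rewrite /s; have : lift A l' != A by rewrite eq_sym neq_lift.
  have xx0 m : in_ideal sE (xx m - xx m) by rewrite subrr; apply: in_ideal0.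
  have [c [i' ->]] := coP (lift A l').
  have : [|| i' == l, i' == i | i' == j].
    have := S3 _ (fun m => (m == i') : nat).
    rewrite (bigD1 i') //= eqxx big1 => [|m /negbTE -> //].
    by rewrite ![i' == _]eq_sym; case: eqP; case: eqP; case: eqP.
  case/or3P => /eqP -> nA''.
  + rewrite /s6 !co_eq (negbTE li) (negbTE lj) !andbF eqxx !andbT.
    by case: (c) => /=; rewrite tX /t /=; apply: xx0.
  + have -> : c = ~~ b.
      by move: nA''; rewrite eA co_eq eqxx andbT; case: (c); case: (b).
    rewrite /s6 eqxx tSA' GRing.subr_pchar2 // -eI; exact: in_ideal_gen.
  + rewrite /s6 !co_eq [j == i]eq_sym (negbTE ij) andbF eqxx !andbT.
    have [->|nc] := eqVneq c b'.
      have -> : (b' == ~~ b') = false by case: (b').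
      by rewrite tSB.
    have -> : c = ~~ b' by move: nc; case: (c); case: (b').
    by rewrite eqxx -xi'd.
Qed.

Lemma both_zero_edge i : (forall r, (q r).@[p 0] = 0) ->
  cx p i = 0 -> cy p i = 0 -> edgept sc sd p.
Proof.
move/(Sigma_eq0P char2 sc sd a_inj) => hp x0 y0; exists i.
have l0 : lam sc sd p = 0.
  move: (hp i); rewrite x0 mul0r => /esym/eqP.
  by rewrite mulf_eq0 (negbTE (gam_neq0 char2 a_inj i)) expf_eq0 /= => /eqP.
by split=> // j; rewrite hp l0 expr0n mulr0.
Qed.

Lemma ps_lin (f g : pseries k 5) (l : 'I_5) :
  (f * g) U_(l)%MM = f 0%MM * g U_(l)%MM + f U_(l)%MM * g 0%MM.
Proof.
have E (h : pseries k 5) : ordge 1 (h - psC (h 0%MM)).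
  by apply/ordge1; rewrite psD psN psC0 subrr.
have nU : (U_(l) == 0 :> 'X_{1..5})%MM = false by rewrite mnm1_eq0.
have C c (h : pseries k 5) m : (psC c * h) m = c * h m by rewrite psCM.
have Cl c : (psC c : pseries k 5) U_(l)%MM = 0.
  by rewrite /psC /psP /ps_of_mpoly mcoeffC nU mulr0.
set f0 := f 0%MM; set g0 := g 0%MM.
have -> : f * g = (f - psC f0) * (g - psC g0) + (psC f0 * g + psC g0 * f - psC f0 * psC g0).
  ring.
have -> : ((f - psC f0) * (g - psC g0) + (psC f0 * g + psC g0 * f - psC f0 * psC g0)) U_(l)%MM =
   ((f - psC f0) * (g - psC g0)) U_(l)%MM +
   ((psC f0 * g) U_(l)%MM + (psC g0 * f) U_(l)%MM - (psC f0 * psC g0) U_(l)%MM) by [].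
have -> : ((f - psC f0) * (g - psC g0)) U_(l)%MM = 0.
  by apply: (ordgeM (E f) (E g)); rewrite mdeg1.
rewrite !C Cl; ring.
Qed.

Lemma sN0 l : p 0 A != 0 -> sN l 0%MM = p 0 l / p 0 A.
Proof.
move=> pA; have [->|ne] := eqVneq l A.
  by rewrite sN_A divff // /GRing.one /= /ps_of_mpoly mcoeff1 eqxx.
by rewrite sN_xx // psD psC0 (iffLR (ordge1 _) (xx_ord _)) addr0.
Qed.

Lemma sN_lin l l' : sN l U_(l')%MM = (l == lift A l')%:R.
Proof.
rewrite /sN /nu /psP /ps_of_mpoly; case: unliftP => [m|] ->.
  rewrite mcoeffD mcoeffC mnm1_eq0 mulr0 add0r mcoeffX eq_mnm1.
  by rewrite (inj_eq (@lift_inj _ A)).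
by rewrite mcoeff1 mnm1_eq0 (negbTE (neq_lift _ _)).
Qed.

Lemma sE_lin i l : p 0 A != 0 -> sE i U_(l)%MM =
  (p 0 (co true i) * (co false i == lift A l)%:R +
   p 0 (co false i) * (co true i == lift A l)%:R) / p 0 A.
Proof.
move=> pA; rewrite /sE psD psCM expr2 !ps_lin !sN0 // !sN_lin.
rewrite [X in _ + gam a i * X](_ : _ = 0) ?mulr0 ?addr0; last by rewrite mulrC addrr_pchar2.
field; exact: pA.
Qed.

Lemma sE0 i : p 0 A != 0 -> (forall r, (q r).@[p 0] = 0) -> sE i 0%MM = 0.
Proof.
move=> pA /(Sigma_eq0P char2 sc sd a_inj)/(_ i) hp.
have L0 : sL 0%MM = lam sc sd p / p 0 A.
  rewrite /sL ps_sum lamE mulr_suml; apply: eq_bigr => m _.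
  by rewrite psD !psCM !sN0 // !mulrA -mulrDl.
rewrite /sE psD psCM expr2 !psM0 L0 !sN0 //.
have -> : p 0 (co true i) / p 0 A * (p 0 (co false i) / p 0 A) =
  cx p i * cy p i / p 0 A ^+ 2 by rewrite /cx /cy /co; field; exact: pA.
rewrite hp; apply: (char2_eq (e := gam a i * lam sc sd p ^+ 2 / p 0 A ^+ 2)) => //.
field; exact: pA.
Qed.

Lemma mdeg_lt2 (n : nat) (m : 'X_{1..n}) : (mdeg m < 2)%N -> m = 0%MM \/ exists l, m = U_(l)%MM.
Proof.
case: (posnP (mdeg m)) => [/eqP|]; first by rewrite mdeg_eq0 => /eqP ->; left.
move=> pos lt; right.
have /mdeg1P[l /eqP ->] : mdeg m == 1%N by rewrite eqn_leq pos andbT.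
by exists l.
Qed.

(** Comparison of tangent spaces. The A_1 singularity needs three coordinates. Away from edge points
    the three equations have independent linear parts in five variables, which leaves only two. *)
Lemma node_edge : p 0 A != 0 -> (forall r, (q r).@[p 0] = 0) ->
  (exists phi, ps_quot_iso sQ (fun _ : 'I_1 => ps_of_mpoly (A1_eq k)) phi) ->
  edgept sc sd p.
Proof.
move=> pA hp [phi [[ph1 phD phM phZ] phiff phsurj]].
case: (boolP [exists i, (cx p i == 0) && (cy p i == 0)]) => [|/existsPn hn].
  by case/existsP=> i /andP[/eqP x0 /eqP y0]; apply: both_zero_edge x0 y0.
exfalso.
set q' := (fun _ : 'I_1 => ps_of_mpoly (A1_eq k)) in ph1 phD phM phZ phiff phsurj.
pose ev (f g : pseries k 3) := in_ideal q' (f - g).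
have evE f g : ps_cong q' f g <-> ev f g by apply: ps_congE.
have ev_refl f : ev f f by rewrite /ev subrr; apply: in_ideal0.
have ev_sym f g : ev f g -> ev g f by move/in_idealN; rewrite opprB.
have ev_trans f g h : ev f g -> ev g h -> ev f h.
  by move=> fg gh; have := in_idealD fg gh; rewrite addrA subrK.
have evD f g f' g' : ev f f' -> ev g g' -> ev (f + g) (f' + g').
  by move=> h h'; have := in_idealD h h'; rewrite addrACA -opprD.
have evM f g f' g' : ev f f' -> ev g g' -> ev (f * g) (f' * g').
  move=> h h'; rewrite /ev; have -> : f * g - f' * g' = g * (f - f') + f' * (g - g') by ring.
  by apply: in_idealD; apply: in_idealM.
have pD f g : ev (phi (f + g)) (phi f + phi g) by apply/evE/phD.
have pM f g : ev (phi (f * g)) (phi f * phi g) by apply/evE/phM.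
have p1 : ev (phi 1) 1 by apply/evE/ph1.
have pC c f : ev (phi (psC c * f)) (psC c * phi f).
  by have := iffLR (evE _ _) (phZ c f); rewrite !ps_scaleE.
have p0 : ev (phi 0) 0 by have := pC 0 0; rewrite !raddf0 !mul0r.
have pSum I (r : seq I) (F : I -> pseries k 5) :
    ev (phi (\sum_(i <- r) F i)) (\sum_(i <- r) phi (F i)).
  elim: r => [|i r IH]; first by rewrite !big_nil.
  by rewrite !big_cons; apply: (ev_trans) (pD _ _) (evD _ _ _ _ (ev_refl _) IH).
have q'2 f : in_ideal q' f -> ordge 2 f.
  move=> [h ->]; rewrite big_ord1; apply: ordge0M => m lt.
  rewrite /q' /ps_of_mpoly /A1_eq mcoeffD.
  have e2 (i : 'I_3) : 'X_i ^+ 2 = 'X_[U_(i) + U_(i)] :> {mpoly k[3]} by rewrite expr2 -mpolyXD.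
  rewrite e2 -mpolyXD !mcoeffX.
  case: eqP => [e|_]; first by move: lt; rewrite -e mdegD !mdeg1.
  by case: eqP => [e|_]; [move: lt; rewrite -e mdegD !mdeg1|rewrite addr0].
have ev0 f g : ev f g -> f 0%MM = g 0%MM.
  move/q'2/(_ 0%MM); rewrite mdeg0 => /(_ isT); rewrite psD psN => /eqP.
  by rewrite subr_eq0 => /eqP.
have sQ0 r : sQ r 0%MM = 0.
  by rewrite sQ_sE ps_sum big1 // => i _; rewrite psCM sE0 // mulr0.
(* [phi] is only an abstract isomorphism of quotients, so its locality has to be proved: if phi(f)
   were a unit, f would have an inverse modulo q, which is impossible on constant terms. *)
have ph_ord f : ordge 1 f -> ordge 1 (phi f).
  move=> f1; apply/ordge1/eqP/negPn/negP => /ps_inv[g fg].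
  have [h hg] := phsurj g; move/evE: hg => hg.
  have e1 : ev (phi (f * h)) (phi 1).
    apply: (ev_trans) (pM _ _) _; apply: (ev_trans) (evM _ _ _ _ (ev_refl _) hg) _.
    by rewrite fg; apply: ev_sym.
  have /ps_congE[H HE] := iffRL (phiff (f * h) 1) (iffRL (evE _ _) e1).
  have := congr1 (fun u : pseries k 5 => u 0%MM) HE.
  rewrite ps_sum big1 => [|r _]; last by rewrite psM0 sQ0 mulr0.
  rewrite psD psN psM0 (iffLR (ordge1 _) f1) mul0r add0r /GRing.one /= /ps_of_mpoly mcoeff1 eqxx.
  by move/eqP; rewrite oppr_eq0 oner_eq0.
have /choice[f fE] (i : 'I_3) : exists f, ev (phi f) (psP 'X_i).
  by have [f h] := phsurj (psP 'X_i); exists f; apply/evE.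
have f1 i : ordge 1 (f i).
  pose c := f i 0%MM.
  have h1 : ordge 1 (f i + psC (- c) * 1).
    by apply/ordge1; rewrite psD psCM /GRing.one /= /ps_of_mpoly mcoeff1 eqxx mulr1 subrr.
  have h2 := ph_ord _ h1.
  have : ev (phi (f i + psC (- c) * 1)) (psP 'X_i + psC (- c) * 1).
    apply: (ev_trans) (pD _ _) _; apply: (evD) => //; apply: (ev_trans) (pC _ _) _.
    exact: evM.
  move/ev0; rewrite (iffLR (ordge1 _) h2) psD psCM (iffLR (ordge1 _) (@ordge1_X k 3 i)).
  rewrite add0r /GRing.one /= /ps_of_mpoly mcoeff1 eqxx mulr1 => /esym/eqP.
  by rewrite oppr_eq0 => /eqP c0; apply/ordge1.
(* The linear parts of lifts of the three coordinates and of the three equations: six rows in a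
   space of dimension 5, so there is a dependency u = (c, d). *)
pose M : 'M[k]_(3 + 3, 5) :=
  col_mx (\matrix_(i, l) f i U_(l)%MM) (\matrix_(i, l) sE i U_(l)%MM).
have [u u0 uM] : exists2 u : 'rV[k]_(3 + 3), u != 0 & u *m M = 0.
  have : kermx M != 0.
    rewrite kermx_eq0 /row_free; apply/eqP => e.
    by have := rank_leq_col M; rewrite e.
  by case/rowV0Pn => u /sub_kermxP h h0; exists u.
pose c i := u 0 (lshift 3 i); pose d i := u 0 (rshift 3 i).
have cd l : \sum_i c i * f i U_(l)%MM + \sum_i d i * sE i U_(l)%MM = 0.
  have := congr1 (fun v : 'rV[k]_5 => v 0 l) uM; rewrite mxE [RHS]mxE big_split_ord /= => h.
  rewrite -[RHS]h.
  by congr (_ + _); apply: eq_bigr => i _; rewrite ?col_mxEu ?col_mxEd mxE.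
pose F := \sum_i psC (c i) * f i + \sum_i psC (d i) * sE i.
have F2 : ordge 2 F.
  move=> m /mdeg_lt2[->|[l ->]]; rewrite /F psD !ps_sum.
    rewrite !big1 ?addr0 // => i _; rewrite psCM ?sE0 ?mulr0 //.
    by rewrite (iffLR (ordge1 _) (f1 i)) mulr0.
  by rewrite -[RHS](cd l); congr (_ + _); apply: eq_bigr => i _; rewrite psCM.
have phF : ev (phi F) (\sum_i psC (c i) * psP 'X_i).
  apply: (ev_trans) (pD _ _) _; rewrite -[X in ev _ X]addr0; apply: (evD).
    apply: (ev_trans) (pSum _ _ _) _; apply: (big_ind2 ev) => [//|u1 u2 v1 v2|i _]; first exact: evD.
    by apply: (ev_trans) (pC _ _) _; apply: (evM).
  apply: (ev_trans _ _ _ _ p0); apply/evE/phiff/ps_congE; rewrite subr0.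
  by apply: in_ideal_sQ; apply: in_ideal_sum => i _; apply/in_idealM/in_ideal_gen.
(* Since F is a sum of products of two series without constant term, so is phi(F) modulo q', and q'
   has order 2. As phi(F) is also congruent to sum c_i X_i, all c_i vanish; the d_i follow from the
   independence of the equations. *)
have phF2 : ordge 2 (phi F).
  have [|G FG GN] := @ps_split_vars k 5 xpredT F.
    move=> m hm; rewrite (_ : m = 0%MM) ?F2 ?mdeg0 //.
    by apply/mnmP => i; rewrite hm // mnm0E.
  rewrite -[phi F](subrK (\sum_i phi (psP 'X_i * G i))).
  apply: ordgeD; first by apply: q'2; rewrite FG; apply: pSum.
  apply: (big_ind (ordge 2)) => // [*|i _]; first exact: ordgeD.
  rewrite -[phi _](subrK (phi (psP 'X_i) * phi (G i))); apply: ordgeD; first exact/q'2/pM.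
  apply: (@ordgeM _ _ 1 1); apply: ph_ord; [exact: ordge1_X|exact: GN].
have X2 : ordge 2 (\sum_i psC (c i) * psP ('X_i : {mpoly k[3]})).
  move/ev_sym/q'2: phF => h; rewrite -[X in ordge _ X](subrK (phi F)); exact: ordgeD.
have c0 i : c i = 0.
  have := X2 U_(i)%MM; rewrite mdeg1 => /(_ isT); rewrite ps_sum (bigD1 i) //= psCM.
  rewrite {1}/psP /ps_of_mpoly mcoeffX eqxx mulr1 big1 ?addr0 // => j ji.
  by rewrite psCM /psP /ps_of_mpoly mcoeffX eq_mnm1 (negbTE ji) mulr0.
have d0 i : d i = 0.
  have [b [nb pb]] : exists b, co b i != A /\ p 0 (co (~~ b) i) != 0.
    have [b [m eA]] := coP A.
    have [im|im] := eqVneq i m.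
      exists (~~ b); rewrite negbK im -eA; split=> //; rewrite eA co_eq eqxx andbT.
      by case: (b).
    move: (hn i); rewrite negb_and => /orP[h|h]; [exists false|exists true];
      by rewrite eA co_eq (negbTE im) andbF; split.
  have [l el] : exists l, co b i = lift A l.
    by move: nb; rewrite eq_sym => /unlift_some[l -> _]; exists l.
  have := cd l; rewrite big1 ?add0r => [|j _]; last by rewrite c0 mul0r.
  rewrite (bigD1 i) //= big1 ?addr0 => [|j ji]; last first.
    by rewrite sE_lin // -el !co_eq (negbTE ji) !andbF !mulr0 addr0 mul0r mulr0.
  rewrite sE_lin // -el !co_eq eqxx !andbT => /eqP; rewrite mulf_eq0 => /orP[/eqP //|].
  rewrite mulf_eq0 invr_eq0 (negbTE pA) orbF.
  by case: (b) pb => /= pb; rewrite mulr1 mulr0 ?addr0 ?add0r (negbTE pb).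
case/eqP: u0; apply/rowP => m; rewrite mxE.
by case: (split_ordP (m : 'I_(3 + 3))) => i ->; [exact: c0|exact: d0].
Qed.

End Node.

Section NodeIff.
Variables (k : closedFieldType) (char2 : 2%N \in [pchar k]).
Variables (a sc sd : 'I_3 -> k) (a_inj : injective a).
Hypothesis sc_neq0 : forall i, sc i != 0.
Hypothesis sd_neq0 : forall i, sd i != 0.
Local Notation q := (Sigma_eq a (sqf sc) (sqf sd)).

Lemma node_meeting p : node q p <-> meeting_point sc sd p.
Proof.
rewrite meeting_pointP //; split.
  move=> [hp [A pA iso]]; split; last exact: (node_edge char2 a_inj pA hp iso).
  by apply: contraNneq pA => ->; rewrite mxE.
move=> [p0 ed]; split.
  apply/(Sigma_eq0P char2 sc sd a_inj) => i.
  by case: ed => l [_ _ -> h]; rewrite h expr0n mulr0.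
have /existsP[A pA] : [exists A, p 0 A != 0].
  apply: contraNT p0; rewrite negb_exists => /forallP h; apply/eqP/rowP => A.
  by rewrite mxE; apply/eqP; rewrite -[_ == _]negbK.
by exists A => //; apply: edge_node.
Qed.

Lemma singular_node p : singular_point q p -> node q p.
Proof.
move=> [p0 hp rk]; apply/node_meeting/meeting_pointP => //; split=> //.
by have [e|//] := rank_jacobian char2 a_inj hp p0; rewrite e in rk.
Qed.

End NodeIff.

Lemma meval_ext (R : nzRingType) n (f g : 'I_n -> R) (P : {mpoly R[n]}) :
  f =1 g -> P.@[f] = P.@[g].
Proof. by move/funext ->. Qed.

(** * Places and the Nullstellensatz *)

Section Places.
Variables (k K : fieldType) (iota : {rmorphism k -> K}).

(* [v f r] reads: f is regular at the place and takes the value r there. *)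
Record place (v : K -> k -> Prop) : Prop := Place {
  pl_c : forall c, v (iota c) c;
  pl_D : forall f g r s, v f r -> v g s -> v (f + g) (r + s);
  pl_M : forall f g r s, v f r -> v g s -> v (f * g) (r * s);
  pl_V : forall f r, v f r -> r != 0 -> v f^-1 r^-1;
  pl_fun : forall f r s, v f r -> v f s -> r = s }.

Section Theory.
Variables (v : K -> k -> Prop) (plv : place v).

Lemma pl_0 : v 0 0. Proof. by have := pl_c plv 0; rewrite raddf0. Qed.
Lemma pl_1 : v 1 1. Proof. by have := pl_c plv 1; rewrite rmorph1. Qed.
Lemma pl_N f r : v f r -> v (- f) (- r).
Proof.
by move=> h; rewrite -mulN1r -[X in v _ X]mulN1r -(rmorph1 iota) -rmorphN; apply: pl_M (pl_c _ _) h.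
Qed.
Lemma pl_B f g r s : v f r -> v g s -> v (f - g) (r - s).
Proof. by move=> hf hg; apply: pl_D hf (pl_N hg). Qed.
Lemma pl_neq0 f r : v f r -> r != 0 -> f != 0.
Proof. by move=> h; apply: contra_neq => e; rewrite e in h; apply: (pl_fun plv h pl_0). Qed.
Lemma pl_X f r n : v f r -> v (f ^+ n) (r ^+ n).
Proof. by move=> h; elim: n => [|n IH]; [exact: pl_1|rewrite !exprS; apply: pl_M]. Qed.
Lemma pl_div f g r s : v f r -> v g s -> s != 0 -> v (f / g) (r / s).
Proof. by move=> hf hg s0; apply: pl_M => //; apply: pl_V. Qed.
Lemma pl_sum I (r : seq I) (P : pred I) F G :
  (forall i, P i -> v (F i) (G i)) ->
  v (\sum_(i <- r | P i) F i) (\sum_(i <- r | P i) G i).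
Proof. by move=> h; apply: (big_ind2 v) => // *; [exact: pl_0|exact: pl_D]. Qed.
Lemma pl_prod I (r : seq I) (P : pred I) F G :
  (forall i, P i -> v (F i) (G i)) ->
  v (\prod_(i <- r | P i) F i) (\prod_(i <- r | P i) G i).
Proof. by move=> h; apply: (big_ind2 v) => // *; [exact: pl_1|exact: pl_M]. Qed.

Lemma pl_mmap n (t : 'I_n -> K) (tau : 'I_n -> k) (P : {mpoly k[n]}) :
  (forall i, v (t i) (tau i)) -> v (mmap iota t P) P.@[tau].
Proof.
move=> h; rewrite mevalE /mmap; apply: pl_sum => m _; apply: (pl_M plv); first exact: (pl_c plv).
by apply: pl_prod => i _; apply: pl_X.
Qed.
End Theory.

Definition spec n (t : 'I_n -> K) (tau : 'I_n -> k) :=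
  forall P : {mpoly k[n]}, mmap iota t P = 0 -> P.@[tau] = 0.

(** The local ring at tau of the affine variety with generic point t, each element paired with its
    value; [vp] is the same for a point of a projective variety. *)
Definition loc n (t : 'I_n -> K) (tau : 'I_n -> k) f r :=
  exists P Q : {mpoly k[n]},
    [/\ Q.@[tau] != 0, f = mmap iota t P / mmap iota t Q & r = P.@[tau] / Q.@[tau]].

Lemma place_spec v n (t : 'I_n -> K) tau :
  place v -> (forall i, v (t i) (tau i)) -> spec t tau.
Proof.
move=> plv h P P0; have := pl_mmap plv P h; rewrite P0 => h'.
exact: (pl_fun plv h' (pl_0 plv)).
Qed.

Lemma loc_sub v n (t : 'I_n -> K) tau f r :
  place v -> (forall i, v (t i) (tau i)) -> loc t tau f r -> v f r.
Proof. by move=> plv h [P [Q [Q0 -> ->]]]; apply: pl_div Q0 => //; apply: pl_mmap. Qed.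

Lemma loc_var n (t : 'I_n -> K) tau i : loc t tau (t i) (tau i).
Proof.
exists 'X_i, 1; rewrite !rmorph1 oner_eq0 !divr1; split=> //.
  by rewrite mmapX mmap1U.
by rewrite mevalXU.
Qed.

Lemma place_loc n (t : 'I_n -> K) tau : spec t tau -> place (loc t tau).
Proof.
move=> sp; have nz Q : Q.@[tau] != 0 -> mmap iota t Q != 0.
  by apply: contra_neq => /sp.
split.
- move=> c; exists c%:MP, 1; rewrite !rmorph1 oner_eq0 !divr1 mmapC mevalC; split=> //.
- move=> f g r s [P [Q [Q0 -> ->]]] [P' [Q' [Q0' -> ->]]].
  exists (P * Q' + P' * Q), (Q * Q'); rewrite !rmorphM mulf_neq0 // !rmorphD !rmorphM /=.
  by split=> //; rewrite addf_div //; apply: nz.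
- move=> f g r s [P [Q [Q0 -> ->]]] [P' [Q' [Q0' -> ->]]].
  exists (P * P'), (Q * Q'); rewrite !rmorphM /= mulf_neq0 //.
  by split=> //; rewrite mulf_div.
- move=> f r [P [Q [Q0 -> ->]]]; rewrite mulf_eq0 invr_eq0 (negbTE Q0) orbF => P0.
  by exists Q, P; rewrite P0 !invfM !invrK ![_^-1 * _]mulrC.
- move=> f r s [P [Q [Q0 -> ->]]] [P' [Q' [Q0' e ->]]].
  have := sp (P * Q' - P' * Q); rewrite !rmorphB !rmorphM /= => h.
  apply/eqP; rewrite eqr_div // -subr_eq0; apply/eqP/h/eqP; rewrite subr_eq0 -eqr_div ?nz //.
  exact/eqP.
Qed.

Definition vp n (y : 'rV[K]_n) (p : 'rV[k]_n) f r :=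
  exists d (F G : {mpoly k[n]}),
    [/\ F \is d.-homog, G \is d.-homog, G.@[p 0] != 0,
        f = hval iota y F / hval iota y G & r = F.@[p 0] / G.@[p 0]].

Lemma local_ringE n (y : 'rV[K]_n) p f : local_ring iota y p f <-> exists r, vp y p f r.
Proof.
split=> [[d [F [G [hF hG G0 e]]]]|[r [d [F [G [hF hG G0 e _]]]]]].
  by exists (F.@[p 0] / G.@[p 0]), d, F, G.
by exists d, F, G.
Qed.

Lemma max_idealE n (y : 'rV[K]_n) p f : max_ideal iota y p f <-> vp y p f 0.
Proof.
split=> [[d [F [G [hF hG F0 G0 e]]]]|[d [F [G [hF hG G0 e r0]]]]].
  by exists d, F, G; rewrite F0 mul0r.
exists d, F, G; split=> //; apply/eqP; move/esym/eqP: r0.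
by rewrite mulf_eq0 invr_eq0 (negbTE G0) orbF.
Qed.

Lemma place_vp n (y : 'rV[K]_n) p : point iota y p -> place (vp y p).
Proof.
move=> [p0 sp]; have nz d Q : Q \is d.-homog -> Q.@[p 0] != 0 -> hval iota y Q != 0.
  by move=> hQ; apply: contra_neq => /(sp d); apply.
have hvM F G : hval iota y (F * G) = hval iota y F * hval iota y G by apply: rmorphM.
have hvD F G : hval iota y (F + G) = hval iota y F + hval iota y G by apply: rmorphD.
have hvB F G : hval iota y (F - G) = hval iota y F - hval iota y G by apply: rmorphB.
split.
- move=> c; exists 0%N, c%:MP, 1; rewrite /hval !rmorph1 oner_eq0 !divr1 mmapC mevalC.
  split=> //; last exact: dhomog1.
  by rewrite -[c%:MP]mulr1 mul_mpolyC dhomogZ // dhomog1.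
- move=> f g r s [d [P [Q [hP hQ Q0 -> ->]]]] [d' [P' [Q' [hP' hQ' Q0' -> ->]]]].
  exists (d + d')%N, (P * Q' + P' * Q), (Q * Q').
  rewrite hvD !hvM !rmorphD !rmorphM /= mulf_neq0 //; split=> //.
  + by apply: rpredD; [|rewrite addnC]; apply: dhomogM.
  + exact: dhomogM.
  + by rewrite addf_div //; [exact: (nz _ _ hQ Q0)|exact: (nz _ _ hQ' Q0')].
  + by rewrite addf_div.
- move=> f g r s [d [P [Q [hP hQ Q0 -> ->]]]] [d' [P' [Q' [hP' hQ' Q0' -> ->]]]].
  exists (d + d')%N, (P * P'), (Q * Q'); rewrite !hvM !rmorphM /= mulf_neq0 //.
  by split=> //; [exact: dhomogM|exact: dhomogM|rewrite mulf_div|rewrite mulf_div].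
- move=> f r [d [P [Q [hP hQ Q0 -> ->]]]]; rewrite mulf_eq0 invr_eq0 (negbTE Q0) orbF => P0.
  by exists d, Q, P; rewrite P0 !invfM !invrK ![_^-1 * _]mulrC.
- move=> f r s [d [P [Q [hP hQ Q0 -> ->]]]] [d' [P' [Q' [hP' hQ' Q0' e ->]]]].
  have := sp (d + d')%N (P * Q' - P' * Q); rewrite hvB !hvM !rmorphB !rmorphM /= => h.
  apply/eqP; rewrite eqr_div // -subr_eq0; apply/eqP/h.
    by apply: rpredB; [|rewrite addnC]; apply: dhomogM.
  apply/eqP; rewrite subr_eq0 -eqr_div ?(nz _ _ hQ) ?(nz _ _ hQ') //.
  exact/eqP.
Qed.

Lemma vp_ratio n (y : 'rV[K]_n) (p : 'rV[k]_n) i j : p 0 j != 0 -> vp y p (y 0 i / y 0 j) (p 0 i / p 0 j).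
Proof.
move=> pj; exists 1%N, 'X_i, 'X_j; rewrite /hval !mevalXU !mmapX !mmap1U.
by split=> //; rewrite dhomogX /= mdeg1.
Qed.

Lemma mmap_homog n (y : 'I_n -> K) c d (F : {mpoly k[n]}) : F \is d.-homog ->
  mmap iota (fun i => c * y i) F = c ^+ d * mmap iota y F.
Proof.
move=> /dhomogP hF; rewrite /mmap mulr_sumr; apply: eq_big_seq => m mF.
rewrite mulrCA; congr (_ * _); have <- : mdeg m = d := hF m mF.
rewrite /mmap1 mdegE -prodrXr.
by rewrite -big_split; apply: eq_bigr => i _; rewrite exprMn.
Qed.

Lemma hval_homog n (y : 'rV[K]_n) j d (F : {mpoly k[n]}) : F \is d.-homog -> y 0 j != 0 ->
  hval iota y F = y 0 j ^+ d * mmap iota (fun i => y 0 i / y 0 j) F.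
Proof.
move=> hF yj; rewrite -mmap_homog // /hval /mmap; apply: eq_bigr => m _; congr (_ * _).
by apply: eq_bigr => i _; rewrite mulrC mulfVK.
Qed.

Lemma meval_homog n (p : 'I_n -> k) c d (F : {mpoly k[n]}) : F \is d.-homog ->
  F.@[fun i => c * p i] = c ^+ d * F.@[p].
Proof.
move=> /dhomogP hF; rewrite !mevalE mulr_sumr; apply: eq_big_seq => m mF.
rewrite mulrCA; congr (_ * _); have <- : mdeg m = d := hF m mF.
rewrite mdegE -prodrXr.
by rewrite -big_split; apply: eq_bigr => i _; rewrite exprMn.
Qed.

Lemma point_neq0 n (y : 'rV[K]_n) (p : 'rV[k]_n) : point iota y p -> exists2 j, p 0 j != 0 & y 0 j != 0.
Proof.
move=> [p0 sp]; have /existsP[j pj] : [exists j, p 0 j != 0].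
  apply: contraNT p0; rewrite negb_exists => /forallP h; apply/eqP/rowP => A.
  by rewrite mxE; apply/eqP; rewrite -[_ == _]negbK.
exists j => //; apply: contra_neq pj => yj.
rewrite -(mevalXU (p 0) j); apply: (sp 1%N); first by rewrite dhomogX /= mdeg1.
by rewrite /hval mmapX mmap1U.
Qed.

Lemma vp_loc n (y : 'rV[K]_n) (p : 'rV[k]_n) j f r : point iota y p -> p 0 j != 0 -> vp y p f r ->
  loc (fun i => y 0 i / y 0 j) (fun i => p 0 i / p 0 j) f r.
Proof.
move=> pt pj [d [F [G [hF hG G0 -> ->]]]].
have yj : y 0 j != 0.
  apply: contra_neq pj => yj; case: pt => _ sp.
  rewrite -(mevalXU (p 0) j); apply: (sp 1%N); first by rewrite dhomogX /= mdeg1.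
  by rewrite /hval mmapX mmap1U.
have hE (H : {mpoly k[n]}) : H \is d.-homog -> H.@[p 0] = p 0 j ^+ d * H.@[fun i => p 0 i / p 0 j].
  move=> hH; rewrite -meval_homog //; apply: meval_ext => i; rewrite mulrC mulfVK //.
exists F, G; rewrite (hval_homog hF yj) (hval_homog hG yj) (hE _ hF) (hE _ hG).
have pd : p 0 j ^+ d != 0 by rewrite expf_neq0.
have yd : y 0 j ^+ d != 0 by rewrite expf_neq0.
split.
- by move: G0; rewrite hE // mulf_eq0 negb_or pd.
- by rewrite -mulf_div divff // mul1r.
- by rewrite -mulf_div divff // mul1r.
Qed.

(** The centre of a place on a projective variety: if all coordinates divided by the j-th are
    regular, their values are the coordinates of a point whose local ring is dominated by the
    place. *)
Lemma point_place v n (y : 'rV[K]_n) j (be : 'I_n -> k) :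
  place v -> y 0 j != 0 -> (forall i, v (y 0 i / y 0 j) (be i)) ->
  let p := \row_i be i in
  [/\ point iota y p, p 0 j = 1 & forall f r, vp y p f r -> v f r].
Proof.
move=> plv yj h p; have pE i : p 0 i = be i by rewrite mxE.
have pj : p 0 j = 1.
  by rewrite pE; have := h j; rewrite divff // => h'; apply: (pl_fun plv h' (pl_1 plv)).
have pt : point iota y p.
  split=> [|d F hF F0].
    by apply/eqP => e; move: pj; rewrite e mxE => /esym/eqP; rewrite oner_eq0.
  have := pl_mmap plv F h; move/eqP: F0; rewrite (hval_homog hF yj) mulf_eq0 expf_eq0.
  rewrite (negbTE yj) andbF /= => /eqP -> h0.
  rewrite (_ : F.@[p 0] = F.@[be]); first exact: (pl_fun plv h0 (pl_0 plv)).
  exact: meval_ext.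
split=> // f r fr; have := vp_loc pt _ fr => /(_ j); rewrite pj oner_eq0 => /(_ isT).
by apply: loc_sub => // i; rewrite divr1 pE.
Qed.

(** A rational map is defined at p' as soon as one coordinate divides all the others in the local
    ring of p'. *)
Lemma dominates_ratio n' (y' : 'rV[K]_n') n (y : 'rV[K]_n) :
  (forall p', point iota y' p' -> exists2 j, y 0 j != 0 &
     forall i, exists r, vp y' p' (y 0 i / y 0 j) r) ->
  dominates iota y' y.
Proof.
move=> h p' pt'; have [j yj /choice[be hbe]] := h p' pt'.
have [pt _ sub] := point_place (place_vp pt') yj hbe.
exists (\row_i be i); split=> //.
  by move=> f /local_ringE[r fr]; apply/local_ringE; exists r; apply: sub.
by move=> f /max_idealE fr; apply/max_idealE; apply: sub.
Qed.

End Places.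

(** * The weak Nullstellensatz *)

Definition is_ideal (R : pzRingType) (I : R -> Prop) :=
  [/\ I 0, forall x y, I x -> I y -> I (x + y) & forall x y, I y -> I (x * y)].

Lemma is_ideal_sum (R : pzRingType) (I : R -> Prop) J (r : seq J) (P : pred J) F :
  is_ideal I -> (forall j, P j -> I (F j)) -> I (\sum_(j <- r | P j) F j).
Proof. by move=> [I0 ID _] h; apply: (big_ind I). Qed.

Lemma is_idealB (R : pzRingType) (I : R -> Prop) x y :
  is_ideal I -> I x -> I y -> I (x - y).
Proof. by move=> [_ ID IM] Ix Iy; apply: ID => //; rewrite -mulN1r; apply: IM. Qed.

Lemma det_trick (R : comPzRingType) (I : R -> Prop) d (M : 'M[R]_d) (v : 'I_d -> R) :
  is_ideal I -> (forall i, I (\sum_j M i j * v j)) -> forall j, I (\det M * v j).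
Proof.
move=> idI Mv j.
pose V : 'cV[R]_d := \col_i v i.
have -> : \det M * v j = \sum_i \adj M j i * (\sum_l M i l * v l).
  have := congr1 (fun X : 'cV[R]_d => X j 0) (mulmxA (\adj M) M V).
  rewrite mul_adj_mx mul_scalar_mx !mxE => <-; apply: eq_bigr => i _; rewrite !mxE.
  by congr (_ * _); apply: eq_bigr => l _; rewrite mxE.
by apply: is_ideal_sum => // i _; case: idI => _ _; apply.
Qed.

Lemma base_expansion_inj B n (f g : 'I_n -> nat) :
  (forall i, f i < B)%N -> (forall i, g i < B)%N ->
  (\sum_i f i * B ^ i = \sum_i g i * B ^ i)%N -> f =1 g.
Proof.
elim: n f g => [|n IH] f g hf hg; first by move=> _ [].
have E (h : 'I_n.+1 -> nat) :
   (\sum_i h i * B ^ i = h ord0 + B * \sum_(i < n) h (lift ord0 i) * B ^ i)%N.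
  rewrite big_ord_recl expn0 muln1; congr (_ + _)%N; rewrite big_distrr /=.
  by apply: eq_bigr => i _; rewrite mulnCA; congr (_ * _)%N; rewrite expnS.
rewrite !E => e.
have e0 : f ord0 = g ord0.
  have := congr1 (modn^~ B) e.
  by rewrite ![(_ + B * _)%N]addnC !(mulnC B) !modnMDl !modn_small.
have B0 : (0 < B)%N by apply: leq_ltn_trans (hf ord0).
move: e; rewrite e0 => /addnI/eqP; rewrite eqn_pmul2l // => /eqP/IH h i.
case: (unliftP ord0 i) => [j|] -> //; exact: h.
Qed.

(** Descent on the degree of g: either g divides every element of L, and any root of g works, or
    some nonzero remainder modulo g belongs to L. *)
Lemma poly_ideal_root (k : closedFieldType) (L : {poly k} -> Prop) :
  is_ideal L -> ~ L 1 -> exists b, forall f, L f -> f.[b] = 0.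
Proof.
move=> idL L1; have [L0 LD LM] := idL.
have [[g Lg g0]|h] := pselect (exists2 g, L g & g != 0); last first.
  exists 0 => f Lf; have [->|f0] := eqVneq f 0; first by rewrite horner0.
  by case: h; exists f.
have [n] := ubnP (size g); elim: n g Lg g0 => // n IH g Lg g0 gn.
have [sg|sg] := eqVneq (size g) 1%N.
  case: L1; move/eqP/size_poly1P: sg => [c c0 e].
  have -> : 1 = (c^-1)%:P * g by rewrite e -polyCM mulVf.
  exact: LM.
have [b rb] := closed_rootP g sg.
have [h|] := pselect (forall f, L f -> g %| f).
  by exists b => f /h /dvdpP[q ->]; rewrite hornerM (rootP rb) mulr0.
move=> /existsNP[f /not_implyP[Lf nd]].
apply: (IH (f %% g)).
- have -> : f %% g = f - (f %/ g) * g by rewrite {2}(divp_eq f g) addrC addKr.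
  by apply: is_idealB => //; apply: LM.
- by apply/negP => /eqP z; apply: nd; apply/modp_eq0P.
- by apply: leq_trans (ltn_modpN0 f g0) _; rewrite -ltnS.
Qed.

Section NSS.
Variable k : closedFieldType.

(** If some f in J reduced to 1, the remainders of X^i f modulo the monic p would lie in J and
    reduce to X^i. Their coefficient matrix M then reduces to the identity, while [det_trick] at the
    entry X^0 = 1 puts det M in J; so [ev] would send det M both to 0 and to 1. *)
Lemma monic_elimination (A : comNzRingType) (ev : {rmorphism A -> k})
    (J : {poly A} -> Prop) (p : {poly A}) :
  is_ideal J -> ~ J 1 -> J p -> p \is monic ->
  (forall a, exists c, ev c = a) ->
  (forall c, J c%:P -> ev c = 0) ->
  exists b, forall f, J f -> (map_poly ev f).[b] = 0.
Proof.
move=> idJ J1 Jp mp evS evJ; have [J0 JD JM] := idJ.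
pose L (f : {poly k}) := exists2 g, J g & f = map_poly ev g.
have Lid : is_ideal L.
  split; first by exists 0; rewrite ?rmorph0.
    by move=> _ _ [f Jf ->] [g Jg ->]; exists (f + g); rewrite ?rmorphD //; apply: JD.
  move=> f _ [g Jg ->].
  have [h ->] : exists h, f = map_poly ev h.
    elim/poly_ind: f => [|f c [h ->]]; first by exists 0; rewrite rmorph0.
    have [c' <-] := evS c.
    by exists (h * 'X + c'%:P); rewrite rmorphD rmorphM /= map_polyX map_polyC.
  by exists (h * g); rewrite ?rmorphM //; apply: JM.
suff L1 : ~ L 1.
  by have [b hb] := poly_ideal_root Lid L1; exists b => f Jf; apply: hb; exists f.
case=> f Jf fE.
have [d dE] : exists d, size p = d.+1.
  by exists (size p).-1; rewrite prednK // lt0n size_poly_eq0 monic_neq0.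
case: d => [|d] in dE.
  apply: J1; move/eqP/size_poly1P: dE mp Jp => [c c0 ->].
  by rewrite monicE lead_coefC => /eqP ->.
pose r (i : 'I_d.+1) := Pdiv.Ring.rmodp ('X^i * f) p.
have Jr i : J (r i).
  have -> : r i = 'X^i * f - Pdiv.Ring.rdivp ('X^i * f) p * p.
    apply/eqP; rewrite eq_sym subr_eq addrC; apply/eqP.
    exact: (Pdiv.RingMonic.rdivp_eq mp ('X^i * f)).
  by apply: is_idealB => //; apply: JM.
have sr i : (size (r i) <= d.+1)%N.
  by rewrite -ltnS -dE Pdiv.Ring.ltn_rmodpN0 // monic_neq0.
pose M : 'M[A]_d.+1 := \matrix_(i, j) (r i)`_j.
have Mv i : J (\sum_j (M i j)%:P * 'X^j).
  rewrite (_ : \sum_j _ = r i) //; under eq_bigr => j _ do rewrite mxE mul_polyC.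
  rewrite -(poly_def d.+1 (fun j => (r i)`_j)); apply/polyP => j; rewrite coef_poly.
  by case: ltnP => // le; rewrite nth_default // (leq_trans (sr i)).
have Mev : map_mx ev M = 1%:M.
  apply/matrixP => i j; rewrite !mxE -coef_map /=.
  have -> : map_poly ev (r i) = 'X^i.
    have mp' : map_poly ev p \is monic by apply: monic_map.
    have sp : size (map_poly ev p) = d.+2.
      rewrite -dE size_poly_eq // -/(lead_coef p) (monicP mp) rmorph1; exact: oner_neq0.
    have := congr1 (map_poly ev) (Pdiv.RingMonic.rdivp_eq mp ('X^i * f)).
    rewrite -/(r i) rmorphM /= -fE mulr1 map_polyXn rmorphD rmorphM /= => e.
    have lt : (size (map_poly ev (r i)) < size (map_poly ev p))%N.
      by rewrite sp ltnS; apply: leq_trans (size_poly _ _) (sr i).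
    have := Pdiv.RingMonic.rmodp_addl_mul_small mp' (map_poly ev (Pdiv.Ring.rdivp ('X^i * f) p)) lt.
    by rewrite -e Pdiv.Ring.rmodp_small // size_polyXn sp ltnS.
  by rewrite coefXn eq_sym.
have := @det_trick _ J _ (map_mx polyC M) (fun j => 'X^j) idJ.
move=> /(_ _)/(_ ord0) H.
have : J (\det M)%:P.
  rewrite -det_map_mx -[X in J X]mulr1; apply: H => i.
  by under eq_bigr => j _ do rewrite mxE.
move/evJ; rewrite -det_map_mx Mev det1 => /eqP; by rewrite oner_eq0.
Qed.

Section Nagata.
Variables (n B : nat).
Hypothesis B0 : (0 < B)%N.
Local Notation A := {mpoly k[n]}.

(** Nagata's change of variables, in which X_i with i > 0 becomes X_i + X^(B^i). A monomial acquires
    the degree whose base-B digits are its exponents. *)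
Definition nag_var (i : 'I_n.+1) : {poly A} :=
  if unlift ord0 i is Some j then ('X_j)%:P + 'X^(B ^ i) else 'X.
Definition nag : {mpoly k[n.+1]} -> {poly A} := mmap (polyC \o @mpolyC n k) nag_var.
HB.instance Definition _ := GRing.RMorphism.on nag.

Definition nag_deg (m : 'X_{1..n.+1}) := (\sum_i m i * B ^ i)%N.

Lemma nag_var_monic i : nag_var i \is monic /\ size (nag_var i) = (B ^ i).+1.
Proof.
rewrite /nag_var; case: unliftP => [j|] ->; last first.
  by rewrite monicX size_polyX expn0.
have Bi : (0 < B ^ lift ord0 j)%N by rewrite expn_gt0 B0.
have lt : (size (('X_(j : 'I_n))%:P : {poly A}) < size ('X^(B ^ lift ord0 j) : {poly A}))%N.
  by rewrite size_polyXn ltnS; apply: leq_trans (size_polyC_leq1 _) _.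
rewrite addrC monicE lead_coefDl // lead_coefXn eqxx size_polyDl //.
by rewrite size_polyXn.
Qed.

Lemma nag_mono m : mmap1 nag_var m \is monic /\ size (mmap1 nag_var m) = (nag_deg m).+1.
Proof.
rewrite /mmap1 /nag_deg.
have h (i : 'I_n.+1) : nag_var i ^+ m i \is monic /\ size (nag_var i ^+ m i) = (m i * B ^ i).+1.
  have [mi si] := nag_var_monic i; split; first exact: monic_exp.
  elim: (m i) => [|e IH]; first by rewrite expr0 size_poly1.
  rewrite exprS size_monicM ?monic_neq0 ?monic_exp // si IH /=; lia.
elim/big_rec2: _ => [|i d p _ [mp sp]]; first by rewrite monic1 size_poly1.
have [mi si] := h i; split; first by rewrite monicMr.
by rewrite size_monicM ?monic_neq0 // si sp addnS.
Qed.

Lemma nagE (F : {mpoly k[n.+1]}) :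
  nag F = \sum_(m <- msupp F) (F@_m)%:MP%:P * mmap1 nag_var m.
Proof. by []. Qed.

(** All exponents of F are below B, so distinct monomials get distinct degrees in X and the top one
    cannot cancel; its coefficient is a constant. *)
Lemma nag_lead (F : {mpoly k[n.+1]}) : F != 0 -> (msize F <= B)%N ->
  exists c d, [/\ c != 0, (nag F)`_d = c%:MP & (size (nag F) <= d.+1)%N].
Proof.
move=> F0 sF.
have [ms msF msmax] : exists2 ms, ms \in msupp F &
    forall m, m \in msupp F -> (nag_deg m <= nag_deg ms)%N.
  have : msupp F != [::] by rewrite msupp_eq0.
  elim: (msupp F) => // m s IH _; have [->|/IH[ms mss mx]] := eqVneq s [::].
    by exists m; rewrite ?inE // => m'; rewrite inE => /eqP ->.
  have [le|lt] := leqP (nag_deg m) (nag_deg ms).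
    exists ms; rewrite ?inE ?mss ?orbT // => m'; rewrite inE => /orP[/eqP -> //|]; exact: mx.
  exists m; rewrite ?inE ?eqxx // => m'; rewrite inE => /orP[/eqP -> //|/mx h].
  by apply: leq_trans h (ltnW lt).
have inj m : m \in msupp F -> nag_deg m = nag_deg ms -> m = ms.
  move=> mF e; apply/mnmP; apply: (base_expansion_inj _ _ e) => i.
    apply: leq_trans sF; apply: leq_trans (msize_mdeg_lt mF); rewrite ltnS mdegE.
    by rewrite (bigD1 i) //= leq_addr.
  apply: leq_trans sF; apply: leq_trans (msize_mdeg_lt msF); rewrite ltnS mdegE.
  by rewrite (bigD1 i) //= leq_addr.
exists F@_ms, (nag_deg ms); split; first by rewrite -mcoeff_msupp.
  rewrite nagE coef_sum (bigD1_seq ms) ?msupp_uniq //= big1_seq ?addr0.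
    rewrite coefCM; have [mm sm] := nag_mono ms.
    by move/monicP: mm; rewrite lead_coefE sm /= => ->; rewrite mulr1.
  move=> m /andP[ne mF]; rewrite coefCM nth_default ?mulr0 //.
  have [_ ->] := nag_mono m; rewrite ltn_neqAle msmax // andbT.
  by apply: contra ne => /eqP /inj ->.
rewrite nagE; apply: leq_trans (size_sum _ _ _) _.
apply/bigmax_leqP_seq => m mF _.
apply: leq_trans (size_polyMleq _ _) _.
rewrite size_polyC; have [_ ->] := nag_mono m.
by have := msmax _ mF; case: (_ != 0); rewrite /= ?addSn /=; lia.
Qed.

Definition nag_inv (p : {poly A}) : {mpoly k[n.+1]} :=
  (map_poly (mmap (@mpolyC n.+1 k)
     (fun j => 'X_(lift ord0 j) - 'X_ord0 ^+ (B ^ lift ord0 j))) p).['X_ord0].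

Fact nag_inv_additive : additive nag_inv.
Proof. by move=> p q; rewrite /nag_inv rmorphB hornerD hornerN. Qed.
HB.instance Definition _ := GRing.isAdditive.Build _ _ nag_inv nag_inv_additive.
Fact nag_inv_multiplicative : multiplicative nag_inv.
Proof. by split=> [p q|]; rewrite /nag_inv ?rmorphM ?hornerM // rmorph1 hornerC. Qed.
HB.instance Definition _ := GRing.isMultiplicative.Build _ _ nag_inv nag_inv_multiplicative.

Lemma nagK F : nag_inv (nag F) = F.
Proof.
have hC c : nag_inv (c%:MP)%:P = c%:MP by rewrite /nag_inv map_polyC hornerC /= mmapC.
have hX i : nag_inv (nag_var i) = 'X_i.
  rewrite /nag_var; case: unliftP => [j|] ->.
    rewrite rmorphD rmorphXn /= {1 2}/nag_inv map_polyC map_polyX hornerC hornerX /=.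
    by rewrite mmapX mmap1U subrK.
  by rewrite /nag_inv map_polyX hornerX.
rewrite nagE [RHS]mpolyE rmorph_sum; apply: eq_bigr => m _ /=.
rewrite rmorphM /= hC -mul_mpolyC; congr (_ * _).
rewrite mpolyXE_id /mmap1 rmorph_prod; apply: eq_bigr => i _ /=.
by rewrite rmorphXn /= hX.
Qed.

Lemma nag_eval (a : 'I_n -> k) b (F : {mpoly k[n.+1]}) :
  (map_poly (meval a) (nag F)).[b] =
  F.@[fun i => if unlift ord0 i is Some j then a j + b ^+ (B ^ i) else b].
Proof.
rewrite nagE mevalE rmorph_sum horner_sum; apply: eq_bigr => m _ /=.
rewrite rmorphM hornerM /= map_polyC hornerC /= mevalC; congr (_ * _).
rewrite /mmap1 rmorph_prod horner_prod; apply: eq_bigr => i _ /=.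
rewrite rmorphXn horner_exp /nag_var; case: unlift => [j|] /=; last by rewrite map_polyX hornerX.
by rewrite rmorphD /= map_polyC /= mevalXU map_polyXn hornerD hornerC hornerXn.
Qed.

End Nagata.

(** Induction on n. After Nagata's substitution a nonzero F of I is monic up to a constant; the
    constants of the transformed ideal have a common zero by induction, and [monic_elimination]
    extends it by one coordinate. *)
Theorem weak_nullstellensatz n (I : {mpoly k[n]} -> Prop) :
  is_ideal I -> ~ I 1 -> exists tau, forall P, I P -> P.@[tau] = 0.
Proof.
elim: n I => [|n IH] I idI I1; have [I0 ID IM] := idI.
  exists (fun=> 0) => P IP; apply/eqP/negP => /negP nz; apply: I1.
  have e : P = (P.@[fun=> 0])%:MP.
    rewrite {1}[P]mpolyE mevalE raddf_sum; apply: eq_bigr => m _ /=.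
    rewrite -mul_mpolyC (_ : m = 0%MM) ?mpolyX0; last by apply/mnmP => -[].
    by rewrite mulr1 big1 ?mulr1 // => -[].
  have -> : 1 = ((P.@[fun=> 0])^-1)%:MP * P by rewrite {2}e -mpolyCM mulVf.
  exact: IM.
have [[F IF F0]|h] := pselect (exists2 F, I F & F != 0); last first.
  exists (fun=> 0) => P IP; have [->|P0] := eqVneq P 0; first by rewrite rmorph0.
  by case: h; exists P.
pose B := (msize F).+1; pose ng := @nag n B.
pose J p := I (@nag_inv n B p).
have idJ : is_ideal J.
  split; rewrite /J; first by rewrite raddf0.
    by move=> p q hp hq; rewrite raddfD; apply: ID.
  by move=> p q hq; rewrite rmorphM; apply: IM.
have J1 : ~ J 1 by rewrite /J rmorph1.
have JI G : I G -> J (ng G) by rewrite /J nagK.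
have [c [d [c0 ed sd]]] := @nag_lead n B (ltn0Sn _) F F0 (leqnSn _).
pose p := (c^-1)%:MP%:P * ng F.
have Jp : J p by case: idJ => _ _ JM; apply/JM/JI.
have mp : p \is monic.
  have pd : p`_d = 1 by rewrite coefCM ed -mpolyCM mulVf.
  have sp : (size p <= d.+1)%N.
    by rewrite /p mul_polyC; apply: leq_trans (size_scale_leq _ _) sd.
  rewrite monicE lead_coefE; suff -> : size p = d.+1 by rewrite pd.
  apply/eqP; rewrite eqn_leq sp ltnNge; apply/negP => le.
  by move: pd; rewrite nth_default // => /eqP; rewrite eq_sym oner_eq0.
have [||a ha] := IH (fun c => J c%:P).
- case: idJ => J0 JD JM; split=> [|x y hx hy|x y hy]; first by [].
    by rewrite polyCD; apply: JD.
  by rewrite polyCM; apply: JM.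
- by [].
have [|b hb] := monic_elimination (ev := meval a) idJ J1 Jp mp _ ha.
  by move=> x; exists x%:MP; exact: (mevalC a x).
exists (fun i => if unlift ord0 i is Some j then a j + b ^+ (B ^ i) else b) => G IG.
by rewrite -nag_eval; apply/hb/JI.
Qed.

End NSS.

(** Rows of W outside the current row space are added one at a time; the rank grows at each step and
    cannot exceed L. *)
Lemma subspace_matrix (k : fieldType) L (W : 'rV[k]_L -> Prop) :
  W 0 -> (forall x y, W x -> W y -> W (x + y)) -> (forall c x, W x -> W (c *: x)) ->
  exists r (B : 'M[k]_(r, L)), forall x, W x <-> (x <= B)%MS.
Proof.
move=> W0 WD WZ.
have rowsW r (B : 'M[k]_(r, L)) : (forall i, W (row i B)) -> forall x, (x <= B)%MS -> W x.
  move=> hB x /submxP[D ->]; rewrite mulmx_sum_row.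
  by apply: (big_ind W) => // i _; apply: WZ.
have H j : (exists r (B : 'M[k]_(r, L)), forall x, W x <-> (x <= B)%MS) \/
    exists r (B : 'M[k]_(r, L)), (j <= \rank B)%N /\ forall i, W (row i B).
  elim: j => [|j [|[r [B [rB hB]]]]]; [|by left|].
    by right; exists 0%N, 0; split=> // -[].
  have [h|] := pselect (forall x, W x -> (x <= B)%MS).
    by left; exists r, B => x; split; [exact: h|exact: rowsW].
  move=> /existsNP[x /not_implyP[Wx xB]]; right.
  exists (r + 1)%N, (col_mx B x); split.
    apply: leq_ltn_trans rB _; apply: rank_ltmx; rewrite /ltmx.
    have e : (col_mx B x :=: B + x)%MS by apply/eqmx_sym/addsmxE.
    rewrite !e addsmxSl /=; apply/negP => h; apply: xB.
    by apply: submx_trans h; apply: addsmxSr.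
  move=> i; case: (split_ordP i) => l ->; rewrite ?rowKu ?rowKd //.
  by rewrite (ord1 l) row_id.
have [//|[r [B [rB _]]]] := H L.+1.
by have := leq_trans rB (rank_leq_col B); rewrite ltnn.
Qed.

(** * Regular local rings of surfaces in characteristic 2 *)

Section HalfMonomials.
Variables (k : closedFieldType) (char2 : 2%N \in [pchar k]) (n : nat).

Definition sqrtk (x : k) : k := projT1 (cid (closed_sqrt x)).
Lemma sqrtkE x : sqrtk x ^+ 2 = x. Proof. exact: (projT2 (cid (closed_sqrt x))). Qed.

Definition mhalf (m : 'X_{1..n}) : 'X_{1..n} := [multinom (m i)./2 | i < n].
Definition mpar (m : 'X_{1..n}) : {set 'I_n} := [set i | odd (m i)].
Definition msq (e : {set 'I_n}) : 'X_{1..n} := [multinom nat_of_bool (i \in e) | i < n].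

Lemma mhalf_par m : m = (mhalf m + mhalf m + msq (mpar m))%MM.
Proof.
apply/mnmP => i; rewrite !mnmDE !mnmE inE.
by rewrite addnn addnC odd_double_half.
Qed.

(** Monomials are sorted by the parities e of their exponents. The part of P of parity e is the
    square of this polynomial times the squarefree monomial of e, coefficients having square roots
    in k. *)
Definition mpoly_half (P : {mpoly k[n]}) (e : {set 'I_n}) : {mpoly k[n]} :=
  \sum_(m <- msupp P | mpar m == e) sqrtk P@_m *: 'X_[mhalf m].

Lemma mpoly_halfE P : P = \sum_e mpoly_half P e ^+ 2 * 'X_[msq e].
Proof.
have h := char2_mpoly char2 n.
have sqs I (r : seq I) (Q : pred I) (F : I -> {mpoly k[n]}) :
   (\sum_(i <- r | Q i) F i) ^+ 2 = \sum_(i <- r | Q i) F i ^+ 2.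
  rewrite -(pFrobenius_autE h); elim/big_rec2: _ => [|i x y _ <-].
    by rewrite pFrobenius_autE expr0n.
  by rewrite pFrobenius_autD_comm ?pFrobenius_autE //; apply: mulrC.
rewrite {1}[P]mpolyE (partition_big mpar xpredT) //=; apply: eq_bigr => e _.
rewrite /mpoly_half sqs mulr_suml; apply: eq_bigr => m /eqP <-.
by rewrite exprZn sqrtkE -scalerAl expr2 -!mpolyXD -mhalf_par.
Qed.

(** Square roots halve degrees. This is the source of the finiteness used in [krull]. *)
Lemma mpoly_half_size P e : (msize (mpoly_half P e) <= (msize P)./2.+1)%N.
Proof.
rewrite /mpoly_half; apply: leq_trans (mmeasure_sum _ _ _ _) _.
apply/bigmax_leqP_seq => m mP _.
apply: leq_trans (mmeasureZ_le _ _ _) _; rewrite mmeasureX ltnS.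
have h : (mdeg m <= msize P)%N by apply: ltnW; apply: msize_mdeg_lt.
rewrite geq_half_double; apply: leq_trans h.
by rewrite -addnn [X in (_ <= mdeg X)%N]mhalf_par !mdegD leq_addr.
Qed.

End HalfMonomials.

Section Regular.
Variables (k : closedFieldType) (K : fieldType) (iota : {rmorphism k -> K}).
Hypothesis char2 : 2%N \in [pchar k].
Variables (v : K -> k -> Prop) (plv : place iota v).
Variables (n : nat) (t : 'I_n -> K) (tau : 'I_n -> k).
Hypotheses (vt : forall i, v (t i) (tau i)).
Hypothesis gen : forall f r, v f r -> loc iota t tau f r.
Definition Rv f := exists r, v f r.
Hypothesis Rfrac : forall f, exists a b, [/\ Rv a, Rv b, b != 0 & f = a / b].
Variables (u w : K) (vu : v u 0) (vw : v w 0).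
Hypothesis params : forall f, v f 0 -> exists a b, [/\ Rv a, Rv b & f = a * u + b * w].
Variable m4 : 'I_4 -> K.
Hypothesis m4_free : forall c : 'I_4 -> K,
  \sum_i c i ^+ 2 * m4 i = 0 -> forall i, c i = 0.

Lemma charK : 2%N \in [pchar K]. Proof. exact: rmorph_pchar char2. Qed.

Local Notation Fr := (pFrobenius_aut charK).
Local Notation evt := (mmap iota t).

Lemma sqrD_K (x y : K) : (x + y) ^+ 2 = x ^+ 2 + y ^+ 2.
Proof. by rewrite -!(pFrobenius_autE charK) rmorphD. Qed.

Lemma sqr_sum_K I (r : seq I) (P : pred I) (F : I -> K) :
  (\sum_(i <- r | P i) F i) ^+ 2 = \sum_(i <- r | P i) F i ^+ 2.
Proof.
rewrite -(pFrobenius_autE charK) rmorph_sum /=.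
by apply: eq_bigr => i _; rewrite pFrobenius_autE.
Qed.

Lemma RvD f g : Rv f -> Rv g -> Rv (f + g).
Proof. by move=> [r h] [s h']; exists (r + s); apply: (pl_D plv). Qed.
Lemma RvM f g : Rv f -> Rv g -> Rv (f * g).
Proof. by move=> [r h] [s h']; exists (r * s); apply: (pl_M plv). Qed.
Lemma RvN f : Rv f -> Rv (- f).
Proof. by move=> [r h]; exists (- r); apply: (pl_N plv). Qed.
Lemma Rvc c : Rv (iota c). Proof. by exists c; apply: (pl_c plv). Qed.
Lemma Rv0 : Rv 0. Proof. by exists 0; apply: (pl_0 plv). Qed.
Lemma Rv1 : Rv 1. Proof. by exists 1; apply: (pl_1 plv). Qed.
Lemma RvX f i : Rv f -> Rv (f ^+ i).
Proof. by move=> [r h]; exists (r ^+ i); apply: (pl_X plv). Qed.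
Lemma Rv_sum I (r : seq I) (P : pred I) F :
  (forall i, P i -> Rv (F i)) -> Rv (\sum_(i <- r | P i) F i).
Proof. by move=> h; apply: (big_ind Rv) => //; [exact: Rv0|exact: RvD]. Qed.
Lemma Rv_prod I (r : seq I) (P : pred I) F :
  (forall i, P i -> Rv (F i)) -> Rv (\prod_(i <- r | P i) F i).
Proof. by move=> h; apply: (big_ind Rv) => //; [exact: Rv1|exact: RvM]. Qed.
Lemma Rv_ev P : Rv (evt P). Proof. by exists P.@[tau]; apply: pl_mmap. Qed.
Lemma Rv_det d (A : 'M[K]_d) : (forall i j, Rv (A i j)) -> Rv (\det A).
Proof.
move=> h; apply: Rv_sum => s _; apply: RvM; first by apply/RvX/RvN/Rv1.
by apply: Rv_prod => i _.
Qed.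
Lemma pl_det d (A : 'M[K]_d) (B : 'M[k]_d) : (forall i j, v (A i j) (B i j)) -> v (\det A) (\det B).
Proof.
move=> h; apply: (pl_sum plv) => s _; apply: (pl_M plv).
  by apply/(pl_X plv)/(pl_N plv)/(pl_1 plv).
by apply: (pl_prod plv).
Qed.
Lemma m_Rv f g : v f 0 -> Rv g -> v (f * g) 0.
Proof. by move=> h [r h']; rewrite -(mul0r r); apply: (pl_M plv). Qed.
Lemma m_sum I (r : seq I) (P : pred I) F :
  (forall i, P i -> v (F i) 0) -> v (\sum_(i <- r | P i) F i) 0.
Proof.
by move=> h; apply: (big_ind (v^~ 0)) => // [|x y hx hy]; [exact: (pl_0 plv)|rewrite -[X in v _ X]addr0; apply: (pl_D plv)].
Qed.

(** The form of Nakayama's lemma used here: the determinant of 1 - N has value 1, so it is a unit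
    and the adjugate gives an inverse over the local ring. *)
Lemma Rv_invmx d (N : 'M[K]_d) : (forall i j, v (N i j) 0) ->
  exists2 B : 'M[K]_d, B *m (1%:M - N) = 1%:M & forall i j, Rv (B i j).
Proof.
move=> hN; set A := 1%:M - N.
have vA i j : v (A i j) ((1%:M : 'M[k]_d) i j).
  rewrite mxE [(- N) i j]mxE -[X in v _ X]subr0; apply: (pl_B plv) => //.
  by rewrite !mxE; case: (i == j); [exact: (pl_1 plv)|exact: (pl_0 plv)].
have vd : v (\det A) 1 by rewrite -(det1 k d); apply: pl_det.
have d0 : \det A != 0 by apply: (pl_neq0 plv vd); apply: oner_neq0.
exists ((\det A)^-1 *: \adj A).
  by rewrite -scalemxAl mul_adj_mx scale_scalar_mx mulVf.
move=> i j; rewrite mxE; apply: RvM.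
  by exists 1^-1; apply: (pl_V plv) => //; apply: oner_neq0.
rewrite mxE /cofactor; apply: RvM; first by apply/RvX/RvN/Rv1.
by apply: Rv_det => i' j'; rewrite mxE mxE; eexists; apply: vA.
Qed.

Definition e4 (i : 'I_4) : K := nth 0 [:: 1; u; w; u * w] i.

Lemma Rv_e4 i : Rv (e4 i).
Proof.
have Ru : Rv u by exists 0. have Rw : Rv w by exists 0.
have Ruw : Rv (u * w) by apply: RvM.
by case: i => -[|[|[|[|i]]]] //= h; rewrite /e4 /=; first [exact: Rv1|exact: Ruw|exact: Ru|exact: Rw].
Qed.

Lemma sum4 (F : 'I_4 -> K) : \sum_i F i = F 0 + F 1 + F 2 + F 3.
Proof.
rewrite !big_ord_recl big_ord0 addr0 !addrA.
by congr (_ + F _ + F _ + F _); apply: val_inj.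
Qed.

Lemma Rv_split f : Rv f -> exists r a b, [/\ Rv a, Rv b & f = iota r + a * u + b * w].
Proof.
move=> [r fr]; have : v (f - iota r) 0 by rewrite -(subrr r); apply: (pl_B plv) fr (pl_c plv r).
by case/params=> a [b [Ra Rb e]]; exists r, a, b; split=> //; rewrite -addrA -e addrC subrK.
Qed.

(** A Taylor expansion to second order in u and w, with constant coefficients on 1, u, w, uw. The
    coefficient of the mixed term uw collects two contributions and is expanded once more. *)
Lemma Rv_split2 f : Rv f -> exists (ka : 'I_4 -> k) g h,
  [/\ Rv g, Rv h & f = \sum_i iota (ka i) * e4 i + u ^+ 2 * g + w ^+ 2 * h].
Proof.
move=> Rf; have [r [a [b [Ra Rb ->]]]] := Rv_split Rf.
have [a0 [a1 [a2 [Ra1 Ra2 ->]]]] := Rv_split Ra.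
have [b0 [b1 [b2 [Rb1 Rb2 ->]]]] := Rv_split Rb.
have [c0 [c1 [c2 [Rc1 Rc2 e]]]] := Rv_split (RvD Ra2 Rb1).
exists (fun i => nth 0 [:: r; a0; b0; c0] i), (a1 + c1 * w), (b2 + c2 * u).
have Ru : Rv u by exists 0. have Rw : Rv w by exists 0.
split; [by apply: RvD => //; apply: RvM|by apply: RvD => //; apply: RvM|].
rewrite sum4 /e4 /=.
have -> : iota r + (iota a0 + a1 * u + a2 * w) * u + (iota b0 + b1 * u + b2 * w) * w =
  iota r + iota a0 * u + iota b0 * w + a1 * u ^+ 2 + b2 * w ^+ 2 + (a2 + b1) * (u * w) by ring.
rewrite e; ring.
Qed.

(** The squarefree monomials in the affine coordinates. They generate the local ring over its
    squares by [mpoly_half]. *)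
Definition te (e : {set 'I_n}) := evt 'X_[msq e].

Lemma ev_half P : evt P = \sum_e evt (mpoly_half P e) ^+ 2 * te e.
Proof.
rewrite {1}(mpoly_halfE char2 P) rmorph_sum; apply: eq_bigr => e _ /=.
by rewrite rmorphM rmorphXn.
Qed.

Local Notation M := #|{: {set 'I_n}}|.
Definition te' (l : 'I_M) := te (enum_val l).

Lemma sum_te (F : {set 'I_n} -> K) : \sum_e F e = \sum_(l < M) F (enum_val l).
Proof. by rewrite -big_enum_val; apply: eq_bigl => e; rewrite inE. Qed.

(** Nakayama's lemma over the subring of squares. Modulo u^2 and w^2 each generator is a constant
    combination of 1, u, w, uw, and the remainder is expressed through the generators again, with
    coefficients that are squares of elements of the maximal ideal. *)
Lemma te_decomp : exists g : 'I_M -> 'I_4 -> K,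
  (forall l i, Rv (g l i)) /\ forall l, te' l = \sum_i g l i ^+ 2 * e4 i.
Proof.
(* Writing P/Q as PQ/Q^2 makes the denominator a square. *)
have Rsq f : Rv f -> exists c : 'I_M -> K, (forall l, Rv (c l)) /\ f = \sum_l c l ^+ 2 * te' l.
  move=> [r /gen[P [Q [Q0 -> _]]]]; have vQ := pl_mmap plv Q vt.
  have q0 := pl_neq0 plv vQ Q0.
  exists (fun l => evt (mpoly_half (P * Q) (enum_val l)) / evt Q); split.
    move=> l; apply: RvM; first exact: Rv_ev.
    by exists (Q.@[tau])^-1; apply: (pl_V plv).
  have -> : evt P / evt Q = evt (P * Q) / evt Q ^+ 2 by rewrite rmorphM expr2 invfM mulrA mulfK.
  rewrite ev_half sum_te mulr_suml; apply: eq_bigr => l _.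
  by rewrite exprMn exprVn mulrAC.
have H l : exists p : ('I_4 -> k) * ('I_M -> K), (forall l', v (p.2 l') 0) /\
    te' l = \sum_i iota (p.1 i) ^+ 2 * e4 i + \sum_l' p.2 l' ^+ 2 * te' l'.
  have [ka [g [h [Rg Rh e]]]] := Rv_split2 (Rv_ev 'X_[msq (enum_val l)]).
  have [cg [Rcg eg]] := Rsq _ Rg; have [ch [Rch eh]] := Rsq _ Rh.
  exists (fun i => sqrtk (ka i), fun l' => u * cg l' + w * ch l'); split=> [l'|] /=.
    by rewrite -[X in v _ X]addr0; apply: (pl_D plv); apply: m_Rv.
  rewrite [LHS]e -addrA eg eh !mulr_sumr -big_split /=; congr (_ + _).
    by apply: eq_bigr => i _; rewrite -rmorphXn /= sqrtkE.
  by apply: eq_bigr => l' _; rewrite sqrD_K !exprMn; ring.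
have [p hp] := choice H.
pose N : 'M[K]_M := \matrix_(l, l') (p l).2 l'.
(* The matrix 1 - N is inverted before its entries are squared. As Frobenius is a ring morphism, the
   inverse of the squared matrix then has squares of elements of the local ring as entries. *)
have [l l'|B BN RB] := @Rv_invmx M N; first by rewrite mxE; case: (hp l).
pose Ka : 'M[K]_(M, 4) := \matrix_(l, i) iota ((p l).1 i).
exists (fun l i => (B *m Ka) l i); split.
  by move=> l i; rewrite mxE; apply: Rv_sum => l' _; apply: RvM => //; rewrite mxE; apply: Rvc.
pose T : 'cV[K]_M := \col_l te' l; pose E : 'cV[K]_4 := \col_i e4 i.
have TE : (1%:M - map_mx Fr N) *m T = map_mx Fr Ka *m E.
  apply/matrixP => l j; rewrite mulmxBl mul1mx !mxE.
  have -> : \sum_j0 (map_mx Fr N) l j0 * T j0 j = \sum_l' (p l).2 l' ^+ 2 * te' l'.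
    by apply: eq_bigr => l' _; rewrite !mxE pFrobenius_autE.
  case: (hp l) => _ ->; rewrite addrK; apply: eq_bigr => i _.
  by rewrite !mxE pFrobenius_autE.
have e1 : map_mx Fr (1%:M - N) = 1%:M - map_mx Fr N by rewrite map_mxB map_mx1.
have : T = map_mx Fr (B *m Ka) *m E.
  by rewrite map_mxM -mulmxA -TE -e1 mulmxA -map_mxM BN map_mx1 mul1mx.
move=> e l; have := congr1 (fun X : 'cV[K]_M => X l 0) e; rewrite !mxE => ->.
by apply: eq_bigr => i _; rewrite [E _ _]mxE [map_mx _ _ _ _]mxE pFrobenius_autE.
Qed.

Lemma sq_decomp f : Rv f -> exists c : 'I_4 -> K,
  (forall i, Rv (c i)) /\ f = \sum_i c i ^+ 2 * e4 i.
Proof.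
have [g [Rg hg]] := te_decomp.
move=> [r /gen[P [Q [Q0 -> _]]]]; have vQ := pl_mmap plv Q vt.
have q0 := pl_neq0 plv vQ Q0.
exists (fun i => \sum_l evt (mpoly_half (P * Q) (enum_val l)) / evt Q * g l i); split.
  move=> i; apply: Rv_sum => l _; apply: RvM => //; apply: RvM; first exact: Rv_ev.
  by exists (Q.@[tau])^-1; apply: (pl_V plv).
have -> : evt P / evt Q = evt (P * Q) / evt Q ^+ 2 by rewrite rmorphM expr2 invfM mulrA mulfK.
rewrite ev_half sum_te mulr_suml.
under eq_bigr => l _ do rewrite -/(te' l) hg !mulr_sumr.
under [in RHS]eq_bigr => i _ do rewrite sqr_sum_K mulr_suml.
rewrite [RHS]exchange_big /=; apply: eq_bigr => l _; rewrite mulr_suml; apply: eq_bigr => i _.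
by rewrite !exprMn exprVn; ring.
Qed.

(** The four elements 1, u, w, uw span K over its squares, and [m4] is an independent family of the
    same size. The matrix expressing [m4] is therefore invertible, and a relation among the spanning
    elements would give one among the [m4]. *)
Lemma e4_free (c : 'I_4 -> K) : \sum_i c i ^+ 2 * e4 i = 0 -> forall i, c i = 0.
Proof.
have Kdec f : exists c : 'I_4 -> K, f = \sum_i c i ^+ 2 * e4 i.
  have [a [b [Ra Rb b0 ->]]] := Rfrac f; have [d [_ e]] := sq_decomp (RvM Ra Rb).
  exists (fun i => d i / b).
  have -> : a / b = a * b / b ^+ 2 by rewrite expr2 invfM mulrA mulfK.
  by rewrite e mulr_suml; apply: eq_bigr => i _; rewrite exprMn exprVn mulrAC.
have [S hS] := choice (fun i => Kdec (m4 i)).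
pose SM : 'M[K]_4 := \matrix_(i, j) S i j.
pose E : 'cV[K]_4 := \col_i e4 i; pose m : 'cV[K]_4 := \col_i m4 i.
have mE : m = map_mx Fr SM *m E.
  apply/matrixP => i j; rewrite !mxE hS; apply: eq_bigr => l _.
  by rewrite !mxE pFrobenius_autE.
have free (r : 'rV[K]_4) : map_mx Fr r *m m = 0 -> r = 0.
  move=> h; apply/rowP => i; rewrite mxE; apply: (m4_free (c := r 0)).
  have := congr1 (fun X : 'M[K]_1 => X 0 0) h; rewrite mxE [RHS]mxE => e; rewrite -[RHS]e.
  by apply: eq_bigr => j _; rewrite !mxE pFrobenius_autE.
have uS : SM \in unitmx.
  rewrite -row_free_unit -kermx_eq0; apply/rowV0P => r /sub_kermxP rS.
  by apply: free; rewrite mE mulmxA -map_mxM rS map_mx0 mul0mx.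
move=> h; pose r : 'rV[K]_4 := \row_i c i.
have rE : map_mx Fr r *m E = 0.
  apply/matrixP => i j; rewrite !mxE -[RHS]h; apply: eq_bigr => l _.
  by rewrite !mxE pFrobenius_autE.
have : r *m invmx SM = 0.
  by apply: free; rewrite mE mulmxA -map_mxM mulmxKV.
move=> /(congr1 (mulmx^~ SM)); rewrite mulmxKV // mul0mx => r0 i.
by have := congr1 (fun X : 'rV[K]_4 => X 0 i) r0; rewrite !mxE.
Qed.

Lemma e4_uniq (c d : 'I_4 -> K) :
  \sum_i c i ^+ 2 * e4 i = \sum_i d i ^+ 2 * e4 i -> forall i, c i = d i.
Proof.
move=> h i; apply/eqP; rewrite -subr_eq0; apply/eqP.
apply: (e4_free (c := fun i => c i - d i)).
rewrite -[RHS](subrr (\sum_i c i ^+ 2 * e4 i)) {2}h -sumrB; apply: eq_bigr => j _.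
by rewrite -mulrBl !(GRing.subr_pchar2 charK) sqrD_K.
Qed.

Lemma common_denominator d (f : 'I_d -> K) : (forall i, Rv (f i)) ->
  exists (S : {mpoly k[n]}) (G : 'I_d -> {mpoly k[n]}),
    S.@[tau] != 0 /\ forall i, f i = evt (G i) / evt S.
Proof.
elim: d f => [|d IH] f Rf; first by exists 1, (fun=> 0); rewrite rmorph1 oner_neq0; split=> // -[].
have [|S [G [S0 hG]]] := IH (fun i => f (lift ord0 i)); first by [].
have [r /gen[P [Q [Q0 fE _]]]] := Rf ord0.
have q0 := pl_neq0 plv (pl_mmap plv Q vt) Q0; have s0 := pl_neq0 plv (pl_mmap plv S vt) S0.
exists (S * Q), (fun i => if unlift ord0 i is Some j then G j * Q else P * S).
split=> [|i]; first by rewrite rmorphM mulf_neq0.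
case: unliftP => [j|] ->; rewrite !rmorphM /= invfM.
  by rewrite hG [_^-1 * _]mulrC mulrA mulfK.
by rewrite fE mulrA mulfK.
Qed.

(* Krull's intersection theorem in the form needed here: the coefficient maps
   [c |-> c_i] act on a finite-dimensional space containing [c], by a bound on
   degrees, so Nakayama's lemma applies. *)
Lemma krull (Z : K -> Prop) :
  Z 0 -> (forall x y, Z x -> Z y -> Z (x + y)) -> (forall x y, Rv x -> Z y -> Z (x * y)) ->
  (forall c, Z c -> exists d : 'I_4 -> K, (forall i, Z (d i)) /\ c = \sum_i d i ^+ 2 * e4 i) ->
  (forall c, Z c -> v c 0) -> forall c, Z c -> c = 0.
Proof.
move=> Z0 ZD ZM Zk Zm c Zc.
have [g [Rg hg]] := te_decomp.
have [S [G [S0 hG]]] := @common_denominator (#|{: 'I_M * 'I_4}|)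
   (fun li => g (enum_val li).1 (enum_val li).2) (fun li => Rg _ _).
pose Gl l i := G (enum_rank (l, i)).
have gE l i : g l i = evt (Gl l i) / evt S by rewrite /Gl -hG enum_rankK.
have [s sdef] : exists s, s = evt S by exists (evt S).
have vS : v s S.@[tau] by rewrite sdef; apply: pl_mmap.
rewrite -sdef in gE.
have s0 : s != 0 := pl_neq0 plv vS S0.
have Rs : Rv s^-1 by exists (S.@[tau])^-1; apply: (pl_V plv).
have [r /gen[P [Q [Q0 cE _]]]] : Rv c by exists 0; apply: Zm.
have vQ := pl_mmap plv Q vt; have q0 := pl_neq0 plv vQ Q0.
have Z1 : Z (evt P / s ^+ 2).
  have -> : evt P / s ^+ 2 = (evt Q * (s^-1) ^+ 2) * c by rewrite cE exprVn; field; rewrite q0 s0.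
  by apply: ZM => //; apply: RvM; [exact: Rv_ev|exact: RvX].
suff : evt P / s ^+ 2 = 0.
  move/eqP; rewrite mulf_eq0 invr_eq0 expf_eq0 (negbTE s0) andbF orbF => /eqP P0.
  by rewrite cE P0 mul0r.
pose y := \max_(li : 'I_M * 'I_4) msize (Gl li.1 li.2).
(* Halving a polynomial of size at most D and multiplying by some [Gl], of size at most y, gives
   size at most D again once D is at least 2 y + 4. *)
pose D := maxn (msize P) (2 * y + 4).
have half_size (F : {mpoly k[n]}) l i : (msize F <= D)%N ->
    (msize (mpoly_half F (enum_val l) * Gl l i) <= D)%N.
  move=> sF; apply: leq_trans (msizeM_le _ _) _.
  have h1 : (msize (Gl l i) <= y)%N.
    exact: (@leq_bigmax _ (fun li : 'I_M * 'I_4 => msize (Gl li.1 li.2)) (l, i)).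
  have h2 := mpoly_half_size F (enum_val l).
  have h3 : (2 * y + 4 <= D)%N by apply: leq_maxr.
  move: h1 h2 h3 sF; move: y D (msize _) (msize F) (msize _) => y D x z z'.
  clear; lia.
pose L := #|{: 'X_{1..n < D}}|.
pose mon (l : 'I_L) : 'X_{1..n} := bmnm (enum_val l).
pose ws (l : 'I_L) : K := evt 'X_[mon l] / s ^+ 2.
pose W (x : 'rV[k]_L) := Z (\sum_l iota (x 0 l) * ws l).
have toW F : (msize F <= D)%N -> exists x : 'rV[k]_L, evt F / s ^+ 2 = \sum_l iota (x 0 l) * ws l.
  move=> sF; exists (\row_l F@_(mon l)); rewrite [F in LHS](mpolywE sF) rmorph_sum mulr_suml /=.
  under [RHS]eq_bigr => l _ do rewrite mxE.
  have -> : \sum_l iota F@_(mon l) * ws l =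
     \sum_(m : 'X_{1..n < D}) iota F@_m * (evt 'X_[m] / s ^+ 2).
    rewrite -(big_enum_val (A := {: 'X_{1..n < D}}) (fun m : 'X_{1..n < D} => iota F@_m * (evt 'X_[m] / s ^+ 2))).
    by apply: eq_bigl => m; rewrite inE.
  by apply: eq_bigr => m _; rewrite -mul_mpolyC rmorphM /= mmapC mulrA.
have [||| r' [B hB]] := @subspace_matrix k L W.
- by rewrite /W big1 // => l _; rewrite mxE raddf0 mul0r.
- move=> x x' hx hx'; rewrite /W.
  under eq_bigr => l _ do rewrite mxE raddfD mulrDl.
  by rewrite big_split; apply: ZD.
- move=> a x hx; rewrite /W.
  under eq_bigr => l _ do rewrite mxE rmorphM -mulrA.
  by rewrite -mulr_sumr; apply: ZM => //; apply: Rvc.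
pose z (j : 'I_r') := \sum_l iota (B j l) * ws l.
have Zz j : Z (z j).
  have /hB : (row j B <= B)%MS by apply: row_sub.
  by rewrite /W; under eq_bigr => l _ do rewrite mxE.
have spanz f F : (msize F <= D)%N -> f = evt F / s ^+ 2 -> Z f ->
    exists mu : 'I_r' -> k, f = \sum_j iota (mu j) * z j.
  move=> sF -> ; have [x ->] := toW F sF; rewrite -/(W x) => /hB/submxP[mu ->].
  exists (mu 0); under eq_bigr => l _ do rewrite mxE raddf_sum mulr_suml.
  rewrite exchange_big; apply: eq_bigr => j _; rewrite mulr_sumr; apply: eq_bigr => l _ /=.
  by rewrite rmorphM mulrA.
have zform j : exists2 F, (msize F <= D)%N & z j = evt F / s ^+ 2.
  exists (\sum_l B j l *: 'X_[mon l]).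
    apply: leq_trans (mmeasure_sum _ _ _ _) _; apply/bigmax_leqP => l _.
    by apply: leq_trans (mmeasureZ_le _ _ _) _; rewrite mmeasureX bmdeg.
  rewrite rmorph_sum mulr_suml; apply: eq_bigr => l _ /=.
  by rewrite -mul_mpolyC rmorphM /= mmapC mulrA.
have zdec j : exists ga : 'I_4 -> 'I_r' -> k,
    z j = \sum_i (\sum_l iota (ga i l) * z l) ^+ 2 * e4 i.
  have [F sF zF] := zform j; have [d [Zd de]] := Zk _ (Zz j).
  pose d' i := evt (\sum_l mpoly_half F (enum_val l) * Gl l i) / s ^+ 2.
  have d'E : z j = \sum_i d' i ^+ 2 * e4 i.
    rewrite zF ev_half sum_te mulr_suml.
    under eq_bigr => l _ do rewrite -/(te' l) hg mulr_sumr mulr_suml.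
    rewrite exchange_big /=; apply: eq_bigr => i _.
    rewrite /d' rmorph_sum /= exprMn sqr_sum_K. 
    rewrite !mulr_suml; apply: eq_bigr => l _ /=.
    rewrite rmorphM /= gE !exprMn !exprVn; field; exact: s0.
  have dd' i : d i = d' i by apply: e4_uniq; rewrite -de -d'E.
  have sd' i : (msize (\sum_l mpoly_half F (enum_val l) * Gl l i) <= D)%N.
    apply: leq_trans (mmeasure_sum _ _ _ _) _; apply/bigmax_leqP => l _; exact: half_size.
  have /choice[ga hga] i := spanz _ _ (sd' i) (dd' i) (Zd i).
  by exists ga; rewrite [LHS]de; apply: eq_bigr => i _; rewrite hga.
have [ga hga] := choice zdec.
(* In each z_l^2 one factor goes into the matrix and the other stays in the vector. The entries lie
   in the maximal ideal because the z_l do, so 1 - N is invertible and kills the vector z. *)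
pose N : 'M[K]_r' := \matrix_(j, l) (\sum_i iota (ga j i l) ^+ 2 * e4 i * z l).
have [j l|Bi BN _] := @Rv_invmx r' N.
  rewrite mxE; apply: m_sum => i _; rewrite mulrC; apply: m_Rv; first exact: Zm.
  by apply: RvM; [apply/RvX/Rvc|exact: Rv_e4].
pose zc : 'cV[K]_r' := \col_j z j.
have Nz : (1%:M - N) *m zc = 0.
  apply/matrixP => j j0; rewrite mulmxBl mul1mx !mxE.
  have -> : \sum_l N j l * zc l j0 = \sum_i (\sum_l iota (ga j i l) * z l) ^+ 2 * e4 i.
    under [RHS]eq_bigr => i _ do rewrite sqr_sum_K mulr_suml.
    rewrite [RHS]exchange_big; apply: eq_bigr => l _ /=; rewrite !mxE mulr_suml.
    by apply: eq_bigr => i _; ring.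
  by rewrite -hga subrr.
have z0 j : z j = 0.
  have : zc = 0 by rewrite -[zc]mul1mx -BN -mulmxA Nz mulmx0.
  by move/(congr1 (fun X : 'cV[K]_r' => X j 0)); rewrite !mxE.
have [|mu ->] := spanz _ P _ erefl Z1; first exact: leq_maxl.
by rewrite big1 // => j _; rewrite z0 mulr0.
Qed.

Lemma Rv_unit f r : v f r -> r != 0 -> Rv f^-1.
Proof. by move=> h r0; exists r^-1; apply: (pl_V plv). Qed.

(* The coefficients c_i of c again satisfy c_i f^(2^e) \in R for all e, and one
   of the iterated coefficients is a unit unless c = 0. *)
Lemma completely_closed f c : c != 0 -> (forall i, Rv (c * f ^+ i)) -> Rv f.
Proof.
move=> c0 cf; apply: contrapT => nf.
pose Z x := forall e, Rv (x * f ^+ (2 ^ e)) /\ Rv x.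
have Zm x : Z x -> v x 0.
  move=> /(_ 0%N); rewrite expn0 expr1 => -[h [r xr]].
  have [e|r0] := eqVneq r 0; first by rewrite -e.
  case: nf; have x0 := pl_neq0 plv xr r0.
  by rewrite -(mulKf x0 f); apply: RvM h; apply: Rv_unit xr r0.
suff : c = 0 by move/eqP; rewrite (negbTE c0).
apply: (krull (Z := Z)) => //.
- by move=> e; rewrite mul0r; split; apply: Rv0.
- move=> x y hx hy e; rewrite mulrDl; have [h1 h2] := hx e; have [h3 h4] := hy e.
  by split; apply: RvD.
- move=> x y hx hy e; rewrite -mulrA; have [h1 h2] := hy e.
  by split; apply: RvM.
- move=> x hx; have [_ Rx] := hx 0%N; have [d [Rd xE]] := sq_decomp Rx.
  exists d; split=> // i e; split=> //; have [h _] := hx e.+1.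
  have [d' [Rd' xE']] := sq_decomp h.
  suff -> : d i * f ^+ (2 ^ e) = d' i by [].
  apply: (e4_uniq (c := fun i => d i * f ^+ (2 ^ e))); rewrite -xE' xE mulr_suml.
  apply: eq_bigr => j _; rewrite exprMn -exprM -expnSr.
  by rewrite mulrAC.
- by move=> e; split=> //; have := cf 0%N; rewrite expr0 mulr1.
Qed.

(** With f = a/b, the integral equation reduces all powers of f to those of exponent at most d, so
    b^d is a common denominator for them. *)
Lemma integrally_closed f d (r : 'I_d -> K) : (forall i, Rv (r i)) ->
  f ^+ d = \sum_i r i * f ^+ i -> Rv f.
Proof.
move=> Rr fE; have [a [b [Ra Rb b0 ab]]] := Rfrac f.
apply: (completely_closed (c := b ^+ d)); first by rewrite expf_neq0.
have small i : (i <= d)%N -> Rv (b ^+ d * f ^+ i).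
  move=> le; have -> : b ^+ d * f ^+ i = b ^+ (d - i) * a ^+ i.
    rewrite -{1}(subnK le) exprD -mulrA -exprMn; congr (_ * _ ^+ _).
    by rewrite ab mulrC mulfVK.
  by apply: RvM; apply: RvX.
move=> i; have [m] := ubnP i; elim: m i => // m IH i im.
have [le|lt] := leqP i d; first exact: small.
rewrite -(subnK (ltnW lt)) exprD fE mulr_sumr mulr_sumr; apply: Rv_sum => j _.
have -> : b ^+ d * (f ^+ (i - d) * (r j * f ^+ j)) = r j * (b ^+ d * f ^+ (i - d + j)).
  by rewrite exprD; ring.
by apply: RvM => //; apply: IH; have := ltn_ord j; lia.
Qed.

(** The leading coefficient times th is integral, hence an element [be] of the local ring; absorbing
    it into the next coefficient lowers the degree. If this destroys all unit coefficients, then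
    either [be] is a unit and 1/th is regular, or the leading coefficient is a unit and th is
    regular. *)
Lemma kaplansky (th : K) (H : {poly K}) : (forall i, Rv H`_i) ->
  (exists i r, v H`_i r /\ r != 0) -> H.[th] = 0 -> Rv th \/ Rv th^-1.
Proof.
have [d] := ubnP (size H); elim: d H => // d IH H sH RH [i [r [vr r0]]] H0.
have i_lt : (i < size H)%N.
  rewrite ltnNge; apply/negP => le; move: vr; rewrite nth_default // => vr.
  by move/eqP: r0; apply; apply: (pl_fun plv vr (pl_0 plv)).
case sE : (size H) => [|[|m]]; first by rewrite sE in i_lt.
  have i0 : i = 0%N by move: i_lt; rewrite sE; case: (i).
  move: H0; rewrite horner_coef sE big_ord1 expr0 mulr1 /= => e.
  by move: vr; rewrite i0 e => vr; case/eqP: r0; apply: (pl_fun plv vr (pl_0 plv)).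
have HE : \sum_(j < m.+1) H`_j * th ^+ j = - (H`_m.+1 * th ^+ m.+1).
  by apply/eqP; rewrite -addr_eq0 -[X in _ == X]H0 horner_coef sE [X in _ == X]big_ord_recr.
pose be := H`_m.+1 * th.
have Rbe : Rv be.
  apply: (@integrally_closed be m.+1 (fun j => - (H`_j * H`_m.+1 ^+ (m - j)))).
    by move=> j; apply/RvN/RvM => //; apply: RvX.
  have -> : be ^+ m.+1 = H`_m.+1 ^+ m * (H`_m.+1 * th ^+ m.+1) by rewrite /be exprMn !exprS; ring.
  rewrite -[_ * th ^+ _]opprK -HE mulrN mulr_sumr -sumrN; apply: eq_bigr => j _.
  have le : (j <= m)%N by rewrite -ltnS.
  have -> : H`_m.+1 ^+ m = H`_m.+1 ^+ (m - j) * H`_m.+1 ^+ j by rewrite -exprD subnK.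
  by rewrite /be mulNr exprMn; congr (- _); ring.
have unit_th s : v H`_m.+1 s -> s != 0 -> Rv th.
  move=> vs s0; have h0 := pl_neq0 plv vs s0.
  by rewrite -(mulKf h0 th); apply: RvM Rbe; apply: Rv_unit vs s0.
have [b vb] := Rbe.
have [rm vrm] := RH m.
pose H' := \poly_(j < m.+1) (if j == m then H`_m + be else H`_j).
have H'E j : H'`_j = if (j < m.+1)%N then (if j == m then H`_m + be else H`_j) else 0.
  by rewrite coef_poly.
have sH' : (size H' < d)%N by apply: leq_ltn_trans (size_poly _ _) _; rewrite -ltnS -sE.
have RH' j : Rv H'`_j.
  rewrite H'E; case: ifP => _; last exact: Rv0.
  by case: ifP => // _; apply: RvD.
have H'0 : H'.[th] = 0.
  have HE' : \sum_(j < m) H`_j * th ^+ j + H`_m * th ^+ m + H`_m.+1 * th ^+ m.+1 = 0.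
    by apply/eqP; rewrite addr_eq0 -HE big_ord_recr.
  rewrite horner_poly big_ord_recr /= eqxx.
  under eq_bigr => j _ do rewrite ltn_eqF //.
  by rewrite -[RHS]HE' /be exprS; ring.
have fin : (exists j s, v H'`_j s /\ s != 0) -> Rv th \/ Rv th^-1.
  by move=> h; apply: (IH H').
have [e|ne] := eqVneq (rm + b) 0; last first.
  apply: fin; exists m, (rm + b); split=> //; rewrite H'E ltnSn eqxx.
  exact: (pl_D plv).
have [b0|b0] := eqVneq b 0; last first.
  right; have be0 := pl_neq0 plv vb b0.
  have : Rv (be^-1 * H`_m.+1) by apply: RvM (RH _); apply: Rv_unit vb b0.
  rewrite /be invfM mulrAC mulVf ?mul1r //.
  by apply: contra be0 => /eqP z; rewrite /be z mul0r.
have rm0 : rm = 0 by rewrite -[rm]addr0 -[X in _ + X]b0.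
have [im|im] := eqVneq i m.+1; first by left; apply: unit_th r0; rewrite -im.
have im' : i != m.
  by apply: contra r0 => /eqP z; apply/eqP; rewrite -rm0; apply: (pl_fun plv vr); rewrite z.
apply: fin; exists i, r; split=> //; rewrite H'E (negbTE im').
have -> : (i < m.+1)%N by rewrite ltn_neqAle im -ltnS -sE.
by [].
Qed.

End Regular.

(** * The function field *)

Section Datum.
Variables (k K : fieldType) (iota : {rmorphism k -> K}).

Definition zz (z : 'I_3 -> K) (i : 'I_2) : K := z (widen_ord (leqnSn 2) i).

(** The presentation of K kept throughout. The field [d_free] says that z_0, z_1 are algebraically
    independent and that z_2 is not in k(z_0, z_1). It is stated with polynomials so that the
    symmetries can be checked on coefficients. *)
Record datum (z : 'I_3 -> K) (al de : 'I_3 -> k) : Prop := Datum {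
  d_al : forall i, al i != 0;
  d_de : forall i, de i != 0;
  d_z : forall i, z i != 0;
  d_rel : \sum_i (iota (al i) * z i + iota (de i) / z i) = 1;
  d_gen : forall S : K -> Prop, (forall c, S (iota c)) -> (forall i, S (z i)) ->
    (forall f g, S f -> S g -> S (f + g)) -> (forall f g, S f -> S g -> S (f * g)) ->
    (forall f, S f -> S f^-1) -> forall f, S f;
  d_free : forall P Q : {mpoly k[2]},
    mmap iota (zz z) P + z 2 * mmap iota (zz z) Q = 0 -> P = 0 /\ Q = 0 }.
End Datum.

(** Excludes a rational root P/Q of the quadratic equation of z_2, with x for z_0 and the
    indeterminate for z_1. In lowest terms numerator and denominator divide a constant multiple of
    X, so each is a constant times 1 or X. *)
Lemma no_poly_root (F : fieldType) (x a1 b1 a2 b2 c1 : F) (P Q : {poly F}) : x != 0 -> b1 != 0 ->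
    a2 != 0 -> b2 != 0 -> c1 != 0 -> Q != 0 ->
  (a2 * x) *: 'X * P ^+ 2 + ((x * a1) *: 'X^2 + c1 *: 'X + (x * b1)%:P) * P * Q
   + (b2 * x) *: 'X * Q ^+ 2 <> 0.
Proof.
move=> x0 b10 a20 b20 c10 Q0.
set B := (_ + _%:P); have [B' BE] : exists B', B' = B by exists B.
rewrite -BE => e.
have [g defg] : exists g, g = gcdp P Q by exists (gcdp P Q).
have g0 : g != 0 by rewrite defg gcdp_eq0 negb_and Q0 orbT.
have [P1 eP] : exists P1, P = P1 * g by exists (P %/ g); rewrite divpK // defg dvdp_gcdl.
have [Q1 eQ] : exists Q1, Q = Q1 * g by exists (Q %/ g); rewrite divpK // defg dvdp_gcdr.
have cop : coprimep P1 Q1.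
  have := @coprimep_div_gcd _ P Q; rewrite Q0 orbT => /(_ isT).
  by rewrite -defg eP eQ !mulpK.
have : g ^+ 2 * ((a2 * x) *: 'X * P1 ^+ 2 + B' * P1 * Q1 + (b2 * x) *: 'X * Q1 ^+ 2) = 0.
  by rewrite -e eP eQ; ring.
move/eqP; rewrite mulf_eq0 expf_eq0 (negbTE g0) andbF /= => /eqP e0.
have dvX (R : {poly F}) : R %| 'X -> exists i c, [/\ (i <= 1)%N, c != 0 & R = c *: 'X^i].
  have {1}-> : 'X = ('X - 0%:P) ^+ 1 :> {poly F} by rewrite subr0 expr1.
  move/dvdp_exp_XsubCP => [i i1]; rewrite subr0 => /eqpP[[c c'] /= /andP[c0 c0'] e'].
  exists i; exists (c' / c); split=> //; first by rewrite mulf_neq0 ?invr_eq0.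
  by rewrite mulrC -scalerA -e' scalerA mulVf // scale1r.
have mulunit (R : {poly F}) c : c != 0 -> R %| c *: 'X -> R %| 'X by move=> c0; rewrite dvdpZr.
have [i [p [i1 p0 ep]]] : exists i c, [/\ (i <= 1)%N, c != 0 & P1 = c *: 'X^i].
  apply/dvX/(@mulunit _ (b2 * x)); first by rewrite mulf_neq0.
  have : P1 %| ((b2 * x) *: 'X) * Q1 ^+ 2.
    have -> : (b2 * x) *: 'X * Q1 ^+ 2 = P1 * (- ((a2 * x) *: 'X * P1 + B' * Q1)).
      by rewrite -[LHS]subr0 -e0; ring.
    exact: dvdp_mulIl.
  by rewrite Gauss_dvdpl // coprimep_expr.
have [j [q [j1 q0 eq]]] : exists i c, [/\ (i <= 1)%N, c != 0 & Q1 = c *: 'X^i].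
  apply/dvX/(@mulunit _ (a2 * x)); first by rewrite mulf_neq0.
  have : Q1 %| ((a2 * x) *: 'X) * P1 ^+ 2.
    have -> : (a2 * x) *: 'X * P1 ^+ 2 = Q1 * (- ((b2 * x) *: 'X * Q1 + B' * P1)).
      by rewrite -[LHS]subr0 -e0; ring.
    exact: dvdp_mulIl.
  by rewrite Gauss_dvdpl // coprimep_expr // coprimep_sym.
have {}e0 : (a2 * x * p ^+ 2) *: 'X^((i + i).+1) + (p * q) *: (B * 'X^(i + j)) + (b2 * x * q ^+ 2) *: 'X^((j + j).+1) = 0.
  by rewrite -[RHS]e0 ep eq BE -!mul_polyC !(rmorphM, rmorphXn) /= !exprS !exprD; ring.
(* The two outer terms have odd degrees 2i + 1 and 2j + 1, and this index is even. It isolates the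
   constant term of the middle coefficient if i = j and its linear coefficient otherwise. *)
have := congr1 (coefp (i + j + odd (i + j))) e0.
rewrite /= /B !coefD !coefZ !coefXn !coefMXn !coefD !coefZ !coefXn !coefX !coefC ?coef0.
have pq : p * q != 0 by rewrite mulf_neq0.
case: i i1 {ep e0} => [|[|//]] _; case: j j1 {eq} => [|[|//]] _; rewrite /= !(mulr0, mulr1, addr0, add0r) => /eqP;
  by rewrite mulf_eq0 (negbTE pq) /= ?(negbTE c10) // mulf_eq0 (negbTE x0) (negbTE b10).
Qed.

Lemma ratio_div (A : idomainType) (x : {fraction A}) : exists P Q : A, Q != 0 /\ x * tofrac Q = tofrac P.
Proof.
elim/quotW: x => y; exists (\n_y), (\d_y); split; first exact: denom_ratioP.
apply/eqP; rewrite !piE /FracField.mulf FracField.equivfE !numden_Ratio ?oner_eq0 ?mulr1 ?denom_ratioP //.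
by rewrite mulrC.
Qed.

Lemma msupp2 (k : fieldType) (m m' : 'X_{1..2}) : m ord0 = m' ord0 -> m ord_max = m' ord_max -> m = m'.
Proof.
move=> h0 h1; apply/mnmP => i.
by have [->|->] : i = ord0 \/ i = ord_max by case: i => [[|[|//]] ?]; [left|right]; apply: val_inj.
Qed.

Lemma mmap_poly_inj (k : fieldType) (P : {mpoly k[2]}) (f : {rmorphism k -> {poly {poly k}}}) (h : 'I_2 -> {poly {poly k}}) :
  (forall c, f c = c%:P%:P) -> h ord0 = 'X%:P -> h ord_max = 'X -> mmap f h P = 0 -> P = 0.
Proof.
move=> fE h0 h1 e; apply/mpolyP => m; rewrite mcoeff0.
have : ((mmap f h P)`_(m ord_max))`_(m ord0) = 0 by rewrite e !coef0.
rewrite /mmap coef_sum coef_sum => <-; rewrite [X in X@_m]mpolyE raddf_sum /=; apply: eq_bigr => m' _.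
rewrite mcoeffZ mcoeffX /mmap1 big_ord_recr big_ord1 fE /=.
have -> : widen_ord (leqnSn 1) ord0 = ord0 by apply: val_inj.
rewrite h0 h1 -rmorphXn /= mulrA -rmorphM /= coefCM coefXn mulr_natr.
have [e1|n1] := eqVneq (m ord_max) (m' ord_max); last first.
  rewrite mulr0n coef0; case: eqP => [em|_]; rewrite ?mulr0 //.
  by rewrite em eqxx in n1.
rewrite mulr1n coefCM coefXn; congr (_ * _%:R).
have [e0|n0] := eqVneq (m ord0) (m' ord0); first by rewrite (msupp2 k e0 e1) eqxx.
by case: eqP => // em; rewrite em eqxx in n0.
Qed.

Lemma quad_ext (L : fieldType) (a b c : L) : a != 0 -> (forall t, a * t ^+ 2 + b * t + c != 0) ->
  exists (K : fieldType) (j : {rmorphism L -> K}) (z : K),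
    [/\ j a * z ^+ 2 + j b * z + j c = 0, forall t, z != j t
      & forall w, exists q : {poly L}, w = (map_poly j q).[z]].
Proof.
move=> a0 nr; pose p : {poly L} := Poly [:: c; b; a].
have pE : p = [:: c; b; a] :> seq L by rewrite (@PolyK _ 0).
have sp : size p = 3 by rewrite pE.
have p_root t : p.[t] = a * t ^+ 2 + b * t + c.
  by rewrite horner_Poly /= mul0r add0r; ring.
have p_irr : irreducible_poly p.
  apply: cubic_irreducible; first by rewrite sp.
  by move=> t; rewrite rootE p_root nr.
have [K dK [z zr zK]] := irredp_FAdjoin p_irr.
exists K, (GRing.in_alg K), z; split.
- move/rootP: zr; rewrite /p map_Poly_id0 ?rmorph0 // horner_Poly /= mul0r add0r => <-.
  by ring.
- move=> t; apply/eqP => zt; have := nr t; rewrite -p_root; apply/negP.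
  by move: zr; rewrite zt fmorph_root negbK.
move=> w; have : w \in <<1; z>>%VS by rewrite zK memvf.
case/Fadjoin_polyP => q /polyOverP hq ->.
have /choice[g hg] : forall i, exists u : L, q`_i = GRing.in_alg K u.
  by move=> i; have /vlineP[u ->] := hq i; exists u.
exists (\poly_(i < size q) g i); congr (_.[z]); apply/polyP => i.
by rewrite coef_map coef_poly; case: ltnP => h; [exact: hg|rewrite nth_default //; exact: (esym (rmorph0 _))].
Qed.

Definition gen_by (k L : fieldType) (c : {rmorphism k -> L}) I (z : I -> L) :=
  forall S : L -> Prop, (forall e, S (c e)) -> (forall i, S (z i)) ->
    (forall f g, S f -> S g -> S (f + g)) -> (forall f g, S f -> S g -> S (f * g)) ->
    (forall f, S f -> S f^-1) -> forall f, S f.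

Lemma closed_poly (L : fieldType) (S : L -> Prop) (A : nzRingType) (f : {rmorphism {poly A} -> L}) :
  (forall e, S (f e%:P)) -> S (f 'X) -> 
  (forall f g, S f -> S g -> S (f + g)) -> (forall f g, S f -> S g -> S (f * g)) -> forall P, S (f P).
Proof.
move=> Sc SX SD SM; elim/poly_ind => [|P c IH]; first by rewrite -polyC0.
by rewrite rmorphD rmorphM; apply: SD => //; apply: SM.
Qed.

Lemma rat_field (k : fieldType) : exists (L : fieldType) (f : {rmorphism {poly {poly k}} -> L}),
  (forall P, (f P == 0) = (P == 0)) /\ forall t, exists P Q, Q != 0 /\ t * f Q = f P.
Proof.
exists {fraction {poly {poly k}}}, (@tofrac {poly {poly k}}); split; first exact: tofrac_eq0.
by move=> t; have [P [Q [Q0 h]]] := ratio_div t; exists P, Q.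
Qed.

Lemma frac_datum (k : fieldType) (al de : 'I_3 -> k) : (forall i, al i != 0) -> (forall i, de i != 0) ->
  exists (L : fieldType) (c : {rmorphism k -> L}) (x : 'I_2 -> L),
    [/\ gen_by c x, forall i, x i != 0, forall F : {mpoly k[2]}, mmap c x F = 0 -> F = 0
      & forall t, c (al 2) * t ^+ 2 +
        (c (al 0) * x ord0 + c (de 0) / x ord0 + c (al 1) * x ord_max + c (de 1) / x ord_max - 1) * t + c (de 2) != 0].
Proof.
move=> al0 de0; have [L [f [f0 frat]]] := rat_field k.
pose cA : {rmorphism k -> {poly {poly k}}} := (@polyC {poly k} \o @polyC k)%FUN.
pose c : {rmorphism k -> L} := (f \o cA)%FUN.
pose hA (i : 'I_2) : {poly {poly k}} := if val i is 0%N then 'X%:P else 'X.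
have cE e : c e = f (e%:P%:P) by [].
have x00 : f 'X%:P != 0 by rewrite f0 polyC_eq0 polyX_eq0.
have x10 : f 'X != 0 by rewrite f0 polyX_eq0.
exists L, c, (fun i => f (hA i)); split.
- move=> S Sc Sz SD SM SV t; have [P [Q [Q0 h]]] := frat t.
  have -> : t = f P / f Q by rewrite -h mulfK // f0.
  have SA : forall P, S (f P).
    apply: closed_poly => //; last exact: (Sz ord_max).
    by apply: (@closed_poly _ _ _ (f \o polyC)%FUN) => //; exact: (Sz ord0).
  by apply: SM => //; apply: SV.
- by rewrite /hA => -[[|[|//]] i2] /=.
- move=> F F0; apply: (@mmap_poly_inj _ F cA hA) => //.
  apply/eqP; rewrite -f0; apply/eqP; rewrite -[RHS]F0 /mmap rmorph_sum /=; apply: eq_bigr => m _.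
  rewrite rmorphM /=; congr (_ * _); rewrite /mmap1 rmorph_prod /=; apply: eq_bigr => i _.
  by rewrite rmorphXn.
move=> t; apply/eqP; have [P [Q [Q0 ht]]] := frat t => e.
pose h : {rmorphism {poly k} -> {fraction {poly k}}} := @tofrac {poly k}.
have h0 y : (h y == 0) = (y == 0) by exact: tofrac_eq0.
have h_inj : injective h by move=> y y' /eqP; rewrite /h /= tofrac_eq => /eqP.
have nz e' : e' != 0 -> h e'%:P != 0 by rewrite h0 polyC_eq0.
have [h' h'E] : exists h' : {rmorphism {poly k} -> {fraction {poly k}}}, h' = h by exists h.
rewrite -h'E in h0 h_inj nz; clear h'E h.
pose c1 := h' ((al 0)%:P * 'X ^+ 2 + (de 0)%:P - 'X).
apply: (@no_poly_root _ (h' 'X) (h' (al 1)%:P) (h' (de 1)%:P) (h' (al 2)%:P) (h' (de 2)%:P) c1 (map_poly h' P) (map_poly h' Q)); rewrite ?nz ?h0 ?polyX_eq0 //.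
- by apply/eqP => /(congr1 (coefp 1)) /eqP; rewrite /= coefB coefD coefCM coefXn coefC coefX coef0 /= mulr0 add0r sub0r oppr_eq0 oner_eq0.
- by apply: contra Q0 => /eqP e0; apply/eqP/(map_inj_poly h_inj (rmorph0 _)); rewrite e0 rmorph0.
(* After clearing denominators the equation holds in k[x_0][x_1]; it is then read in k(x_0)[x_1],
   where [no_poly_root] applies. *)
have e2 : ((al 2)%:P * 'X) *: 'X * P ^+ 2 + (('X * (al 1)%:P) *: 'X^2 + ((al 0)%:P * 'X ^+ 2 + (de 0)%:P - 'X) *: 'X + ('X * (de 1)%:P)%:P) * P * Q + ((de 2)%:P * 'X) *: 'X * Q ^+ 2 = 0 :> {poly {poly k}}.
  apply/eqP; rewrite -f0; apply/eqP.
  rewrite -!mul_polyC !(rmorphD, rmorphN, rmorphM, rmorphXn).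
  rewrite -!cE -ht; move: e; rewrite /hA /=.
  move: (f 'X%:P) (f 'X) (c (al 0)) (c (al 1)) (c (al 2)) (c (de 0)) (c (de 1)) (c (de 2)) (f Q) x00 x10 => x0 x1 a0 a1 a2 b0 b1 b2 q x00 x10 e.
  by rewrite -[RHS](mulr0 (x0 * x1 * q ^+ 2)) -e; field; rewrite x00 x10.
have := congr1 (map_poly h') e2.
rewrite -!mul_polyC rmorph0 !(rmorphD, rmorphN, rmorphM, rmorphXn) /= ?map_polyC ?map_polyX /= ?(rmorphD, rmorphN, rmorphM, rmorphXn) /= ?map_polyC ?map_polyX /= => <-; rewrite /c1 ?(rmorphD, rmorphN, rmorphM, rmorphXn) /=.
by rewrite !expr2.
Qed.

Lemma datum_exists (k : fieldType) (al de : 'I_3 -> k) : (forall i, al i != 0) -> (forall i, de i != 0) ->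
  exists (K : fieldType) (iota : {rmorphism k -> K}) z, datum iota z al de.
Proof.
move=> al0 de0; have [L [c [x [gen x0 free nr]]]] := frac_datum al0 de0.
have [|K [j [z [zE zn zK]]]] := quad_ext _ nr; first by rewrite fmorph_eq0.
pose iota : {rmorphism k -> K} := (j \o c)%FUN.
pose zf := fun i : 'I_3 => if val i is 0%N then j (x ord0) else if val i is 1%N then j (x ord_max) else z.
have z0 : z != 0 by rewrite -(rmorph0 j).
have zf0 i : zf i != 0.
  by rewrite /zf; case: (val i) => [|[|m]] //; rewrite fmorph_eq0.
have jE e : iota e = j (c e) by [].
exists K, iota, zf; split=> //.
- rewrite sum3 /=.
  have -> : iota (al 2) * zf 2 + iota (de 2) / zf 2 =
     - j (c (al 0) * x ord0 + c (de 0) / x ord0 + c (al 1) * x ord_max + c (de 1) / x ord_max - 1).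
    have -> : zf 2 = z by [].
    apply: (mulIf z0); rewrite mulrDl mulfVK // mulNr; apply/eqP; rewrite -subr_eq0 opprK -zE.
    by apply/eqP; rewrite !jE; ring.
  have -> : zf 0 = j (x ord0) by [].
  have -> : zf 1 = j (x ord_max) by [].
  by rewrite /= ?jE -!fmorphV -!rmorphM -!rmorphD -rmorphN -rmorphD; rewrite -[RHS](rmorph1 j); congr (j _); ring.
- move=> S Sc Sz SD SM SV f.
  have SL : forall t, S (j t).
    apply: (gen (fun t => S (j t))) => //.
    + by case=> [[|[|//]] i2]; [have := Sz 0|have := Sz 1]; rewrite /zf /=; set a := x _; set b := x _; have -> : a = b by congr x; apply: val_inj.
    + by move=> t u ht hu; rewrite rmorphD; apply: SD.
    + by move=> t u ht hu; rewrite rmorphM; apply: SM.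
    + by move=> t ht; rewrite fmorphV; apply: SV.
  have [q ->] := zK f; apply: (@closed_poly _ S _ (horner_eval z \o map_poly j)%FUN) => //= [e|].
    by rewrite map_polyC /horner_eval hornerC; exact: SL.
  by rewrite map_polyX /horner_eval hornerX; exact: (Sz 2).
- move=> P Q.
  have evE F : mmap iota (zz zf) F = j (mmap c x F).
    rewrite /mmap !rmorph_sum /=; apply: eq_bigr => m _; rewrite !rmorphM /=; congr (_ * _).
    rewrite /mmap1 !rmorph_prod /=; apply: eq_bigr => i _; rewrite !rmorphXn /=; congr (_ ^+ _).
    by rewrite /zz /zf /=; case: i => [[|[|//]] ?] /=; congr (j (x _)); apply: val_inj.
  have -> : zf 2 = z by [].
  rewrite !evE => e.
  have [Q0|Q0] := eqVneq (mmap c x Q) 0.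
    move: e; rewrite Q0 !rmorph0 mulr0 addr0 => /eqP; rewrite fmorph_eq0 => /eqP P0.
    by rewrite (free _ P0) (free _ Q0).
  have := zn (- mmap c x P / mmap c x Q); case/eqP.
  rewrite rmorphM fmorphV rmorphN; apply/(canRL (mulfK _)); first by rewrite fmorph_eq0.
  by apply/eqP; rewrite -addr_eq0 addrC e.
Qed.

(** * Laurent polynomials and the symmetries of the relation *)

Lemma zz0 (K : fieldType) (z : 'I_3 -> K) : zz z ord0 = z 0.
Proof. by congr z; apply: val_inj. Qed.
Lemma zz1 (K : fieldType) (z : 'I_3 -> K) : zz z ord_max = z 1.
Proof. by congr z; apply: val_inj. Qed.

(** A Laurent polynomial in z_0, z_1 is a list of terms (coefficient, exponents), in which exponents
    may repeat; [coefl] collects the total coefficient. *)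
Definition coefl (k : zmodType) (s : seq (k * (int * int))) e := \sum_(t <- s | t.2 == e) t.1.

Lemma coefl0_sum (k : pzRingType) (V : lmodType k) (E : int * int -> V) s :
  (forall e, coefl s e = 0) -> \sum_(t <- s) t.1 *: E t.2 = 0.
Proof.
move=> h; pose u := undup [seq t.2 | t <- s].
have -> : \sum_(t <- s) t.1 *: E t.2 = \sum_(t <- s) \sum_(e <- u | e == t.2) t.1 *: E e.
  apply: eq_big_seq => t ts; rewrite -big_filter filter_pred1_uniq ?undup_uniq ?big_seq1 //.
  by rewrite mem_undup; apply/mapP; exists t.
rewrite (exchange_big_dep predT) //= big1 // => e _.
transitivity (coefl s e *: E e); last by rewrite h scale0r.
by rewrite /coefl scaler_suml; apply: eq_bigl => t; rewrite eq_sym.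
Qed.

Lemma absz_shift (a : int) (N : nat) : (absz a <= N)%N -> Posz (absz (a + N%:Z)) = N%:Z + a.
Proof. lia. Qed.

Lemma exp_bound (s : seq (int * int)) : exists N : nat, forall e, e \in s -> (absz e.1 <= N)%N /\ (absz e.2 <= N)%N.
Proof.
elim: s => [|e s [N h]]; first by exists 0%N.
exists (N + absz e.1 + absz e.2)%N => e'; rewrite inE => /orP[/eqP ->|/h[h1 h2]].
  by rewrite -addnA addnCA leq_addr addnA leq_addl.
by rewrite -addnA; split; [apply: leq_trans h1 _|apply: leq_trans h2 _]; rewrite leq_addr.
Qed.

Section Laurent.
Variables (k K : fieldType) (iota : {rmorphism k -> K}).

Definition lmon (z : 'I_3 -> K) (e : int * int) : K := z 0 ^ e.1 * z 1 ^ e.2.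
Definition lv z s : K := \sum_(t <- s) iota t.1 * lmon z t.2.

Definition nexp (N : nat) (e : int * int) : 'X_{1..2} :=
  [multinom (if i == ord0 then absz (e.1 + N%:Z)%R else absz (e.2 + N%:Z)%R) | i < 2].

Lemma mmap2 (z : 'I_3 -> K) (P : {mpoly k[2]}) :
  mmap iota (zz z) P = \sum_(m <- msupp P) iota P@_m * (z 0 ^+ m ord0 * z 1 ^+ m ord_max).
Proof.
rewrite /mmap; apply: eq_bigr => m _; congr (_ * _).
rewrite /mmap1 big_ord_recr big_ord1 /= zz1; have -> : widen_ord (leqnSn 1) ord0 = ord0 by apply: val_inj.
by rewrite zz0.
Qed.

Lemma mmapX2 (z : 'I_3 -> K) m : mmap iota (zz z) 'X_[m] = z 0 ^+ m ord0 * z 1 ^+ m ord_max.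
Proof.
rewrite mmapX /mmap1 big_ord_recr big_ord1 /= zz1.
have -> : widen_ord (leqnSn 1) ord0 = ord0 by apply: val_inj.
by rewrite zz0.
Qed.

(** Multiplication by a high power of z_0 z_1 makes all exponents nonnegative, and [d_free]
    applies. *)
Lemma laurent_free z al de s s' : datum iota z al de -> lv z s + z 2 * lv z s' = 0 ->
  (forall e, coefl s e = 0) /\ (forall e, coefl s' e = 0).
Proof.
move=> dz e0.
suff h e : coefl s e = 0 /\ coefl s' e = 0 by split=> e; have [] := h e.
have [N hN] := exp_bound (e :: [seq t.2 | t <- s] ++ [seq t.2 | t <- s']).
pose P (s : seq (k * (int * int))) : {mpoly k[2]} := \sum_(t <- s) t.1 *: 'X_[nexp N t.2].
have PE r : {subset r <= s ++ s'} -> mmap iota (zz z) (P r) = (z 0 * z 1) ^+ N * lv z r.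
  move=> hr; rewrite /P rmorph_sum /= mulr_sumr; apply: eq_big_seq => t tr.
  rewrite mmapZ mulrCA; congr (_ * _); rewrite mmapX2 !mnmE /=.
  have [h1 h2] : (absz t.2.1 <= N)%N /\ (absz t.2.2 <= N)%N.
    by apply: hN; rewrite inE -map_cat map_f ?orbT //; apply: hr.
  rewrite /lmon exprMn mulrACA !exprnP -!expfzDr ?(d_z dz) //.
  by rewrite !absz_shift.
have Pc r : {subset r <= s ++ s'} -> (P r)@_(nexp N e) = coefl r e.
  move=> hr; rewrite /P raddf_sum /coefl /= [RHS]big_mkcond; apply: eq_big_seq => t tr.
  have [h1 h2] : (absz t.2.1 <= N)%N /\ (absz t.2.2 <= N)%N.
    by apply: hN; rewrite inE -map_cat map_f ?orbT //; apply: hr.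
  have [h3 h4] : (absz e.1 <= N)%N /\ (absz e.2 <= N)%N by apply: hN; rewrite inE eqxx.
  rewrite mcoeffZ mcoeffX; have [->|ne] := eqVneq t.2 e; first by rewrite eqxx mulr1.
  case: eqP; rewrite ?mulr0 // => /mnmP en; case/eqP: ne.
  have := congr1 Posz (en ord_max); have := congr1 Posz (en ord0); rewrite !mnmE /= !absz_shift // => /addrI a1 /addrI a2.
  by rewrite [t.2]surjective_pairing [e]surjective_pairing a1 a2.
have s1 : {subset s <= s ++ s'} by move=> x xs; rewrite mem_cat xs.
have s2 : {subset s' <= s ++ s'} by move=> x xs; rewrite mem_cat xs orbT.
have [|P0 Q0] := d_free dz (P := P s) (Q := P s').
  by rewrite !PE // mulrCA -mulrDr e0 mulr0.
by rewrite -!Pc // P0 Q0 mcoeff0.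
Qed.

Definition fexp (sg : 'I_3 -> bool) (m : 'X_{1..2}) : int * int :=
  (if sg 0 then - (m ord0)%:Z else (m ord0)%:Z, if sg 1 then - (m ord_max)%:Z else (m ord_max)%:Z).

Definition zflip (sg : 'I_3 -> bool) (z : 'I_3 -> K) i := if sg i then (z i)^-1 else z i.
Definition cflip (T : Type) (sg : 'I_3 -> bool) (al de : 'I_3 -> T) i := if sg i then de i else al i.

(** Only freeness needs care: polynomials in inverted variables are Laurent polynomials in the
    original ones, and when z_2 is inverted, multiplying the relation by z_2 exchanges P and Q. *)
Lemma datum_flip sg z al de : datum iota z al de ->
  datum iota (zflip sg z) (cflip sg al de) (cflip sg de al).
Proof.
move=> dz; split.
- by move=> i; rewrite /cflip; case: ifP; rewrite ?(d_al dz) ?(d_de dz).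
- by move=> i; rewrite /cflip; case: ifP; rewrite ?(d_al dz) ?(d_de dz).
- by move=> i; rewrite /zflip; case: ifP; rewrite ?invr_eq0 (d_z dz).
- rewrite -[RHS](d_rel dz); apply: eq_bigr => i _; rewrite /zflip /cflip; case: ifP => // _.
  by rewrite invrK addrC.
- move=> S Sc Sz SD SM SV; apply: (d_gen dz) => // i; have := Sz i; rewrite /zflip; case: ifP => // _ /SV.
  by rewrite invrK.
move=> P Q; pose L (P : {mpoly k[2]}) := [seq (P@_m, fexp sg m) | m <- msupp P].
have LE F : mmap iota (zz (zflip sg z)) F = lv z (L F).
  rewrite mmap2 /lv [RHS]big_map; apply: eq_bigr => m _; congr (_ * _).
  rewrite /lmon /fexp /zflip /=.
  by congr (_ * _); case: ifP => // _; rewrite -exprnN exprVn.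
have Lc F m : coefl (L F) (fexp sg m) = F@_m.
  rewrite /coefl [LHS]big_map /=.
  have E m' : (fexp sg m' == fexp sg m) = (m' == m).
    apply/eqP/eqP => [[]|-> //].
    by case: (sg 0); case: (sg 1) => h0 h1; apply: (msupp2 k); lia.
  rewrite (eq_bigl (fun m' => m' == m)) //; have [mF|mF] := boolP (m \in msupp F).
    by rewrite -big_filter filter_pred1_uniq ?msupp_uniq ?big_seq1.
  rewrite big1_seq ?(memN_msupp_eq0 mF) // => m' /andP[/eqP ->]; by rewrite (negbTE mF).
suff fr r r' : lv z (L r) + z 2 * lv z (L r') = 0 -> r = 0 /\ r' = 0.
  rewrite !LE /zflip; case: ifP => _; last exact: fr.
  move=> e; have [] // := fr Q P; move: e => /(congr1 (fun x => z 2 * x)).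
  by rewrite mulrDr mulrA mulfV ?(d_z dz) // mul1r mulr0 addrC.
move/(laurent_free dz) => [h h']; split; apply/mpolyP => m; rewrite mcoeff0 -Lc ?h ?h' //.
Qed.

Definition sw (T : Type) (f : 'I_3 -> T) : 'I_3 -> T := f \o tperm 0 1.

Lemma datum_sw z al de : datum iota z al de -> datum iota (sw z) (sw al) (sw de).
Proof.
move=> dz; split.
- by move=> i; apply: (d_al dz).
- by move=> i; apply: (d_de dz).
- by move=> i; apply: (d_z dz).
- by rewrite -[RHS](d_rel dz) [RHS](reindex_inj (@perm_inj _ (tperm 0 1))).
- move=> S Sc Sz SD SM SV; apply: (d_gen dz) => // i; have := Sz (tperm 0 1 i).
  by rewrite /sw /= tpermK.
have sw0 : sw z 0 = z 1 by rewrite /sw /= tpermL.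
have sw1 : sw z 1 = z 0 by rewrite /sw /= tpermR.
have sw2 : sw z 2 = z 2 by rewrite /sw /= tpermD.
move=> P Q; pose L (P : {mpoly k[2]}) := [seq (P@_m, ((m ord_max)%:Z, (m ord0)%:Z)) | m <- msupp P].
have LE F : mmap iota (zz (sw z)) F = lv z (L F).
  rewrite mmap2 /lv [RHS]big_map; apply: eq_bigr => m _; congr (_ * _).
  by rewrite /lmon /= sw0 sw1 mulrC.
have Lc F (m : 'X_{1..2}) : coefl (L F) ((m ord_max)%:Z, (m ord0)%:Z) = F@_m.
  rewrite /coefl [LHS]big_map /=.
  have E (m' : 'X_{1..2}) : (((m' ord_max)%:Z, (m' ord0)%:Z) == ((m ord_max)%:Z, (m ord0)%:Z)) = (m' == m).
    by apply/eqP/eqP => [[h0 h1]|-> //]; apply: (msupp2 k).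
  rewrite (eq_bigl (fun m' => m' == m)) //; have [mF|mF] := boolP (m \in msupp F).
    by rewrite -big_filter filter_pred1_uniq ?msupp_uniq ?big_seq1.
  by rewrite big1_seq ?(memN_msupp_eq0 mF) // => m' /andP[/eqP ->]; rewrite (negbTE mF).
rewrite !LE sw2 => /(laurent_free dz) [h h'].
by split; apply/mpolyP => m; rewrite mcoeff0 -Lc ?h ?h'.
Qed.

(** Elements (P + Q eta)/D are closed under the field operations: products are reduced by the
    quadratic equation, inverses use the norm [Nm]. *)
Lemma quad_repr n (t : 'I_n -> K) (eta : K) (A B C : {mpoly k[n]}) :
    mmap iota t A != 0 ->
    mmap iota t A * eta ^+ 2 + mmap iota t B * eta + mmap iota t C = 0 ->
    (forall S : K -> Prop, (forall c, S (iota c)) -> (forall i, S (t i)) -> S eta ->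
      (forall f g, S f -> S g -> S (f + g)) -> (forall f g, S f -> S g -> S (f * g)) ->
      (forall f, S f -> S f^-1) -> forall f, S f) ->
  forall f, exists P Q D : {mpoly k[n]}, mmap iota t D != 0 /\
    f * mmap iota t D = mmap iota t P + mmap iota t Q * eta.
Proof.
set ev := mmap iota t => A0 e gen; apply: gen.
- by move=> c; exists c%:MP, 0, 1; rewrite /ev rmorph1 rmorph0 oner_eq0 mmapC mul0r addr0 mulr1.
- by move=> i; exists 'X_i, 0, 1; rewrite /ev rmorph1 rmorph0 oner_eq0 mmapX mmap1U mul0r addr0 mulr1.
- by exists 0, 1, 1; rewrite /ev rmorph1 rmorph0 oner_eq0 mul1r add0r mulr1.
- move=> f g [P [Q [D [D0 h]]]] [P' [Q' [D' [D0' h']]]].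
  exists (P * D' + P' * D), (Q * D' + Q' * D), (D * D').
  rewrite /ev !(rmorphM, rmorphD) /= -/ev mulf_neq0 //; split=> //.
  by rewrite mulrDl mulrA h (mulrCA g) h'; ring.
- move=> f g [P [Q [D [D0 h]]]] [P' [Q' [D' [D0' h']]]].
  exists (A * P * P' - Q * Q' * C), (A * (P * Q' + Q * P') - Q * Q' * B), (A * (D * D')).
  rewrite /ev !(rmorphM, rmorphD, rmorphN) /= -/ev !mulf_neq0 //; split=> //.
  have -> : f * g * (ev A * (ev D * ev D')) = ev A * (f * ev D) * (g * ev D') by ring.
  rewrite h h' -[LHS]subr0 -(mulr0 (ev Q * ev Q')) -e; ring.
move=> f [P [Q [D [D0 h]]]]; have [->|f0] := eqVneq f 0.
  by exists 0, 0, 1; rewrite /ev rmorph1 !rmorph0 oner_eq0 invr0 !mul0r addr0.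
have fD : f * ev D != 0 by rewrite mulf_neq0.
pose Nm := A * P ^+ 2 - B * P * Q + C * Q ^+ 2.
have NmE : ev Nm = (f * ev D) * (ev A * ev P - ev B * ev Q - ev A * ev Q * eta).
  rewrite h /Nm /ev !(rmorphM, rmorphD, rmorphN, rmorphXn) /= -/ev.
  rewrite -[RHS]addr0 -(mulr0 (ev Q ^+ 2)) -e; ring.
have [Nm0|Nm0] := eqVneq (ev Nm) 0; last first.
  exists (D * (A * P - B * Q)), (- (D * (A * Q))), Nm; split=> //.
  apply: (mulfI f0); rewrite (mulVKf f0) NmE /ev !(rmorphM, rmorphD, rmorphN) /=; ring.
move: Nm0; rewrite NmE => /eqP; rewrite mulf_eq0 (negbTE fD) /= => /eqP c0.
(* The norm can vanish when eta is rational over k(t). In that case A Q eta = A P - B Q, so f itself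
   is rational over k(t) and is inverted directly. *)
have fA : f * ev (D * A) = ev (A * P + A * P - B * Q).
  rewrite /ev !(rmorphM, rmorphD, rmorphN) /= -/ev mulrA h -[LHS]addr0 -c0; ring.
exists (D * A), 0, (A * P + A * P - B * Q); rewrite -fA (mulKf f0) (_ : ev 0 = 0) ?mul0r ?addr0; last exact: (rmorph0 _).
split=> //.
by rewrite mulf_neq0 // /ev rmorphM mulf_neq0.
Qed.

End Laurent.

Lemma pred_add_leq (a b e s : nat) : (a <= s)%N -> (b <= e.+1)%N -> ((a + b).-1 <= (e + s).+1)%N.
Proof. lia. Qed.

Lemma msizeM_pred (k : fieldType) n (U V : {mpoly k[n]}) : (msize (U * V) <= (msize U + msize V).-1)%N.
Proof.
have [->|U0] := eqVneq U 0; first by rewrite mul0r mmeasure0.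
have [->|V0] := eqVneq V 0; first by rewrite mulr0 mmeasure0.
by rewrite msizeM.
Qed.

(** For c = 2 a^2 + 1, the inequality c^3 > 2 (c a)^2: cubic growth beats quadratic growth in
    [trdeg2_K]. *)
Lemma cube_bound (a : nat) : (2 * ((2 * a ^ 2).+1 * a) ^ 2 < (2 * a ^ 2).+1 ^ 3)%N.
Proof.
have [c cE] : exists c, c = (2 * a ^ 2).+1 by exists (2 * a ^ 2).+1.
have -> : (2 * ((2 * a ^ 2).+1 * a) ^ 2 = c ^ 2 * (2 * a ^ 2))%N by rewrite -cE expnMn mulnCA.
rewrite -cE [X in (_ < X)%N]expnSr ltn_mul2l expn_gt0 /= cE ltnSn.
by [].
Qed.

Section Field.
Variables (k K : fieldType) (iota : {rmorphism k -> K}).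

Definition ratio n (y : 'rV[K]_n) (f : K) : Prop := exists d (F G : {mpoly k[n]}),
  [/\ F \is d.-homog, G \is d.-homog, hval iota y G != 0 & f = hval iota y F / hval iota y G].

Lemma function_field_gen n (y : 'rV[K]_n) I (z : I -> K) : y != 0 -> gen_by iota z ->
  (forall i, ratio y (z i)) -> has_function_field iota y.
Proof.
move=> y0 gen h; split=> //; apply: gen => //.
- move=> e; exists 0%N, e%:MP, 1; rewrite /hval rmorph1 oner_eq0 divr1 mmapC; split=> //.
    by rewrite -[e%:MP]mulr1 mul_mpolyC rpredZ ?dhomog1.
  by rewrite dhomog1.
- move=> f g [d [F [G [hF hG G0 ->]]]] [d' [F' [G' [hF' hG' G0' ->]]]].
  exists (d + d')%N, (F * G' + F' * G), (G * G'); split.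
  + by rewrite rpredD //; [exact: dhomogM|rewrite addnC; exact: dhomogM].
  + exact: dhomogM.
  + by rewrite /hval rmorphM mulf_neq0.
  + by rewrite /hval !(rmorphD, rmorphM) /= addf_div.
- move=> f g [d [F [G [hF hG G0 ->]]]] [d' [F' [G' [hF' hG' G0' ->]]]].
  exists (d + d')%N, (F * F'), (G * G'); split; rewrite ?dhomogM //.
  + by rewrite /hval rmorphM mulf_neq0.
  + by rewrite /hval !(rmorphD, rmorphM) /= mulf_div.
move=> f [d [F [G [hF hG G0 ->]]]]; have [F0|F0] := eqVneq (hval iota y F) 0.
  exists 0%N, 0, 1; rewrite F0 mul0r invr0 /hval rmorph1 oner_eq0 rmorph0 mul0r dhomog1; split=> //.
  exact: dhomog0.
by exists d, G, F; rewrite invf_div.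
Qed.

Variables (z : 'I_3 -> K) (al de : 'I_3 -> k).
Hypothesis dz : datum iota z al de.
Notation ev := (mmap iota (zz z)).

Definition pA : {mpoly k[2]} := al 2 *: ('X_ord0 * 'X_ord_max).
Definition pB : {mpoly k[2]} := al 0 *: ('X_ord0 ^+ 2 * 'X_ord_max) + de 0 *: 'X_ord_max
  + al 1 *: ('X_ord_max ^+ 2 * 'X_ord0) + de 1 *: 'X_ord0 - 'X_ord0 * 'X_ord_max.
Definition pC : {mpoly k[2]} := de 2 *: ('X_ord0 * 'X_ord_max).

Lemma ev_X i : ev 'X_i = zz z i. Proof. by rewrite mmapX mmap1U. Qed.

Lemma ev_inj P : ev P = 0 -> P = 0.
Proof. by move=> e; have [] // := d_free dz (P := P) (Q := 0); rewrite e rmorph0 mulr0 addr0. Qed.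

Lemma pA_neq0 : pA != 0.
Proof.
apply/eqP => /(congr1 ev)/eqP; rewrite rmorph0 mmapZ rmorphM /= !ev_X zz0 zz1.
by rewrite !mulf_eq0 fmorph_eq0 (negbTE (d_al dz _)) !(negbTE (d_z dz _)).
Qed.

Lemma pB_neq0 : pB != 0.
Proof.
apply/eqP => /(congr1 (mcoeff (U_(ord0) + U_(ord0) + U_(ord_max))%MM)).
rewrite mcoeff0 /pB !(mcoeffD, mcoeffB, mcoeffN, mcoeffZ) !expr2 -!mpolyXD !mcoeffX eqxx.
do 4![case: eqP => [/mnmP h|_]; first by have := h ord0; have := h ord_max; rewrite !mnmDE !mnm1E /=].
by rewrite !mulr0 mulr1 oppr0 !addr0 => /eqP; apply/negP/(d_al dz).
Qed.

Lemma quad_z2_p : ev pA * z 2 ^+ 2 + ev pB * z 2 + ev pC = 0.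
Proof.
rewrite /pA /pB /pC !(rmorphD, rmorphN) /= !mmapZ !(rmorphM, rmorphXn) /= !ev_X zz0 zz1.
have := d_rel dz; rewrite sum3 => h.
transitivity (z 0 * z 1 * z 2 * (iota (al 0) * z 0 + iota (de 0) / z 0 +
    (iota (al 1) * z 1 + iota (de 1) / z 1) + (iota (al 2) * z 2 + iota (de 2) / z 2) - 1)).
  by field; rewrite !(d_z dz).
by rewrite h subrr mulr0.
Qed.

(** Seals the coefficients of the quadratic equation of z_2 behind a sigma type, so that later
    computations see only their nonvanishing and the equation. *)
Lemma quad_sig : {q : {mpoly k[2]} * {mpoly k[2]} * {mpoly k[2]} |
  [/\ q.1.1 != 0, q.1.2 != 0 & ev q.1.1 * z 2 ^+ 2 + ev q.1.2 * z 2 + ev q.2 = 0]}.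
Proof. by exists (pA, pB, pC); split; [exact: pA_neq0|exact: pB_neq0|exact: quad_z2_p]. Qed.

Definition qA := (sval quad_sig).1.1.
Definition qB := (sval quad_sig).1.2.
Definition qC := (sval quad_sig).2.
Lemma qA_neq0 : qA != 0. Proof. by have [] := svalP quad_sig. Qed.
Lemma qB_neq0 : qB != 0. Proof. by have [] := svalP quad_sig. Qed.
Lemma quad_z2 : ev qA * z 2 ^+ 2 + ev qB * z 2 + ev qC = 0. Proof. by have [] := svalP quad_sig. Qed.

Lemma datum_repr f : exists P Q D : {mpoly k[2]}, ev D != 0 /\ f * ev D = ev P + ev Q * z 2.
Proof.
apply: (quad_repr (A := qA) (B := qB) (C := qC)) quad_z2 _ f.
  by apply: contra qA_neq0 => /eqP/ev_inj ->.
move=> S Sc Sz S2 SD SM SV; apply: (d_gen dz) => // i; elim/ord3_ind: i => //.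
  by rewrite -zz0.
by rewrite -zz1.
Qed.

Lemma datum_repr_common n (t : 'I_n -> K) : exists (D : {mpoly k[2]}) (P Q : 'I_n -> {mpoly k[2]}),
  ev D != 0 /\ forall i, t i * ev D = ev (P i) + ev (Q i) * z 2.
Proof.
have /choice[P hP] i : exists P, exists Q D : {mpoly k[2]}, ev D != 0 /\ t i * ev D = ev P + ev Q * z 2.
  exact: datum_repr.
have /choice[Q hQ] := hP; have /choice[D hD] := hQ.
exists (\prod_i D i), (fun i => P i * \prod_(j | j != i) D j), (fun i => Q i * \prod_(j | j != i) D j).
split; first by rewrite rmorph_prod; apply/prodf_neq0 => i _; have [] := hD i.
move=> i; rewrite (bigD1 i) //= !rmorphM mulrA (hD i).2; ring.
Qed.

Definition mon4 (i : 'I_4) : 'X_{1..2} := [multinom (if j == ord0 then (i %% 2)%N else (i %/ 2)%N) | j < 2].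
Definition m4 (i : 'I_4) : K := ev 'X_[mon4 i].

Hypothesis char2 : 2%N \in [pchar k].

Lemma sqr_mpoly (P : {mpoly k[2]}) : P ^+ 2 = \sum_(m <- msupp P) P@_m ^+ 2 *: 'X_[m + m].
Proof.
have h := char2_mpoly char2 2.
rewrite -(pFrobenius_autE h) {1}[P]mpolyE rmorph_sum /=; apply: eq_bigr => m _.
by rewrite pFrobenius_autE exprZn; congr (_ *: _); rewrite expr2 -mpolyXD.
Qed.

Lemma parity_free (P : 'I_4 -> {mpoly k[2]}) : \sum_i P i ^+ 2 * 'X_[mon4 i] = 0 -> forall i, P i = 0.
Proof.
move=> e i; apply/mpolyP => m; rewrite mcoeff0; suff h2 : (P i)@_m ^+ 2 = 0 by move/eqP: h2; rewrite expf_eq0 => /eqP.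
have := congr1 (mcoeff (m + m + mon4 i)) e; rewrite mcoeff0 raddf_sum /= => <-.
have E j : (P j ^+ 2 * 'X_[mon4 j])@_(m + m + mon4 i) = if j == i then (P i)@_m ^+ 2 else 0.
  rewrite sqr_mpoly mulr_suml raddf_sum /=.
  have E' m' : ((m' + m' + mon4 j)%MM == (m + m + mon4 i)%MM) = (j == i) && (m' == m).
    apply/eqP/andP => [/mnmP h|[/eqP -> /eqP ->] //].
    have := h ord0; have := h ord_max; rewrite !mnmDE !mnmE /= => h1 h0.
    have ij : j = i by apply: val_inj => /=; case: i j {h e} h0 h1 => [[|[|[|[|//]]]] ?] [[|[|[|[|//]]]] ?] /=; lia.
    by split; apply/eqP => //; apply: (msupp2 k); rewrite ij in h0 h1; lia.
  rewrite (eq_bigr (fun m' => (P j)@_m' ^+ 2 * ((j == i) && (m' == m))%:R)); last first.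
    by move=> m' _; rewrite -scalerAl mcoeffZ -mpolyXD mcoeffX E'.
  case: eqP => [->|_]; last by rewrite big1 // => m' _; rewrite mulr0.
  have [mP|mP] := boolP (m \in msupp (P i)).
    rewrite (bigD1_seq m) ?msupp_uniq //= eqxx mulr1 big1 ?addr0 // => m' /negbTE ->.
    by rewrite mulr0.
  rewrite (memN_msupp_eq0 mP) expr0n big1_seq // => m' /andP[_ m'P].
  by case: eqP => [e'|_]; rewrite ?mulr0 //; move: mP; rewrite -e' m'P.
rewrite (eq_bigr _ (fun j _ => E j)) -big_mkcond big_pred1_eq //.
Qed.

(** Independence of 1, z_0, z_1, z_0 z_1 over K^2. Writing c_i = (P_i + Q_i z_2)/D leads to sP + sQ
    z_2^2 = 0. Eliminating z_2^2 leaves [qB] sQ as coefficient of z_2, and [qB] is nonzero, which is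
    the separability of z_2 over k(z_0, z_1). *)
Lemma m4_free (c : 'I_4 -> K) : \sum_i c i ^+ 2 * m4 i = 0 -> forall i, c i = 0.
Proof.
have [D [P [Q [D0 h]]]] := datum_repr_common c => e.
have cK : 2%N \in [pchar K] by exact: rmorph_pchar char2.
have sq (x y : K) : (x + y) ^+ 2 = x ^+ 2 + y ^+ 2.
  by rewrite -!(pFrobenius_autE cK) (pFrobenius_autD_comm _ (mulrC _ _)).
pose sP := \sum_i P i ^+ 2 * 'X_[mon4 i]; pose sQ := \sum_i Q i ^+ 2 * 'X_[mon4 i].
have e1 : ev sP + ev sQ * z 2 ^+ 2 = 0.
  rewrite -[RHS](mulr0 (ev D ^+ 2)) -e !rmorph_sum /= mulr_suml mulr_sumr -big_split /=.
  apply: eq_bigr => i _; rewrite [RHS]mulrA (mulrC (ev D ^+ 2)) -[c i ^+ 2 * _]exprMn h sq /m4.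
  rewrite !(rmorphM, rmorphXn) /=; ring.
have [|h1 h2] := d_free dz (P := qA * sP - qC * sQ) (Q := - (qB * sQ)).
  rewrite !(rmorphN, rmorphD, rmorphM) /=.
  transitivity (ev qA * (ev sP + ev sQ * z 2 ^+ 2) - ev sQ * (ev qA * z 2 ^+ 2 + ev qB * z 2 + ev qC)); first by ring.
  by rewrite e1 quad_z2 !mulr0 subr0.
have sQ0 : sQ = 0.
  by apply/eqP; move/eqP: h2; rewrite oppr_eq0 mulf_eq0 (negbTE qB_neq0).
have sP0 : sP = 0.
  by apply/eqP; move/eqP: h1; rewrite sQ0 mulr0 subr0 mulf_eq0 (negbTE qA_neq0).
move=> i; apply: (mulIf D0); rewrite h (parity_free sP0) (parity_free sQ0) !rmorph0 !mul0r add0r.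
by [].
Qed.

Definition bnd e (f : K) := exists P Q : {mpoly k[2]}, [/\ (msize P <= e.+1)%N, (msize Q <= e.+1)%N & f = ev P + ev Q * z 2].

Lemma bnd_step s e (P Q : {mpoly k[2]}) f : (msize (qA * P) <= s)%N -> (msize (qC * Q) <= s)%N ->
  (msize (qA * Q) <= s)%N -> (msize (qB * Q) <= s)%N -> bnd e f -> bnd (e + s) (ev qA * (ev P + ev Q * z 2) * f).
Proof.
move=> s1 s2 s3 s4 [F [G [hF hG ->]]].
have sM (U V : {mpoly k[2]}) : (msize U <= s)%N -> (msize V <= e.+1)%N -> (msize (U * V) <= (e + s).+1)%N.
  move=> hU hV; exact: leq_trans (msizeM_pred _ _) (pred_add_leq hU hV).
have sD (U V : {mpoly k[2]}) : (msize U <= (e + s).+1)%N -> (msize V <= (e + s).+1)%N -> (msize (U + V) <= (e + s).+1)%N.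
  by move=> hU hV; apply: leq_trans (mmeasureD_le _ _ _) _; rewrite geq_max hU.
exists (qA * P * F - qC * Q * G), (qA * P * G + qA * Q * F - qB * Q * G); split.
- by apply: (sD); rewrite ?mmeasureN; apply: sM.
- by apply: (sD); [apply: (sD)|rewrite ?mmeasureN]; apply: sM.
rewrite !(rmorphD, rmorphN, rmorphM) /=.
rewrite -[LHS]subr0 -(mulr0 (ev Q * ev G)) -quad_z2; ring.
Qed.

Lemma bnd_lin I (r : seq I) (c : I -> k) (P Q : I -> {mpoly k[2]}) :
  \sum_(i <- r) iota (c i) * (ev (P i) + ev (Q i) * z 2) = ev (\sum_(i <- r) c i *: P i) + ev (\sum_(i <- r) c i *: Q i) * z 2.
Proof.
rewrite !rmorph_sum /= mulr_suml -big_split /=; apply: eq_bigr => i _.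
by rewrite !mmapZ mulrDr mulrA.
Qed.

(** Counting dimensions. After multiplication by a common denominator, the monomials in three
    elements of exponents below M lie in k[z_0, z_1] + k[z_0, z_1] z_2 with degrees linear in M.
    There are M^3 of them in a space of dimension quadratic in M. *)
Lemma trdeg2_K : trdeg2 iota.
Proof.
split; first by exists (zz z) => F; apply: ev_inj.
move=> t ind; have [D [P [Q [D0 h]]]] := datum_repr_common t.
pose W := qA * D; have W0 : ev W != 0 by rewrite rmorphM mulf_neq0 // ; apply: contra qA_neq0 => /eqP/ev_inj ->.
have [s [sW sP]] : exists s, [/\ (msize W <= s)%N, (msize (qC * 0) <= s)%N, (msize (qA * 0) <= s)%N & (msize (qB * 0) <= s)%N] /\
   forall i, [/\ (msize (qA * P i) <= s)%N, (msize (qC * Q i) <= s)%N, (msize (qA * Q i) <= s)%N & (msize (qB * Q i) <= s)%N].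
  exists (msize W + (\max_i msize (qA * P i) + \max_i msize (qC * Q i) + \max_i msize (qA * Q i) + \max_i msize (qB * Q i)))%N.
  split; first by rewrite !mulr0 mmeasure0 leq_addr.
  move=> i; have := @leq_bigmax _ (fun i => msize (qA * P i)) i; have := @leq_bigmax _ (fun i => msize (qA * Q i)) i.
  have := @leq_bigmax _ (fun i => msize (qC * Q i)) i; have := @leq_bigmax _ (fun i => msize (qB * Q i)) i.
  by move=> /= *; split; lia.
have bndm N : forall m : 'X_{1..3}, (mdeg m <= N)%N -> bnd (N * s) (ev W ^+ N * mmap1 t m).
  elim: N => [|N IH] m hm.
    have -> : m = 0%MM by apply/eqP; rewrite -mdeg_eq0 -leqn0.
    exists 1, 0; rewrite mmap11 rmorph1 rmorph0 mul0r addr0 mulr1 mmeasure0 mul0n; split=> //.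
    by rewrite msize1.
  have [m0|m0] := eqVneq m 0%MM.
    rewrite exprS -mulrA mulSn addnC.
    have {1}-> : ev W = ev qA * (ev D + ev 0 * z 2) by rewrite rmorph0 mul0r addr0 -rmorphM.
    have [sW1 sW2 sW3 sW4] := sW.
    by apply: bnd_step => //; apply: IH; rewrite m0 mdeg0.
  have [i mi] : exists i, m i != 0%N.
    apply/existsP; apply: contraNT m0 => /existsPn m0; apply/eqP/mnmP => i; rewrite mnm0E.
    by apply/eqP; have := m0 i; rewrite negbK.
  have mE : m = (U_(i) + (m - U_(i)))%MM by rewrite addmC submK // lep1mP.
  have -> : ev W ^+ N.+1 * mmap1 t m = ev qA * (ev (P i) + ev (Q i) * z 2) * (ev W ^+ N * mmap1 t (m - U_(i))).
    have mm1 (m' : 'X_{1..3}) : mmap1 t m' = mmap iota t 'X_[m'] by rewrite mmapX.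
    have mi1 : mmap iota t 'X_[U_(i)] = t i by rewrite mmapX mmap1U.
    have e2 : mmap iota t 'X_[m] = t i * mmap iota t 'X_[m - U_(i)] by rewrite -mi1 -rmorphM -mpolyXD -mE.
    have e3 : ev W = ev qA * ev D by rewrite -rmorphM.
    rewrite !mm1 e2 -h exprS {1}e3.
    by move: (mmap iota t _) (ev W ^+ N) (ev D) (ev qA) => *; ring.
  rewrite mulSn addnC; have [? ? ? ?] := sP i; apply: bnd_step => //; apply: IH.
  by rewrite mE mdegD mdeg1 in hm.
(* The degree of such a monomial is at most N = 3 M, and N s + 1 is at most M (3 s + 1), so
   [cube_bound] with a = 3 s + 1 gives M^3 > 2 (N s + 1)^2. *)
pose M := (2 * (3 * s + 1) ^ 2).+1; pose N := (3 * M)%N.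
pose I := {ffun 'I_3 -> 'I_M}; pose J := {ffun 'I_2 -> 'I_(N * s).+1}.
pose mI (f : I) : 'X_{1..3} := [multinom (f i : nat) | i < 3].
pose mJ (f : J) : 'X_{1..2} := [multinom (f i : nat) | i < 2].
have degI f : (mdeg (mI f) <= N)%N.
  rewrite mdegE /N; have -> : (3 * M = \sum_(i < 3) M)%N by rewrite sum_nat_const card_ord.
  by apply: leq_sum => i _; rewrite mnmE ltnW.
have /choice[p hp] f := bndm N (mI f) (degI f).
have /choice[q hq] := hp.
pose T : 'M[k]_(#|{: I}|, #|{: J}| + #|{: J}|) := \matrix_(i, j)
   match split j with inl j => (p (enum_val i))@_(mJ (enum_val j)) | inr j => (q (enum_val i))@_(mJ (enum_val j)) end.
have rT : (\rank T < #|{: I}|)%N.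
  apply: leq_ltn_trans (rank_leq_col _) _; rewrite !card_ffun !card_ord /N /M.
  set a := (3 * s + 1)%N; set b := (2 * a ^ 2)%N.
  have h1 : ((3 * b.+1 * s).+1 <= b.+1 * a)%N by rewrite /a; lia.
  have h2 : ((3 * b.+1 * s).+1 ^ 2 <= (b.+1 * a) ^ 2)%N by rewrite leq_exp2r.
  apply: (@leq_ltn_trans (2 * (b.+1 * a) ^ 2)%N); first by lia.
  exact: cube_bound.
have /rowV0Pn[u uT u0] : kermx T != 0 by rewrite kermx_eq0 /row_free neq_ltn rT.
have {}uT : u *m T = 0 by apply/sub_kermxP.
pose F : {mpoly k[3]} := \sum_f u 0 (enum_rank f) *: 'X_[mI f].
have FE f : F@_(mI f) = u 0 (enum_rank f).
  rewrite /F raddf_sum (bigD1 f) //= mcoeffZ mcoeffX eqxx mulr1 big1 ?addr0 // => g gf.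
  rewrite mcoeffZ mcoeffX; case: eqP => [/mnmP e|]; rewrite ?mulr0 //.
  by case/eqP: gf; apply/ffunP => i; apply: val_inj; have := e i; rewrite !mnmE.
have F0 : F = 0.
  apply: ind; apply: (mulfI (expf_neq0 N W0)); rewrite mulr0 /F rmorph_sum /= mulr_sumr.
  transitivity (\sum_(f : I) iota (u 0 (enum_rank f)) * (ev (p f) + ev (q f) * z 2)).
    apply: eq_bigr => f _; rewrite mmapZ mulrCA; congr (_ * _); rewrite mmapX.
    by have [_ _ <-] := hq f.
  have z0 (r : I -> {mpoly k[2]}) : (forall f, (msize (r f) <= (N * s).+1)%N) ->
     (forall j : J, \sum_f u 0 (enum_rank f) * (r f)@_(mJ j) = 0) -> \sum_f u 0 (enum_rank f) *: r f = 0.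
    move=> hr hj; apply/mpolyP => m; rewrite mcoeff0 raddf_sum /=.
    have [hm|hm] := leqP (mdeg m) (N * s); last first.
      rewrite big1 // => f _; rewrite mcoeffZ memN_msupp_eq0 ?mulr0 //.
      apply/negP => /msize_mdeg_lt; have := hr f; lia.
    have mm i : (m i < (N * s).+1)%N.
      by rewrite ltnS; apply: leq_trans hm; rewrite mdegE (bigD1 i) //= leq_addr.
    rewrite -[RHS](hj [ffun i => Ordinal (mm i)]); apply: eq_bigr => f _; rewrite mcoeffZ; congr (_ * _@__).
    by apply/mnmP => i; rewrite mnmE ffunE.
  rewrite bnd_lin // !z0 ?rmorph0 ?mul0r ?addr0 // => [f|j|f|j]; try by have [] := hq f.
    move/rowP/(_ (rshift _ (enum_rank j))): uT; rewrite !mxE => eu; rewrite -[RHS]eu.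
    rewrite [RHS](reindex enum_rank) /=; last by apply: onW_bij; exact: enum_rank_bij.
    by apply: eq_bigr => f _; rewrite !mxE (unsplitK (inr _)) !enum_rankK.
  move/rowP/(_ (lshift _ (enum_rank j))): uT; rewrite !mxE => eu; rewrite -[RHS]eu.
  rewrite [RHS](reindex enum_rank) /=; last by apply: onW_bij; exact: enum_rank_bij.
  by apply: eq_bigr => f _; rewrite !mxE (unsplitK (inl _)) !enum_rankK.
case/eqP: u0; apply/rowP => i; rewrite mxE -(enum_valK i) -FE F0 mcoeff0 //.
Qed.

End Field.

(** * The generic point *)

Section GenericPoint.
Variables (k : fieldType) (char2 : 2%N \in [pchar k]).
Variables (a sc sd : 'I_3 -> k).
Hypotheses (a_inj : injective a) (sc_neq0 : forall i, sc i != 0) (sd_neq0 : forall i, sd i != 0).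
Variables (K : fieldType) (iota : {rmorphism k -> K}) (z : 'I_3 -> K).
Hypothesis dz : datum iota z sc (fun i => sd i * gam a i).

Local Notation Lam := (LamP sc sd).
Local Notation nqs := (nq a sc sd).
Local Notation gam := (gam a).
Local Notation X := (X k).
Local Notation Y := (Y k).

(** The generic point is normalized by L = 1, so that Y_i = gam_i / X_i and the definition of L
    becomes the relation of the datum. *)
Definition xpt : 'rV[K]_6 := \row_l match split l with inl i => z i | inr i => iota (gam i) / z i end.

Lemma hval_X i : hval iota xpt (X i) = z i.
Proof. by rewrite /hval /X mmapX mmap1U mxE (unsplitK (inl i)). Qed.
Lemma hval_Y i : hval iota xpt (Y i) = iota (gam i) / z i.
Proof. by rewrite /hval /Y mmapX mmap1U mxE (unsplitK (inr i)). Qed.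

Lemma hval_Lam : hval iota xpt Lam = 1.
Proof.
rewrite -(d_rel dz) /LamP {1}/hval rmorph_sum; apply: eq_bigr => i _.
rewrite rmorphD /= !mmapZ -!/(hval _ _ _) hval_X hval_Y rmorphM /=; ring.
Qed.

Lemma hval_nq i : hval iota xpt (nqs i) = 0.
Proof.
have cK : 2%N \in [pchar K] by exact: rmorph_pchar char2.
rewrite /nq {1}/hval rmorphD /= rmorphM /= mmapZ rmorphXn /= -!/(hval _ _ _) hval_X hval_Y hval_Lam.
by rewrite expr1n mulr1 mulrC mulfVK ?(d_z dz) // addrr_pchar2.
Qed.

Definition inI (F : {mpoly k[6]}) := exists h : 'I_3 -> {mpoly k[6]}, F = \sum_i h i * nqs i.

Lemma inI0 : inI 0.
Proof. by exists (fun=> 0); rewrite big1 // => i _; rewrite mul0r. Qed.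
Lemma inID F G : inI F -> inI G -> inI (F + G).
Proof.
move=> [h ->] [h' ->]; exists (fun i => h i + h' i); rewrite -big_split.
by apply: eq_bigr => i _; rewrite mulrDl.
Qed.
Lemma inIM F G : inI G -> inI (F * G).
Proof. by move=> [h ->]; exists (fun i => F * h i); rewrite mulr_sumr; apply: eq_bigr => i _; rewrite mulrA. Qed.
Lemma inI_nq i : inI (nqs i).
Proof.
exists (fun j => (j == i)%:R); rewrite (bigD1 i) //= eqxx mul1r big1 ?addr0 // => j /negbTE ->.
by rewrite mul0r.
Qed.
Lemma inIZ c G : inI G -> inI (c *: G).
Proof. by rewrite -mul_mpolyC; apply: inIM. Qed.
Lemma inI_eq F G : F = G -> inI F -> inI G. Proof. by move->. Qed.

Lemma hval_inI F : inI F -> hval iota xpt F = 0.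
Proof.
move=> [h ->]; rewrite {1}/hval rmorph_sum big1 // => i _.
by rewrite rmorphM /= -!/(hval _ _ _) hval_nq mulr0.
Qed.

(** Homogeneous lifts of Laurent monomials: X_i lifts z_i and [Yg i] lifts its inverse, with X_i
    [Yg i] = L^2 modulo the ideal. Powers of L pad [mu e r] to the desired degree. *)
Definition Yg i := (gam i)^-1 *: Y i.
Definition pw i (n : int) : {mpoly k[6]} := match n with Posz n => X i ^+ n | Negz n => Yg i ^+ n.+1 end.
Definition mu (e : int * int) r := pw 0 e.1 * pw 1 e.2 * Lam ^+ r.
Definition wt (e : int * int) := (absz e.1 + absz e.2)%N.

Lemma XYg i : inI (X i * Yg i - Lam ^+ 2).
Proof.
apply: inI_eq (inIZ (gam i)^-1 (inI_nq i)).
rewrite /nq scalerDr scalerA mulVf ?gam_neq0 // scale1r scalerAr -/(Yg i).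
by congr (_ + _); rewrite oppr_pchar2 // char2_mpoly.
Qed.

Lemma hval_pw i n : hval iota xpt (pw i n) = z i ^ n.
Proof.
case: n => n; rewrite /hval rmorphXn /= -/(hval _ _ _) ?hval_X //.
have -> : hval iota xpt (Yg i) = (z i)^-1.
  by rewrite /hval /Yg mmapZ -/(hval _ _ _) hval_Y fmorphV mulKf ?fmorph_eq0 ?gam_neq0.
by rewrite NegzE -exprnN exprVn.
Qed.

Lemma hval_mu e r : hval iota xpt (mu e r) = lmon z e.
Proof.
rewrite /mu /hval !rmorphM /= rmorphXn /= -!/(hval _ _ _) hval_Lam expr1n mulr1.
by rewrite !hval_pw.
Qed.

Lemma X_pw i n r : inI (X i * (pw i n * Lam ^+ r) - pw i (n + 1) * Lam ^+ (r + (absz n).+1 - absz (n + 1))).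
Proof.
case: n => n.
  have -> : (Posz n + 1 = Posz n.+1)%R by lia.
  have -> : (r + (absz n).+1 - absz n.+1)%N = r by rewrite /=; lia.
  by apply: inI_eq inI0; rewrite /pw !(exprS _ n) ?(exprS _ n.+1) ?exprS; ring.
have -> : (Negz n + 1 = - (n%:Z))%R by lia.
have -> : (r + (absz (Negz n)).+1 - absz (- n%:Z)%R)%N = (r + 2)%N by rewrite /= abszN /=; lia.
have -> : pw i (- n%:Z) = Yg i ^+ n by case: n => [|n]; rewrite ?oppr0 ?expr0 // -NegzE.
apply: inI_eq (inIM (Yg i ^+ n * Lam ^+ r) (XYg i)).
by rewrite /pw (exprS _ n) exprD; ring.
Qed.

Lemma Y_pw i n r : inI (Yg i * (pw i n * Lam ^+ r) - pw i (n - 1) * Lam ^+ (r + (absz n).+1 - absz (n - 1))).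
Proof.
case: n => n; last first.
  have -> : (Negz n - 1 = Negz n.+1)%R by lia.
  have -> : (r + (absz (Negz n)).+1 - absz (Negz n.+1))%N = r by rewrite /=; lia.
  by apply: inI_eq inI0; rewrite /pw !(exprS _ n) ?(exprS _ n.+1) ?exprS; ring.
case: n => [|n].
  have -> : (r + (absz 0).+1 - absz (0%:Z - 1))%N = r by rewrite /=; lia.
  by apply: inI_eq inI0; rewrite /= expr0 expr1; ring.
have -> : (Posz n.+1 - 1 = n)%R by lia.
have -> : (r + (absz n.+1).+1 - absz n)%N = (r + 2)%N by rewrite /=; lia.
apply: inI_eq (inIM (X i ^+ n * Lam ^+ r) (XYg i)).
by rewrite /pw (exprS _ n) exprD; ring.
Qed.

Definition nf d s := \sum_(t <- s) t.1 *: mu t.2 (d - wt t.2).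
Definition Mn d F := exists s : seq (k * (int * int)), all (fun t => wt t.2 <= d)%N s /\ inI (F - nf d s).

Lemma Mn0 d : Mn d 0.
Proof. by exists [::]; rewrite /nf big_nil subr0; split=> //; exact: inI0. Qed.
Lemma MnD d F G : Mn d F -> Mn d G -> Mn d (F + G).
Proof.
move=> [s [hs h]] [s' [hs' h']]; exists (s ++ s'); rewrite all_cat hs hs'; split=> //.
by apply: inI_eq (inID h h'); rewrite /nf big_cat /=; ring.
Qed.
Lemma MnI d F G : inI (F - G) -> Mn d G -> Mn d F.
Proof. by move=> h [s [hs h']]; exists s; split=> //; apply: inI_eq (inID h h'); ring. Qed.
Lemma Mn_mu d c e : (wt e <= d)%N -> Mn d (c *: mu e (d - wt e)).
Proof.
move=> h; exists [:: (c, e)]; rewrite /= h; split=> //.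
by rewrite /nf big_seq1 subrr; exact: inI0.
Qed.
Lemma MnZ d c F : Mn d F -> Mn d (c *: F).
Proof.
move=> [s [hs h]]; exists [seq (c * t.1, t.2) | t <- s]; split; first by rewrite all_map.
apply: inI_eq (inIZ c h); rewrite /nf big_map scalerBr scaler_sumr.
by congr (_ - _); apply: eq_bigr => t _; rewrite scalerA.
Qed.

Lemma Mn_mul V d F : (forall e, (wt e <= d)%N -> exists e', (wt e' <= d.+1)%N /\ inI (V * mu e (d - wt e) - mu e' (d.+1 - wt e'))) ->
  Mn d F -> Mn d.+1 (V * F).
Proof.
move=> hV [s [hs h]]; apply: (@MnI _ _ (V * nf d s)); first by rewrite -mulrBr; apply: inIM.
elim: s hs {h} => [|t s IH] /=; first by rewrite /nf big_nil mulr0 => _; apply: Mn0.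
case/andP => ht /IH hs; rewrite /nf big_cons mulrDr; apply: MnD => //.
have [e' [he' hI]] := hV _ ht; rewrite -scalerAr; apply: MnI (Mn_mu t.1 he').
by rewrite -scalerBr; apply: inIZ.
Qed.

Lemma Mn_Lam d F : Mn d F -> Mn d.+1 (Lam * F).
Proof.
apply: Mn_mul => e he; exists e; split; first exact: leqW.
by apply: inI_eq inI0; rewrite subSn // /mu exprS; ring.
Qed.

Lemma Mn_XY d F (i : bool) (V : {mpoly k[6]}) : V = X (if i then 1 else 0) \/ V = Yg (if i then 1 else 0) ->
  Mn d F -> Mn d.+1 (V * F).
Proof.
move=> hV; apply: Mn_mul => -[n m] he; rewrite /wt /= in he *.
case: i hV => -[] -> /=.
- exists (n, m + 1); rewrite /wt /=; split; first by lia.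
  apply: inI_eq (inIM (pw 0 n) (X_pw 1 m (d - (absz n + absz m)))); rewrite /mu /=.
  have -> : (d - (absz n + absz m) + (absz m).+1 - absz (m + 1)%R = d.+1 - (absz n + absz (m + 1)%R))%N by lia.
  ring.
- exists (n, m - 1); rewrite /wt /=; split; first by lia.
  apply: inI_eq (inIM (pw 0 n) (Y_pw 1 m (d - (absz n + absz m)))); rewrite /mu /=.
  have -> : (d - (absz n + absz m) + (absz m).+1 - absz (m - 1)%R = d.+1 - (absz n + absz (m - 1)%R))%N by lia.
  ring.
- exists (n + 1, m); rewrite /wt /=; split; first by lia.
  apply: inI_eq (inIM (pw 1 m) (X_pw 0 n (d - (absz n + absz m)))); rewrite /mu /=.
  have -> : (d - (absz n + absz m) + (absz n).+1 - absz (n + 1)%R = d.+1 - (absz (n + 1)%R + absz m))%N by lia.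
  ring.
- exists (n - 1, m); rewrite /wt /=; split; first by lia.
  apply: inI_eq (inIM (pw 1 m) (Y_pw 0 n (d - (absz n + absz m)))); rewrite /mu /=.
  have -> : (d - (absz n + absz m) + (absz n).+1 - absz (n - 1)%R = d.+1 - (absz (n - 1)%R + absz m))%N by lia.
  ring.
Qed.

Lemma Mn_Y d F (i : bool) : Mn d F -> Mn d.+1 (Y (if i then 1 else 0) * F).
Proof.
move=> h; have -> : Y (if i then 1 else 0) = gam (if i then 1 else 0) *: Yg (if i then 1 else 0).
  by rewrite /Yg scalerA mulfV ?gam_neq0 // scale1r.
by rewrite -scalerAl; apply/MnZ/(@Mn_XY _ _ i) => //; right.
Qed.

(** The normal form of a form of degree d is G + X_2 H, with G and H lifted Laurent polynomials of
    degrees d and d - 1; for d = 0 the second part is 0. *)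
Definition Mp d F := match d with 0 => F = 0 | d'.+1 => Mn d' F end.
Definition Nn d F := exists G H, [/\ Mn d G, Mp d H & inI (F - (G + X 2 * H))].

Lemma Mp0 d : Mp d 0. Proof. by case: d => // d; apply: Mn0. Qed.
Lemma MpD d F G : Mp d F -> Mp d G -> Mp d (F + G).
Proof. by case: d => [-> ->|d]; rewrite ?addr0 //; apply: MnD. Qed.
Lemma MpZ d c F : Mp d F -> Mp d (c *: F).
Proof. by case: d => [->|d]; rewrite ?scaler0 //; apply: MnZ. Qed.

Lemma NnD d F G : Nn d F -> Nn d G -> Nn d (F + G).
Proof.
move=> [G1 [H1 [a1 b1 c1]]] [G2 [H2 [a2 b2 c2]]]; exists (G1 + G2), (H1 + H2); split.
- exact: MnD.
- exact: MpD.
- by apply: inI_eq (inID c1 c2); ring.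
Qed.
Lemma NnZ d c F : Nn d F -> Nn d (c *: F).
Proof.
move=> [G1 [H1 [a1 b1 c1]]]; exists (c *: G1), (c *: H1); split.
- exact: MnZ.
- exact: MpZ.
- by apply: inI_eq (inIZ c c1); rewrite scalerBr scalerDr scalerAr.
Qed.

Lemma Nn_mul V : (forall d F, Mn d F -> Mn d.+1 (V * F)) -> forall d F, Nn d F -> Nn d.+1 (V * F).
Proof.
move=> hV d F [G [H [a1 b1 c1]]]; exists (V * G), (V * H); split; first exact: hV.
  by case: d b1 {a1} => [->|d] /=; [rewrite mulr0; apply: Mn0|apply: hV].
by apply: inI_eq (inIM V c1); ring.
Qed.

Lemma Nn_M d F : Mn d F -> Nn d F.
Proof. by move=> h; exists F, 0; split=> //; [exact: Mp0|apply: inI_eq inI0; ring]. Qed.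

(** By the definition of L this equals sc_2 X_2 + sd_2 Y_2. It eliminates Y_2 in favour of X_2 and
    of variables with index below 2. *)
Definition rest : {mpoly k[6]} := Lam + sc 0 *: X 0 + sd 0 *: Y 0 + (sc 1 *: X 1 + sd 1 *: Y 1).

Lemma restE : rest = sc 2 *: X 2 + sd 2 *: Y 2.
Proof.
have h := char2_mpoly char2 6; rewrite /rest /LamP sum3.
set u := sc 0 *: _; set v := sd 0 *: _; set s := sc 1 *: _; set t := sd 1 *: _; set w := sc 2 *: _; set r := sd 2 *: _.
by apply: (@char2_eq _ (u + v + s + t)) => //; ring.
Qed.

Lemma Mn_rest d F : Mn d F -> Mn d.+1 (rest * F).
Proof.
move=> h; rewrite /rest !mulrDl -!scalerAl.
have h0 : Mn d.+1 (X 0 * F) by apply: (@Mn_XY _ _ false) => //; left.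
have h1 : Mn d.+1 (X 1 * F) by apply: (@Mn_XY _ _ true) => //; left.
have h2 : Mn d.+1 (Y 0 * F) by apply: (@Mn_Y _ _ false).
have h3 : Mn d.+1 (Y 1 * F) by apply: (@Mn_Y _ _ true).
by repeat apply: MnD; rewrite ?addrA; try apply: MnZ => //; apply: Mn_Lam.
Qed.

Lemma Nn_X2 d F : Nn d F -> Nn d.+1 (X 2 * F).
Proof.
move=> [G [H [a1 b1 c1]]].
exists (((sc 2)^-1 * sd 2 * gam 2) *: (Lam * (Lam * H))), (G + (sc 2)^-1 *: (rest * H)); split.
- apply: MnZ; case: d b1 {a1} => [->|d hH] /=; first by rewrite !mulr0; apply: Mn0.
  by do 2!apply: Mn_Lam.
- apply: MnD => //; apply: MnZ; case: d b1 {a1} => [->|d hH] /=; first by rewrite mulr0; apply: Mn0.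
  exact: Mn_rest.
have e1 : X 2 * Y 2 = nqs 2 + gam 2 *: Lam ^+ 2.
  by rewrite /nq -addrA addrr_pchar2 ?addr0 // char2_mpoly.
(* The square of X_2 is reduced by multiplying [rest] by X_2 and replacing X_2 Y_2 by gam_2 L^2. *)
have e2 : X 2 * X 2 = (sc 2)^-1 *: (X 2 * rest) - ((sc 2)^-1 * sd 2) *: (nqs 2 + gam 2 *: Lam ^+ 2).
  rewrite -e1 restE mulrDr scalerDr -!scalerAr !scalerA mulVf // scale1r; ring.
have h : inI (X 2 * (F - (G + X 2 * H)) + (((sc 2)^-1 * sd 2) *: H) * nqs 2).
  by apply: inID; apply: inIM => //; apply: inI_nq.
apply: inI_eq h.
have -> : X 2 * (F - (G + X 2 * H)) = X 2 * F - X 2 * G - (X 2 * X 2) * H by ring.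
rewrite e2; move: (gam 2) => g0; rewrite -!mul_mpolyC !mpolyCM.
have hh := char2_mpoly char2 6.
move: (nqs 2) (sc 2)^-1%:MP (sd 2)%:MP g0%:MP rest Lam => N s t g r L.
by apply: (@char2_eq _ (s * t * H * N + s * t * g * L ^+ 2 * H)) => //; ring.
Qed.

Lemma Nn_var (l : 'I_6) d F : Nn d F -> Nn d.+1 ('X_l * F).
Proof.
move=> h; have X0 : Nn d.+1 (X 0 * F).
  by apply: (Nn_mul _ h) => d' F'; apply: (@Mn_XY _ _ false); left.
have X1 : Nn d.+1 (X 1 * F).
  by apply: (Nn_mul _ h) => d' F'; apply: (@Mn_XY _ _ true); left.
have Y0 : Nn d.+1 (Y 0 * F) by apply: (Nn_mul _ h) => d' F'; apply: (@Mn_Y _ _ false).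
have Y1 : Nn d.+1 (Y 1 * F) by apply: (Nn_mul _ h) => d' F'; apply: (@Mn_Y _ _ true).
have X2 := Nn_X2 h.
have Y2 : Nn d.+1 (Y 2 * F).
  have -> : Y 2 = (sd 2)^-1 *: rest - ((sd 2)^-1 * sc 2) *: X 2.
    by rewrite restE scalerDr !scalerA mulVf // scale1r; ring.
  rewrite mulrBl -!scalerAl -scaleNr; apply: NnD; apply: NnZ => //.
  by apply: (Nn_mul _ h) => d' F'; apply: Mn_rest.
have XX i : Nn d.+1 (X i * F) by elim/ord3_ind: i.
have YY i : Nn d.+1 (Y i * F) by elim/ord3_ind: i.
rewrite -[l](@splitK 3 3); case: (split _) => i /=; [exact: (XX i)|exact: (YY i)].
Qed.

Lemma Nn_homog d F : F \is d.-homog -> Nn d F.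
Proof.
have N0 d' : Nn d' 0 by apply/Nn_M/Mn0.
have Nm m : Nn (mdeg m) ('X_[m] : {mpoly k[6]}).
  have [d' e] : exists d', mdeg m = d' by exists (mdeg m).
  rewrite e; elim: d' m e => [|d' IH] m e.
    have -> : m = 0%MM by apply/eqP; rewrite -mdeg_eq0 e.
    apply: Nn_M; rewrite mpolyX0; have := @Mn_mu 0 1 (0, 0) isT; rewrite scale1r.
    by rewrite /mu /= !expr0 !mul1r.
  have [i mi] : exists i, m i != 0%N.
    apply/existsP; apply: contra_eqT e => /existsPn m0.
    have -> : m = 0%MM by apply/mnmP => i; rewrite mnm0E; apply/eqP; have := m0 i; rewrite negbK.
    by rewrite mdeg0.
  have mE : m = (U_(i) + (m - U_(i)))%MM by rewrite addmC submK // lep1mP.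
  rewrite mE mpolyXD; apply/Nn_var/IH.
  by move: e; rewrite {1}mE mdegD mdeg1 => -[].
move=> /dhomogP hF; rewrite [F]mpolyE big_seq; apply: big_ind => //; first exact: NnD.
by move=> m mF; apply: NnZ; have := hF m mF => /= <-.
Qed.

Lemma hval_nf d s : hval iota xpt (nf d s) = lv iota z s.
Proof.
rewrite /hval /nf rmorph_sum /lv; apply: eq_bigr => t _.
by rewrite /= mmapZ -/(hval _ _ _) hval_mu.
Qed.

(** The value of a normal form at the generic point is u + z_2 v with u, v Laurent polynomials in
    z_0, z_1. If it vanishes, all coefficients vanish by [laurent_free], and the form lies in the
    ideal. So the three quadrics cut out a reduced irreducible variety. *)
Lemma generic_inI d F : F \is d.-homog -> hval iota xpt F = 0 -> inI F.
Proof.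
move=> /Nn_homog [G [H [[s [_ hs]] hH hF]]] F0.
have [s' [d' hs']] : exists s' d', inI (H - nf d' s').
  case: d hH {hs} => [->|d] /=; first by exists [::], 0%N; rewrite /nf big_nil subr0; exact: inI0.
  by move=> [s' [_ h]]; exists s', d.
have hI : inI (F - (nf d s + X 2 * nf d' s')).
  by apply: inI_eq (inID (inID hF hs) (inIM (X 2) hs')); ring.
have := hval_inI hI; rewrite /hval rmorphB rmorphD rmorphM /= -!/(hval _ _ _) F0 !hval_nf hval_X sub0r.
move/eqP; rewrite oppr_eq0 => /eqP /(laurent_free dz) [h h'].
move: hI; rewrite /nf (@coefl0_sum _ _ (fun e => mu e (d - wt e))) //.
by rewrite (@coefl0_sum _ _ (fun e => mu e (d' - wt e))) // mulr0 addr0 subr0.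
Qed.

Lemma inI_Sigma F : inI F <-> poly_ideal (Sigma_eq a (sqf sc) (sqf sd)) F.
Proof.
split=> -[h ->].
  exists (fun r => \sum_i vinv a i r *: h i).
  rewrite (eq_bigr (fun i => \sum_r (vinv a i r *: h i) * Sigma_eq a (sqf sc) (sqf sd) r)).
    by rewrite exchange_big; apply: eq_bigr => r _; rewrite mulr_suml.
  move=> i _; rewrite (nq_Sigma_eq char2) // mulr_sumr; apply: eq_bigr => r _.
  by rewrite -scalerAr scalerAl.
apply: (big_ind inI) => [|? ?|r _]; [exact: inI0|exact: inID|apply: inIM].
rewrite (Sigma_eq_nq char2) //; apply: (big_ind inI) => [|? ?|i _]; [exact: inI0|exact: inID|].
exact/inIZ/inI_nq.
Qed.

Lemma xpt_generic : generic_point iota (Sigma_eq a (sqf sc) (sqf sd)) xpt.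
Proof.
move=> d F hF; split=> [F0|/inI_Sigma]; last exact: hval_inI.
exact/inI_Sigma/(generic_inI hF).
Qed.

Lemma homog1X (l : 'I_6) : ('X_l : {mpoly k[6]}) \is 1.-homog.
Proof. by rewrite dhomogX /= mdeg1. Qed.

Lemma Lam_homog : Lam \is 1.-homog.
Proof. by rewrite /LamP rpred_sum // => i _; rewrite rpredD // rpredZ // homog1X. Qed.

Lemma xpt_field : has_function_field iota xpt.
Proof.
apply: (function_field_gen (z := z)).
- apply/eqP => e; have := hval_X 0; rewrite /hval /Defs.X e.
  by rewrite mmapX mmap1U mxE => /esym/eqP; apply/negP/(d_z dz).
- by move=> S *; apply: (d_gen dz).
by move=> i; exists 1%N, (X i), Lam; rewrite homog1X Lam_homog hval_Lam hval_X oner_eq0 divr1.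
Qed.

End GenericPoint.

(** * The smooth model *)

Section TaylorOne.
Variables (k : fieldType) (n : nat) (tau : 'I_n -> k).

Lemma mpoly_taylor1 (P : {mpoly k[n]}) : exists h : 'I_n -> {mpoly k[n]},
  P = P.@[tau]%:MP + \sum_i h i * ('X_i - (tau i)%:MP).
Proof.
pose T P := exists h : 'I_n -> {mpoly k[n]}, P = P.@[tau]%:MP + \sum_i h i * ('X_i - (tau i)%:MP).
have TD A B : T A -> T B -> T (A + B).
  move=> [h e] [h' e']; exists (fun i => h i + h' i); rewrite {1}e {1}e' rmorphD /= mpolyCD addrACA -big_split /=.
  by congr (_ + _); apply: eq_bigr => i _; rewrite mulrDl.
have TM A B : T A -> T B -> T (A * B).
  move=> [h e] [h' e']; exists (fun i => h i * B + A.@[tau]%:MP * h' i).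
  rewrite (eq_bigr (fun i => B * (h i * ('X_i - (tau i)%:MP)) + A.@[tau]%:MP * (h' i * ('X_i - (tau i)%:MP)))).
    rewrite big_split /= -!mulr_sumr rmorphM /= mpolyCM {1}e.
    have -> : \sum_i h' i * ('X_i - (tau i)%:MP) = B - B.@[tau]%:MP by rewrite [X in X - _]e' addrC addKr.
    by ring.
  by move=> i _; ring.
have TC c : T c%:MP by exists (fun=> 0); rewrite mevalC big1 ?addr0 // => i _; rewrite mul0r.
have TX i : T 'X_i.
  exists (fun j => (j == i)%:R); rewrite mevalXU (bigD1 i) //= eqxx mul1r big1 ?addr0; last by move=> j /negbTE ->; rewrite mul0r.
  by rewrite addrC subrK.
rewrite [P]mpolyE; apply: (big_ind T) => [||m _]; [rewrite -mpolyC0; exact: TC|exact: TD|].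
rewrite -mul_mpolyC; apply: (TM) => //; rewrite mpolyXE_id; apply: (big_ind T) => [||i _]; [rewrite -mpolyC1; exact: TC|exact: TM|].
by elim: (m i) => [|e IH]; [rewrite expr0 -mpolyC1; exact: TC|rewrite exprS; apply: (TM)].
Qed.
End TaylorOne.

Section Params.
Variables (k K : fieldType) (iota : {rmorphism k -> K}).
Variables (v : K -> k -> Prop) (plv : place iota v).

Definition reg (w : K -> k -> Prop) f := exists r, w f r.

Lemma regD f g : reg v f -> reg v g -> reg v (f + g).
Proof. by move=> [r h] [s h']; exists (r + s); apply: (pl_D plv). Qed.
Lemma regM f g : reg v f -> reg v g -> reg v (f * g).
Proof. by move=> [r h] [s h']; exists (r * s); apply: (pl_M plv). Qed.
Lemma regN f : reg v f -> reg v (- f).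
Proof. by move=> [r h]; exists (- r); apply: (pl_N plv). Qed.
Lemma regB f g : reg v f -> reg v g -> reg v (f - g).
Proof. by move=> h h'; apply/regD/regN. Qed.
Lemma regX f n : reg v f -> reg v (f ^+ n).
Proof. by move=> [r h]; exists (r ^+ n); apply: (pl_X plv). Qed.
Lemma regC c : reg v (iota c). Proof. by exists c; apply: (pl_c plv). Qed.
Lemma reg1 : reg v 1. Proof. by exists 1; apply: pl_1 plv. Qed.
Lemma reg_prod I (r : seq I) (P : pred I) F : (forall i, P i -> reg v (F i)) -> reg v (\prod_(i <- r | P i) F i).
Proof. by move=> h; apply: big_ind => //; [exact: reg1|exact: regM]. Qed.

Definition lparams u w := [/\ v u 0, v w 0 & forall f, v f 0 -> exists a b, [/\ reg v a, reg v b & f = a * u + b * w]].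

Lemma max_lin n (t : 'I_n -> K) tau : (forall i, v (t i) (tau i)) -> (forall f r, v f r -> loc iota t tau f r) ->
  forall f, v f 0 -> exists h : 'I_n -> K, (forall i, reg v (h i)) /\ f = \sum_i h i * (t i - iota (tau i)).
Proof.
move=> vt gen f f0; have [P [Q [Q0 fE r0]]] := gen _ _ f0.
have vP R : v (mmap iota t R) R.@[tau] by apply: (pl_mmap plv).
have P0 : P.@[tau] = 0.
  by move/esym/eqP: r0; rewrite mulf_eq0 invr_eq0 (negbTE Q0) orbF => /eqP.
have [h hE] := mpoly_taylor1 tau P.
exists (fun i => mmap iota t (h i) / mmap iota t Q); split.
  by move=> i; exists ((h i).@[tau] / Q.@[tau]); apply: (pl_div plv).
rewrite fE {1}hE P0 mpolyC0 add0r rmorph_sum /= mulr_suml; apply: eq_bigr => i _.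
by rewrite rmorphM rmorphB /= mmapC mmapX mmap1U mulrAC.
Qed.

(** Jacobian criterion: the relation with unit coefficient [g c] expresses t_c - tau_c through the
    other two differences, which therefore generate the maximal ideal. *)
Lemma smooth_params (t : 'I_3 -> K) tau (g : 'I_3 -> K) (gv : 'I_3 -> k) c :
  (forall i, v (t i) (tau i)) -> (forall f r, v f r -> loc iota t tau f r) ->
  (forall i, v (g i) (gv i)) -> \sum_i g i * (t i - iota (tau i)) = 0 -> gv c != 0 ->
  lparams (t (c + 1) - iota (tau (c + 1))) (t (c + 2) - iota (tau (c + 2))).
Proof.
move=> vt gen vg e gc.
have v0 i : v (t i - iota (tau i)) 0 by rewrite -(subrr (tau i)); apply: (pl_B plv) => //; apply: (pl_c plv).
split=> // f /(max_lin vt gen)[h [hR ->]].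
have gc0 : g c != 0 := pl_neq0 plv (vg c) gc.
have iR : reg v (g c)^-1 by exists (gv c)^-1; apply: (pl_V plv).
have gR i : reg v (g i) by exists (gv i).
exists (h (c + 1) - h c * (g c)^-1 * g (c + 1)), (h (c + 2) - h c * (g c)^-1 * g (c + 2)).
split; try by apply: regB => //; do 2?apply: regM.
move: e; rewrite !(sum3c _ c).
move: (t c - _) (t (c + 1) - _) (t (c + 2) - _) => x y w e.
rewrite -[LHS]subr0 -(mulr0 (h c / g c)) -e; by field.
Qed.
End Params.

(** The Leibniz expansion of the derivative of [gG], with the squares treated as constants, isolated
    in plain variables for [ring]. *)
Lemma D_rel_ring (K : fieldType) (x th y a0 a1 a2 d0 d1 d2 X2 T2 Y2 Dx Dt Dy : K) :
  th * (a2 * Y2 + d2 - y) * Dx +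
  (a0 * X2 * y + d0 * y + x * (a2 * Y2 + d2 - y)) * Dt +
  (a0 * X2 * th + d0 * th + a1 * X2 * T2 + d1 - x * th) * Dy =
  ((0 * X2 + a0 * 0) * th + a0 * X2 * Dt) * y + a0 * X2 * th * Dy +
  ((0 * th + d0 * Dt) * y + d0 * th * Dy) +
  (((0 * X2 + a1 * 0) * T2 + a1 * X2 * 0) * y + a1 * X2 * T2 * Dy) +
  (0 * y + d1 * Dy) +
  (((0 * x + a2 * Dx) * th + a2 * x * Dt) * Y2 + a2 * x * th * 0) +
  ((0 * x + d2 * Dx) * th + d2 * x * Dt) -
  ((Dx * th + x * Dt) * y + x * th * Dy).
Proof. ring. Qed.

Section Chart.
Variables (k : fieldType) (char2 : 2%N \in [pchar k]) (K : fieldType) (iota : {rmorphism k -> K}).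

Definition chart (z : 'I_3 -> K) (i : 'I_3) : K :=
  match val i with 0 => z 0 | 1 => z 1 / z 0 | _ => z 2 end.

(** The Poincare residue of dlog z_0 dlog z_1 dlog z_2 / F with F the relation: z_2 dF/dz_2 = al_2
    z_2 - de_2 / z_2, and signs disappear in characteristic 2. *)
Definition om (z : 'I_3 -> K) (al de : 'I_3 -> k) (D1 D2 : K -> K) : K :=
  (D1 (z 0) * D2 (z 1) + D1 (z 1) * D2 (z 0)) / (z 0 * z 1 * (iota (al 2) * z 2 + iota (de 2) / z 2)).

Section OneChart.
Variables (z : 'I_3 -> K) (al de : 'I_3 -> k).
Hypothesis dz : datum iota z al de.
Variables (v : K -> k -> Prop) (plv : place iota v) (tau : 'I_3 -> k).
Hypotheses (vt : forall i, v (chart z i) (tau i)) (gen : forall f r, v f r -> loc iota (chart z) tau f r).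
Let x := z 0.
Let th := z 1 / z 0.
Let y := z 2.
Let a0 := iota (al 0). Let a1 := iota (al 1). Let a2 := iota (al 2).
Let d0 := iota (de 0). Let d1 := iota (de 1). Let d2 := iota (de 2).

(** The relation multiplied by z_1 z_2, which is a polynomial in the chart coordinates. *)
Definition gG := a0 * x ^+ 2 * th * y + d0 * th * y + a1 * x ^+ 2 * th ^+ 2 * y + d1 * y + a2 * x * th * y ^+ 2 + d2 * x * th - x * th * y.

Lemma gG0 : gG = 0.
Proof.
have := d_rel dz; rewrite sum3 => h.
transitivity (z 1 * z 2 * (iota (al 0) * z 0 + iota (de 0) / z 0 +
    (iota (al 1) * z 1 + iota (de 1) / z 1) + (iota (al 2) * z 2 + iota (de 2) / z 2) - 1)).
  by rewrite /gG /x /th /y /a0 /a1 /a2 /d0 /d1 /d2; field; rewrite !(d_z dz).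
by rewrite h subrr mulr0.
Qed.

Let x0 := tau 0. Let th0 := tau 1. Let y0 := tau 2.
Let X0 := iota x0. Let T0 := iota th0. Let Y0 := iota y0.

(** Divided differences of [gG], changing one coordinate at a time from the generic point to tau, so
    that [gg_rel] telescopes. Their values [gv] form the gradient at tau. *)
Definition gg (i : 'I_3) : K := match val i with
  | 0 => (x + X0) * (a0 * th * y + a1 * th ^+ 2 * y) + th * (a2 * y ^+ 2 + d2 - y)
  | 1 => a0 * X0 ^+ 2 * y + d0 * y + a1 * X0 ^+ 2 * (th + T0) * y + X0 * (a2 * y ^+ 2 + d2 - y)
  | _ => a0 * X0 ^+ 2 * T0 + d0 * T0 + a1 * X0 ^+ 2 * T0 ^+ 2 + d1 + a2 * X0 * T0 * (y + Y0) - X0 * T0 end.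

Definition gv (i : 'I_3) : k := match val i with
  | 0 => (x0 + x0) * (al 0 * th0 * y0 + al 1 * th0 ^+ 2 * y0) + th0 * (al 2 * y0 ^+ 2 + de 2 - y0)
  | 1 => al 0 * x0 ^+ 2 * y0 + de 0 * y0 + al 1 * x0 ^+ 2 * (th0 + th0) * y0 + x0 * (al 2 * y0 ^+ 2 + de 2 - y0)
  | _ => al 0 * x0 ^+ 2 * th0 + de 0 * th0 + al 1 * x0 ^+ 2 * th0 ^+ 2 + de 1 + al 2 * x0 * th0 * (y0 + y0) - x0 * th0 end.

Lemma vx : v x x0. Proof. exact: (vt 0). Qed.
Lemma vth : v th th0. Proof. exact: (vt 1). Qed.
Lemma vy : v y y0. Proof. exact: (vt 2). Qed.

Ltac pl := repeat first [exact: vx | exact: vth | exact: vy | exact: (pl_c plv) | apply: (pl_N plv) | apply: (pl_D plv) | apply: (pl_B plv) | apply: (pl_M plv) | apply: (pl_X plv)].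

Lemma vgg i : v (gg i) (gv i).
Proof. by rewrite /gg /gv; case: i => -[|[|[|//]]] ? /=; pl. Qed.

Definition G0 := al 0 * x0 ^+ 2 * th0 * y0 + de 0 * th0 * y0 + al 1 * x0 ^+ 2 * th0 ^+ 2 * y0 + de 1 * y0 + al 2 * x0 * th0 * y0 ^+ 2 + de 2 * x0 * th0 - x0 * th0 * y0.

Lemma G00 : G0 = 0.
Proof. by apply: (pl_fun plv (f := gG)); last rewrite gG0; [rewrite /gG /G0; pl|exact: (pl_0 plv)]. Qed.

Lemma gg_rel : \sum_i gg i * (chart z i - iota (tau i)) = 0.
Proof.
rewrite sum3 /chart /gg /= -/x -/th -/y -/X0 -/T0 -/Y0.
transitivity (gG - iota G0); last by rewrite gG0 G00 rmorph0 subr0.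
rewrite /gG /G0 !(rmorphB, rmorphD, rmorphM, rmorphXn) /= -/X0 -/T0 -/Y0 -/a0 -/a1 -/a2 -/d0 -/d1 -/d2.
by ring.
Qed.

(** If the gradient vanished, the equation minus y_0 times its y-derivative would give x_0 th_0
    (al_2 y_0^2 + de_2) = 0. Each vanishing factor contradicts another partial derivative, since the
    de_i are nonzero. *)
Lemma gv_neq0 : exists c, gv c != 0.
Proof.
case: (boolP [exists c, gv c != 0]) => [/existsP //|/existsPn h].
have e i : gv i = 0 by have := h i; rewrite negbK => /eqP.
have := e 0; have := e 1; have := e 2; rewrite /gv /= !addrr_pchar2 // mul0r add0r !mulr0 mul0r !addr0 => e2 e1 e0.
have : x0 * th0 * (al 2 * y0 ^+ 2 + de 2) = 0.
  rewrite -[RHS]G00 -[LHS]addr0 -(mulr0 y0) -e2 /G0; ring.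
move/eqP; rewrite !mulf_eq0 => /orP[/orP[] /eqP f|/eqP f].
- have th00 : th0 != 0.
    by apply: contraNneq (d_de dz 1) => t0; move/eqP: e2; rewrite f t0 !(mulr0, mul0r, expr0n, addr0, add0r, subr0).
  have yy0 : y0 = 0.
    apply/eqP; move/eqP: e1; rewrite f !(mulr0, mul0r, expr0n, addr0, add0r, subr0) /= ?(mulr0, mul0r, addr0, add0r) mulf_eq0.
    by rewrite (negbTE (d_de dz 0)).
  move/eqP: e0; rewrite yy0 expr0n /= mulr0 add0r subr0 mulf_eq0 (negbTE th00) /=.
  by rewrite (negbTE (d_de dz 2)).
- move/eqP: e2; rewrite f !(mulr0, mul0r, expr0n, addr0, add0r, subr0) /= ?(mulr0, mul0r, addr0, add0r, subr0).
  by rewrite (negbTE (d_de dz 1)).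
have yy0 : y0 != 0.
  by apply: contraNneq (d_de dz 2) => t0; move/eqP: f; rewrite t0 expr0n /= mulr0 add0r.
move/eqP: e0; rewrite f sub0r mulrN oppr_eq0 mulf_eq0 (negbTE yy0) orbF => /eqP t0.
by move/eqP: e2; rewrite t0 !(mulr0, mul0r, expr0n, addr0, add0r, subr0) /= ?(mulr0, mul0r, addr0, add0r, subr0) (negbTE (d_de dz 1)).
Qed.

Lemma z2_neq : iota (al 2) * z 2 + iota (de 2) / z 2 != 0.
Proof.
have cK : 2%N \in [pchar K] by exact: rmorph_pchar char2.
apply/eqP => h; have := d_rel dz; rewrite sum3 h addr0 => e.
pose P : {mpoly k[2]} := pB al de.
have [] // := d_free dz (P := P) (Q := 0).
  rewrite rmorph0 mulr0 addr0 /P /pB !(rmorphD, rmorphN) /= !mmapZ !(rmorphM, rmorphXn) /= !mmapX !mmap1U zz0 zz1.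
  transitivity (z 0 * z 1 * (iota (al 0) * z 0 + iota (de 0) / z 0 + (iota (al 1) * z 1 + iota (de 1) / z 1) - 1)).
    by field; rewrite !(d_z dz).
  by rewrite e subrr mulr0.
by move/eqP; rewrite (negbTE (pB_neq0 dz)).
Qed.

Definition gd (i : 'I_3) : K := match val i with
  | 0 => th * (a2 * y ^+ 2 + d2 - y)
  | 1 => a0 * x ^+ 2 * y + d0 * y + x * (a2 * y ^+ 2 + d2 - y)
  | _ => a0 * x ^+ 2 * th + d0 * th + a1 * x ^+ 2 * th ^+ 2 + d1 - x * th end.

Lemma vgd i : v (gd i) (gv i).
Proof.
rewrite /gd /gv; case: i => -[|[|[|//]]] ? /=; rewrite addrr_pchar2 // ?mulr0 ?mul0r ?addr0 ?add0r; pl.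
Qed.

Lemma D_exp2 D f : k_derivation iota D -> D (f ^+ 2) = 0.
Proof.
have cK : 2%N \in [pchar K] by exact: rmorph_pchar char2.
by case=> _ DM _; rewrite expr2 DM mulrC addrr_pchar2.
Qed.

Lemma D_opp D f : k_derivation iota D -> D (- f) = - D f.
Proof.
case=> DD DM Dc; rewrite -mulN1r -(rmorph1 iota) -rmorphN DM Dc mul0r add0r rmorphN rmorph1 mulN1r //.
Qed.

Lemma D_rel D : k_derivation iota D -> gd 0 * D x + gd 1 * D th + gd 2 * D y = 0.
Proof.
move=> hD; have [DD DM Dc] := hD; have sq f := D_exp2 f hD.
have : D gG = 0 by rewrite gG0; have := Dc 0; rewrite rmorph0.
rewrite /gG /gd /=; move: (Dc (al 0)) (Dc (al 1)) (Dc (al 2)) (Dc (de 0)) (Dc (de 1)) (Dc (de 2)).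
rewrite -/a0 -/a1 -/a2 -/d0 -/d1 -/d2; move: (sq x) (sq th) (sq y).
clearbody x th y a0 a1 a2 d0 d1 d2.
move: (x ^+ 2) (th ^+ 2) (y ^+ 2) => X2 T2 Y2 e1 e2 e3 e4 e5 e6 e7 e8 e9.
rewrite !DD D_opp // !DM e1 e2 e3 e4 e5 e6 e7 e8 e9 => e; rewrite -[RHS]e; exact: D_rel_ring.
Qed.

(** By [D_rel] the gradient annihilates the vectors of derivatives of the three coordinates under D1
    and D2, so their 2 x 2 minors are proportional to the gradient. It remains to identify one
    minor, the one for c = 2. *)
Lemma om_chart (c : 'I_3) D1 D2 : k_derivation iota D1 -> k_derivation iota D2 -> gv c != 0 ->
  om z al de D1 D2 = (gd c)^-1 *
    (D1 (chart z (c + 1) - iota (tau (c + 1))) * D2 (chart z (c + 2) - iota (tau (c + 2))) -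
     D1 (chart z (c + 2) - iota (tau (c + 2))) * D2 (chart z (c + 1) - iota (tau (c + 1)))).
Proof.
have cK : 2%N \in [pchar K] by exact: rmorph_pchar char2.
move=> h1 h2 gc.
have DB D f e : k_derivation iota D -> D (f - iota e) = D f.
  by move=> hD; have [DD _ Dc] := hD; rewrite DD D_opp // Dc subr0.
rewrite !DB // (oppr_pchar2 cK).
have gc0 : gd c != 0 := pl_neq0 plv (vgd c) gc.
have x_n0 : x != 0 by apply: (d_z dz).
have y_n0 : y != 0 by apply: (d_z dz).
have th_n0 : th != 0 by rewrite mulf_neq0 ?invr_eq0 ?(d_z dz).
have z1E : z 1 = x * th by rewrite /th /x mulrC mulfVK ?(d_z dz).
have zE := z2_neq.
have wE : a2 * y ^+ 2 + d2 != 0.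
  apply: contraNneq zE => w0.
  have -> : iota (al 2) * z 2 + iota (de 2) / z 2 = (a2 * y ^+ 2 + d2) / y by rewrite /a2 /d2 /y; field; rewrite (d_z dz).
  by rewrite w0 mul0r.
have gyE : y * gd 2 = x * th * (a2 * y ^+ 2 + d2).
  apply: (@char2_eq _ (- (x * th * (a2 * y ^+ 2 + d2)))) => //.
  rewrite -[LHS]subr0 -gG0 /gd /gG /=; ring.
have g2 : gd 2 != 0.
  by apply: contraNneq (mulf_neq0 (mulf_neq0 x_n0 th_n0) wE) => g0; rewrite -gyE g0 mulr0.
have base : om z al de D1 D2 = (gd 2)^-1 * (D1 x * D2 th + D1 th * D2 x).
  have [_ M1 _] := h1; have [_ M2 _] := h2.
  rewrite /om -/x -/y -/a2 -/d2 z1E M1 M2.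
  have -> : D1 x * (D2 x * th + x * D2 th) + (D1 x * th + x * D1 th) * D2 x = x * (D1 x * D2 th + D1 th * D2 x).
    by apply: (@char2_eq _ (D1 x * D2 x * th)) => //; ring.
  have -> : x * (x * th) * (a2 * y + d2 / y) = x * gd 2.
    by apply: (mulfI y_n0); rewrite [RHS]mulrCA gyE; field.
  by rewrite invfM mulrACA mulfV // mul1r mulrC.
have r1 := D_rel h1; have r2 := D_rel h2.
have sw2 (A B C A' B' C' g0 g1 : K) : g0 * A + g1 * B + gd 2 * C = 0 -> g0 * A' + g1 * B' + gd 2 * C' = 0 ->
   g0 * (A * B' + B * A') = gd 2 * (B * C' + C * B').
  move=> e e'; apply: (@char2_eq _ (- (g1 * B * B' + gd 2 * (B * C' + C * B')))) => //.
  apply/eqP; rewrite -subr_eq0; apply/eqP.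
  transitivity ((g0 * A + g1 * B + gd 2 * C) * B' + (g0 * A' + g1 * B' + gd 2 * C') * B); first by ring.
  by rewrite e e' !mul0r addr0.
elim/ord3_ind: c gc gc0 => gc gc0.
- have -> : (0 + 1 = 1 :> 'I_3) by apply: val_inj.
  have -> : (0 + 2 = 2 :> 'I_3) by apply: val_inj.
  rewrite base /chart /= -/x -/th -/y.
  by apply: (mulfI gc0); rewrite mulVKf // mulrCA (sw2 _ _ _ _ _ _ _ _ r1 r2) mulKf //.
- have -> : (1 + 1 = 2 :> 'I_3) by apply: val_inj.
  have -> : (1 + 2 = 0 :> 'I_3) by apply: val_inj.
  rewrite base /chart /= -/x -/th -/y.
  apply: (mulfI gc0); rewrite mulVKf // mulrCA.
  have e1 : gd 1 * D1 th + gd 0 * D1 x + gd 2 * D1 y = 0 by rewrite -r1; ring.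
  have e2 : gd 1 * D2 th + gd 0 * D2 x + gd 2 * D2 y = 0 by rewrite -r2; ring.
  rewrite [D1 x * D2 th + _]addrC (sw2 _ _ _ _ _ _ _ _ e1 e2) mulKf // addrC; ring.
have -> : (2 + 1 = 0 :> 'I_3) by apply: val_inj.
have -> : (2 + 2 = 1 :> 'I_3) by apply: val_inj.
by rewrite base /chart /= -/x -/th -/y addrC.
Qed.

(** Multiplied by z_1, the coordinates of Sigma become regular, and the one proportional to 1/z_1
    becomes a constant: Sigma is dominated on this chart. Only z_1/z_2 is not a visible polynomial;
    it comes from the relation multiplied by z_1. *)
Lemma chart_dom i : reg v (z 1 * z i) /\ reg v (z 1 / z i).
Proof.
have rx : reg v x by exists x0; exact: vx.
have rt : reg v th by exists th0; exact: vth.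
have ry : reg v y by exists y0; exact: vy.
have z1E : z 1 = x * th by rewrite /th /x mulrC mulfVK ?(d_z dz).
have r1 : reg v (z 1) by rewrite z1E; apply: (regM plv).
have r0 : reg v (z 0) by [].
split; first by apply: (regM plv) => //; elim/ord3_ind: i.
elim/ord3_ind: i; [exact: rt|rewrite mulfV ?(d_z dz) //; exact: (reg1 plv)|].
have -> : z 1 / z 2 = iota (de 2)^-1 * (z 1 - a0 * (z 0 * z 1) - d0 * th - a1 * (z 1 ^+ 2) - d1 - a2 * (z 2 * z 1)).
  have := d_rel dz; rewrite sum3 => h.
  have d20 : d2 != 0 by rewrite fmorph_eq0 (d_de dz).
  rewrite fmorphV; apply: (mulfI d20); rewrite mulVKf //.
  rewrite -[X in _ = X - _ - _ - _ - _ - _]mul1r -h /th -/d0 -/d1 -/d2 -/a0 -/a1 -/a2; field.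
  by rewrite !(d_z dz).
by apply: (regM plv); [exact: (regC plv)|]; repeat apply: (regB plv) => //; repeat apply: (regM plv) => //; try exact: (regC plv); apply: (regX plv).
Qed.

End OneChart.
End Chart.

(** * The model in (P^1)^5 and its symmetries *)

Section Model.
Variables (k : fieldType) (char2 : 2%N \in [pchar k]) (K : fieldType) (iota : {rmorphism k -> K}).

(** The symmetries that bring any point into the standard chart: z_i is inverted where [sg i] holds,
    then indices 0 and 1 are exchanged if [b]. *)
Definition zfs (sg : 'I_3 -> bool) (b : bool) (z : 'I_3 -> K) : 'I_3 -> K := if b then sw (zflip sg z) else zflip sg z.
Definition cfs (sg : 'I_3 -> bool) (b : bool) (al de : 'I_3 -> k) : 'I_3 -> k := if b then sw (cflip sg al de) else cflip sg al de.

Lemma datum_fs sg b z al de : datum iota z al de -> datum iota (zfs sg b z) (cfs sg b al de) (cfs sg b de al).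
Proof. by rewrite /zfs /cfs => dz; case: b; [apply: datum_sw|]; apply: datum_flip. Qed.

Definition pib (b : bool) (i : 'I_3) : 'I_3 := if b then tperm 0 1 i else i.

Lemma pibK b : involutive (pib b).
Proof. by rewrite /pib; case: b => // i; rewrite tpermK. Qed.

Lemma zfsE sg b z i : zfs sg b z i = zflip sg z (pib b i).
Proof. by rewrite /zfs /pib; case: b. Qed.

Lemma zfs_pm sg b z i : (z i = zfs sg b z (pib b i)) \/ (z i = (zfs sg b z (pib b i))^-1).
Proof. by rewrite zfsE pibK /zflip; case: (sg i); [right; rewrite invrK|left]. Qed.

Variables (z : 'I_3 -> K) (al de : 'I_3 -> k).
Hypothesis dz : datum iota z al de.

(** Inverting z changes dlog z by a sign only, hence not at all in characteristic 2. *)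
Lemma om_fs sg b D1 D2 : k_derivation iota D1 -> k_derivation iota D2 ->
  om iota (zfs sg b z) (cfs sg b al de) (cfs sg b de al) D1 D2 = om iota z al de D1 D2.
Proof.
move=> h1 h2; have cK : 2%N \in [pchar K] by exact: rmorph_pchar char2.
have oppE (f : K) : - f = f by rewrite oppr_pchar2.
have DV D f : k_derivation iota D -> f != 0 -> D f^-1 = D f / f ^+ 2.
  move=> hD f0; have [_ DM Dc] := hD; have : D (f * f^-1) = 0.
    by rewrite mulfV //; have := Dc 1; rewrite rmorph1.
  rewrite DM => /(congr1 (fun g => g / f)); rewrite mul0r mulrDl (mulrC f) mulfK // => e.
  apply/eqP; rewrite -subr_eq0 oppE; apply/eqP; rewrite -[RHS]e addrC; congr (_ + _).
  by rewrite -mulrA -invfM.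
have flip sg' : om iota (zflip sg' z) (cflip sg' al de) (cflip sg' de al) D1 D2 = om iota z al de D1 D2.
  rewrite /om; have -> : iota (cflip sg' al de 2) * zflip sg' z 2 + iota (cflip sg' de al 2) / zflip sg' z 2 = iota (al 2) * z 2 + iota (de 2) / z 2.
    by rewrite /cflip /zflip; case: (sg' 2); rewrite // invrK addrC.
  move: (iota (al 2) * z 2 + _) => w.
  have E f g : (D1 f * D2 g + D1 g * D2 f) / (f * g * w) = ((D1 f / f) * (D2 g / g) + (D1 g / g) * (D2 f / f)) / w.
    by rewrite !mulf_div (mulrC g f) -mulrDl -[RHS]mulrA -invfM.
  have dl D i : k_derivation iota D -> D (zflip sg' z i) / zflip sg' z i = D (z i) / z i.
    move=> hD; rewrite /zflip; case: (sg' i) => //.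
    by rewrite (DV _ _ hD (d_z dz i)) invrK expr2 invfM mulrA mulfVK ?(d_z dz).
  by rewrite !E !dl.
rewrite /zfs /cfs; case: b; rewrite -(flip sg) // /om /sw /= tpermL tpermR tpermD //.
by congr (_ / (_ * _)); [rewrite addrC; congr (_ + _); rewrite mulrC|rewrite mulrC].
Qed.

Definition phi (z : 'I_3 -> K) (s : 'I_5) : K :=
  match val s with 0 => z 0 | 1 => z 1 | 2 => z 2 | 3 => z 0 / z 1 | _ => z 0 * z 1 end.

Lemma phi_neq0 s : phi z s != 0.
Proof.
have h := d_z dz.
by rewrite /phi; case: s => -[|[|[|[|[|//]]]]] ? /=; rewrite ?mulf_neq0 ?invr_eq0 ?h.
Qed.

Lemma phi_fs sg b s : exists s', phi z s = phi (zfs sg b z) s' \/ phi z s = (phi (zfs sg b z) s')^-1.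
Proof.
have h := d_z dz; have h0 := h 0; have h1 := h 1; have h2 := h 2.
have E0 : zfs sg b z 0 = zflip sg z (if b then 1 else 0) by rewrite zfsE /pib; case: (b); rewrite ?tpermL.
have E1 : zfs sg b z 1 = zflip sg z (if b then 0 else 1) by rewrite zfsE /pib; case: (b); rewrite ?tpermR.
have E2 : zfs sg b z 2 = zflip sg z 2 by rewrite zfsE /pib; case: (b); rewrite ?tpermD.
pose i0 : 'I_5 := inord 0; pose i1 : 'I_5 := inord 1; pose i2 : 'I_5 := inord 2; pose i3 : 'I_5 := inord 3; pose i4 : 'I_5 := inord 4.
have pE (z' : 'I_3 -> K) : [/\ phi z' i0 = z' 0, phi z' i1 = z' 1, phi z' i2 = z' 2, phi z' i3 = z' 0 / z' 1 & phi z' i4 = z' 0 * z' 1].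
  by rewrite /phi /i0 /i1 /i2 /i3 /i4 /= !inordK.
have [p0 p1 p2 p3 p4] := pE (zfs sg b z).
have : [\/ s = i0, s = i1, s = i2 | s = i3 \/ s = i4].
  case: s => -[|[|[|[|[|//]]]]] ?; [apply: Or41|apply: Or42|apply: Or43|apply: Or44; left|apply: Or44; right]; by apply: val_inj; rewrite /= inordK.
have [q0 q1 q2 q3 q4] := pE z.
case=> [->|->|->|[->|->]].
- exists (if b then i1 else i0); rewrite q0; case: b E0 E1 p0 p1 {pE p2 p3 p4 E2} => E0 E1 p0 p1; rewrite ?p0 ?p1 ?E0 ?E1 /zflip; case: (sg 0); by [left|right; rewrite invrK].
- exists (if b then i0 else i1); rewrite q1; case: b E0 E1 p0 p1 {pE p2 p3 p4 E2} => E0 E1 p0 p1; rewrite ?p0 ?p1 ?E0 ?E1 /zflip; case: (sg 1); by [left|right; rewrite invrK].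
- by exists i2; rewrite q2 p2 E2 /zflip; case: (sg 2); [right; rewrite invrK|left].
- rewrite q3; exists (if sg 0 == sg 1 then i3 else i4); case: b E0 E1 {pE p0 p1 p2 E2} p3 p4 => E0 E1 p3 p4; rewrite /zflip in E0 E1; case: (sg 0) E0 E1 => E0 E1; case: (sg 1) E0 E1 => E0 E1; rewrite ?p3 ?p4 E0 E1; by [left; rewrite ?(invfM, invrK) // mulrC|right; rewrite ?(invfM, invrK) // mulrC].
- rewrite q4; exists (if sg 0 == sg 1 then i4 else i3); case: b E0 E1 {pE p0 p1 p2 E2} p3 p4 => E0 E1 p3 p4; rewrite /zflip in E0 E1; case: (sg 0) E0 E1 => E0 E1; case: (sg 1) E0 E1 => E0 E1; rewrite ?p3 ?p4 E0 E1; by [left; rewrite ?(invfM, invrK) // mulrC|right; rewrite ?(invfM, invrK) // mulrC].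
Qed.

(** The Segre embedding of (P^1)^5: the factor s has coordinates (1, [phi z s]), and a Segre
    coordinate is the choice of the subset of factors contributing [phi]. *)
Definition yseg : 'rV[K]_#|{set 'I_5}| := \row_l \prod_(s in (enum_val l : {set 'I_5})) phi z s.

Lemma ysegE (I : {set 'I_5}) : yseg 0 (enum_rank I) = \prod_(s in I) phi z s.
Proof. by rewrite mxE enum_rankK. Qed.

Lemma yseg_neq0 l : yseg 0 l != 0.
Proof. by rewrite mxE; apply/prodf_neq0 => s _; apply: phi_neq0. Qed.

Lemma yseg_field : has_function_field iota yseg.
Proof.
apply: (function_field_gen (z := z)).
- by apply/eqP => e; have := yseg_neq0 (enum_rank set0); rewrite e mxE eqxx.
- by move=> S *; apply: (d_gen dz).
move=> i; have [s sE] : exists s, phi z s = z i.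
  by elim/ord3_ind: i; [exists (inord 0)|exists (inord 1)|exists (inord 2)]; rewrite /phi /= inordK.
exists 1%N, 'X_(enum_rank [set s]), 'X_(enum_rank set0).
rewrite !dhomogX /= !mdeg1 /hval !mmapX !mmap1U !ysegE big_set1 big_set0 oner_eq0 divr1 sE; split=> //.
Qed.

Section AtPoint.
Variables (w : K -> k -> Prop) (plw : place iota w).

End AtPoint.

Lemma yseg_sign p : point iota yseg p -> exists J : {set 'I_5},
  forall s, reg (vp iota yseg p) (if s \in J then (phi z s)^-1 else phi z s).
Proof.
move=> pt; have [j pj _] := point_neq0 pt; exists (enum_val j) => s.
have yj := yseg_neq0 j.
pose J : {set 'I_5} := enum_val j.
have yJ : yseg 0 j = \prod_(s in J) phi z s by rewrite mxE.
case: ifP => sJ.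
  exists (p 0 (enum_rank (J :\ s)) / p 0 j).
  have -> : (phi z s)^-1 = yseg 0 (enum_rank (J :\ s)) / yseg 0 j.
    rewrite ysegE yJ [X in _ / X](big_setD1 s) //= invfM mulrCA mulfV ?mulr1 //.
    by apply/prodf_neq0 => *; apply: phi_neq0.
  exact: vp_ratio.
exists (p 0 (enum_rank (s |: J)) / p 0 j).
have -> : phi z s = yseg 0 (enum_rank (s |: J)) / yseg 0 j.
  rewrite ysegE yJ big_setU1 ?sJ //= mulfK //.
  by apply/prodf_neq0 => *; apply: phi_neq0.
exact: vp_ratio.
Qed.

Definition yratio (I J : {set 'I_5}) : K := \prod_(s in I :\: J) phi z s * \prod_(s in J :\: I) (phi z s)^-1.

Lemma yratioE i j : yseg 0 i / yseg 0 j = yratio (enum_val i) (enum_val j).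
Proof.
rewrite !mxE; set I := enum_val i; set J := enum_val j.
rewrite (big_setID J) /= [X in _ / X](big_setID I) /= setIC invfM mulrACA mulfV ?mul1r.
  by rewrite /yratio prodfV.
by apply/prodf_neq0 => *; apply: phi_neq0.
Qed.

Lemma reg_signs (w : K -> k -> Prop) (J : {set 'I_5}) : place iota w ->
  (forall s, reg w (if s \in J then (phi z s)^-1 else phi z s)) ->
  forall i, reg w (yseg 0 i / yseg 0 (enum_rank J)).
Proof.
move=> plw h i; rewrite yratioE enum_rankK; apply: (regM plw); apply: (reg_prod plw) => s; rewrite inE => /andP[h1 h2].
  by have := h s; rewrite (negbTE h1).
by have := h s; rewrite h2.
Qed.

(** The flips follow from which of z_i and 1/z_i is regular at p. The ratio of the flipped z_0 and
    z_1 is, up to inversion, z_0/z_1 or z_0 z_1, both coordinates of the model, and this decides the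
    swap. Conversely the chart algebra localized at tau has a centre on the model, which must be
    p. *)
Lemma yseg_chart p : point iota yseg p -> exists sg b tau,
  (forall i, vp iota yseg p (chart (zfs sg b z) i) (tau i)) /\
  (forall f r, vp iota yseg p f r -> loc iota (chart (zfs sg b z)) tau f r).
Proof.
move=> pt; have plv := place_vp pt; have [J hJ] := yseg_sign pt; set v := vp iota yseg p in plv hJ *.
have h0 := d_z dz 0; have h1 := d_z dz 1.
pose sg (i : 'I_3) := (inord i : 'I_5) \in J.
have ph (i : 'I_3) : phi z (inord i) = z i.
  by elim/ord3_ind: i; rewrite /phi /= inordK.
have zr i : reg v (zflip sg z i) by have := hJ (inord i); rewrite ph.
have [b hb] : exists b, reg v (zfs sg b z 1 / zfs sg b z 0).
  suff : reg v (zflip sg z 1 / zflip sg z 0) \/ reg v (zflip sg z 0 / zflip sg z 1).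
    by case=> h; [exists false|exists true; rewrite !zfsE /pib tpermL tpermR].
  have := hJ (inord 3); have := hJ (inord 4); rewrite /phi /= !inordK // /zflip.
  have e1 : (z 0 / z 1)^-1 = z 1 / z 0 by rewrite invf_div.
  case: (sg 0); case: (sg 1); rewrite ?invrK ?e1.
  - by move=> _; case: ifP => _ h; [right|left]; rewrite mulrC.
  - by move=> h _; move: h; case: ifP => _ h; [right; rewrite -invfM|left; rewrite mulrC].
  - by move=> h _; move: h; case: ifP => _ h; [left; rewrite -invfM mulrC|right].
  - by move=> _; case: ifP => _ h; [left|right].
have [tau ht] : exists tau, forall i, v (chart (zfs sg b z) i) (tau i).
  have /choice[tau ht] i : reg v (chart (zfs sg b z) i); last by exists tau.
  by elim/ord3_ind: i; rewrite /chart /=; [rewrite zfsE|exact: hb|rewrite zfsE].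
exists sg, b, tau; split=> // f r fr.
pose w := loc iota (chart (zfs sg b z)) tau.
have plw : place iota w by apply: place_loc; apply: place_spec ht.
have wv f' r' : w f' r' -> v f' r' by apply: loc_sub.
have wc i : reg w (chart (zfs sg b z) i) by exists (tau i); apply: loc_var.
have dzf := datum_fs sg b dz.
have c0 := wc 0; have c1 := wc 1; have c2 := wc 2; rewrite /chart /= in c0 c1 c2.
have z1r : reg w (zfs sg b z 1) by rewrite -[zfs sg b z 1](mulfVK (d_z dzf 0)); apply: (regM plw).
have pm s : reg w (phi (zfs sg b z) s) \/ reg w (phi (zfs sg b z) s)^-1.
  rewrite /phi; case: s => -[|[|[|[|[|//]]]]] ? /=; [by left|by left|by left|by right; rewrite invf_div|left; exact: (regM plw)].
have pm' s : reg w (phi z s) \/ reg w (phi z s)^-1.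
  have [s' [->|->]] := phi_fs sg b s; first exact: pm.
  by rewrite invrK or_comm; exact: pm.
(* The place [w] is contained in that of p. If f' is regular at p and 1/f' is regular in [w], then
   the value of 1/f' is nonzero and f' is regular in [w]. *)
have up f' : reg v f' -> reg w f' \/ reg w f'^-1 -> reg w f'.
  move=> [s hs] [//|[t ht']]; have f0 : f' != 0 \/ f' = 0 by case: (eqVneq f' 0) => [e|e]; [right|left].
  case: f0 => [f0|->]; last by exists 0; exact: (pl_0 plw).
  have t0 : t != 0.
    apply: contra_neq (oner_neq0 k) => t0.
    by apply: (pl_fun plv (f := f'^-1 * f')); [rewrite mulVf //; exact: (pl_1 plv)|rewrite -[0](mul0r s) -t0; apply: (pl_M plv) => //; exact: wv].
  by exists t^-1; rewrite -[f']invrK; apply: (pl_V plw).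
have sw' s : reg w (if s \in J then (phi z s)^-1 else phi z s).
  have := hJ s; case: ifP => _ h; last by apply: (up) => //; exact: pm'.
  by apply: (up) => //; rewrite invrK or_comm; exact: pm'.
have /choice[be hbe] := reg_signs plw sw'.
have [ptb _ sub] := point_place plw (yseg_neq0 _) hbe.
have [j pj _] := point_neq0 pt.
have hloc := vp_loc pt; 
have plb := place_vp ptb.
pose J' := enum_rank J.
have [t hvt] : exists t, v f t by exists r.
have pJ : p 0 J' != 0.
  have [e he] : reg v (yseg 0 j / yseg 0 J').
    by exists (be j); apply: wv; exact: hbe.
  apply: contra_neq (oner_neq0 k) => pJ0.
  have hr := vp_ratio iota yseg J' pj.
  apply: (pl_fun plv (f := yseg 0 J' / yseg 0 j * (yseg 0 j / yseg 0 J'))).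
    by rewrite mulrA mulfVK ?yseg_neq0 // mulfV ?yseg_neq0 //; exact: (pl_1 plv).
  by have := pl_M plv hr he; rewrite pJ0 !mul0r.
have := vp_loc pt pJ fr; apply: loc_sub => // i.
have [e he] : reg w (yseg 0 i / yseg 0 J') by exists (be i); exact: hbe.
have -> // : p 0 i / p 0 J' = e.
by apply: (pl_fun plv (f := yseg 0 i / yseg 0 J')); [exact: vp_ratio|exact: wv].
Qed.

Lemma yseg_smooth : smooth_surface iota yseg.
Proof.
split; [exact: yseg_field|exact: (trdeg2_K dz)|].
move=> p pt; have [sg [b [tau [ht gen]]]] := yseg_chart pt; have plv := place_vp pt.
have dzf := datum_fs sg b dz.
have [c hc] := gv_neq0 char2 dzf plv ht.
have [u0 w0 hp] := smooth_params plv ht gen (vgg _ _ plv ht) (gg_rel dzf plv ht) hc.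
exists (chart (zfs sg b z) (c + 1) - iota (tau (c + 1))), (chart (zfs sg b z) (c + 2) - iota (tau (c + 2))).
split; [exact/max_idealE|exact/max_idealE|].
by move=> f /max_idealE /hp[a' [b' [ha hb e]]]; exists a', b'; split=> //; apply/local_ringE.
Qed.

Lemma yseg_canonical : trivial_canonical iota yseg.
Proof.
exists (om iota z al de) => p pt; have [sg [b [tau [ht gen]]]] := yseg_chart pt; have plv := place_vp pt.
have dzf := datum_fs sg b dz.
have [c hc] := gv_neq0 char2 dzf plv ht.
have [u0 w0 hp] := smooth_params plv ht gen (vgg _ _ plv ht) (gg_rel dzf plv ht) hc.
have gdv := vgd char2 (cfs sg b al de) (cfs sg b de al) plv ht c.
exists (chart (zfs sg b z) (c + 1) - iota (tau (c + 1))), (chart (zfs sg b z) (c + 2) - iota (tau (c + 2))).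
exists (gd iota (zfs sg b z) (cfs sg b al de) (cfs sg b de al) c)^-1; split.
- split; [exact/max_idealE|exact/max_idealE|].
  by move=> f /max_idealE /hp[a' [b' [ha hb e]]]; exists a', b'; split=> //; apply/local_ringE.
- by apply/local_ringE; exists (gv (cfs sg b al de) (cfs sg b de al) tau c)^-1; apply: (pl_V plv).
- move/max_idealE => h; have := pl_V plv gdv hc => h'.
  by have /eqP := pl_fun plv h h'; rewrite eq_sym invr_eq0 (negbTE hc).
by move=> D1 D2 h1 h2; rewrite -(om_fs sg b h1 h2) (om_chart char2 dzf plv ht h1 h2 hc).
Qed.

End Model.

Section Dominates.
Variables (k : fieldType) (char2 : 2%N \in [pchar k]) (a sc sd : 'I_3 -> k).
Hypothesis a_inj : injective a.
Variables (K : fieldType) (iota : {rmorphism k -> K}) (z : 'I_3 -> K).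
Hypothesis dz : datum iota z sc (fun i => sd i * gam a i).

Lemma xptE l : xpt a iota z 0 l = match @split 3 3 l with inl i => z i | inr i => iota (gam a i) / z i end.
Proof. by rewrite mxE. Qed.

Lemma xpt_neq0 l : xpt a iota z 0 l != 0.
Proof.
rewrite xptE; case: split => i; first exact: (d_z dz).
by rewrite mulf_neq0 ?invr_eq0 ?(d_z dz) // fmorph_eq0 gam_neq0.
Qed.

Lemma xpt_dominated n (y : 'rV[K]_n) v j : place iota v ->
  (forall i, reg v (z j * z i) /\ reg v (z j / z i)) \/ (forall i, reg v ((z j)^-1 * z i) /\ reg v ((z j)^-1 / z i)) ->
  exists l, forall i, reg v (xpt a iota z 0 i / xpt a iota z 0 l).
Proof.
move=> plv; case=> h.
  exists (rshift 3 j) => i; rewrite (xptE (rshift 3 j)) (unsplitK (inr j)) xptE invf_div mulrA mulrC.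
  apply: (regM plv); first by rewrite -fmorphV; apply: (regC plv).
  case: split => i'; have [h1 h2] := h i'; first by rewrite mulrC.
  by rewrite -mulrA; apply: (regM plv); [apply: (regC plv)|rewrite mulrC].
exists (lshift 3 j) => i; rewrite (xptE (lshift 3 j)) (unsplitK (inl j)) xptE.
case: split => i'; have [h1 h2] := h i'; first by rewrite mulrC.
by rewrite -mulrA; apply: (regM plv); [apply: (regC plv)|rewrite mulrC].
Qed.

Lemma yseg_dominates : dominates iota (yseg z) (xpt a iota z).
Proof.
apply: dominates_ratio => p pt; have plv := place_vp pt.
have [sg [b [tau [ht gen]]]] := yseg_chart dz pt.
have dzf := datum_fs sg b dz; have dom := chart_dom dzf plv ht.
have dom' i : reg (vp iota (yseg z) p) (zfs sg b z 1 * z i) /\ reg (vp iota (yseg z) p) (zfs sg b z 1 / z i).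
  have [h1 h2] := dom (pib b i).
  by case: (zfs_pm sg b z i) => ->; rewrite ?invrK; split.
have [|l hl] := @xpt_dominated _ (yseg z) _ (pib b 1) plv; last first.
  by exists l; [exact: xpt_neq0|exact: hl].
by have := dom'; rewrite zfsE /zflip; case: (sg _) => h; [right|left].
Qed.
End Dominates.

Lemma sum_lt (p q p1 q1 N : nat) : (p + q < N.+1)%N -> (p1 <= p)%N -> (q1 <= q)%N ->
  (p1 < p)%N \/ (q1 < q)%N -> (p1 + q1 < N)%N.
Proof. lia. Qed.

(** * Minimality *)

Section Minimal.
Variables (k K : fieldType) (iota : {rmorphism k -> K}).
Variables (v : K -> k -> Prop) (plv : place iota v).
Local Notation reg := (reg v).

(** Coefficientwise reduction of a polynomial to the residue field. *)
Definition red (H : {poly K}) (h : {poly k}) := forall i, v H`_i h`_i.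

Lemma redC c : red (iota c)%:P c%:P.
Proof. by move=> i; rewrite !coefC; case: ifP => _; [apply: (pl_c plv)|apply: (pl_0 plv)]. Qed.
Lemma redCv f r : v f r -> red f%:P r%:P.
Proof. by move=> h i; rewrite !coefC; case: ifP => _ //; apply: (pl_0 plv). Qed.
Lemma redD F G f g : red F f -> red G g -> red (F + G) (f + g).
Proof. by move=> hF hG i; rewrite !coefD; apply: (pl_D plv). Qed.
Lemma redN F f : red F f -> red (- F) (- f).
Proof. by move=> hF i; rewrite !coefN; apply: (pl_N plv). Qed.
Lemma redM F G f g : red F f -> red G g -> red (F * G) (f * g).
Proof. by move=> hF hG i; rewrite !coefM; apply: (pl_sum plv) => j _; apply: (pl_M plv). Qed.
Lemma redX : red 'X 'X.
Proof. by move=> i; rewrite !coefX; case: eqP => _; [apply: (pl_1 plv)|apply: (pl_0 plv)]. Qed.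
Lemma redXn F f n : red F f -> red (F ^+ n) (f ^+ n).
Proof.
move=> h; elim: n => [|n IH]; last by rewrite !exprS; apply: redM.
by rewrite !expr0 -!polyC1 -(rmorph1 iota); apply: redC.
Qed.

Variables (x th eta : K) (etav : k).
Hypotheses (vx : v x 0) (veta : v eta etav) (x0 : x != 0) (th0 : th != 0).
Variables (aj ai al dj di dl : k).
Hypotheses (ai0 : ai != 0) (dj0 : dj != 0).
Hypothesis rel : iota ai * x ^+ 2 * th * eta ^+ 2 + ((iota aj * x ^+ 2 + iota dj) * th + x * (iota al * th ^+ 2 + iota dl) - x * th) * eta + iota di * th = 0.
Let t (i : 'I_2) : K := if val i is 0%N then x else th.
Hypothesis gen : forall S : K -> Prop, (forall c, S (iota c)) -> S x -> S th -> S eta ->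
  (forall f g, S f -> S g -> S (f + g)) -> (forall f g, S f -> S g -> S (f * g)) ->
  (forall f, S f -> S f^-1) -> forall f, S f.
Hypothesis kap : forall H : {poly K}, (forall i, reg H`_i) -> (exists i r, v H`_i r /\ r != 0) ->
  H.[th] = 0 -> reg th \/ reg th^-1.
Variable e : 'I_4 -> K.
Hypotheses (e_reg : forall i, reg (e i))
  (e_dec : forall f, reg f -> exists c : 'I_4 -> K, (forall i, reg (c i)) /\ f = \sum_i c i ^+ 2 * e i)
  (e_uniq : forall c d : 'I_4 -> K, \sum_i c i ^+ 2 * e i = \sum_i d i ^+ 2 * e i -> forall i, c i = d i).
Hypotheses (ra : reg (x * th)) (rb : reg (x / th)).
Hypothesis nreg : ~ (reg th \/ reg th^-1).

Local Notation ev := (mmap iota t).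
Definition tK (i : 'I_2) : {poly K} := if val i is 0%N then x%:P else 'X.
Definition tk (i : 'I_2) : {poly k} := if val i is 0%N then 0 else 'X.
Definition hK (P : {mpoly k[2]}) : {poly K} := mmap (polyC \o iota) tK P.
Definition rk (P : {mpoly k[2]}) : {poly k} := mmap (@polyC k) tk P.

Lemma hK_ev P : (hK P).[th] = ev P.
Proof.
rewrite /hK /mmap horner_sum; apply: eq_bigr => m _; rewrite hornerM hornerC; congr (_ * _).
rewrite /mmap1 horner_prod; apply: eq_bigr => i _; rewrite horner_exp /tK /t; congr (_ ^+ _).
by case: (val i) => [|n]; rewrite ?hornerC ?hornerX.
Qed.

Lemma red_hK P : red (hK P) (rk P).
Proof.
rewrite /hK /rk /mmap; apply: (big_ind2 red) => [||m _].
- by rewrite -!polyC0 -(rmorph0 iota); apply: redC.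
- by move=> *; apply: redD.
apply: redM; first exact: redC.
apply: (big_ind2 red) => [||i _].
- by rewrite -!polyC1 -(rmorph1 iota); apply: redC.
- by move=> *; apply: redM.
apply: redXn; rewrite /tK /tk; case: (val i) => [|n]; last exact: redX.
by rewrite -polyC0; apply: redCv.
Qed.

(** Values at th of polynomials with nonzero reduction. By [kap] and [nreg] they are nonzero, so
    they can serve as denominators: they define the localization of R[th] at the ideal generated by
    the maximal ideal of R. *)
Definition good (g : K) := exists (H : {poly K}) (h : {poly k}), [/\ h != 0, red H h & g = H.[th]].

Lemma good_neq0 g : good g -> g != 0.
Proof.
move=> [H [h [h0 hr ->]]]; apply/eqP => H0; apply: nreg; apply: (kap (H := H)) => //.
  by move=> i; exists h`_i.
by exists (size h).-1, (lead_coef h); rewrite lead_coef_eq0; split=> //; apply: hr.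
Qed.
Lemma goodM f g : good f -> good g -> good (f * g).
Proof.
move=> [H [h [h0 hr ->]]] [H' [h' [h0' hr' ->]]]; exists (H * H'), (h * h').
by rewrite mulf_neq0 // hornerM; split=> //; apply: redM.
Qed.
Lemma good1 : good 1.
Proof.
exists 1%:P, 1%:P; rewrite hornerC polyC1 oner_eq0 -polyC1; split=> //.
by rewrite -[X in red X%:P](rmorph1 iota); apply: redC.
Qed.

Lemma rk0 P : rk P = 0 -> exists P', P = 'X_ord0 * P'.
Proof.
move=> P0; have c0 (m : 'X_{1..2}) : m ord0 = 0%N -> P@_m = 0.
  move=> m0; have := congr1 (coefp (m ord_max)) P0; rewrite /= coef0 /rk /mmap coef_sum => <-.
  rewrite [X in X@_m]mpolyE raddf_sum /=; apply: eq_bigr => m' _.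
  rewrite mcoeffZ mcoeffX /mmap1 big_ord_recr big_ord1 /= coefCM; congr (_ * _).
  have -> : widen_ord (leqnSn 1) ord0 = ord0 by apply: val_inj.
  rewrite /tk /=; case m'0: (m' ord0) => [|n].
    rewrite expr0 mul1r coefXn; have [e1|n1] := eqVneq (m ord_max) (m' ord_max).
      have -> : m' = m by apply: (msupp2 k); rewrite ?m'0 ?m0 ?e1.
      by rewrite eqxx.
    by case: eqP => // e1; rewrite e1 eqxx in n1.
  rewrite exprS !mul0r coef0; case: eqP => // e1; by rewrite e1 m0 in m'0.
exists (\sum_(m <- msupp P) P@_m *: 'X_[m - U_(ord0)]).
rewrite {1}[P]mpolyE mulr_sumr; apply: eq_big_seq => m mP.
rewrite -scalerAr -mpolyXD addmC submK // lep1mP.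
by apply: contraTneq mP => /c0 m0; rewrite mcoeff_msupp m0 eqxx.
Qed.

Lemma xdiv P Q : P != 0 \/ Q != 0 -> exists n P' Q', [/\ P = 'X_ord0 ^+ n * P', Q = 'X_ord0 ^+ n * Q' & rk P' != 0 \/ rk Q' != 0].
Proof.
have X0 : 'X_ord0 != 0 :> {mpoly k[2]}.
  by apply/eqP => /(congr1 (mcoeff U_(ord0)))/eqP; rewrite mcoeffX eqxx mcoeff0 oner_eq0.
have sz F : 'X_ord0 * F != 0 :> {mpoly k[2]} -> (msize F < msize ('X_ord0 * F))%N.
  by rewrite mulf_eq0 negb_or => /andP[_ F0]; rewrite msizeM // msizeX mdeg1.
have [N] := ubnP (msize P + msize Q); elim: N P Q => // N IH P Q hN nz.
have [rP|] := eqVneq (rk P) 0; last by exists 0%N, P, Q; rewrite expr0 !mul1r; split=> //; left.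
have [rQ|] := eqVneq (rk Q) 0; last by exists 0%N, P, Q; rewrite expr0 !mul1r; split=> //; right.
have [P1 eP] := rk0 rP; have [Q1 eQ] := rk0 rQ.
have nz1 : P1 != 0 \/ Q1 != 0.
  by case: nz => h; [left; apply: contra_neq h => e0; rewrite eP e0 mulr0|right; apply: contra_neq h => e0; rewrite eQ e0 mulr0].
have szle (F : {mpoly k[2]}) : (msize F <= msize ('X_ord0 * F))%N.
  by have [->|F0] := eqVneq F 0; [rewrite mulr0|apply/ltnW/sz; rewrite mulf_neq0].
have lt : (msize P1 + msize Q1 < N)%N.
  have h1 := szle P1; have h2 := szle Q1; rewrite -eP in h1; rewrite -eQ in h2.
  apply: (sum_lt hN h1 h2); case: nz => h; [left|right].
    by rewrite eP; apply: (sz); rewrite -eP.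
  by rewrite eQ; apply: (sz); rewrite -eQ.
have [n [P' [Q' [e1 e2 h]]]] := IH _ _ lt nz1.
by exists n.+1, P', Q'; rewrite !exprS -!mulrA -e1 -e2.
Qed.

Lemma ev_X0 : ev 'X_ord0 = x. Proof. by rewrite mmapX mmap1U. Qed.
Lemma ev_X1 : ev 'X_ord_max = th. Proof. by rewrite mmapX mmap1U. Qed.

Lemma good_ev P : ev P != 0 -> exists n g, good g /\ ev P = x ^+ n * g.
Proof.
move=> P0; have [|n [P' [Q' [e1 e2 h]]]] := @xdiv P 0; first by left; apply: contra_neq P0 => ->; rewrite rmorph0.
exists n, (ev P'); split; last by rewrite e1 rmorphM rmorphXn /= ev_X0.
exists (hK P'), (rk P'); split; [|exact: red_hK|by rewrite hK_ev].
case: h => // Q0; exfalso; move/eqP: e2; rewrite eq_sym mulf_eq0 expf_eq0 => /orP[/andP[_ /eqP X0]|/eqP Q'0].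
  by have := congr1 ev X0; rewrite ev_X0 rmorph0 => /eqP; rewrite (negbTE x0).
by move: Q0; rewrite Q'0 /rk rmorph0 eqxx.
Qed.

Let A2 : {mpoly k[2]} := ai *: ('X_ord0 ^+ 2 * 'X_ord_max).
Let B2 : {mpoly k[2]} := (aj *: 'X_ord0 ^+ 2 + dj%:MP) * 'X_ord_max + 'X_ord0 * (al *: 'X_ord_max ^+ 2 + dl%:MP) - 'X_ord0 * 'X_ord_max.
Let C2 : {mpoly k[2]} := di *: 'X_ord_max.

Lemma evA2 : ev A2 = iota ai * x ^+ 2 * th.
Proof. by rewrite /A2 mmapZ rmorphM rmorphXn /= ev_X0 ev_X1 mulrA. Qed.
Lemma evB2 : ev B2 = (iota aj * x ^+ 2 + iota dj) * th + x * (iota al * th ^+ 2 + iota dl) - x * th.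
Proof. by rewrite /B2 !(rmorphB, rmorphD, rmorphM) /= !(rmorphD, mmapZ) /= !rmorphXn /= !mmapC ev_X0 ev_X1. Qed.
Lemma evC2 : ev C2 = iota di * th.
Proof. by rewrite /C2 mmapZ ev_X1. Qed.

Lemma rkX0 : rk 'X_ord0 = 0. Proof. by rewrite /rk mmapX mmap1U. Qed.
Lemma rkX1 : rk 'X_ord_max = 'X. Proof. by rewrite /rk mmapX mmap1U. Qed.
Lemma rkA2 : rk A2 = 0.
Proof. by rewrite /A2 /rk mmapZ rmorphM rmorphXn /= -!/(rk _) rkX0 expr0n mul0r mulr0. Qed.
Lemma rkB2 : rk B2 = dj%:P * 'X.
Proof.
rewrite /B2 /rk !(rmorphB, rmorphD, rmorphM) /= !(rmorphD, mmapZ) /= !rmorphXn /= !mmapC -!/(rk _) rkX0 rkX1 expr0n /=.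
by rewrite mulr0 add0r !mul0r addr0 subr0.
Qed.

(** Up to powers of x every nonzero f is a quotient of good elements. Numerator and denominator are
    polynomials in x and th plus eta times such; common powers of x are removed, and the rest is
    good if its reduction at x = 0 is nonzero. *)
Lemma xgood f : f != 0 -> exists n1 n2 g1 g2, [/\ good g1, good g2 & f * (x ^+ n1 * g1) = x ^+ n2 * g2].
Proof.
move=> f0; have A20 : ev A2 != 0 by rewrite evA2 !mulf_neq0 ?expf_neq0 ?fmorph_eq0.
have e2 : ev A2 * eta ^+ 2 + ev B2 * eta + ev C2 = 0 by rewrite evA2 evB2 evC2 rel.
have gen' : forall S : K -> Prop, (forall c, S (iota c)) -> (forall i, S (t i)) -> S eta ->
      (forall f g, S f -> S g -> S (f + g)) -> (forall f g, S f -> S g -> S (f * g)) ->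
      (forall f, S f -> S f^-1) -> forall f, S f.
  move=> S Sc St Se SD SM SV; apply: gen => //; [exact: (St ord0)|exact: (St ord_max)].
have [P [Q [D [D0 h]]]] := quad_repr A20 e2 gen' f.
have [n1 [g1 [gg1 eD]]] := good_ev D0.
have PQ : P != 0 \/ Q != 0.
  have [P0|] := eqVneq P 0; last by left.
  right; apply: contra_neq (mulf_neq0 f0 D0) => Q0; by rewrite h P0 Q0 rmorph0 mul0r addr0.
have [n [P' [Q' [eP eQ hr]]]] := xdiv PQ.
pose F := ev P' + ev Q' * eta.
have fF : f * (x ^+ n1 * g1) = x ^+ n * F.
  rewrite -eD h eP eQ !rmorphM !rmorphXn /= ev_X0 /F; ring.
have F0 : F != 0.
  by apply: contra_neq (mulf_neq0 f0 D0) => F0; rewrite eD fF F0 mulr0.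
have [r0|r0] := eqVneq (rk P' + rk Q' * etav%:P) 0; last first.
  exists n1, n, g1, F; split=> //; exists (hK P' + hK Q' * eta%:P), (rk P' + rk Q' * etav%:P); split=> //.
    by apply: redD; [exact: red_hK|apply: redM; [exact: red_hK|exact: redCv]].
  by rewrite hornerD hornerM hornerC !hK_ev.
have rQ : rk Q' != 0.
  by case: hr => // rP; apply: contra_neq rP => Q0; move: r0; rewrite Q0 mul0r addr0.
(* When the reduction of F vanishes, its conjugate is used: at x = 0 the leading coefficient A2
   vanishes and B2 becomes dj X, so [G] is good, while F G is a norm and hence a polynomial in x and
   th. *)
pose G := ev A2 * ev P' - ev B2 * ev Q' - ev A2 * ev Q' * eta.
have gG : good G.
  exists (hK A2 * hK P' - hK B2 * hK Q' - hK A2 * hK Q' * eta%:P), (rk A2 * rk P' - rk B2 * rk Q' - rk A2 * rk Q' * etav%:P); split.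
  - by rewrite rkA2 rkB2 !mul0r subr0 sub0r oppr_eq0 !mulf_neq0 ?polyX_eq0 ?polyC_eq0.
  - by repeat first [exact: red_hK | exact: redCv | apply: redM | apply: redD | apply: redN].
  by rewrite !(hornerD, hornerN, hornerM) hornerC !hK_ev.
pose Nm := A2 * P' ^+ 2 - B2 * P' * Q' + C2 * Q' ^+ 2.
have NmE : ev Nm = F * G.
  rewrite /Nm !(rmorphD, rmorphN) /= !rmorphM /= ?rmorphXn /= /F /G.
  have -> : ev C2 = - (ev A2 * eta ^+ 2 + ev B2 * eta) by apply/eqP; rewrite -addr_eq0 addrC e2.
  by move: (ev A2) (ev B2) (ev P') (ev Q') => A B p q; ring.
have Nm0 : ev Nm != 0 by rewrite NmE mulf_neq0 // good_neq0.
have [n2 [g2 [gg2 eN]]] := good_ev Nm0.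
exists n1, (n + n2)%N, (g1 * G), g2; split=> //; first exact: goodM.
have -> : f * (x ^+ n1 * (g1 * G)) = (f * (x ^+ n1 * g1)) * G by ring.
by rewrite fF -mulrA -NmE eN exprD mulrA.
Qed.

(** The localization of R[th] whose denominators are the good elements. *)
Definition inA f := exists g G, [/\ good g, (exists H h, red H h /\ G = H.[th]) & f = G / g].

(** By [xgood], f = x^n2 g2 / (x^n1 g1). If n2 were at most n1, then g2 = f x^(n1 - n2) g1 with
    first factor in the maximal ideal, and a polynomial with nonzero reduction would vanish at
    th. *)
Lemma max_xA f : v f 0 -> exists g, inA g /\ f = x * g.
Proof.
move=> vf; have [->|f0] := eqVneq f 0.
  exists 0; rewrite mulr0; split=> //; exists 1, 0; rewrite divr1; split=> //; first exact: good1.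
  by exists 0, 0; rewrite horner0; split=> // i; rewrite !coef0; apply: (pl_0 plv).
have [n1 [n2 [g1 [g2 [h1 h2 E]]]]] := xgood f0.
have g10 := good_neq0 h1.
have [le|lt] := leqP n2 n1; last first.
  exists (x ^+ (n2 - n1).-1 * g2 / g1); split.
    have [H [h [_ hr g2E]]] := h2.
    exists g1, (x ^+ (n2 - n1).-1 * g2); split=> //.
    exists ((x%:P) ^+ (n2 - n1).-1 * H), ((0%:P) ^+ (n2 - n1).-1 * h); split; last by rewrite hornerM horner_exp hornerC g2E.
    by apply: redM => //; apply: redXn; apply: redCv.
  apply: (mulIf (mulf_neq0 (expf_neq0 n1 x0) g10)); rewrite E.
  have -> : n2 = (n1 + (n2 - n1).-1.+1)%N by rewrite prednK ?subn_gt0 // subnKC // ltnW.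
  have -> : (n1 + (n2 - n1).-1.+1 - n1 = (n2 - n1).-1.+1)%N by rewrite addKn.
  rewrite exprD exprS /=; field; exact: g10.
exfalso; have [H1 [w1 [w10 r1 g1E]]] := h1; have [H2 [w2 [w20 r2 g2E]]] := h2.
have : good 0; last by move/good_neq0; rewrite eqxx.
exists (H2 - (f * x ^+ (n1 - n2))%:P * H1), (w2 - (0 * 0 ^+ (n1 - n2))%:P * w1); split.
- by rewrite mul0r polyC0 mul0r subr0.
- by apply: redD => //; apply: redN; apply: redM => //; apply: redCv; apply: (pl_M plv) => //; apply: (pl_X plv).
rewrite hornerD hornerN hornerM hornerC -g1E -g2E; apply/esym/eqP; rewrite subr_eq0; apply/eqP.
apply: (mulfI (expf_neq0 n2 x0)); rewrite -E (_ : x ^+ n1 = x ^+ n2 * x ^+ (n1 - n2)); last by rewrite -exprD subnKC.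
ring.
Qed.

Lemma inAD f g : inA f -> inA g -> inA (f + g).
Proof.
move=> [g1 [G1 [a1 [H1 [h1 [r1 e1]]] ->]]] [g2 [G2 [a2 [H2 [h2 [r2 e2]]] ->]]].
have [I1 [i1 [_ s1 t1]]] := a1; have [I2 [i2 [_ s2 t2]]] := a2.
exists (g1 * g2), (G1 * g2 + G2 * g1); split; [exact: goodM| |by rewrite addf_div ?good_neq0].
exists (H1 * I2 + H2 * I1), (h1 * i2 + h2 * i1); split; last by rewrite hornerD !hornerM e1 e2 -t1 -t2.
by apply: redD; apply: redM.
Qed.
Lemma inAM f g : inA f -> inA g -> inA (f * g).
Proof.
move=> [g1 [G1 [a1 [H1 [h1 [r1 e1]]] ->]]] [g2 [G2 [a2 [H2 [h2 [r2 e2]]] ->]]].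
exists (g1 * g2), (G1 * G2); split; [exact: goodM| |by rewrite mulf_div].
by exists (H1 * H2), (h1 * h2); split; [apply: redM|rewrite hornerM e1 e2].
Qed.
Lemma inA_reg f : reg f -> inA f.
Proof.
move=> [r h]; exists 1, f; rewrite divr1; split=> //; first exact: good1.
by exists f%:P, r%:P; rewrite hornerC; split=> //; apply: redCv.
Qed.

(** Expanding x/th and x th over squares gives coefficients b_i and a_i = th b_i. None is a unit, as
    otherwise th or 1/th would be regular, so all are divisible by x in the localization of R[th].
    But x is the sum of the a_i b_i e_i, hence divisible by x^2, which makes x invertible there. *)
Lemma minimal_absurd : False.
Proof.
have [b [b_reg bE]] := e_dec rb; have [a [a_reg aE]] := e_dec ra.
(* Since x th = th^2 (x/th), uniqueness of the coefficients over squares applies. *)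
have ab i : a i = th * b i.
  apply: (e_uniq (c := a) (d := fun j => th * b j)); rewrite -aE.
  transitivity (th ^+ 2 * (x / th)); first by field.
  by rewrite bE mulr_sumr; apply: eq_bigr => j _; rewrite exprMn mulrA.
have bm i : v (b i) 0.
  have [r hr] := b_reg i; have [r0|r0] := eqVneq r 0; first by rewrite -r0.
  case: nreg; left; have b0 := pl_neq0 plv hr r0.
  have -> : th = a i / b i by rewrite ab mulfK.
  by apply: (regM plv) => //; exists r^-1; apply: (pl_V plv).
have am i : v (a i) 0.
  have [r hr] := a_reg i; have [r0|r0] := eqVneq r 0; first by rewrite -r0.
  case: nreg; right; have a0 := pl_neq0 plv hr r0.
  have -> : th^-1 = b i / a i.
    by rewrite ab invfM mulrCA mulfV ?mulr1 //; apply: contra_neq a0 => b0; rewrite ab b0 mulr0.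
  by apply: (regM plv) => //; exists r^-1; apply: (pl_V plv).
have xE : x = \sum_i a i * b i * e i.
  transitivity (th * (x / th)); first by field.
  by rewrite bE mulr_sumr; apply: eq_bigr => i _; rewrite ab; ring.
have /choice[a' ha] i := max_xA (am i); have /choice[b' hb] i := max_xA (bm i).
have gA : inA (\sum_i a' i * b' i * e i).
  apply: big_ind => [||i _]; [apply: inA_reg; exists 0; exact: (pl_0 plv)|exact: inAD|].
  by apply: inAM; [apply: inAM; [exact: (ha i).1|exact: (hb i).1]|apply: inA_reg].
have x1 : 1 = x * (\sum_i a' i * b' i * e i).
  apply: (mulfI x0); rewrite mulr1 {1}xE mulrA -expr2 mulr_sumr; apply: eq_bigr => i _.
  by rewrite (ha i).2 (hb i).2; ring.
have [g [G [gg [H [h [r GE]]] E]]] := gA; move: x1; rewrite E => x1.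
have [I [i [i0 s gE]]] := gg; have g0 := good_neq0 gg.
have : good 0; last by move/good_neq0; rewrite eqxx.
exists (I - x%:P * H), (i - 0%:P * h); split.
- by rewrite polyC0 mul0r subr0.
- by apply: redD => //; apply: redN; apply: redM => //; apply: redCv.
rewrite hornerD hornerN hornerM hornerC -gE -GE; apply/esym/eqP; rewrite subr_eq0; apply/eqP.
by apply: (mulIf (invr_neq0 g0)); rewrite mulfV // {1}x1 mulrA.
Qed.

End Minimal.

Lemma third_index (q i : 'I_3) : i != q -> exists l : 'I_3,
  (forall (V : nmodType) (F : 'I_3 -> V), \sum_m F m = F q + F i + F l) /\ (forall m, [\/ m = q, m = i | m = l]).
Proof.
move=> iq; have h : exists l : 'I_3, [/\ l != q, l != i & forall m, [\/ m = q, m = i | m = l]].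
  elim/ord3_ind: q iq => iq; elim/ord3_ind: i iq => //= _.
  - by exists 2; split=> //; elim/ord3_ind; [apply: Or31|apply: Or32|apply: Or33].
  - by exists 1; split=> //; elim/ord3_ind; [apply: Or31|apply: Or33|apply: Or32].
  - by exists 2; split=> //; elim/ord3_ind; [apply: Or32|apply: Or31|apply: Or33].
  - by exists 0; split=> //; elim/ord3_ind; [apply: Or33|apply: Or31|apply: Or32].
  - by exists 1; split=> //; elim/ord3_ind; [apply: Or32|apply: Or33|apply: Or31].
  - by exists 0; split=> //; elim/ord3_ind; [apply: Or33|apply: Or32|apply: Or31].
have [l [lq li hm]] := h; exists l; split=> // V F.
rewrite (bigD1 q) //= (bigD1 i) //= (bigD1 l) ?lq ?li //= big1 ?addr0 ?addrA //.
by move=> m /andP[/andP[h1 h2] h3]; case: (hm m) => e; rewrite e eqxx in h1 h2 h3.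
Qed.

Section MinCore.
Variables (k K : fieldType) (iota : {rmorphism k -> K}).
Variables (v : K -> k -> Prop) (plv : place iota v).
Local Notation reg := (reg v).
Hypothesis kap : forall (th : K) (H : {poly K}), (forall i, reg H`_i) -> (exists i r, v H`_i r /\ r != 0) ->
  H.[th] = 0 -> reg th \/ reg th^-1.
Variable e : 'I_4 -> K.
Hypotheses (e_reg : forall i, reg (e i))
  (e_dec : forall f, reg f -> exists c : 'I_4 -> K, (forall i, reg (c i)) /\ f = \sum_i c i ^+ 2 * e i)
  (e_uniq : forall c d : 'I_4 -> K, \sum_i c i ^+ 2 * e i = \sum_i d i ^+ 2 * e i -> forall i, c i = d i).

Lemma regV f r : v f r -> r != 0 -> reg f^-1.
Proof. by move=> h r0; exists r^-1; apply: (pl_V plv). Qed.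

Section Core.
Variables (Z : 'I_3 -> K) (al de : 'I_3 -> k).
Hypothesis dZ : datum iota Z al de.

Lemma phi_pairs : (forall m, reg (Z m) \/ reg (Z m)^-1) ->
  (forall m n, m != n -> (reg (Z m / Z n) \/ reg (Z m / Z n)^-1) /\ (reg (Z m * Z n) \/ reg (Z m * Z n)^-1)) ->
  forall s, reg (phi Z s) \/ reg (phi Z s)^-1.
Proof.
move=> h1 h2 s; have [h3 h4] := h2 0 1 isT.
by rewrite /phi; case: s => -[|[|[|[|[|//]]]]] ? /=.
Qed.

(** Here Z_q vanishes and Z_i/Z_q is a unit. With x = Z_q, th = Z_l and eta = Z_i/Z_q,
    [minimal_absurd] shows that Z_l or its inverse is regular; the remaining ratios and products
    follow from [dom]. *)
Lemma core_unit q i r : i != q -> (forall m, reg (Z q * Z m) /\ reg (Z q / Z m)) -> v (Z q) 0 ->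
  v (Z q / Z i) r -> r != 0 -> forall s, reg (phi Z s) \/ reg (phi Z s)^-1.
Proof.
move=> iq dom vX vB r0; have [l [sumE cov]] := third_index iq.
have nz := d_z dZ.
have ve : v (Z i / Z q) r^-1 by rewrite -invf_div; apply: (pl_V plv).
have re : reg (Z i / Z q) by exists r^-1.
have rq : reg (Z q) by exists 0.
have rl : reg (Z l) \/ reg (Z l)^-1.
  case: (pselect (reg (Z l) \/ reg (Z l)^-1)) => // nreg; exfalso.
  apply: (@minimal_absurd _ _ iota v plv (Z q) (Z l) (Z i / Z q) r^-1 vX ve (nz q) (nz l)
    (al q) (al i) (al l) (de q) (de i) (de l) (d_al dZ i) (d_de dZ q) _ _ (@kap (Z l)) e e_reg e_dec e_uniq _ _ nreg).
  - have := d_rel dZ; rewrite sumE => h.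
    transitivity (Z q * (Z i / Z q) * Z l * (iota (al q) * Z q + iota (de q) / Z q + (iota (al i) * Z i + iota (de i) / Z i) + (iota (al l) * Z l + iota (de l) / Z l) - 1)); last by rewrite h subrr mulr0.
    by field; rewrite !nz.
  - move=> S Sc Sq Sl Se SD SM SV; apply: (d_gen dZ) => // m; case: (cov m) => -> //.
    by rewrite -[Z i](mulfVK (nz q)); apply: SM.
  - exact: (dom l).1.
  - exact: (dom l).2.
have ri : reg (Z i) by rewrite -[Z i](mulfVK (nz q)); apply: (regM plv).
apply: phi_pairs => [m|m n mn]; first by case: (cov m) => ->; [left|left|].
have prodE x y u : u != 0 -> x / u * (u * y) = x * y :> K by move=> u0; rewrite mulrA mulfVK.
have divE x y u : u != 0 -> x / u * (u / y) = x / y :> K by move=> u0; rewrite mulrA mulfVK.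
have pi j : (reg (Z i / Z j)) /\ (reg (Z i * Z j)).
  split; first by rewrite -(divE _ _ _ (nz q)); apply: (regM plv) => //; exact: (dom j).2.
  by rewrite -(prodE _ _ _ (nz q)); apply: (regM plv) => //; exact: (dom j).1.
case: (cov m) => em; rewrite ?em.
- by split; left; [exact: (dom n).2|exact: (dom n).1].
- by split; left; [exact: (pi n).1|exact: (pi n).2].
case: (cov n) => en; rewrite ?en.
- by split; [right; rewrite invf_div; exact: (dom l).2|left; rewrite mulrC; exact: (dom l).1].
- by split; [right; rewrite invf_div; exact: (pi l).1|left; rewrite mulrC; exact: (pi l).2].
by rewrite em en eqxx in mn.
Qed.
End Core.

(** The relation multiplied by Z_q shows that Z_q is regular and computes its value. If it is a
    unit, everything is regular by [dom]; otherwise a second unit is found and [core_unit]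
    applies. *)
Lemma core_all Z al de q : datum iota Z al de -> (forall m, reg (Z q * Z m) /\ reg (Z q / Z m)) ->
  forall s, reg (phi Z s) \/ reg (phi Z s)^-1.
Proof.
move=> dZ dom; have nz := d_z dZ.
have /choice[A hA] m : exists r, v (Z q * Z m) r := (dom m).1.
have /choice[B hB] m : exists r, v (Z q / Z m) r := (dom m).2.
have vX : v (Z q) (\sum_m (al m * A m + de m * B m)).
  rewrite -[X in v X](mulr1 (Z q)) -(d_rel dZ) mulr_sumr; apply: (pl_sum plv) => m _.
  rewrite mulrDr; apply: (pl_D plv).
    by rewrite mulrCA; apply: (pl_M plv) => //; apply: (pl_c plv).
  by rewrite mulrCA; apply: (pl_M plv) => //; apply: (pl_c plv).
have [r0|r0] := eqVneq (\sum_m (al m * A m + de m * B m)) 0; last first.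
  have rX := regV vX r0.
  have rz m : reg (Z m) by rewrite -[Z m](mulKf (nz q)); apply: (regM plv) => //; exact: (dom m).1.
  have rz' m : reg (Z m)^-1 by rewrite -[(Z m)^-1](mulKf (nz q)); apply: (regM plv) => //; exact: (dom m).2.
  by apply: phi_pairs => [m|m n _]; [left|split; left; apply: (regM plv)].
rewrite r0 in vX.
(* If all A_i and B_i with i different from q vanished, the value of Z_q would be de_q, because A_q
   = 0 and B_q = 1; but it is 0. *)
have [i iq [Ai|Bi]] : exists2 i, i != q & A i != 0 \/ B i != 0.
- case: (boolP [exists i, (i != q) && ((A i != 0) || (B i != 0))]) => [/existsP[i /andP[iq /orP h]]|/existsPn h].
    by exists i.
  case/eqP: (d_de dZ q); move: r0; rewrite (bigD1 q) //= [X in _ + X]big1 ?addr0.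
    have -> : A q = 0 by apply: (pl_fun plv (hA q)); rewrite -(mul0r 0); apply: (pl_M plv).
    have -> : B q = 1 by apply: (pl_fun plv (hB q)); rewrite mulfV //; apply: (pl_1 plv).
    by rewrite mulr0 mulr1 add0r.
  by move=> m mq; have := h m; rewrite mq /= negb_or !negbK => /andP[/eqP -> /eqP ->]; rewrite !mulr0 addr0.
(* When the unit is Z_q Z_i instead of Z_q/Z_i, inverting Z_i reduces to the other case. *)
- pose sg := fun m : 'I_3 => m == i.
  have dZ' := datum_flip sg dZ.
  have fq : zflip sg Z q = Z q by rewrite /zflip /sg eq_sym (negbTE iq).
  have fi : zflip sg Z i = (Z i)^-1 by rewrite /zflip /sg eqxx.
  have h : forall s, reg (phi (zflip sg Z) s) \/ reg (phi (zflip sg Z) s)^-1.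
    apply: (core_unit dZ' iq (r := A i)) => //.
    + move=> m; rewrite fq /zflip; have [h1 h2] := dom m; case: (sg m); first by rewrite invrK.
      by [].
    + by rewrite fq.
    + by rewrite fq fi invrK.
  move=> s; have [s' [->|->]] := phi_fs dZ sg false s; first exact: h.
  by rewrite invrK or_comm; exact: h.
exact: (core_unit dZ iq dom vX (hB i) Bi).
Qed.
End MinCore.

Section MinRes.
Variables (k : closedFieldType) (char2 : 2%N \in [pchar k]) (a sc sd : 'I_3 -> k).
Hypothesis a_inj : injective a.
Variables (K : fieldType) (iota : {rmorphism k -> K}) (z : 'I_3 -> K).
Hypothesis dz : datum iota z sc (fun i => sd i * gam a i).

(** [kaplansky] and the decomposition over squares are available at every point of a resolution, so
    [core_all] shows that each [phi z s] or its inverse is regular. The set J of those to be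
    inverted designates a Segre coordinate dividing all the others. *)
Lemma yseg_minimal n' (y' : 'rV[K]_n') : resolution iota (xpt a iota z) y' -> dominates iota y' (yseg z).
Proof.
move=> [[ff _ sm] dom]; apply: dominates_ratio => p' pt'.
have plv := place_vp pt'; have [j pj yj] := point_neq0 pt'.
set v := vp iota y' p' in plv *.
pose t i := y' 0 i / y' 0 j; pose tau i := p' 0 i / p' 0 j.
have vt i : v (t i) (tau i) by apply: vp_ratio.
have gen f r : v f r -> loc iota t tau f r by apply: vp_loc.
have Rfrac f : exists b c, [/\ Rv v b, Rv v c, c != 0 & f = b / c].
  have [_ /(_ f)[d [F [G [hF hG G0 ->]]]]] := ff.
  exists (mmap iota t F), (mmap iota t G).
  have hGE := hval_homog iota hG yj; have hFE := hval_homog iota hF yj.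
  split; [by exists F.@[tau]; apply: (pl_mmap plv)|by exists G.@[tau]; apply: (pl_mmap plv)| |].
    by apply: contra_neq G0; rewrite hGE => ->; rewrite mulr0.
  by rewrite hGE hFE -mulf_div divff ?mul1r // expf_neq0.
have [u [w [/max_idealE vu /max_idealE vw params]]] := sm _ pt'.
have params' f : v f 0 -> exists b c, [/\ Rv v b, Rv v c & f = b * u + c * w].
  move/max_idealE/params => [b [c [/local_ringE hb /local_ringE hc ->]]]; by exists b, c.
have m4f := m4_free dz char2.
have [p [pt lsub _]] := dom _ pt'.
have [l pl xl] := point_neq0 pt.
have rx i : reg v (xpt a iota z 0 i / xpt a iota z 0 l).
  by apply/local_ringE/lsub/local_ringE; eexists; apply: vp_ratio.
have phir : forall s, reg v (phi z s) \/ reg v (phi z s)^-1.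
  (* The image point on Sigma has a nonzero coordinate, X_q or Y_q. Dividing by it makes 1/z_q or
     z_q times every z_m and 1/z_m regular; [b] says whether all z are to be inverted. *)
  have [q [b hq]] : exists q (b : bool), forall m, reg v (zflip (fun=> b) z q * z m) /\ reg v (zflip (fun=> b) z q / z m).
    have xE := @xptE k a K iota z.
    have gn m : iota (gam a m) != 0 by rewrite fmorph_eq0 gam_neq0.
    have rgV m (f : K) : reg v (iota (gam a m) * f) -> reg v f.
      move=> h; rewrite -[f](mulKf (gn m)); apply: (regM plv) => //.
      by rewrite -fmorphV; apply: (regC plv).
    move: rx xl; rewrite (xE l); case: (@split 3 3 l) => q rx xl.
      exists q, true => m; rewrite /zflip; split.
        by have := rx (lshift 3 m); rewrite xE (unsplitK (inl m)) mulrC.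
      have := rx (rshift 3 m); rewrite xE (unsplitK (inr m)) -mulrA => /rgV.
      by rewrite mulrC.
    exists q, false => m; rewrite /zflip; split.
      have := rx (lshift 3 m); rewrite xE (unsplitK (inl m)) invf_div mulrA => h.
      have := regM plv (regC plv (gam a q)) h; rewrite mulrCA mulfV // mulr1.
      by rewrite mulrC.
    have := rx (rshift 3 m); rewrite xE (unsplitK (inr m)) invf_div -mulrA => /rgV h.
    have := regM plv (regC plv (gam a q)) h.
    by have -> : iota (gam a q) * ((z m)^-1 * (z q / iota (gam a q))) = z q / z m by field; rewrite gn (d_z dz).
  have dZ := datum_flip (fun=> b) dz.
  have h : forall s, reg v (phi (zflip (fun=> b) z) s) \/ reg v (phi (zflip (fun=> b) z) s)^-1.
    apply: (core_all plv (e := e4 u w) _ _ _ _ dZ (q := q)).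
    - exact: (kaplansky char2 plv vt gen Rfrac vu vw params' m4f).
    - exact: (Rv_e4 plv vu vw).
    - by move=> f; apply: (sq_decomp char2 plv vt gen vu vw params').
    - exact: (e4_uniq char2 plv vt gen Rfrac vu vw params' m4f).
    move=> m; have [h1 h2] := hq m; rewrite [zflip _ z m]/zflip; case: (b) h1 h2; rewrite ?invrK; by split.
  move=> s; have [s' [->|->]] := phi_fs dz (fun=> b) false s; first exact: h.
  by rewrite invrK or_comm; exact: h.
pose J := [set s : 'I_5 | ~~ `[< reg v (phi z s) >]].
exists (enum_rank J); first exact: (yseg_neq0 dz).
apply: (reg_signs dz plv) => s; rewrite inE; case: asboolP => //= h.
by case: (phir s).
Qed.
End MinRes.

(** * Vanishing of the first cohomology group *)

Section Alg.
Variables (k K : fieldType) (iota : {rmorphism k -> K}).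

Definition alg n (t : 'I_n -> K) (f : K) := exists P : {mpoly k[n]}, f = mmap iota t P.

Lemma alg_ind n (t : 'I_n -> K) (S : K -> Prop) : (forall c, S (iota c)) -> (forall i, S (t i)) ->
  (forall f g, S f -> S g -> S (f + g)) -> (forall f g, S f -> S g -> S (f * g)) -> forall f, alg t f -> S f.
Proof.
move=> Sc St SD SM f [P ->]; rewrite /mmap; apply: (big_ind S) => [||m _]; [by rewrite -(rmorph0 iota)|exact: SD|].
apply: (SM) => //; apply: (big_ind S) => [||i _]; [by rewrite -(rmorph1 iota)|exact: SM|].
by elim: (m i) => [|e IH]; [rewrite expr0 -(rmorph1 iota)|rewrite exprS; apply: (SM)].
Qed.

Section Closure.
Variables (n : nat) (t : 'I_n -> K).
Lemma algD f g : alg t f -> alg t g -> alg t (f + g).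
Proof. by move=> [P ->] [Q ->]; exists (P + Q); rewrite rmorphD. Qed.
Lemma algM f g : alg t f -> alg t g -> alg t (f * g).
Proof. by move=> [P ->] [Q ->]; exists (P * Q); rewrite rmorphM. Qed.
Lemma algC c : alg t (iota c). Proof. by exists c%:MP; rewrite mmapC. Qed.
Lemma algV i : alg t (t i). Proof. by exists 'X_i; rewrite mmapX mmap1U. Qed.
Lemma alg1 : alg t 1. Proof. by rewrite -(rmorph1 iota); apply: algC. Qed.
Lemma alg0 : alg t 0. Proof. by rewrite -(rmorph0 iota); apply: algC. Qed.
Lemma algX f m : alg t f -> alg t (f ^+ m).
Proof. by move=> h; elim: m => [|m IH]; [exact: alg1|rewrite exprS; apply: algM]. Qed.
Lemma alg_reg v f : place iota v -> (forall i, reg v (t i)) -> alg t f -> reg v f.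
Proof.
move=> plv h; apply: alg_ind => //; [exact: regC|by move=> *; apply: (regD plv)|by move=> *; apply: (regM plv)].
Qed.
Lemma alg_sum I (r : seq I) (F : I -> K) : (forall i, alg t (F i)) -> alg t (\sum_(i <- r) F i).
Proof. by move=> h; apply: big_ind => //; [exact: alg0|exact: algD]. Qed.
End Closure.

(** Generators of k[t, 1/h], the functions on a principal open set. *)
Definition text n (t : 'I_n -> K) (h : K) (i : 'I_n.+1) : K := oapp t h^-1 (unlift ord_max i).

Lemma text_lift n (t : 'I_n -> K) h i : text t h (lift ord_max i) = t i.
Proof. by rewrite /text liftK. Qed.
Lemma text_max n (t : 'I_n -> K) h : text t h ord_max = h^-1.
Proof. by rewrite /text unlift_none. Qed.
Lemma alg_text n (t : 'I_n -> K) h f : alg t f -> alg (text t h) f.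
Proof.
apply: alg_ind; [exact: algC|by move=> i; rewrite -(text_lift t h i); apply: algV|exact: algD|exact: algM].
Qed.
Lemma text_inv n (t : 'I_n -> K) h f : alg t h -> h != 0 -> alg (text t h) f -> exists N, alg t (h ^+ N * f).
Proof.
move=> ah h0; move: f; apply: alg_ind.
- by move=> c; exists 0%N; rewrite mul1r; apply: algC.
- move=> i; case: (unliftP ord_max i) => [j|] ->.
    by exists 0%N; rewrite text_lift mul1r; apply: algV.
  by exists 1%N; rewrite text_max expr1 mulfV //; apply: alg1.
- move=> f g [N hf] [M hg]; exists (N + M)%N; rewrite exprD mulrDr.
  apply: algD; first by rewrite mulrAC mulrC; apply: algM => //; apply: algX.
  by rewrite -mulrA; apply: algM => //; apply: algX.
- move=> f g [N hf] [M hg]; exists (N + M)%N; rewrite exprD mulrACA; exact: algM.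
Qed.

Lemma reg_up (v w : K -> k -> Prop) f : place iota v -> place iota w -> (forall f r, v f r -> w f r) ->
  reg v f \/ reg v f^-1 -> reg w f -> reg v f.
Proof.
move=> plv plw vw [//|[r hr]] [s hs]; have [->|f0] := eqVneq f 0; first by exists 0; apply: (pl_0 plv).
have r0 : r != 0.
  apply: contra_neq (oner_neq0 k) => r0.
  apply: (pl_fun plw (f := f * f^-1)); first by rewrite mulfV //; apply: (pl_1 plw).
  by rewrite -(mulr0 s) -r0; apply: (pl_M plw) => //; apply: vw.
by exists r^-1; rewrite -[f]invrK; apply: (pl_V plv).
Qed.
End Alg.

Section Affine.
Variables (k : closedFieldType) (K : fieldType) (iota : {rmorphism k -> K}).
Variables (z : 'I_3 -> K) (al de : 'I_3 -> k).
Hypothesis dz : datum iota z al de.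
Local Notation y := (yseg z).
Local Notation vy := (vp iota y).
Local Notation alg := (alg iota).

Definition phJ (J : {set 'I_5}) s := if s \in J then (phi z s)^-1 else phi z s.

(** Expresses that k[t] is the coordinate algebra of an open part of the Segre chart J: it contains
    the chart functions, and any place lying over the chart and contained in a place where t is
    regular already has t regular. *)
Definition chartlike n (t : 'I_n -> K) (J : {set 'I_5}) : Prop :=
  (forall s, alg t (phJ J s)) /\
  forall v w, place iota v -> place iota w -> (forall f r, v f r -> w f r) ->
    (forall s, reg v (phJ J s)) -> (forall i, reg w (t i)) -> forall i, reg v (t i).

Lemma phJ_reg p J : point iota y p -> p 0 (enum_rank J) != 0 -> forall s, reg (vy p) (phJ J s).
Proof.
move=> pt pj s; set j := enum_rank J in pj.
have yj := yseg_neq0 dz j.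
have yJ : y 0 j = \prod_(s in J) phi z s by rewrite ysegE.
rewrite /phJ; case: ifP => sJ.
  exists (p 0 (enum_rank (J :\ s)) / p 0 j).
  have -> : (phi z s)^-1 = y 0 (enum_rank (J :\ s)) / y 0 j.
    rewrite ysegE yJ [X in _ / X](big_setD1 s) //= invfM mulrCA mulfV ?mulr1 //.
    by apply/prodf_neq0 => *; apply: (phi_neq0 dz).
  exact: vp_ratio.
exists (p 0 (enum_rank (s |: J)) / p 0 j).
have -> : phi z s = y 0 (enum_rank (s |: J)) / y 0 j.
  rewrite ysegE yJ big_setU1 ?sJ //= mulfK //.
  by apply/prodf_neq0 => *; apply: (phi_neq0 dz).
exact: vp_ratio.
Qed.

Lemma cl_point n (t : 'I_n -> K) J tau : chartlike t J -> spec iota t tau -> exists p,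
  [/\ point iota y p, p 0 (enum_rank J) != 0, forall f r, vy p f r -> loc iota t tau f r & forall i, vy p (t i) (tau i)].
Proof.
move=> [aJ cl] sp; have plw := place_loc sp; set w := loc iota t tau in plw *.
have wt i : w (t i) (tau i) by apply: loc_var.
have wr i : reg w (t i) by exists (tau i).
have /choice[be hbe] := reg_signs dz plw (J := J) (fun s => alg_reg plw wr (aJ s)).
have [pt p1 sub] := point_place plw (yseg_neq0 dz _) hbe.
set p := \row_i be i in pt p1 sub.
have pj : p 0 (enum_rank J) != 0 by rewrite p1 oner_neq0.
exists p; split=> // i.
have [r hr] := cl _ _ (place_vp pt) plw sub (phJ_reg pt pj) wr i.
by have -> : tau i = r by apply: (pl_fun plw (wt i)); apply: sub.
Qed.

Lemma ratio_alg n (t : 'I_n -> K) J i : chartlike t J -> alg t (y 0 i / y 0 (enum_rank J)).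
Proof.
move=> [aJ _]; rewrite (yratioE dz) enum_rankK; apply: algM; apply: big_ind; try exact: alg1; try exact: algM;
  move=> s; rewrite inE => /andP[h1 h2]; have := aJ s; rewrite /phJ; by rewrite ?(negbTE h1) ?h2.
Qed.

Lemma cl_ext n (t : 'I_n -> K) J h : chartlike t J -> alg t h -> h != 0 -> chartlike (text t h) J.
Proof.
move=> [aJ cl] ah h0; split; first by move=> s; apply: alg_text.
move=> v w plv plw vw hJ hw; have ht : forall i, reg v (t i).
  by apply: (cl _ _ plv plw vw hJ) => i; rewrite -(text_lift t h i).
move=> i; case: (unliftP ord_max i) => [j|] ->; first by rewrite text_lift.
apply: (reg_up plv plw vw); last exact: hw.
by right; rewrite text_max invrK; apply: (alg_reg plv ht).
Qed.

(** The denominators of f form an ideal of polynomials. A common zero would be a point of the model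
    where f is regular, hence with a denominator that does not vanish; by the Nullstellensatz the
    ideal contains 1. *)
Lemma cl_regular n (t : 'I_n -> K) J f : chartlike t J ->
  (forall p, point iota y p -> (forall i, reg (vy p) (t i)) -> reg (vy p) f) -> alg t f.
Proof.
move=> cl hf; pose I (P : {mpoly k[n]}) := alg t (mmap iota t P * f).
have idI : is_ideal I.
  split; first by rewrite /I rmorph0 mul0r; apply: alg0.
    by move=> P Q; rewrite /I rmorphD mulrDl; apply: algD.
  by move=> P Q; rewrite /I rmorphM -mulrA => h; apply: algM => //; exists P.
case: (pselect (I 1)) => [|n1]; first by rewrite /I rmorph1 mul1r.
have [tau ht] := weak_nullstellensatz idI n1.
have sp : spec iota t tau by move=> P P0; apply: ht; rewrite /I P0 mul0r; apply: alg0.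
have [p [pt _ sub hp]] := cl_point cl sp.
have [|r hr] := hf p pt; first by move=> i; exists (tau i).
have [P [Q [Q0 fE _]]] := sub _ _ hr.
have Qn : mmap iota t Q != 0.
  apply: (pl_neq0 (place_loc sp) _ Q0); apply: (pl_mmap (place_loc sp)) => i; exact: loc_var.
by case/eqP: Q0; apply: ht; rewrite /I fE mulrC mulfVK //; exists P.
Qed.

(** Quasi-compactness of affine space: polynomials without common zero generate 1 by a finite
    combination. *)
Lemma gen_one n (S : {mpoly k[n]} -> Prop) : (forall tau, exists2 H, S H & H.@[tau] != 0) ->
  exists s : seq ({mpoly k[n]} * {mpoly k[n]}), (forall q, q \in s -> S q.2) /\ 1 = \sum_(q <- s) q.1 * q.2.
Proof.
move=> hS; pose I P := exists s : seq ({mpoly k[n]} * {mpoly k[n]}), (forall q, q \in s -> S q.2) /\ P = \sum_(q <- s) q.1 * q.2.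
case: (pselect (I 1)) => // n1.
have idI : is_ideal I.
  split; first by exists [::]; rewrite big_nil.
    move=> P Q [s [hs ->]] [s' [hs' ->]]; exists (s ++ s'); rewrite big_cat; split=> // q.
    by rewrite mem_cat => /orP[/hs|/hs'].
  move=> P Q [s [hs ->]]; exists [seq (P * q.1, q.2) | q <- s]; split.
    by move=> q /mapP[q' q's ->] /=; apply: hs.
  by rewrite big_map mulr_sumr; apply: eq_bigr => q _; rewrite mulrA.
have [tau ht] := weak_nullstellensatz idI n1; have [H SH /eqP H0] := hS tau.
case: H0; apply: ht; exists [:: (1, H)]; rewrite big_seq1 mul1r; split=> // q; by rewrite inE => /eqP ->.
Qed.

Section Serre.
Variables (r : nat) (U : 'I_r -> 'rV[k]_#|{set 'I_5}| -> Prop) (c : 'I_r -> K).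
Hypotheses (Uo : forall i, zopen iota y (U i)) (Ucov : forall p, point iota y p -> exists i, U i p).
Hypothesis Uc : forall i j p, point iota y p -> U i p -> U j p -> reg (vy p) (c i - c j).

(** All functions live in K, so a cocycle has the form c_i - c_j with c_i in K, and splitting it is
    a Cousin problem: find one h with c_i - h regular on each U_i. This is the condition at the
    point p; two local solutions differ by a regular function. *)
Definition Sol p h := forall i, U i p -> reg (vy p) (c i - h).

Lemma Sol_one p h i : point iota y p -> U i p -> reg (vy p) (c i - h) -> Sol p h.
Proof.
move=> pt Ui hi j Uj; have -> : c j - h = (c j - c i) + (c i - h) by rewrite addrA subrK.
by apply: (regD (place_vp pt)) => //; apply: Uc.
Qed.

Lemma Sol_diff p h h' : point iota y p -> Sol p h -> Sol p h' -> reg (vy p) (h - h').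
Proof.
move=> pt s s'; have [i Ui] := Ucov pt.
have -> : h - h' = (c i - h') - (c i - h) by ring.
by apply: (regB (place_vp pt)); [exact: s'|exact: s].
Qed.

Lemma Sol_shift p h h' : point iota y p -> Sol p h -> reg (vy p) h' -> Sol p (h + h').
Proof. by move=> pt s rh i Ui; rewrite opprD addrA; apply: (regB (place_vp pt)) => //; apply: s. Qed.

(** Serre's argument: the cover is refined by principal open sets h_l, denominators of the
    differences are cleared by a common power N, and the local solutions are combined by a partition
    of unity in the h_l^N. *)
Lemma Sol_affine n (t : 'I_n -> K) J : chartlike t J ->
  exists h, forall p, point iota y p -> (forall i, reg (vy p) (t i)) -> Sol p h.
Proof.
move=> cl; case: (posnP r) => [r0|r0].
  by exists 0 => p pt _ i; exfalso; move: (ltn_ord i); rewrite [X in (_ < X)%N]r0.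
pose S (H : {mpoly k[n]}) := exists i, forall p e, point iota y p -> (forall i, reg (vy p) (t i)) ->
  vy p (mmap iota t H) e -> e != 0 -> U i p.
have [s [hs s1]] : exists s : seq ({mpoly k[n]} * {mpoly k[n]}), (forall q, q \in s -> S q.2) /\ 1 = \sum_(q <- s) q.1 * q.2.
  apply: gen_one => tau; case: (pselect (spec iota t tau)) => [sp|nsp]; last first.
    have [P [P0 /eqP Pt]] : exists P, mmap iota t P = 0 /\ P.@[tau] <> 0.
      by apply: contrapT => h; apply: nsp => P P0; apply: contrapT => h'; apply: h; exists P.
    exists P => //; exists (Ordinal r0) => p e pt _ he; rewrite P0 in he.
    by rewrite (pl_fun (place_vp pt) he (pl_0 (place_vp pt))) eqxx.
  have [p [pt pj sub hp]] := cl_point cl sp.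
  have [i Ui] := Ucov pt; have [T [Th hT]] := Uo i.
  have [F TF F0] := (hT p pt).1 Ui; have [d hd] := Th F TF.
  pose yJ := y 0 (enum_rank J); have yJ0 : yJ != 0 := yseg_neq0 dz _.
  have /choice[R hR] l : exists R : {mpoly k[n]}, y 0 l / yJ = mmap iota t R := ratio_alg l cl.
  (* The equation F cutting a neighbourhood of p out of U_i, rewritten in the affine coordinates
     t. *)
  pose H := mmap (@mpolyC n k) R F.
  have HE : mmap iota t H = mmap iota (fun l => y 0 l / yJ) F.
    rewrite /H [X in mmap iota t X]/mmap rmorph_sum /mmap; apply: eq_bigr => m _; rewrite rmorphM /= mmapC; congr (_ * _).
    by rewrite /mmap1 rmorph_prod; apply: eq_bigr => l _; rewrite rmorphXn /= hR.
  have Fval p' : point iota y p' -> p' 0 (enum_rank J) != 0 -> vy p' (mmap iota t H) F.@[fun l => p' 0 l / p' 0 (enum_rank J)].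
    by move=> pt' pj'; rewrite HE; apply: (pl_mmap (place_vp pt')) => l; apply: vp_ratio.
  have hE (p' : 'rV[k]_#|{set 'I_5}|) : p' 0 (enum_rank J) != 0 -> F.@[p' 0] = p' 0 (enum_rank J) ^+ d * F.@[fun l => p' 0 l / p' 0 (enum_rank J)].
    by move=> pj'; rewrite -(meval_homog _ _ hd); apply: meval_ext => l; rewrite mulrC mulfVK.
  exists H.
    exists i => p' e pt' ht' he e0; apply/(hT p' pt'); exists F => //.
    have pj' : p' 0 (enum_rank J) != 0.
      have [l pl _] := point_neq0 pt'.
      have plv' := place_vp pt'.
      have [e' he'] : reg (vy p') (y 0 l / yJ) by apply: (alg_reg plv' ht'); apply: (ratio_alg l cl).
      apply: contra_neq (oner_neq0 k) => pJ0.
      apply: (pl_fun plv' (f := yJ / y 0 l * (y 0 l / yJ))).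
        by rewrite mulrA mulfVK ?(yseg_neq0 dz) // mulfV //; exact: (pl_1 plv').
      by have := pl_M plv' (vp_ratio iota y (enum_rank J) pl) he'; rewrite pJ0 !mul0r.
    rewrite hE // mulf_neq0 ?expf_neq0 // -(pl_fun (place_vp pt') he (Fval _ pt' pj')) //.
  have := Fval _ pt pj; move=> h1.
  have h2 : loc iota t tau (mmap iota t H) H.@[tau] by apply: (pl_mmap (place_loc sp)) => l; apply: loc_var.
  rewrite (pl_fun (place_loc sp) h2 (sub _ _ h1)).
  by move: F0; rewrite hE // mulf_eq0 negb_or => /andP[].
pose N0 := size s; pose q (l : 'I_N0) := tnth (in_tuple s) l.
have /choice[ix hix] l : S (q l).2 by apply: hs; apply: mem_tnth.
pose hh l := mmap iota t (q l).2.
have ah l : alg t (hh l) by exists (q l).2.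
have one : 1 = \sum_l (q l).1 * (q l).2.
  by rewrite {1}s1 (big_tnth _ _ s).
have diff l m : exists N, alg t ((hh l * hh m) ^+ N * (c (ix l) - c (ix m))).
  have [e|hlm] := eqVneq (hh l * hh m) 0; first by exists 1%N; rewrite e expr1 mul0r; apply: alg0.
  have cl' := cl_ext cl (algM (ah l) (ah m)) hlm.
  have := @cl_regular _ _ J (c (ix l) - c (ix m)) cl'; case=> [p pt ht|P hP]; last first.
    by apply: (text_inv (algM (ah l) (ah m)) hlm); exists P.
  have plv := place_vp pt.
  have ht' i : reg (vy p) (t i) by have := ht (lift ord_max i); rewrite text_lift.
  have [e he] := alg_reg plv ht' (ah l); have [e' he'] := alg_reg plv ht' (ah m).
  have [e'' he''] := ht ord_max; rewrite text_max in he''.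
  have ee : e * e' * e'' = 1.
    apply: (pl_fun plv (f := (hh l * hh m) / (hh l * hh m))); first by apply: (pl_M plv) => //; apply: (pl_M plv).
    by rewrite mulfV //; apply: (pl_1 plv).
  have e0 : e != 0 by apply: contra_eq_neq ee => ->; rewrite !mul0r eq_sym oner_eq0.
  have e0' : e' != 0 by apply: contra_eq_neq ee => ->; rewrite mulr0 mul0r eq_sym oner_eq0.
  by apply: Uc => //; [apply: (hix l) he e0|apply: (hix m) he' e0'].
have /choice[Nf hNf] : forall lm : 'I_N0 * 'I_N0, exists N, alg t ((hh lm.1 * hh lm.2) ^+ N * (c (ix lm.1) - c (ix lm.2))).
  by move=> lm; apply: diff.
pose N := \max_lm Nf lm.
have hN l m : alg t ((hh l * hh m) ^+ N * (c (ix l) - c (ix m))).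
  have -> : N = (N - Nf (l, m) + Nf (l, m))%N by rewrite subnK // (@leq_bigmax _ Nf (l, m)).
  rewrite exprD -mulrA; apply: algM; first by apply/algX/algM.
  exact: (hNf (l, m)).
(* The powers h_l^N have no common zero either. *)
have [s' [hs' s1']] : exists s' : seq ({mpoly k[n]} * {mpoly k[n]}), (forall q', q' \in s' -> exists l, q'.2 = (q l).2 ^+ N) /\ 1 = \sum_(q <- s') q.1 * q.2.
  apply: (gen_one (S := fun H => exists l, H = (q l).2 ^+ N)) => tau.
  case: (boolP [exists l, (q l).2.@[tau] != 0]) => [/existsP[l hl]|/existsPn h].
    by exists ((q l).2 ^+ N); [exists l|rewrite rmorphXn expf_neq0].
  have := congr1 (meval tau) one; rewrite rmorph1 rmorph_sum big1 /=.
    by move/eqP; rewrite oner_eq0.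
  by move=> l _; rewrite rmorphM /=; have := h l; rewrite negbK => /eqP ->; rewrite mulr0.
have /choice[lx hlx] : forall l' : 'I_(size s'), exists l, (tnth (in_tuple s') l').2 = (q l).2 ^+ N.
  by move=> l'; apply: hs'; apply: mem_tnth.
pose Ef l' := mmap iota t (tnth (in_tuple s') l').1.
have one' : 1 = \sum_l' Ef l' * hh (lx l') ^+ N.
  have := congr1 (mmap iota t) s1'; rewrite rmorph1 (big_tnth _ _ s') rmorph_sum /= => ->.
  by apply: eq_bigr => l' _; rewrite rmorphM hlx rmorphXn.
pose g := \sum_l' Ef l' * hh (lx l') ^+ N * c (ix (lx l')).
exists g => p pt ht; have plv := place_vp pt.
have [m [e [he e0]]] : exists m e, vy p (hh m) e /\ e != 0.
  have /choice[e he] l := alg_reg plv ht (ah l).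
  case: (boolP [exists l, e l != 0]) => [/existsP[l hl]|/existsPn h]; first by exists l, (e l).
  have /choice[e' he'] l : reg (vy p) (mmap iota t (q l).1) by apply: (alg_reg plv ht); exists (q l).1.
  have : vy p 1 0.
    have := congr1 (mmap iota t) one; rewrite rmorph1 rmorph_sum /= => ->.
    have -> : 0 = \sum_l e' l * e l.
      by rewrite big1 // => l _; have := h l; rewrite negbK => /eqP ->; rewrite mulr0.
    by apply: (pl_sum plv) => l _; rewrite rmorphM; apply: (pl_M plv); [exact: he'|exact: he].
  by move/(pl_fun plv (pl_1 plv))/eqP; rewrite oner_eq0.
apply: (@Sol_one _ _ (ix m)) => //; first exact: (hix m) he e0.
have hm0 := pl_neq0 plv he e0.
have -> : c (ix m) - g = (hh m ^+ N)^-1 * \sum_l' Ef l' * ((hh m * hh (lx l')) ^+ N * (c (ix m) - c (ix (lx l')))).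
  apply: (mulfI (expf_neq0 N hm0)); rewrite mulVKf ?expf_neq0 // -[c (ix m)]mul1r {1}one' mulr_suml /g -sumrB mulr_sumr.
  by apply: eq_bigr => l' _; rewrite exprMn; ring.
apply: (regM plv); first by exists (e ^+ N)^-1; apply: (pl_V plv); [apply: (pl_X plv)|rewrite expf_neq0].
apply: (alg_reg plv ht); apply: alg_sum => l'; apply: algM; [by exists (tnth (in_tuple s') l').1|exact: hN].
Qed.
End Serre.
End Affine.

(** * Functions regular outside finitely many points of a surface over the plane *)

Section Ray.
Variables (k K : fieldType) (iota : {rmorphism k -> K}) (s t y : K) (al de : k).
Definition pr2 (i : 'I_2) : K := if val i is 0%N then s else t.
Local Notation ev := (mmap iota pr2).
Variable B : {mpoly k[2]}.
Let w := s * t * y.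
Hypotheses (s0 : s != 0) (t0 : t != 0) (y0 : y != 0) (al0 : al != 0).
Hypothesis rel : iota al * (s * t) * y ^+ 2 + ev B * y + iota de * (s * t) = 0.
Hypothesis B0 : rk B != 0.
Hypothesis free : forall P Q, ev P + ev Q * w = 0 -> P = 0 /\ Q = 0.

(** Unlike y, the product w = s t y is integral over k[s, t], so k[s, t] + k[s, t] w is a ring, and
    it is free by [free]. *)
Definition inS f := exists P Q, f = ev P + ev Q * w.

Lemma ev_s : ev 'X_ord0 = s. Proof. by rewrite mmapX mmap1U. Qed.
Lemma ev_t : ev 'X_ord_max = t. Proof. by rewrite mmapX mmap1U. Qed.

Lemma wsq : w ^+ 2 = - (iota al^-1 * (ev B * w + iota de * (s * t) ^+ 2)).
Proof.
have ia : iota al != 0 by rewrite fmorph_eq0.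
apply: (mulfI ia); rewrite mulrN fmorphV mulVKf //; apply/eqP; rewrite -addr_eq0; apply/eqP.
by rewrite -(mulr0 (s * t)) -rel /w; ring.
Qed.

Definition pM (P Q P' Q' : {mpoly k[2]}) : {mpoly k[2]} * {mpoly k[2]} :=
  (P * P' - al^-1 *: (de *: (Q * Q' * ('X_ord0 * 'X_ord_max) ^+ 2)), P * Q' + Q * P' - al^-1 *: (Q * Q' * B)).

Lemma pME P Q P' Q' : (ev P + ev Q * w) * (ev P' + ev Q' * w) = ev (pM P Q P' Q').1 + ev (pM P Q P' Q').2 * w.
Proof.
have -> : (ev P + ev Q * w) * (ev P' + ev Q' * w) = ev P * ev P' + (ev P * ev Q' + ev Q * ev P') * w + ev Q * ev Q' * w ^+ 2 by ring.
rewrite wsq /pM /= !rmorphB rmorphD /= !mmapZ !rmorphM /= ?rmorphXn ?rmorphM /= ev_s ev_t.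
by move: (ev P) (ev Q) (ev P') (ev Q') (ev B) (iota al^-1) => *; ring.
Qed.

Lemma inSM f g : inS f -> inS g -> inS (f * g).
Proof. by move=> [P [Q ->]] [P' [Q' ->]]; exists (pM P Q P' Q').1, (pM P Q P' Q').2; rewrite pME. Qed.
Lemma inSD f g : inS f -> inS g -> inS (f + g).
Proof. by move=> [P [Q ->]] [P' [Q' ->]]; exists (P + P'), (Q + Q'); rewrite !rmorphD /=; ring. Qed.
Lemma inS_ev P : inS (ev P). Proof. by exists P, 0; rewrite rmorph0 mul0r addr0. Qed.
Lemma inS_w : inS w. Proof. by exists 0, 1; rewrite rmorph0 rmorph1 mul1r add0r. Qed.
Lemma inS_C c : inS (iota c). Proof. by rewrite -(mmapC pr2 iota c); apply: inS_ev. Qed.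
Lemma inS_1 : inS 1. Proof. by rewrite -(rmorph1 iota); apply: inS_C. Qed.
Lemma inS_s : inS s. Proof. by rewrite -ev_s; apply: inS_ev. Qed.
Lemma inS_t : inS t. Proof. by rewrite -ev_t; apply: inS_ev. Qed.
Lemma inS_X f n : inS f -> inS (f ^+ n).
Proof. by move=> h; elim: n => [|n IH]; [rewrite expr0; exact: inS_1|rewrite exprS; apply: inSM]. Qed.

(** Where this function is invertible y is regular, because Dp y = - de s t; where w is invertible
    1/y is regular. *)
Definition Dp := iota al * w + ev B.
Lemma Dp_y : Dp * y = - (iota de * (s * t)).
Proof. by apply/eqP; rewrite -addr_eq0; apply/eqP; rewrite -rel /Dp /w; ring. Qed.
Lemma inS_Dp : inS Dp.
Proof. by apply: inSD; [apply: inSM; [exact: inS_C|exact: inS_w]|exact: inS_ev]. Qed.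

Definition clo E f := exists M L, inS (t ^+ L * E ^+ M * f).

Lemma clo_S E f : inS f -> clo E f.
Proof. by move=> h; exists 0%N, 0%N; rewrite !expr0 !mul1r. Qed.
Lemma cloM E f g : clo E f -> clo E g -> clo E (f * g).
Proof.
move=> [M [L h]] [M' [L' h']]; exists (M + M')%N, (L + L')%N; rewrite !exprD.
have -> : t ^+ L * t ^+ L' * (E ^+ M * E ^+ M') * (f * g) = (t ^+ L * E ^+ M * f) * (t ^+ L' * E ^+ M' * g) by ring.
exact: inSM.
Qed.
Lemma cloD E f g : inS E -> clo E f -> clo E g -> clo E (f + g).
Proof.
move=> hE [M [L h]] [M' [L' h']]; exists (M + M')%N, (L + L')%N; rewrite !exprD.
have -> : t ^+ L * t ^+ L' * (E ^+ M * E ^+ M') * (f + g) =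
  (t ^+ L' * E ^+ M') * (t ^+ L * E ^+ M * f) + (t ^+ L * E ^+ M) * (t ^+ L' * E ^+ M' * g) by ring.
by apply: inSD; apply: inSM => //; apply: inSM; apply: inS_X => //; exact: inS_t.
Qed.
Lemma clo_tV E : clo E t^-1.
Proof. by exists 0%N, 1%N; rewrite expr0 mulr1 expr1 mulfV //; exact: inS_1. Qed.
Lemma clo_Dp_y : clo Dp y.
Proof.
exists 1%N, 0%N; rewrite expr0 mul1r expr1 Dp_y -mulN1r -(rmorph1 iota) -rmorphN.
by apply: inSM; [exact: inS_C|apply: inSM; [exact: inS_C|apply: inSM; [exact: inS_s|exact: inS_t]]].
Qed.
Lemma clo_w_yV : clo w y^-1.
Proof. by exists 1%N, 0%N; rewrite expr0 mul1r expr1 /w mulfK //; apply: inSM; [exact: inS_s|exact: inS_t]. Qed.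
Lemma clo_s_y : clo s y.
Proof. by exists 1%N, 1%N; rewrite !expr1 (mulrC t); exact: inS_w. Qed.

(** Reduction modulo s on the component w = lam of the curve s = 0. The two components are the
    solutions lam = 0 and lam = - B/al of the equation of w at s = 0. *)
Definition rho (lam : {poly k}) f p := exists P Q, f = ev P + ev Q * w /\ p = rk P + rk Q * lam.

Lemma rho_fun lam f p q : rho lam f p -> rho lam f q -> p = q.
Proof.
move=> [P [Q [-> ->]]] [P' [Q' [e ->]]].
have [] := free (P := P - P') (Q := Q - Q').
  by rewrite !rmorphB mulrBl addrACA -opprD -e subrr.
by move=> /eqP; rewrite subr_eq0 => /eqP -> /eqP; rewrite subr_eq0 => /eqP ->.
Qed.

Lemma rk_ring : (forall P Q : {mpoly k[2]}, rk (P + Q) = rk P + rk Q) /\ (forall P Q : {mpoly k[2]}, rk (P * Q) = rk P * rk Q).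
Proof. by split=> P Q; rewrite /rk ?rmorphD ?rmorphM. Qed.
Lemma rkB (P Q : {mpoly k[2]}) : rk (P - Q) = rk P - rk Q. Proof. by rewrite /rk rmorphB. Qed.
Lemma rkZ c (P : {mpoly k[2]}) : rk (c *: P) = c%:P * rk P. Proof. by rewrite /rk mmapZ. Qed.

Lemma rhoM lam f g p q : lam * lam = - (al^-1%:P * rk B * lam) -> rho lam f p -> rho lam g q -> rho lam (f * g) (p * q).
Proof.
move=> lE [P [Q [-> ->]]] [P' [Q' [-> ->]]]; exists (pM P Q P' Q').1, (pM P Q P' Q').2; rewrite pME; split=> //.
have [rD rM] := rk_ring; rewrite /pM /= !rkB !rkZ rD !rM ?expr2 ?rM rkX0.
have -> : (rk P + rk Q * lam) * (rk P' + rk Q' * lam) = rk P * rk P' + (rk P * rk Q' + rk Q * rk P') * lam + rk Q * rk Q' * (lam * lam) by ring.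
by rewrite lE; ring.
Qed.
Lemma rhoX lam f p n : lam * lam = - (al^-1%:P * rk B * lam) -> rho lam f p -> rho lam (f ^+ n) (p ^+ n).
Proof.
move=> lE h; elim: n => [|n IH]; last by rewrite !exprS; apply: rhoM.
by exists 1, 0; rewrite !expr0 rmorph1 rmorph0 /rk rmorph1 rmorph0 !mul0r !addr0.
Qed.
Lemma rho_t lam : rho lam t 'X.
Proof. by exists 'X_ord_max, 0; rewrite ev_t rmorph0 rkX1 {1}/rk rmorph0 !mul0r !addr0. Qed.
Lemma rho_s lam : rho lam s 0.
Proof. by exists 'X_ord0, 0; rewrite ev_s rmorph0 rkX0 {1}/rk rmorph0 !mul0r !addr0. Qed.
Lemma inS_rho lam f : inS f -> exists p, rho lam f p.
Proof. by move=> [P [Q ->]]; exists (rk P + rk Q * lam), P, Q. Qed.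

(** The product of s g with t^L E^M is a multiple of s and reduces to 0; it also reduces to p times
    nonzero polynomials. *)
Lemma ray_kill lam E e g p : lam * lam = - (al^-1%:P * rk B * lam) -> rho lam E e -> e != 0 ->
  clo E g -> rho lam (s * g) p -> p = 0.
Proof.
move=> lE hE e0 [M [L h]] hg; have [q hq] := inS_rho lam h.
have h1 := rhoM lE (rhoM lE (rhoX L lE (rho_t lam)) (rhoX M lE hE)) hg.
have h2 := rhoM lE (rho_s lam) hq; rewrite mul0r in h2.
have e1 : t ^+ L * E ^+ M * (s * g) = s * (t ^+ L * E ^+ M * g) by ring.
rewrite e1 in h1; have /eqP := rho_fun h1 h2.
by rewrite !mulf_eq0 !expf_eq0 (negbTE e0) polyX_eq0 !andbF /= => /eqP.
Qed.

(** A factor s can be cancelled from the denominator if the numerator vanishes on both components of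
    s = 0. On w = 0 the function [Dp] reduces to B, on w = - B/al the function w does not vanish, so
    on each component one of the first two hypotheses gives a denominator prime to s. *)
Lemma ray f : clo Dp f -> clo w f -> clo s f -> exists L, inS (t ^+ L * f).
Proof.
move=> hD hw [M [L h]]; exists L; elim: M h => [|M IH]; first by rewrite expr0 mulr1.
have -> : t ^+ L * s ^+ M.+1 * f = s * (t ^+ L * s ^+ M * f) by rewrite exprS; ring.
set g := t ^+ L * s ^+ M * f => hg; apply: IH.
have cg E : clo E f -> clo E g.
  by move=> h; apply: cloM => //; apply/clo_S/inSM; apply: inS_X; [exact: inS_t|exact: inS_s].
have [P [Q gE]] := hg.
have P0 : rk P = 0.
  apply: (@ray_kill 0 Dp (rk B) g (rk P)) => //; rewrite ?mulr0 ?oppr0 //; [|exact: cg|].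
    by exists B, al%:MP; rewrite mulr0 addr0 mmapC addrC.
  by exists P, Q; rewrite mulr0 addr0.
pose lam := - (al^-1%:P * rk B).
have Q0 : rk Q = 0.
  have : rk P + rk Q * lam = 0.
    apply: (@ray_kill lam w lam g) => //; [by rewrite /lam; ring| |by rewrite oppr_eq0 mulf_neq0 // polyC_eq0 invr_eq0|exact: cg|].
      by exists 0, 1; rewrite rmorph0 rmorph1 /rk rmorph0 rmorph1 !mul1r !add0r.
    by exists P, Q.
  move/eqP; rewrite P0 add0r mulf_eq0 oppr_eq0 mulf_eq0 polyC_eq0 invr_eq0 (negbTE al0) (negbTE B0) !orbF.
  by move/eqP.
have [P' eP] := rk0 P0; have [Q' eQ] := rk0 Q0.
exists P', Q'; apply: (mulfI s0); rewrite gE eP eQ !rmorphM /= ev_s; ring.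
Qed.
End Ray.

Section RayFree.
Variables (k K : fieldType) (iota : {rmorphism k -> K}).

Lemma mmap_pr2 (s t : K) (P : {mpoly k[2]}) :
  mmap iota (pr2 s t) P = \sum_(m <- msupp P) iota P@_m * (s ^+ m ord0 * t ^+ m ord_max).
Proof.
rewrite /mmap; apply: eq_bigr => m _; congr (_ * _).
by rewrite /mmap1 big_ord_recr big_ord1 /=; have -> : widen_ord (leqnSn 1) ord0 = ord0 by apply: val_inj.
Qed.

Lemma ray_free (Z : 'I_3 -> K) al de (s t : K) (E : 'X_{1..2} -> int * int) (e0 : int * int) : datum iota Z al de ->
  (forall m : 'X_{1..2}, s ^+ m ord0 * t ^+ m ord_max = lmon Z (E m)) -> injective E -> s * t * Z 2 = lmon Z e0 * Z 2 ->
  forall P Q, mmap iota (pr2 s t) P + mmap iota (pr2 s t) Q * (s * t * Z 2) = 0 -> P = 0 /\ Q = 0.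
Proof.
move=> dZ hE Einj h0 P Q.
pose sh (e : int * int) := (e.1 + e0.1, e.2 + e0.2).
have shinj : injective sh by move=> [a b] [c d] [] /addIr -> /addIr ->.
have lsh e : lmon Z (sh e) = lmon Z e * lmon Z e0.
  by rewrite /lmon /sh /= !expfzDr ?(d_z dZ) // mulrACA.
pose LP := [seq (P@_m, E m) | m <- msupp P]; pose LQ := [seq (Q@_m, sh (E m)) | m <- msupp Q].
have -> : mmap iota (pr2 s t) P = lv iota Z LP.
  by rewrite mmap_pr2 /lv [RHS]big_map; apply: eq_bigr => m _; rewrite hE.
have -> : mmap iota (pr2 s t) Q * (s * t * Z 2) = Z 2 * lv iota Z LQ.
  rewrite mmap_pr2 h0 /lv [X in _ = _ * X]big_map mulr_suml mulr_sumr; apply: eq_bigr => m _.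
  by rewrite hE /= lsh; ring.
move/(laurent_free dZ) => [h h'].
have cE (F : {mpoly k[2]}) (G : 'X_{1..2} -> int * int) m : injective G -> coefl [seq (F@_m, G m) | m <- msupp F] (G m) = F@_m.
  move=> Gi; rewrite /coefl [LHS]big_map /= (eq_bigl (fun m' => m' == m)); last by move=> m'; rewrite (inj_eq Gi).
  have [mF|mF] := boolP (m \in msupp F).
    by rewrite -big_filter filter_pred1_uniq ?msupp_uniq ?big_seq1.
  by rewrite big1_seq ?(memN_msupp_eq0 mF) // => m' /andP[/eqP ->]; rewrite (negbTE mF).
split; apply/mpolyP => m; rewrite mcoeff0; first by rewrite -(cE P E m Einj) h.
by rewrite -(cE Q (sh \o E) m (inj_comp shinj Einj)) h'.
Qed.
End RayFree.

Lemma zfs_inv (K : fieldType) sg b (z : 'I_3 -> K) : zfs (fun i => sg (pib b i)) b (zfs sg b z) = z.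
Proof.
apply: funext => i; rewrite zfsE /zflip zfsE /zflip pibK; case: (sg i) => //.
by rewrite invrK.
Qed.

Definition fl2 (sg : 'I_3 -> bool) (i : 'I_3) := if i == 2 then ~~ sg i else sg i.

Section H1.
Variables (k : closedFieldType) (K : fieldType) (iota : {rmorphism k -> K}).
Variables (z : 'I_3 -> K) (al de : 'I_3 -> k).
Hypothesis dz : datum iota z al de.
Local Notation y := (yseg z).
Local Notation vy := (vp iota y).
Local Notation alg := (alg iota).
Local Notation cl := (chartlike iota z).

Section Transformed.
Variables (sg : 'I_3 -> bool) (b : bool).
Local Notation Z := (zfs sg b z).
Local Notation Z' := (zfs (fl2 sg) b z).

Lemma dZ : datum iota Z (cfs sg b al de) (cfs sg b de al). Proof. exact: datum_fs. Qed.

Lemma pib2 : pib b 2 = 2. Proof. by rewrite /pib; case: b; rewrite ?tpermD. Qed.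
Lemma pib_neq2 i : i != 2 -> pib b i != 2. Proof. by apply: contraNN => /eqP e; rewrite -(pibK b i) e pib2. Qed.

Lemma Z'E i : i != 2 -> Z' i = Z i.
Proof. by move=> i2; rewrite !zfsE /zflip /fl2 (negbTE (pib_neq2 i2)). Qed.
Lemma Z'2 : Z' 2 = (Z 2)^-1.
Proof. by rewrite !zfsE /zflip /fl2 pib2 eqxx; case: (sg 2); rewrite /= ?invrK. Qed.

Lemma phiZ s' : exists s, phi Z s' = phi z s \/ phi Z s' = (phi z s)^-1.
Proof. by have [s h] := phi_fs dZ (fun i => sg (pib b i)) b s'; rewrite zfs_inv in h; exists s. Qed.

Lemma Z_neq0 i : Z i != 0. Proof. exact: (d_z dZ). Qed.

Lemma algZ1 : alg (chart Z) (Z 1).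
Proof. by rewrite -[Z 1](mulfVK (Z_neq0 0)); apply: algM; [exact: (algV _ _ 1)|exact: (algV _ _ 0)]. Qed.

Lemma chart_cl : exists J, cl (chart Z) J.
Proof.
have aZ s' : alg (chart Z) (phi Z s') \/ alg (chart Z) (phi Z s')^-1.
  rewrite /phi; case: s' => -[|[|[|[|[|//]]]]] ? /=.
  - by left; exact: (algV _ _ 0).
  - by left; exact: algZ1.
  - by left; exact: (algV _ _ 2).
  - by right; rewrite invf_div; exact: (algV _ _ 1).
  - by left; apply: algM; [exact: (algV _ _ 0)|exact: algZ1].
have az s : alg (chart Z) (phi z s) \/ alg (chart Z) (phi z s)^-1.
  by have [s' [->|->]] := phi_fs dz sg b s; [|rewrite invrK or_comm].
pose J := [set s : 'I_5 | ~~ `[< alg (chart Z) (phi z s) >]].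
exists J; split.
  by move=> s; rewrite /phJ inE; case: asboolP => //= h; case: (az s).
move=> v w plv plw vw hJ hw i; apply: (reg_up plv plw vw _ (hw i)).
have rz s : reg v (phi z s) \/ reg v (phi z s)^-1 by have := hJ s; rewrite /phJ; case: ifP; [right|left].
have rZ s' : reg v (phi Z s') \/ reg v (phi Z s')^-1.
  by have [s [->|->]] := phiZ s'; [|rewrite invrK or_comm].
elim/ord3_ind: i.
- by have := rZ (inord 0); rewrite /phi /= inordK.
- by have := rZ (inord 3); rewrite /phi /= inordK // invf_div /chart /= or_comm invf_div.
- by have := rZ (inord 2); rewrite /phi /= inordK.
Qed.

Lemma phiZ_pm p s' : point iota y p -> reg (vy p) (phi Z s') \/ reg (vy p) (phi Z s')^-1.
Proof.
move=> pt; have [J hJ] := yseg_sign dz pt.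
have rz s : reg (vy p) (phi z s) \/ reg (vy p) (phi z s)^-1 by have := hJ s; case: ifP; [right|left].
by have [s [->|->]] := phiZ s'; [|rewrite invrK or_comm].
Qed.

Lemma Z2_pm p : point iota y p -> reg (vy p) (Z 2) \/ reg (vy p) (Z 2)^-1.
Proof. by move=> pt; have := phiZ_pm (inord 2) pt; rewrite /phi /= inordK. Qed.
Lemma th_pm p : point iota y p -> reg (vy p) (Z 1 / Z 0) \/ reg (vy p) (Z 0 / Z 1).
Proof. by move=> pt; have := phiZ_pm (inord 3) pt; rewrite /phi /= inordK // invf_div or_comm. Qed.

(** If Z_2 has a pole, the chart with Z_2 inverted is used; there [chart_dom] says that Z_1 divided
    by the inverse of Z_2 is regular. *)
Lemma Z12_reg p : point iota y p -> reg (vy p) (Z 0) -> reg (vy p) (Z 1 / Z 0) -> reg (vy p) (Z 1 * Z 2).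
Proof.
move=> pt r0 r1; have plv := place_vp pt; have [r2|r2] := Z2_pm pt.
  have /choice[tau ht] i : reg (vy p) (chart Z i) by elim/ord3_ind: i.
  by have [] := chart_dom dZ plv ht 2.
have dZ' := datum_fs (fl2 sg) b dz.
have /choice[tau ht] i : reg (vy p) (chart Z' i).
  by elim/ord3_ind: i; rewrite /chart /= ?Z'2 ?Z'E.
by have [_] := chart_dom dZ' plv ht 2; rewrite Z'2 invrK Z'E.
Qed.
End Transformed.

Lemma zfs_sw sg b i : i != 2 -> zfs sg (~~ b) z i = zfs sg b z (tperm 0 1 i).
Proof. by move=> i2; rewrite !zfsE /pib; case: b => //=; rewrite tpermK. Qed.
Lemma zfs_sw0 sg b : zfs sg (~~ b) z 0 = zfs sg b z 1. Proof. by rewrite zfs_sw ?tpermL. Qed.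
Lemma zfs_sw1 sg b : zfs sg (~~ b) z 1 = zfs sg b z 0. Proof. by rewrite zfs_sw ?tpermR. Qed.
Lemma zfs_sw2 sg b : zfs sg (~~ b) z 2 = zfs sg b z 2. Proof. by rewrite !zfsE !pib2. Qed.

Lemma Z012_reg sg b p : point iota y p -> reg (vy p) (zfs sg b z 0) -> reg (vy p) (zfs sg b z 1) ->
  reg (vy p) (zfs sg b z 0 * zfs sg b z 1 * zfs sg b z 2).
Proof.
move=> pt r0 r1; have plv := place_vp pt; have [r2|r2] := th_pm sg b pt.
  by rewrite -mulrA; apply: (regM plv) => //; apply: Z12_reg.
have := @Z12_reg sg (~~ b) p pt; rewrite zfs_sw0 zfs_sw1 zfs_sw2 => /(_ r1 r2) h.
by rewrite mulrAC mulrC; apply: (regM plv).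
Qed.

Variables (r : nat) (U : 'I_r -> 'rV[k]_#|{set 'I_5}| -> Prop) (c : 'I_r -> K).
Hypotheses (Uo : forall i, zopen iota y (U i)) (Ucov : forall p, point iota y p -> exists i, U i p).
Hypothesis Uc : forall i j p, point iota y p -> U i p -> U j p -> reg (vy p) (c i - c j).
Local Notation Sol := (Sol iota z U c).

Definition rs (P : 'rV[k]_#|{set 'I_5}| -> Prop) f := forall p, point iota y p -> P p -> reg (vy p) f.
Definition spl P1 P2 f := exists r1 r2, [/\ rs P1 r1, rs P2 r2 & f = r1 + r2].

Lemma rsM P f g : rs P f -> rs P g -> rs P (f * g).
Proof. by move=> h h' p pt hp; apply: (regM (place_vp pt)); [exact: h|exact: h']. Qed.
Lemma rsX P f n : rs P f -> rs P (f ^+ n).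
Proof. by move=> h p pt hp; apply: (regX (place_vp pt)); exact: h. Qed.
Lemma rsC P e : rs P (iota e).
Proof. by move=> p pt hp; apply: (regC (place_vp pt)). Qed.
Lemma rs0 P : rs P 0. Proof. by rewrite -(rmorph0 iota); exact: rsC. Qed.
Lemma splD P1 P2 f g : spl P1 P2 f -> spl P1 P2 g -> spl P1 P2 (f + g).
Proof.
move=> [r1 [r2 [h1 h2 ->]]] [s1 [s2 [h3 h4 ->]]]; exists (r1 + s1), (r2 + s2); split; last by ring.
- by move=> p pt hp; apply: (regD (place_vp pt)); [exact: h1|exact: h3].
- by move=> p pt hp; apply: (regD (place_vp pt)); [exact: h2|exact: h4].
Qed.
Lemma spl_l P1 P2 f : rs P1 f -> spl P1 P2 f.
Proof. by move=> h; exists f, 0; rewrite addr0; split=> //; exact: rs0. Qed.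
Lemma spl_r P1 P2 f : rs P2 f -> spl P1 P2 f.
Proof. by move=> h; exists 0, f; rewrite add0r; split=> //; exact: rs0. Qed.
Lemma spl_sum P1 P2 I (s : seq I) (F : I -> K) : (forall i, spl P1 P2 (F i)) -> spl P1 P2 (\sum_(i <- s) F i).
Proof. by move=> h; apply: big_ind => //; [apply/spl_l/rs0|exact: splD]. Qed.

(** The Mayer-Vietoris step: a splitting of the difference of two partial solutions corrects them to
    a common one. *)
Lemma glue (P1 P2 : 'rV[k]_#|{set 'I_5}| -> Prop) h1 h2 : (forall p, point iota y p -> P1 p -> Sol p h1) ->
  (forall p, point iota y p -> P2 p -> Sol p h2) -> spl P1 P2 (h1 - h2) ->
  exists h, forall p, point iota y p -> P1 p \/ P2 p -> Sol p h.
Proof.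
move=> s1 s2 [r1 [r2 [hr1 hr2 e]]]; exists (h1 - r1) => p pt [hp|hp].
  by apply: (Sol_shift pt); [exact: s1|apply: (regN (place_vp pt)); exact: hr1].
have -> : h1 = h2 + (r1 + r2) by rewrite -e addrC subrK.
have -> : h2 + (r1 + r2) - r1 = h2 + r2 by ring.
by apply: (Sol_shift pt); [exact: s2|exact: hr2].
Qed.

(** The two charts differ by inverting Z_2, and the difference of the solutions is a polynomial in
    the chart coordinates and 1/Z_2, which is split monomial by monomial. *)
Lemma level3 sg b : exists h, forall p, point iota y p -> reg (vy p) (zfs sg b z 0) ->
  reg (vy p) (zfs sg b z 1 / zfs sg b z 0) -> Sol p h.
Proof.
have nZ := Z_neq0 sg b; set Z := zfs sg b z in nZ *; set Z' := zfs (fl2 sg) b z.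
have [J cJ] := chart_cl sg b; have [J' cJ'] := chart_cl (fl2 sg) b.
have [h1 s1] := Sol_affine dz Uo Ucov Uc cJ; have [h2 s2] := Sol_affine dz Uo Ucov Uc cJ'.
rewrite -/Z in cJ s1; rewrite -/Z' in cJ' s2.
have c'E p : reg (vy p) (Z 0) -> reg (vy p) (Z 1 / Z 0) -> reg (vy p) (Z 2)^-1 -> forall i, reg (vy p) (chart Z' i).
  by move=> a0 a1 a2 i; elim/ord3_ind: i; rewrite /chart /= /Z' ?Z'2 ?Z'E.
pose P1 p := forall i, reg (vy p) (chart Z i); pose P2 p := forall i, reg (vy p) (chart Z' i).
have [h hh] : exists h, forall p, point iota y p -> P1 p \/ P2 p -> Sol p h.
  apply: (glue (h1 := h1) (h2 := h2)) => //.
  have a2 : alg (chart Z) (Z 2) by exact: (algV _ _ 2).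
  have cx := cl_ext cJ a2 (nZ 2).
  have /(text_inv a2 (nZ 2))[N [P eP]] : alg (text (chart Z) (Z 2)) (h1 - h2).
    apply: (cl_regular dz cx) => p pt ht.
    have ht' i : reg (vy p) (chart Z i) by have := ht (lift ord_max i); rewrite text_lift.
    have := ht ord_max; rewrite text_max => r2.
    by apply: (Sol_diff Ucov pt); [apply: s1|apply: s2 => //; apply: c'E => //; [exact: (ht' 0)|exact: (ht' 1)]].
  have -> : h1 - h2 = \sum_(m <- msupp P) iota P@_m * (Z 0 ^+ m 0 * (Z 1 / Z 0) ^+ m 1 * Z 2 ^+ m 2 / Z 2 ^+ N).
    apply: (mulfI (expf_neq0 N (nZ 2))); rewrite eP /mmap mulr_sumr; apply: eq_bigr => m _.
    rewrite mulrCA; congr (_ * _); rewrite /mmap1 !big_ord_recr big_ord0 /= mul1r [RHS]mulrC mulfVK ?expf_neq0 //.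
    have -> : widen_ord (leqnSn 2) (widen_ord (leqnSn 1) ord_max) = 0 :> 'I_3 by apply: val_inj.
    have -> : widen_ord (leqnSn 2) ord_max = 1 :> 'I_3 by apply: val_inj.
    by have -> : ord_max = 2 :> 'I_3 by apply: val_inj.
  (* The sign of the exponent of Z_2 decides on which of the two charts the monomial is regular. *)
  apply: spl_sum => m; have [le|lt] := leqP N (m 2).
    apply: spl_l; apply: rsM; first exact: rsC.
    rewrite -mulrA -expfB_cond; last by rewrite (negbTE (nZ 2)).
    by apply: rsM; [apply: rsM|]; apply: rsX => p pt hp; [exact: (hp 0)|exact: (hp 1)|exact: (hp 2)].
  apply: spl_r; apply: rsM; first exact: rsC.
  have -> : Z 0 ^+ m 0 * (Z 1 / Z 0) ^+ m 1 * Z 2 ^+ m 2 / Z 2 ^+ N = Z' 0 ^+ m 0 * (Z' 1 / Z' 0) ^+ m 1 * Z' 2 ^+ (N - m 2).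
    rewrite /Z' Z'2 !Z'E // -/Z -mulrA; congr (_ * _); rewrite exprVn.
    rewrite -{1}(subnKC (ltnW lt)).
    by rewrite exprD invfM mulrA mulfV ?expf_neq0 // mul1r.
  by apply: rsM; [apply: rsM|]; apply: rsX => p pt hp; [exact: (hp 0)|exact: (hp 1)|exact: (hp 2)].
exists h => p pt a0 a1; apply: hh => //; have [a2|a2] := Z2_pm sg b pt.
  by left=> i; elim/ord3_ind: i.
by right; apply: c'E.
Qed.

Section RayUse.
Variables (sg : 'I_3 -> bool) (b : bool).
Local Notation Z := (zfs sg b z).
Local Notation Z' := (zfs (fl2 sg) b z).
Local Notation alZ := (cfs sg b al de).
Local Notation deZ := (cfs sg b de al).

Lemma ray_clo s t (E : K) B f h (J J' : {set 'I_5}) : t != 0 -> cl (chart Z) J -> cl (chart Z') J' -> alg (chart Z) h -> alg (chart Z') h -> h != 0 ->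
  (forall p, point iota y p -> (forall i, reg (vy p) (text (chart Z) h i)) -> reg (vy p) f) ->
  (forall p, point iota y p -> (forall i, reg (vy p) (text (chart Z') h i)) -> reg (vy p) f) ->
  inS iota s t (Z 2) E ->
  clo iota s t (Z 2) E (Z 0) -> clo iota s t (Z 2) E (Z 1 / Z 0) -> clo iota s t (Z 2) E h^-1 ->
  (clo iota s t (Z 2) E (Z 2) \/ clo iota s t (Z 2) E (Z 2)^-1) ->
  iota (alZ 2) * (s * t) * Z 2 ^+ 2 + mmap iota (pr2 s t) B * Z 2 + iota (deZ 2) * (s * t) = 0 ->
  clo iota s t (Z 2) E f.
Proof.
move=> t0 cJ cJ' ah ah' h0 hf hf' sE c0 c1 ch c2 rel.
have al2 : alZ 2 != 0 := d_al (dZ sg b) 2.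
case: c2 => c2.
  have := cl_regular dz (cl_ext cJ ah h0) hf; move: f {hf hf'}; apply: alg_ind.
  - by move=> e; apply: clo_S; apply: inS_C.
  - move=> i; case: (unliftP ord_max i) => [j|] ->; last by rewrite text_max.
    by rewrite text_lift; elim/ord3_ind: j.
  - by move=> f g; apply: (cloD al2 rel).
  - by move=> f g; apply: (cloM al2 rel).
have := cl_regular dz (cl_ext cJ' ah' h0) hf'; move: f {hf hf'}; apply: alg_ind.
- by move=> e; apply: clo_S; apply: inS_C.
- move=> i; case: (unliftP ord_max i) => [j|] ->; last by rewrite text_max.
  by rewrite text_lift; elim/ord3_ind: j; rewrite /chart /= ?Z'2 ?Z'E.
- by move=> f g; apply: (cloD al2 rel).
- by move=> f g; apply: (cloM al2 rel).
Qed.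
End RayUse.

Section RayInstances.
Variables (sg : 'I_3 -> bool) (b : bool).
Local Notation Z := (zfs sg b z).
Local Notation Z' := (zfs (fl2 sg) b z).
Local Notation alZ := (cfs sg b al de).
Local Notation deZ := (cfs sg b de al).
Local Notation X0 := ('X_ord0 : {mpoly k[2]}).
Local Notation X1 := ('X_ord_max : {mpoly k[2]}).

Definition BA : {mpoly k[2]} := alZ 0 *: (X0 * X0 * X1) + deZ 0 *: X1 + alZ 1 *: (X0 * X0 * (X1 * X1)) + (deZ 1)%:MP - X0 * X1.
Definition BB : {mpoly k[2]} := alZ 0 *: (X1 * X1 * X0) + deZ 0 *: X0 + alZ 1 *: (X0 * X0 * X1) + deZ 1 *: X1 - X0 * X1.

Lemma evBA s t : mmap iota (pr2 s t) BA = iota (alZ 0) * (s * s * t) + iota (deZ 0) * t + iota (alZ 1) * (s * s * (t * t)) + iota (deZ 1) - s * t.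
Proof. by rewrite /BA rmorphB !rmorphD /= !mmapZ !rmorphM /= !mmapC ev_s ev_t. Qed.
Lemma evBB s t : mmap iota (pr2 s t) BB = iota (alZ 0) * (t * t * s) + iota (deZ 0) * s + iota (alZ 1) * (s * s * t) + iota (deZ 1) * t - s * t.
Proof. by rewrite /BB rmorphB !rmorphD /= !mmapZ !rmorphM /= ev_s ev_t. Qed.

Lemma rkBA : rk BA != 0.
Proof.
have -> : rk BA = (deZ 0)%:P * 'X + (deZ 1)%:P.
  rewrite /rk /BA rmorphB !rmorphD /= !mmapZ !rmorphM /= !mmapC -!/(rk _) rkX0 rkX1.
  by rewrite !mul0r !mulr0 add0r addr0 subr0.
apply/eqP => /(congr1 (coefp 0)) /eqP; rewrite /= coefD coefMX !coefC /= add0r.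
by apply/negP; exact: (d_de (dZ sg b) 1).
Qed.
Lemma rkBB : rk BB != 0.
Proof.
have -> : rk BB = (deZ 1)%:P * 'X.
  rewrite /rk /BB rmorphB !rmorphD /= !mmapZ !rmorphM /= -!/(rk _) rkX0 rkX1.
  by rewrite !mul0r !mulr0 !add0r subr0.
by rewrite mulf_neq0 ?polyX_eq0 // polyC_eq0; exact: (d_de (dZ sg b) 1).
Qed.

Lemma sumZ : iota (alZ 0) * Z 0 + iota (deZ 0) / Z 0 + (iota (alZ 1) * Z 1 + iota (deZ 1) / Z 1) + (iota (alZ 2) * Z 2 + iota (deZ 2) / Z 2) = 1.
Proof. by have := d_rel (dZ sg b); rewrite sum3. Qed.

Lemma relA : iota (alZ 2) * (Z 0 * (Z 1 / Z 0)) * Z 2 ^+ 2 + mmap iota (pr2 (Z 0) (Z 1 / Z 0)) BA * Z 2 + iota (deZ 2) * (Z 0 * (Z 1 / Z 0)) = 0.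
Proof.
have nz := Z_neq0 sg b; rewrite evBA; have h := sumZ.
transitivity (Z 1 * Z 2 * (iota (alZ 0) * Z 0 + iota (deZ 0) / Z 0 + (iota (alZ 1) * Z 1 + iota (deZ 1) / Z 1) + (iota (alZ 2) * Z 2 + iota (deZ 2) / Z 2) - 1)); last by rewrite h subrr mulr0.
by field; rewrite !nz.
Qed.
Lemma relB : iota (alZ 2) * (Z 1 * Z 0) * Z 2 ^+ 2 + mmap iota (pr2 (Z 1) (Z 0)) BB * Z 2 + iota (deZ 2) * (Z 1 * Z 0) = 0.
Proof.
have nz := Z_neq0 sg b; rewrite evBB; have h := sumZ.
transitivity (Z 0 * Z 1 * Z 2 * (iota (alZ 0) * Z 0 + iota (deZ 0) / Z 0 + (iota (alZ 1) * Z 1 + iota (deZ 1) / Z 1) + (iota (alZ 2) * Z 2 + iota (deZ 2) / Z 2) - 1)); last by rewrite h subrr mulr0.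
by field; rewrite !nz.
Qed.

Lemma freeA : forall P Q, mmap iota (pr2 (Z 0) (Z 1 / Z 0)) P + mmap iota (pr2 (Z 0) (Z 1 / Z 0)) Q * (Z 0 * (Z 1 / Z 0) * Z 2) = 0 -> P = 0 /\ Q = 0.
Proof.
have nz := Z_neq0 sg b.
apply: (ray_free (E := fun m : 'X_{1..2} => ((m ord0)%:Z - (m ord_max)%:Z, (m ord_max)%:Z)) (e0 := (0, 1)) (dZ sg b)).
- move=> m; rewrite /lmon /= expfzDr // -exprnN exprMn exprVn -!exprnP; ring.
- by move=> m m' [e e1]; move: e; rewrite e1 => /addIr [e]; apply: (msupp2 k).
by rewrite /lmon /= expr0z expr1z mul1r [Z 0 * _]mulrC mulfVK.
Qed.
Lemma freeB : forall P Q, mmap iota (pr2 (Z 1) (Z 0)) P + mmap iota (pr2 (Z 1) (Z 0)) Q * (Z 1 * Z 0 * Z 2) = 0 -> P = 0 /\ Q = 0.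
Proof.
apply: (ray_free (E := fun m : 'X_{1..2} => ((m ord_max)%:Z, (m ord0)%:Z)) (e0 := (1, 1)) (dZ sg b)).
- by move=> m; rewrite /lmon /= mulrC.
- by move=> m m' [e e1]; apply: (msupp2 k).
by rewrite /lmon /= !expr1z (mulrC (Z 1)).
Qed.

(** Instantiates [ray]: in each of its three hypotheses Z_2 or its inverse becomes available, so f
    belongs to the algebra of one of the two charts with h inverted. *)
Lemma ray_gen s t h B f : s != 0 -> t != 0 -> h != 0 -> alg (chart Z) h -> alg (chart Z') h ->
  iota (alZ 2) * (s * t) * Z 2 ^+ 2 + mmap iota (pr2 s t) B * Z 2 + iota (deZ 2) * (s * t) = 0 ->
  rk B != 0 -> (forall P Q, mmap iota (pr2 s t) P + mmap iota (pr2 s t) Q * (s * t * Z 2) = 0 -> P = 0 /\ Q = 0) ->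
  (forall p, point iota y p -> reg (vy p) (Z 0) -> reg (vy p) (Z 1 / Z 0) -> reg (vy p) h^-1 -> reg (vy p) f) ->
  (forall E, clo iota s t (Z 2) E (Z 0) /\ clo iota s t (Z 2) E (Z 1 / Z 0) /\ clo iota s t (Z 2) E h^-1) ->
  exists L P Q, t ^+ L * f = mmap iota (pr2 s t) P + mmap iota (pr2 s t) Q * (s * t * Z 2).
Proof.
move=> s0 t0 h0 ah ah' rel B0 free hf hc.
have al0 : alZ 2 != 0 := d_al (dZ sg b) 2; have y0 := Z_neq0 sg b 2.
have [J cJ] := chart_cl sg b; have [J' cJ'] := chart_cl (fl2 sg) b.
have hf1 p : point iota y p -> (forall i, reg (vy p) (text (chart Z) h i)) -> reg (vy p) f.
  move=> pt ht; apply: hf => //.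
  - by have := ht (lift ord_max 0); rewrite text_lift.
  - by have := ht (lift ord_max 1); rewrite text_lift.
  - by have := ht ord_max; rewrite text_max.
have hf2 p : point iota y p -> (forall i, reg (vy p) (text (chart Z') h i)) -> reg (vy p) f.
  move=> pt ht; apply: hf => //.
  - by have := ht (lift ord_max 0); rewrite text_lift /chart /= Z'E.
  - by have := ht (lift ord_max 1); rewrite text_lift /chart /= !Z'E.
  - by have := ht ord_max; rewrite text_max.
have cl_f E : inS iota s t (Z 2) E -> (clo iota s t (Z 2) E (Z 2) \/ clo iota s t (Z 2) E (Z 2)^-1) -> clo iota s t (Z 2) E f.
  move=> iE c2; have [c0 [c1 c3]] := hc E.
  exact: (ray_clo t0 cJ cJ' ah ah' h0 hf1 hf2 iE c0 c1 c3 c2 rel).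
have cD : clo iota s t (Z 2) (Dp iota s t (Z 2) (alZ 2) B) f.
  by apply: cl_f; [apply: inS_Dp; eassumption|left; apply: clo_Dp_y; eassumption].
have cw : clo iota s t (Z 2) (s * t * Z 2) f.
  by apply: cl_f; [apply: inS_w; eassumption|right; apply: clo_w_yV; eassumption].
have cs : clo iota s t (Z 2) s f.
  by apply: cl_f; [apply: inS_s; eassumption|left; apply: clo_s_y; eassumption].
have [L [P [Q e]]] : exists L, inS iota s t (Z 2) (t ^+ L * f) by eapply ray; eassumption.
by exists L, P, Q.
Qed.
End RayInstances.

Lemma ray_sum s t w L f (P Q : {mpoly k[2]}) : t != 0 -> t ^+ L * f = mmap iota (pr2 s t) P + mmap iota (pr2 s t) Q * w ->
  f = \sum_(m <- msupp P) iota P@_m * (s ^+ m ord0 * t ^+ m ord_max / t ^+ L) +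
      \sum_(m <- msupp Q) iota Q@_m * (s ^+ m ord0 * t ^+ m ord_max / t ^+ L * w).
Proof.
move=> t0 e; apply: (mulfI (expf_neq0 L t0)); rewrite e !mmap_pr2 mulrDr mulr_suml !mulr_sumr.
by congr (_ + _); apply: eq_bigr => m _; field; rewrite expf_neq0.
Qed.

(** On the overlap the difference of solutions is t^-L (u + w v) with t = Z_1/Z_0 and u, v in
    k[Z_0, t]. Terms with nonnegative power of t are regular on the first side, the others on the
    second. *)
Lemma level2 sg b : exists h, forall p, point iota y p -> reg (vy p) (zfs sg b z 0) -> reg (vy p) (zfs sg b z 1) -> Sol p h.
Proof.
have nz := Z_neq0 sg b.
have [h1 s1] := level3 sg b; have [h2 s2] := level3 sg (~~ b).
have s2' p : point iota y p -> reg (vy p) (zfs sg b z 1) -> reg (vy p) (zfs sg b z 0 / zfs sg b z 1) -> Sol p h2.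
  by move=> pt a0 a1; apply: s2 => //; rewrite ?zfs_sw0 ?zfs_sw1.
move: s1 s2' nz; set Z := zfs sg b z => s1 s2' nz.
pose P1 p := reg (vy p) (Z 0) /\ reg (vy p) (Z 1 / Z 0); pose P2 p := reg (vy p) (Z 1) /\ reg (vy p) (Z 0 / Z 1).
have th0 : Z 1 / Z 0 != 0 by rewrite mulf_neq0 ?invr_eq0.
have [h hh] : exists h, forall p, point iota y p -> P1 p \/ P2 p -> Sol p h.
  apply: (glue (h1 := h1) (h2 := h2)) => [p pt [a0 a1]|p pt [a0 a1]|]; [exact: s1|exact: s2'|].
  have [||p pt a0 a1 a2|E|L [P [Q e]]] := @ray_gen sg b (Z 0) (Z 1 / Z 0) (Z 1 / Z 0) (BA sg b) (h1 - h2) (nz 0) th0 th0 _ _ (relA sg b) (rkBA sg b) (@freeA sg b).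
  - exact: (algV _ _ 1).
  - have <- : chart (zfs (fl2 sg) b z) 1 = Z 1 / Z 0 by rewrite /chart /= !Z'E.
    exact: algV.
  - apply: (Sol_diff Ucov pt); first exact: s1.
    apply: s2' => //; last by rewrite -invf_div.
    by rewrite -[Z 1](mulfVK (nz 0)); apply: (regM (place_vp pt)).
  - split; first by apply: clo_S; exact: inS_s.
    split; first by apply: clo_S; exact: inS_t.
    exact: clo_tV.
  rewrite (ray_sum th0 e).
  have z0r : rs P2 (Z 0).
    by move=> p pt [a0 a1]; rewrite -[Z 0](mulfVK (nz 1)); apply: (regM (place_vp pt)).
  have thV : rs P2 (Z 1 / Z 0)^-1 by move=> p pt [a0 a1]; rewrite invf_div.
  have powE m L' : (m < L')%N -> (Z 1 / Z 0) ^+ m / (Z 1 / Z 0) ^+ L' = ((Z 1 / Z 0)^-1) ^+ (L' - m).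
    move=> lt; have -> : L' = (m + (L' - m))%N by rewrite subnKC // ltnW.
    by rewrite exprD invfM mulrA mulfV ?expf_neq0 // mul1r addKn exprVn.
  have powE' m L' : (L' <= m)%N -> (Z 1 / Z 0) ^+ m / (Z 1 / Z 0) ^+ L' = (Z 1 / Z 0) ^+ (m - L').
    by move=> le; rewrite -{1}(subnK le) exprD mulfK ?expf_neq0.
  have r0 : rs P1 (Z 0) by move=> p pt [].
  have rt : rs P1 (Z 1 / Z 0) by move=> p pt [].
  apply: splD; apply: spl_sum => m; have [le|lt] := leqP L (m ord_max); rewrite -[Z 0 ^+ _ * _ / _]mulrA.
  - by apply: spl_l; apply: rsM; [exact: rsC|rewrite powE' //; apply: rsM; exact: rsX].
  - by apply: spl_r; apply: rsM; [exact: rsC|rewrite powE //; apply: rsM; exact: rsX].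
  - apply: spl_l; apply: rsM; [exact: rsC|rewrite powE' //; apply: rsM].
      by apply: rsM; exact: rsX.
    move=> p pt [a0 a1]; have -> : Z 0 * (Z 1 / Z 0) * Z 2 = Z 1 * Z 2 by rewrite [Z 0 * _]mulrC mulfVK.
    exact: Z12_reg.
  apply: spl_r; apply: rsM; [exact: rsC|rewrite powE // -mulrA; apply: rsM; first exact: rsX].
  (* One of the negative powers of t is spent on w = Z_0 t Z_2, leaving Z_0 Z_2, which is regular on
     the second side by [Z12_reg] with the indices swapped. *)
  rewrite -(prednK (_ : 0 < L - m ord_max)%N) ?subn_gt0 // exprS.
  have -> : (Z 1 / Z 0)^-1 * (Z 1 / Z 0)^-1 ^+ (L - m ord_max).-1 * (Z 0 * (Z 1 / Z 0) * Z 2) = (Z 1 / Z 0)^-1 ^+ (L - m ord_max).-1 * (Z 0 * Z 2).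
    by move: (_ ^+ _) => q; field; rewrite !nz.
  apply: rsM; first exact: rsX.
  move=> p pt [a0 a1]; have := @Z12_reg sg (~~ b) p pt; rewrite zfs_sw0 zfs_sw1 zfs_sw2; exact.
exists h => p pt a0 a1; apply: hh => //; have [a2|a2] := th_pm sg b pt; [by left|by right].
Qed.

(** Exponents of z for which the power is regular where z, or 1/z if [b], is regular; [sgok1] is the
    strict version. *)
Definition sgok (b : bool) (i : int) : bool := if b then (i <= 0)%R else (0 <= i)%R.
Definition sgok1 (b : bool) (i : int) : bool := if b then (i < 0)%R else (0 < i)%R.

Lemma sgok_reg p (b : bool) (x : K) i : point iota y p -> x != 0 -> reg (vy p) (if b then x^-1 else x) -> sgok b i -> reg (vy p) (x ^ i).
Proof.
move=> pt x0 h hi; have plv := place_vp pt.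
case: b h hi => h; case: i => n; rewrite /sgok //= => hi; try exact: (regX plv).
  by case: n hi => [_|n] //; rewrite expr0z; exact: (reg1 plv).
by rewrite NegzE -exprnN -exprVn; apply: (regX plv).
Qed.

Lemma sgok1_step (b : bool) (x : K) i : x != 0 -> sgok1 b i -> exists2 i', sgok b i' & x ^ i = (if b then x^-1 else x) * x ^ i'.
Proof.
move=> x0; case: b => hi; rewrite /sgok1 in hi.
  exists (i + 1); first by rewrite /sgok; lia.
  by rewrite expfzDr // expr1z mulrCA mulVf ?mulr1.
exists (i - 1); first by rewrite /sgok; lia.
by rewrite expfzDr // mulrCA exprN1 mulfV ?mulr1.
Qed.
End H1.

(** * Laurent polynomials on the four corners *)

Section LaurentSupport.
Variables (k K : fieldType) (iota : {rmorphism k -> K}) (z : 'I_3 -> K).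
Local Notation lv := (lv iota z).

Definition negl (s : seq (k * (int * int))) := [seq (- t.1, t.2) | t <- s].
Definition cutl (S : pred (int * int)) (s : seq (k * (int * int))) := [seq t <- s | S t.2].

Lemma lv_cat s s' : lv (s ++ s') = lv s + lv s'. Proof. exact: big_cat. Qed.
Lemma lv_negl s : lv (negl s) = - lv s.
Proof. by rewrite [LHS]big_map -sumrN; apply: eq_bigr => t _; rewrite rmorphN mulNr. Qed.
Lemma coefl_cat (s s' : seq (k * (int * int))) e : coefl (s ++ s') e = coefl s e + coefl s' e. Proof. exact: big_cat. Qed.
Lemma coefl_negl s e : coefl (negl s) e = - coefl s e.
Proof. by rewrite /coefl [LHS]big_map -sumrN. Qed.
Lemma coefl_cutl S s e : coefl (cutl S s) e = if S e then coefl s e else 0.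
Proof.
rewrite /coefl big_filter_cond; case: ifP => h; [apply: eq_bigl|apply: big1] => t.
  by case: eqP => [->|]; rewrite ?h ?andbF.
by case/andP=> ht /eqP e'; rewrite e' h in ht.
Qed.
Lemma coefl_map0 I (r : seq I) (F : I -> k) E (S : pred (int * int)) e : (forall m, S (E m)) -> ~~ S e ->
  coefl [seq (F m, E m) | m <- r] e = 0.
Proof.
move=> hS hE; rewrite /coefl [LHS]big_map /= big1 // => m /eqP h.
by move: (hS m); rewrite h (negbTE hE).
Qed.

Lemma lv_reg (v : K -> k -> Prop) s (S : pred (int * int)) x : place iota v -> (forall e, ~~ S e -> coefl s e = 0) ->
  (forall e, S e -> reg v (x * lmon z e)) -> reg v (x * lv s).
Proof.
move=> plv s0 hS; pose u := undup [seq t.2 | t <- s].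
have -> : lv s = \sum_(t <- s) \sum_(e <- u | e == t.2) iota t.1 * lmon z e.
  apply: eq_big_seq => t ts; rewrite -big_filter filter_pred1_uniq ?undup_uniq ?big_seq1 //.
  by rewrite mem_undup; apply/mapP; exists t.
rewrite (exchange_big_dep predT) //= mulr_sumr; apply: big_ind => [|f g|e _].
- by rewrite -(rmorph0 iota); exact: regC.
- exact: (regD plv).
have -> : x * (\sum_(t <- s | e == t.2) iota t.1 * lmon z e) = iota (coefl s e) * (x * lmon z e).
  rewrite /coefl rmorph_sum mulrCA mulr_suml; congr (_ * _).
  by apply: eq_bigl => t; rewrite eq_sym.
have [h|/s0 ->] := boolP (S e); first by apply: (regM plv); [exact: regC|exact: hS].
by rewrite rmorph0 mul0r -(rmorph0 iota); exact: regC.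
Qed.
End LaurentSupport.

Section Corners.
Variables (k : closedFieldType) (K : fieldType) (iota : {rmorphism k -> K}).
Variables (z : 'I_3 -> K) (al de : 'I_3 -> k).
Hypothesis dz : datum iota z al de.
Local Notation y := (yseg z).
Local Notation vy := (vp iota y).

Definition flp (g : bool) (x : K) := if g then x^-1 else x.
Definition sgn (g : bool) (i : int) : int := if g then - i else i.
Definition mk (b : bool) (i j : int) : int * int := if b then (j, i) else (i, j).
Definition cmp (b : bool) (e : int * int) : int := if b then e.1 else e.2.

Lemma cmp_mk b i j : cmp b (mk b i j) = j. Proof. by case: b. Qed.
Lemma lmon_mk b i j : lmon z (mk b i j) = z (pib b 0) ^ i * z (pib b 1) ^ j.
Proof. by rewrite /lmon /mk /pib; case: b; rewrite //= ?tpermL ?tpermR mulrC. Qed.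
Lemma flpX g x (n : nat) : x != 0 -> flp g x ^+ n = x ^ sgn g n%:Z.
Proof. by move=> x0; rewrite /flp /sgn; case: g => //; rewrite exprVn exprnN. Qed.
Lemma sgok_sgn g (n : nat) : sgok g (sgn g n%:Z). Proof. by rewrite /sgok /sgn; case: g; lia. Qed.
Lemma sgok1_sgn g (n : nat) : sgok1 g (sgn g n.+1%:Z). Proof. by rewrite /sgok1 /sgn; case: g; lia. Qed.

(** Along an edge one of z_0, z_1 is invertible and serves as t in [ray_gen], so its exponent is
    free; the other is s and keeps a sign. The sign is strict in the coefficient of z_2 because w =
    s t z_2 carries one more factor s. *)
Lemma edge b g f :
  (forall p, point iota y p -> reg (vy p) (z (pib b 0)) -> reg (vy p) (z (pib b 0))^-1 ->
     reg (vy p) (flp g (z (pib b 1))) -> reg (vy p) f) ->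
  exists s s', [/\ f = lv iota z s + z 2 * lv iota z s',
    forall e, ~~ sgok g (cmp b e) -> coefl s e = 0 & forall e, ~~ sgok1 g (cmp b e) -> coefl s' e = 0].
Proof.
move=> hf; pose sg i := (i == pib b 1) && g.
have z0 i : z i != 0 := d_z dz i.
have Z0E : zfs sg b z 0 = z (pib b 0).
  by rewrite zfsE /zflip /sg (inj_eq (inv_inj (pibK b))).
have Z1E : zfs sg b z 1 = flp g (z (pib b 1)) by rewrite zfsE /zflip /sg eqxx.
have Z2E : zfs sg b z 2 = z 2.
  by rewrite zfsE /zflip /sg (inj_eq (inv_inj (pibK b))) /= pib2.
have nZ i : zfs sg b z i != 0 := d_z (datum_fs sg b dz) i.
have [||p pt a0 a1 a2|E|L [P [Q e]]] := @ray_gen k K iota z al de dz sg b (zfs sg b z 1) (zfs sg b z 0) (zfs sg b z 0) (BB al de sg b) f (nZ 1) (nZ 0) (nZ 0) _ _ (relB dz sg b) (rkBB dz sg b) (@freeB _ _ _ _ _ _ dz sg b).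
- exact: (algV _ _ 0).
- have <- : chart (zfs (fl2 sg) b z) 0 = zfs sg b z 0 by rewrite /chart /= Z'E.
  exact: algV.
- rewrite Z0E in a0 a2; apply: hf => //; rewrite -Z1E -[zfs sg b z 1](mulfVK (nZ 0)).
  by apply: (regM (place_vp pt)) => //; rewrite Z0E.
- split; first by apply: clo_S; exact: inS_t.
  split; last exact: clo_tV.
  by apply: cloM; [exact: (d_al (datum_fs sg b dz) 2)|exact: (relB dz sg b)|apply: clo_S; exact: inS_s|exact: clo_tV].
pose s := [seq (P@_m, mk b ((m ord_max)%:Z - L%:Z) (sgn g (m ord0)%:Z)) | m <- msupp P].
pose s' := [seq (Q@_m, mk b ((m ord_max)%:Z - L%:Z + 1) (sgn g (m ord0).+1%:Z)) | m <- msupp Q].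
exists s, s'; split=> [|e' he|e' he].
- rewrite (ray_sum (nZ 0) e) Z0E Z1E Z2E /lv /s /s' !big_map mulr_sumr; congr (_ + _); apply: eq_bigr => m _ /=.
    by rewrite lmon_mk -flpX // expfzDr // -exprnN -!exprnP; ring.
  rewrite lmon_mk -flpX // !expfzDr // -exprnN -!exprnP ?expr1 ?expr1z exprS; ring.
- apply: (@coefl_map0 k _ _ _ _ (fun e => sgok g (cmp b e)) e') => // m; rewrite cmp_mk; exact: sgok_sgn.
- apply: (@coefl_map0 k _ _ _ _ (fun e => sgok1 g (cmp b e)) e') => // m; rewrite cmp_mk; exact: sgok1_sgn.
Qed.

Definition corner g0 g1 p := reg (vy p) (flp g0 (z 0)) /\ reg (vy p) (flp g1 (z 1)).

Lemma corner_cover p : point iota y p -> exists g0 g1, corner g0 g1 p.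
Proof.
move=> pt; have [J hJ] := yseg_sign dz pt.
have hs s : exists g, reg (vy p) (flp g (phi z s)) by have := hJ s; case: ifP; [exists true|exists false].
have [g0 h0] := hs (inord 0); have [g1 h1] := hs (inord 1).
by exists g0, g1; split; [move: h0|move: h1]; rewrite /phi /= inordK.
Qed.

(** Strictness of the signs in the coefficient of z_2 provides the factors z_0 and z_1, or their
    inverses, that make their product with z_2 regular by [Z012_reg]. *)
Lemma corner_lv p g0 g1 s s' : point iota y p -> corner g0 g1 p ->
  (forall e, ~~ (sgok g0 e.1 && sgok g1 e.2) -> coefl s e = 0) ->
  (forall e, ~~ (sgok1 g0 e.1 && sgok1 g1 e.2) -> coefl s' e = 0) ->
  reg (vy p) (lv iota z s + z 2 * lv iota z s').
Proof.
move=> pt [r0 r1] h h'; have plv := place_vp pt; have z0 i : z i != 0 := d_z dz i.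
have hl e : sgok g0 e.1 && sgok g1 e.2 -> reg (vy p) (lmon z e).
  by case/andP=> a0 a1; apply: (regM plv); [exact: (sgok_reg pt (z0 0) r0 a0)|exact: (sgok_reg pt (z0 1) r1 a1)].
apply: (regD plv).
  rewrite -[lv _ _ _]mul1r; apply: (lv_reg plv h) => e he; rewrite mul1r; exact: hl.
apply: (lv_reg plv h') => e /andP[a0 a1].
have [i hi ei] := sgok1_step (z0 0) a0; have [j hj ej] := sgok1_step (z0 1) a1.
have -> : z 2 * lmon z e = (flp g0 (z 0) * flp g1 (z 1) * z 2) * lmon z (i, j).
  rewrite /lmon ei ej /= -/(flp _ _) -/(flp _ _); ring.
apply: (regM plv); last by apply: hl; rewrite hi.
pose sg (i : 'I_3) := match val i with 0 => g0 | 1 => g1 | _ => false end.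
by have := @Z012_reg _ _ _ _ _ _ dz sg false p pt; apply.
Qed.
End Corners.

(** The a_n are the coefficients of the four edge differences at exponent (i, j), and e is that of
    the correction at the first corner. For i > 0 and j >= 0 the second corner forces e = a1; for i
    = 0 and j > 0 the last two corners force e = - a4; elsewhere e = 0 is admissible. *)
Lemma corner_u (k : comNzRingType) (a1 a2 a3 a4 : k) (i j : int) : a1 + a2 + a3 + a4 = 0 ->
  (~~ sgok false j -> a1 = 0) -> (~~ sgok true i -> a2 = 0) -> (~~ sgok true j -> a3 = 0) -> (~~ sgok false i -> a4 = 0) ->
  let e := (if (0 < i) && (0 <= j) then a1 else 0) - (if (i == 0) && (0 < j) then a4 else 0) in
  [/\ ~~ (sgok false i && sgok false j) -> e = 0, ~~ (sgok true i && sgok false j) -> e - a1 = 0,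
      ~~ (sgok true i && sgok true j) -> e - a1 - a2 = 0 & ~~ (sgok false i && sgok true j) -> e + a4 = 0].
Proof.
rewrite /sgok => h; have e1 : a1 = - (a2 + a3 + a4) by apply/eqP; rewrite -addr_eq0 !addrA h.
case: (Order.TotalTheory.ltgtP i 0) => hi; case: (Order.TotalTheory.ltgtP j 0) => hj /= h1 h2 h3 h4;
  rewrite ?hi ?hj /=; split=> // _; rewrite ?(h1 isT) ?(h2 isT) ?(h3 isT) ?(h4 isT);
  try ring; rewrite e1 ?(h2 isT) ?(h3 isT) ?(h4 isT); ring.
Qed.

(** With strict signs nothing survives at i = 0: there a2 and a4 vanish, and a1, a3 are opposite
    with disjoint ranges of j. *)
Lemma corner_v (k : comNzRingType) (a1 a2 a3 a4 : k) (i j : int) : a1 + a2 + a3 + a4 = 0 ->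
  (~~ sgok1 false j -> a1 = 0) -> (~~ sgok1 true i -> a2 = 0) -> (~~ sgok1 true j -> a3 = 0) -> (~~ sgok1 false i -> a4 = 0) ->
  let e := if (0 < i) then a1 else 0 in
  [/\ ~~ (sgok1 false i && sgok1 false j) -> e = 0, ~~ (sgok1 true i && sgok1 false j) -> e - a1 = 0,
      ~~ (sgok1 true i && sgok1 true j) -> e - a1 - a2 = 0 & ~~ (sgok1 false i && sgok1 true j) -> e + a4 = 0].
Proof.
rewrite /sgok1 => h; have e1 : a1 = - (a2 + a3 + a4) by apply/eqP; rewrite -addr_eq0 !addrA h.
have e2 : a2 = - (a1 + a3 + a4) by apply/eqP; rewrite -addr_eq0 !addrA [a2 + _]addrC h.
have e4 : a4 = - (a1 + a2 + a3) by apply/eqP; rewrite -addr_eq0 addrC h.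
case: (Order.TotalTheory.ltgtP i 0) => hi; case: (Order.TotalTheory.ltgtP j 0) => hj /= h1 h2 h3 h4;
  rewrite ?hi ?hj /=; split=> // _; rewrite ?(h1 isT) ?(h2 isT) ?(h3 isT) ?(h4 isT);
  try ring; first [rewrite e1 ?(h2 isT) ?(h3 isT) ?(h4 isT); ring | rewrite e2 ?(h1 isT) ?(h3 isT) ?(h4 isT); ring | rewrite e4 ?(h1 isT) ?(h2 isT) ?(h3 isT); ring].
Qed.

Section Vanishing.
Variables (k : closedFieldType) (K : fieldType) (iota : {rmorphism k -> K}).
Variables (z : 'I_3 -> K) (al de : 'I_3 -> k).
Hypothesis dz : datum iota z al de.
Local Notation y := (yseg z).
Local Notation vy := (vp iota y).
Local Notation lv := (lv iota z).

(* The four edge splittings of the cocycle around the square of corners are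
   Laurent polynomials summing to zero, and comparing coefficients splits them
   corner by corner. *)
Lemma corners_split d1 d2 d3 d4 s1 s2 s3 s4 t1 t2 t3 t4 : d1 + d2 + d3 + d4 = 0 ->
  d1 = lv s1 + z 2 * lv t1 -> d2 = lv s2 + z 2 * lv t2 -> d3 = lv s3 + z 2 * lv t3 -> d4 = lv s4 + z 2 * lv t4 ->
  (forall e, ~~ sgok false e.2 -> coefl s1 e = 0) -> (forall e, ~~ sgok1 false e.2 -> coefl t1 e = 0) ->
  (forall e, ~~ sgok true e.1 -> coefl s2 e = 0) -> (forall e, ~~ sgok1 true e.1 -> coefl t2 e = 0) ->
  (forall e, ~~ sgok true e.2 -> coefl s3 e = 0) -> (forall e, ~~ sgok1 true e.2 -> coefl t3 e = 0) ->
  (forall e, ~~ sgok false e.1 -> coefl s4 e = 0) -> (forall e, ~~ sgok1 false e.1 -> coefl t4 e = 0) ->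
  exists f, forall p, point iota y p ->
    [/\ corner iota z false false p -> reg (vy p) f, corner iota z true false p -> reg (vy p) (f - d1),
        corner iota z true true p -> reg (vy p) (f - d1 - d2) & corner iota z false true p -> reg (vy p) (f + d4)].
Proof.
move=> dsum e1 e2 e3 e4 hs1 ht1 hs2 ht2 hs3 ht3 hs4 ht4.
have [hs ht] : (forall e, coefl (s1 ++ s2 ++ s3 ++ s4) e = 0) /\ (forall e, coefl (t1 ++ t2 ++ t3 ++ t4) e = 0).
  apply: (laurent_free dz); rewrite !lv_cat -[RHS]dsum e1 e2 e3 e4; ring.
pose s := cutl (fun e => (0 < e.1)%R && (0 <= e.2)%R) s1 ++ negl (cutl (fun e => (e.1 == 0) && (0 < e.2)%R) s4).
pose t := cutl (fun e => (0 < e.1)%R) t1.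
have cs e : coefl s e = (if (0 < e.1) && (0 <= e.2) then coefl s1 e else 0) - (if (e.1 == 0) && (0 < e.2) then coefl s4 e else 0).
  by rewrite coefl_cat coefl_negl !coefl_cutl.
have ct e : coefl t e = if 0 < e.1 then coefl t1 e else 0 by rewrite coefl_cutl.
clearbody s t.
have Hs e : coefl s1 e + coefl s2 e + coefl s3 e + coefl s4 e = 0 by have := hs e; rewrite !coefl_cat !addrA.
have Ht e : coefl t1 e + coefl t2 e + coefl t3 e + coefl t4 e = 0 by have := ht e; rewrite !coefl_cat !addrA.
exists (lv s + z 2 * lv t) => p pt.
have hu e := corner_u (Hs e) (hs1 e) (hs2 e) (hs3 e) (hs4 e).
have hv e := corner_v (Ht e) (ht1 e) (ht2 e) (ht3 e) (ht4 e).
split=> cp.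
- by apply: (corner_lv dz pt cp) => e; rewrite ?cs ?ct; [have [] := hu e|have [] := hv e].
- have -> : lv s + z 2 * lv t - d1 = lv (s ++ negl s1) + z 2 * lv (t ++ negl t1) by rewrite e1 !lv_cat !lv_negl; ring.
  by apply: (corner_lv dz pt cp) => e; rewrite coefl_cat coefl_negl ?cs ?ct; [have [] := hu e|have [] := hv e].
- have -> : lv s + z 2 * lv t - d1 - d2 = lv ((s ++ negl s1) ++ negl s2) + z 2 * lv ((t ++ negl t1) ++ negl t2).
    by rewrite e1 e2 !lv_cat !lv_negl; ring.
  by apply: (corner_lv dz pt cp) => e; rewrite !coefl_cat !coefl_negl ?cs ?ct; [have [] := hu e|have [] := hv e].
have -> : lv s + z 2 * lv t + d4 = lv (s ++ s4) + z 2 * lv (t ++ t4) by rewrite e4 !lv_cat; ring.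
by apply: (corner_lv dz pt cp) => e; rewrite coefl_cat ?cs ?ct; [have [] := hu e|have [] := hv e].
Qed.

(** Choosing a base index turns the cocycle into c_i - c_j. Solutions of the Cousin problem on the
    four corners differ along the edges of a square by [edge], and [corners_split] corrects them to
    a single one. *)
Lemma yseg_H1 : H1_structure_sheaf_zero iota y.
Proof.
move=> [|r] U Uo _ Ucov f fU fc; first by exists (fun=> 0); split=> -[].
pose c i := f i ord0.
have fE i j : f i j = c i - c j by rewrite /c -(fc i j ord0) addrK.
have Uc i j p : point iota y p -> U i p -> U j p -> reg (vy p) (c i - c j).
  by move=> pt Ui Uj; rewrite -fE; apply/local_ringE => //; apply: fU.
have hc g0 g1 : exists h, forall p, point iota y p -> corner iota z g0 g1 p -> Sol iota z U c p h.
  pose sg (i : 'I_3) := match val i with 0 => g0 | 1 => g1 | _ => false end.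
  have [h hh] := level2 dz Uo Ucov Uc sg false; exists h => p pt [r0 r1]; exact: hh.
have [h00 H00] := hc false false; have [h10 H10] := hc true false.
have [h11 H11] := hc true true; have [h01 H01] := hc false true.
have [s1 [t1 [e1 hs1 ht1]]] : exists s s', [/\ h00 - h10 = lv s + z 2 * lv s',
    forall e, ~~ sgok false (cmp false e) -> coefl s e = 0 & forall e, ~~ sgok1 false (cmp false e) -> coefl s' e = 0].
  by apply: (edge dz) => p pt a0 a1 a2; apply: (Sol_diff Ucov pt); [apply: H00|apply: H10].
have [s2 [t2 [e2 hs2 ht2]]] : exists s s', [/\ h10 - h11 = lv s + z 2 * lv s',
    forall e, ~~ sgok true (cmp true e) -> coefl s e = 0 & forall e, ~~ sgok1 true (cmp true e) -> coefl s' e = 0].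
  by apply: (edge dz) => p pt; rewrite /pib tpermL tpermR => a0 a1 a2; apply: (Sol_diff Ucov pt); [apply: H10|apply: H11].
have [s3 [t3 [e3 hs3 ht3]]] : exists s s', [/\ h11 - h01 = lv s + z 2 * lv s',
    forall e, ~~ sgok true (cmp false e) -> coefl s e = 0 & forall e, ~~ sgok1 true (cmp false e) -> coefl s' e = 0].
  by apply: (edge dz) => p pt a0 a1 a2; apply: (Sol_diff Ucov pt); [apply: H11|apply: H01].
have [s4 [t4 [e4 hs4 ht4]]] : exists s s', [/\ h01 - h00 = lv s + z 2 * lv s',
    forall e, ~~ sgok false (cmp true e) -> coefl s e = 0 & forall e, ~~ sgok1 false (cmp true e) -> coefl s' e = 0].
  by apply: (edge dz) => p pt; rewrite /pib tpermL tpermR => a0 a1 a2; apply: (Sol_diff Ucov pt); [apply: H01|apply: H00].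
have dsum : (h00 - h10) + (h10 - h11) + (h11 - h01) + (h01 - h00) = 0 by ring.
have [F hF] := corners_split dsum e1 e2 e3 e4 hs1 ht1 hs2 ht2 hs3 ht3 hs4 ht4.
(* At each corner h is the local solution minus a function that [corners_split] makes regular
   there. *)
pose h := h00 - F.
have hS p : point iota y p -> Sol iota z U c p h.
  move=> pt; have [F0 F1 F2 F3] := hF p pt; have plv := place_vp pt.
  have [[] [[] cp]] := corner_cover dz pt.
  - have -> : h = h11 + - (F - (h00 - h10) - (h10 - h11)) by rewrite /h; ring.
    by apply: (Sol_shift pt); [apply: H11|apply/(regN plv)/F2].
  - have -> : h = h10 + - (F - (h00 - h10)) by rewrite /h; ring.
    by apply: (Sol_shift pt); [apply: H10|apply/(regN plv)/F1].
  - have -> : h = h01 + - (F + (h01 - h00)) by rewrite /h; ring.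
    by apply: (Sol_shift pt); [apply: H01|apply/(regN plv)/F3].
  by apply: (Sol_shift pt); [apply: H00|apply/(regN plv)/F0].
exists (fun i => c i - h); split=> [i p pt Ui|i j]; last by rewrite fE; ring.
by apply/local_ringE => //; exact: hS.
Qed.
End Vanishing.

(** * The theorem *)

Lemma tpat_inj l l' : tpat l =1 tpat l' -> l = l'.
Proof.
move=> h; move: (h 0) (h 1) (h 2); rewrite /tpat /=; clear h.
by case: l => -[[|[|[|[|//]]]] lm]; case: l' => -[[|[|[|[|//]]]] lm'] //= _ _ _; congr (_ _); apply: val_inj.
Qed.

(** The datum has al_i = sc_i and de_i = sd_i gam_i: these are the coefficients of L at X_i = z_i
    and Y_i = gam_i / z_i. *)
Lemma minres_K3 (k : closedFieldType) (char2 : 2%N \in [pchar k]) (a sc sd : 'I_3 -> k) :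
  injective a -> (forall i, sc i != 0) -> (forall i, sd i != 0) ->
  minimal_resolution_is_K3 (Sigma_eq a (sqf sc) (sqf sd)).
Proof.
move=> a_inj sc0 sd0; have de0 i : sd i * gam a i != 0 by rewrite mulf_neq0 ?gam_neq0.
have [K [iota [z dz]]] := datum_exists sc0 de0.
exists K, iota, (xpt a iota z); split; [exact: xpt_generic|exact: (xpt_field dz)|].
exists _, (yseg z); split; last by split; [exact: (yseg_smooth char2 dz)|exact: (yseg_canonical char2 dz)|exact: (yseg_H1 dz)].
split; first by split; [exact: (yseg_smooth char2 dz)|exact: (yseg_dominates char2 a_inj dz)].
by move=> n' y' res; apply: (yseg_minimal char2 a_inj dz).
Qed.

Theorem theorem5p2 (k : closedFieldType) (char2 : 2%N \in [pchar k])
    (a c d : 'I_3 -> k) (a_inj : injective a)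
    (cd_neq0 : \prod_i (c i * d i) != 0)
    (sc sd : 'I_3 -> k)
    (scE : forall i, sc i ^+ 2 = c i) (sdE : forall i, sd i ^+ 2 = d i) :
  (* (1) the lines on Sigma are exactly eight lines Theta_i, E_j *)
  [/\ forall l, exists2 L : {vspace 'rV[k]_6},
        \dim L = 2%N & L =i ThetaE sc sd l,
      forall l l', ThetaE sc sd l =i ThetaE sc sd l' -> l = l'
    & forall L : {vspace 'rV[k]_6}, \dim L = 2%N ->
        ({subset L <= Sigma a c d} <-> exists l, L =i ThetaE sc sd l)] /\
  (* (2) there are exactly twelve nodes, the points where some Theta_i meets
     some E_j; there is no other singular point, and the minimal resolution
     of Sigma is a K3 surface *)
  [/\ exists P : 'I_12 -> 'rV[k]_6,
        [/\ forall n, P n != 0, injective (fun n => <[P n]>%VS)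
          & forall p : 'rV[k]_6, meeting_point sc sd p <->
              p != 0 /\ exists n, <[p]>%VS = <[P n]>%VS],
      forall p, node (Sigma_eq a c d) p <-> meeting_point sc sd p
    & K3_surface_with_nodes (Sigma_eq a c d)].
Proof.
have cd0 i : c i * d i != 0 by move: cd_neq0; rewrite (bigD1 i) //= mulf_eq0 negb_or => /andP[].
have -> : c = sqf sc by apply: funext => i; rewrite -scE.
have -> : d = sqf sd by apply: funext => i; rewrite -sdE.
have sc0 i : sc i != 0 by have := cd0 i; rewrite -scE mulf_eq0 expf_eq0 negb_or => /andP[].
have sd0 i : sd i != 0 by have := cd0 i; rewrite -sdE mulf_eq0 expf_eq0 negb_or => /andP[].
have lsP l : lspace sc sd (tpat l) =i ThetaE sc sd l.
  by move=> v; apply/idP/idP => [/lspaceP h|/ThetaEP h]; [apply/ThetaEP/h|apply/lspaceP/h].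
split; split.
- by move=> l; exists (lspace sc sd (tpat l)); [exact: dim_lspace|exact: lsP].
- move=> l l' h; apply/tpat_inj/(line_ext char2 sc0 sd0) => v.
  by split=> /ThetaEP q; apply/ThetaEP; [rewrite -h|rewrite h].
- move=> L dL; split=> [hL|[l hl] v vL].
    have [|t ->] := Sigma_line char2 a_inj sc0 sd0 dL; first by move=> v /hL /(SigmaP char2 _ _ a_inj).
    have [l tl _] := tpat_parity t; exists l => v; rewrite -lsP.
    by congr (v \in lspace sc sd _); apply: funext => i; rewrite tl.
  have h : line sc sd (tpat l) v by apply/ThetaEP; rewrite -hl.
  by apply/(SigmaP char2 _ _ a_inj); exact: line_Sigma h.
- exact: twelve_points.
- by move=> p; apply: node_meeting.
split; first by move=> p; apply: singular_node.
exact: minres_K3.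
Qed.
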